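(* Let $d\ge1$ and $1<p<\infty$. The action $z\mapsto\alpha^{Ld}_z$ of the group of all families $z=(z_{j,i})_{1\le j\le d,\,1\le i<\infty}$ of complex numbers of modulus $1$ (with pointwise multiplication) extends to a uniformly completely bounded action on $L_p(\widehat{\mathbb F}_\infty)$, with constant depending only on $d$ and $p$: there is a constant $C_{p,d}$ such that for every $z$ the map $\alpha_z^{Ld}$ on $\mathbb C[\mathbb F_\infty]$ extends to a completely bounded map on $L_p(\widehat{\mathbb F}_\infty)$ with cb-norm at most $C_{p,d}$, and these extensions form an action of the group.
   Context: $\mathbb F_\infty$ is the free group on generators $\{g_1,g_2,\dots\}$; $\lambda$ is its left regular representation, $\mathbb C[\mathbb F_\infty]$ the linear span of $\lambda(\mathbb F_\infty)$, $\widehat{\mathbb F}_\infty$ its group von Neumann algebra with canonical trace $\tau(x)=\langle\delta_e,x\delta_e\rangle$, and $L_p(\widehat{\mathbb F}_\infty)$ the associated noncommutative $L_p$-space with its natural (Pisier) operator space structure: a map $T$ on $L_p(\mathcal M)$ is completely bounded iff $\mathrm{Id}_{S_p}\otimes T$ is bounded on $L_p(B(\ell_2)\overline\otimes\mathcal M)$, with cb-norm the norm of that map. Each $g\ne e$ is written in reduced form $g=g_{i_1}^{k_1}\cdots g_{i_n}^{k_n}$ with consecutive indices distinct and $k_j\in\mathbb Z\setminus\{0\}$; $g=e$ corresponds to $n=0$. For $z=(z_{j,i})$ as in the claim, $\alpha_z^{Ld}$ is the linear map on $\mathbb C[\mathbb F_\infty]$ determined by $$\alpha_z^{Ld}(\lambda(g))=z_{1,i_1}^{k_1}z_{2,i_2}^{k_2}\cdots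 z_{d,i_d}^{k_d}\,\lambda(g),$$ where $k_\ell=0$ (so that the corresponding factor is $1$) if $\ell>n$. It extends to a unitary action on $L_2(\widehat{\mathbb F}_\infty)$. *)

(* Defs.v *)
From HB Require Import structures.
From mathcomp Require Import all_boot all_order all_algebra.
From mathcomp Require Import complex.
From mathcomp Require Import all_classical all_reals all_analysis.
From mathcomp Require Import ring lra.

Set Implicit Arguments.
Unset Strict Implicit.
Unset Printing Implicit Defensive.

Import Order.TTheory GRing.Theory Num.Theory.
Import numFieldNormedType.Exports.

Local Open Scope classical_set_scope.
Local Open Scope ring_scope.

(* The syllable (i, k) stands for g_i ^ k. *)
Definition syllable := (nat * int)%type.

Definition reduced (w : seq syllable) : bool :=
  all (fun s => s.2 != 0) w && sorted (fun s t => s.1 != t.1) w.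

(* An element of F_oo is represented by its reduced form. *)
Record freegroup := FreeGroup {word :> seq syllable; _ : reduced word}.

HB.instance Definition _ := [isSub for word].
HB.instance Definition _ := [Countable of freegroup by <:].

Lemma freegroup_reduced (g : freegroup) : reduced g.
Proof. by case: g. Qed.

(* Reduced form of g_i ^ k * w, for w reduced. *)
Definition push (s : syllable) (w : seq syllable) : seq syllable :=
  if s.2 == 0 then w else
  if w is t :: w' then
    if s.1 == t.1 then
      if s.2 + t.2 == 0 then w' else (s.1, s.2 + t.2) :: w'
    else s :: w
  else [:: s].

Lemma reduced_cons s w : reduced (s :: w) =
  [&& s.2 != 0, (if w is t :: _ then s.1 != t.1 else true) & reduced w].
Proof.
rewrite /reduced; case: w => [|t w] /=; first by rewrite andbT.
by rewrite -andbA; congr (_ && _); rewrite andbCA.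
Qed.

Lemma push_reduced s w : reduced w -> reduced (push s w).
Proof.
rewrite /push; have [//|s0] := eqVneq s.2 0.
case: w => [|t w] rw; first by rewrite reduced_cons s0.
have [e|ne] := eqVneq s.1 t.1; last by rewrite reduced_cons s0 ne.
move: rw; rewrite reduced_cons => /and3P[t0 tw rw].
have [//|st0] := eqVneq (s.2 + t.2) 0.
by rewrite reduced_cons /= st0 rw e tw.
Qed.

Lemma push0 i w : push (i, 0) w = w.
Proof. by rewrite /push eqxx. Qed.

Lemma push_id s w : reduced (s :: w) -> push s w = s :: w.
Proof.
rewrite reduced_cons /push => /and3P[/negbTE-> + _].
by case: w => // t w /negbTE->.
Qed.

Lemma pushD i k l w : reduced w -> push (i, k) (push (i, l) w) = push (i, k + l) w.
Proof.
move=> rw; have [->|l0] := eqVneq l 0; first by rewrite push0 addr0.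
have [->|k0] := eqVneq k 0; first by rewrite push0 add0r.
case: w rw => [|[j m] w] rw.
  by rewrite /push /= (negbTE k0) (negbTE l0) eqxx.
rewrite {2}/push /= (negbTE l0).
have [ij|ij] := eqVneq i j; last first.
  by rewrite /push /= (negbTE k0) eqxx (negbTE ij).
subst j; move: rw; rewrite reduced_cons => /and3P[/= m0 iw rw].
have [lm0|lm0] := eqVneq (l + m) 0; last first.
  rewrite {1}/push /= (negbTE k0) eqxx addrA.
  have [kl|kl] := eqVneq (k + l) 0; last by rewrite /push /= (negbTE kl) eqxx.
  by rewrite kl add0r (negbTE m0) push0.
have -> : push (i, k) w = (i, k) :: w.
  by rewrite push_id // reduced_cons /= k0 iw rw.
have -> : m = - l by apply/eqP; rewrite -addr_eq0 addrC lm0.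
have [kl|kl] := eqVneq (k + l) 0.
  by rewrite kl push0; have -> : k = - l by apply/eqP; rewrite -addr_eq0 kl.
by rewrite /push /= (negbTE kl) eqxx addrK (negbTE k0).
Qed.

Definition wmul (u v : seq syllable) : seq syllable := foldr push v u.
Definition winv (u : seq syllable) : seq syllable :=
  rev [seq (s.1, - s.2) | s <- u].

Lemma wmul_reduced u v : reduced v -> reduced (wmul u v).
Proof. by move=> rv; elim: u => //= s u; exact: push_reduced. Qed.

Lemma winv_reduced u : reduced u -> reduced (winv u).
Proof.
move=> /andP[u0 us]; apply/andP; split.
  rewrite all_rev all_map; apply: sub_all u0 => s /=; by rewrite oppr_eq0.
rewrite rev_sorted sorted_map; apply: sub_sorted us => s t /=.
by rewrite eq_sym.
Qed.

Lemma wmul_push s u v : reduced u -> reduced v ->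
  wmul (push s u) v = push s (wmul u v).
Proof.
move=> ru rv; case: s => i k; rewrite {1}/push /=.
have [->|k0] := eqVneq k 0; first by rewrite push0.
case: u ru => [|[j l] u] // ru; have [ij|//] := eqVneq i j.
subst j => /=; rewrite pushD ?wmul_reduced //.
by have [->|//] := eqVneq (k + l) 0; rewrite push0.
Qed.

Lemma wmulA u v w : reduced v -> reduced w ->
  wmul u (wmul v w) = wmul (wmul u v) w.
Proof.
by move=> rv rw; elim: u => //= s u ->; rewrite wmul_push ?wmul_reduced.
Qed.

Lemma wmulw1 u : reduced u -> wmul u [::] = u.
Proof.
elim: u => //= s u IH ru; have := ru; rewrite reduced_cons => /and3P[_ _ /IH->].
exact: push_id.
Qed.

Lemma wmulVw u v : reduced v -> wmul (winv u) (wmul u v) = v.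
Proof.
rewrite /winv; elim: u => //= -[i k] u IH rv.
rewrite rev_cons /wmul -cats1 foldr_cat /= pushD; last exact: wmul_reduced.
by rewrite addNr push0; exact: IH.
Qed.

Definition freeg_mul (g h : freegroup) : freegroup :=
  FreeGroup (wmul_reduced g (freegroup_reduced h)).
Definition freeg_inv (g : freegroup) : freegroup :=
  FreeGroup (winv_reduced (freegroup_reduced g)).
Definition freeg_one : freegroup := @FreeGroup [::] isT.

Lemma freeg_mulA : associative freeg_mul.
Proof. by move=> f g h; apply/val_inj; apply: wmulA; exact: freegroup_reduced. Qed.
Lemma freeg_mul1 : left_id freeg_one freeg_mul.
Proof. by move=> g; apply/val_inj. Qed.
Lemma freeg_mulr1 : right_id freeg_one freeg_mul.
Proof. by move=> g; apply/val_inj/wmulw1/freegroup_reduced. Qed.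
Lemma freeg_mulV : left_inverse freeg_one freeg_inv freeg_mul.
Proof.
move=> g; apply/val_inj => /=.
by rewrite -[X in wmul _ X](wmulw1 (freegroup_reduced g)) wmulVw.
Qed.
Lemma freeg_invK : involutive freeg_inv.
Proof.
move=> g; apply/val_inj; rewrite /= /winv map_rev revK -map_comp -[RHS]map_id.
by apply: eq_map => -[i k] /=; rewrite opprK.
Qed.
Lemma freeg_mulrV : right_inverse freeg_one freeg_inv freeg_mul.
Proof. by move=> g; rewrite -{1}(freeg_invK g) freeg_mulV. Qed.

HB.instance Definition _ := isGroup.Build freegroup
  freeg_mulA freeg_mul1 freeg_mulr1 freeg_mulV freeg_mulrV.

Section Ell2.
Context {R : realType}.
Implicit Types I J : choiceType.

Definition sqmod (c : R[i]) : R := complex.Re c ^+ 2 + complex.Im c ^+ 2.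

Lemma sqmod_ge0 c : 0 <= sqmod c.
Proof. by rewrite addr_ge0 ?sqr_ge0. Qed.

Lemma sqmodM c d : sqmod (c * d) = sqmod c * sqmod d.
Proof. by case: c d => [a b] [a' b']; rewrite /sqmod /=; ring. Qed.

Lemma sqmodD_le c d : sqmod (c + d) <= 2 * sqmod c + 2 * sqmod d.
Proof.
case: c d => [a b] [a' b']; rewrite /sqmod /= -subr_ge0.
have -> : 2 * (a ^+ 2 + b ^+ 2) + 2 * (a' ^+ 2 + b' ^+ 2) -
  ((a + a') ^+ 2 + (b + b') ^+ 2) = (a - a') ^+ 2 + (b - b') ^+ 2 by ring.
by rewrite addr_ge0 ?sqr_ge0.
Qed.

Definition sqsum I (f : I -> R[i]) : \bar R :=
  (\esum_(i in [set: I]) (sqmod (f i))%:E)%E.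

Definition sq_summable I : {pred (I -> R[i])} :=
  fun f => `[< (sqsum f < +oo)%E >].

Lemma sq_summableP I (f : I -> R[i]) :
  reflect (sqsum f < +oo)%E (f \in @sq_summable I).
Proof. exact: asboolP. Qed.

Lemma esumZ_le I (c : R) (a : I -> \bar R) : 0 <= c -> (forall i, 0 <= a i)%E ->
  (\esum_(i in [set: I]) (c%:E * a i) <= c%:E * \esum_(i in [set: I]) a i)%E.
Proof.
move=> c0 a0; rewrite ge_ereal_sup => //= _ [X [finX _]] <-.
rewrite -ge0_mule_fsumr //; apply: lee_wpmul2l; first by rewrite lee_fin.
by apply: ereal_sup_ubound; exists X.
Qed.

Lemma sqsum_ge0 I (f : I -> R[i]) : (0 <= sqsum f)%E.
Proof. by apply: esum_ge0 => i _; rewrite lee_fin sqmod_ge0. Qed.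

Lemma sq_summable_submod I : submod_closed (@sq_summable I).
Proof.
split=> [|c f g /sq_summableP fs /sq_summableP gs].
  apply/sq_summableP; rewrite /sqsum esum1 ?ltry // => i _.
  by rewrite /sqmod /= expr0n addr0.
apply/sq_summableP.
apply: (@le_lt_trans _ _
  ((2 * sqmod c)%:E * sqsum f + 2%:E * sqsum g)%E); last first.
  by rewrite lte_add_pinfty // lte_mul_pinfty ?lee_fin ?mulr_ge0 ?sqmod_ge0.
apply: (@le_trans _ _ (\esum_(i in [set: I])
   ((2 * sqmod c)%:E * (sqmod (f i))%:E + 2%:E * (sqmod (g i))%:E))%E).
  apply: le_esum => i _; rewrite -!EFinM -EFinD lee_fin.
  by apply: le_trans (sqmodD_le _ _) _; rewrite sqmodM mulrA.
rewrite esumD; last 2 first.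
- by move=> i _; rewrite lee_fin !mulr_ge0 ?sqmod_ge0.
- by move=> i _; rewrite lee_fin !mulr_ge0 ?sqmod_ge0.
by apply: leeD; apply: esumZ_le; rewrite ?mulr_ge0 ?sqmod_ge0 // => i;
  rewrite lee_fin sqmod_ge0.
Qed.

HB.instance Definition _ I :=
  GRing.isSubmodClosed.Build _ _ (@sq_summable I) (@sq_summable_submod I).

Record ell2 I := Ell2 {ell2_val :> I -> R[i]; _ : ell2_val \in @sq_summable I}.

HB.instance Definition _ I := [isSub for @ell2_val I].
HB.instance Definition _ I := [Choice of ell2 I by <:].
HB.instance Definition _ I := [SubChoice_isSubLmodule of ell2 I by <:].

Lemma delta_subproof I (i : I) :
  (fun j => (j == i)%:R : R[i]) \in @sq_summable I.
Proof.
apply/sq_summableP; rewrite /sqsum.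
rewrite (eq_esum (b := fun j => if j \in [set i] then 1%:E else 0%E)); last first.
  move=> j _; have [->|ne] := eqVneq j i.
    by rewrite mem_set // /sqmod /= expr1n expr0n addr0.
  rewrite memNset; last by move=> /= e; rewrite e eqxx in ne.
  by rewrite /sqmod /= expr0n addr0.
by rewrite -esum_mkcond esum_set1 ?ltry ?lee_fin.
Qed.
Definition delta I (i : I) : ell2 I := Ell2 (delta_subproof i).

Lemma tens_subproof I J (xi : ell2 I) (eta : ell2 J) :
  (fun k => xi k.1 * eta k.2) \in @sq_summable (I * J)%type.
Proof.
have /sq_summableP xis := valP xi; have /sq_summableP etas := valP eta.
apply/sq_summableP; rewrite /sqsum.
have -> : [set: (I * J)%type] = [set: I] `*`` (fun _ => [set: J]).
  by apply/seteqP; split.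
rewrite -(esum_esum (a := fun i j => (sqmod (xi i * eta j))%:E)); last first.
  by move=> *; rewrite lee_fin sqmod_ge0.
apply: (@le_lt_trans _ _ (sqsum eta * sqsum xi)%E); last first.
  by rewrite lte_mul_pinfty ?sqsum_ge0 // ge0_fin_numE ?sqsum_ge0.
have [r r0 Er] : exists2 r : R, 0 <= r & sqsum eta = r%:E.
  have := sqsum_ge0 eta; case: (sqsum eta) etas => [r _ r0|//|//].
  by exists r; rewrite // -lee_fin.
rewrite Er; apply: le_trans (esumZ_le r0 _); last first.
  by move=> i; rewrite lee_fin sqmod_ge0.
apply: le_esum => i _; rewrite -Er muleC.
apply: le_trans (esumZ_le (sqmod_ge0 _) _); last first.
  by move=> j; rewrite lee_fin sqmod_ge0.
by apply: le_esum => j _; rewrite sqmodM EFinM.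
Qed.
Definition tens I J (xi : ell2 I) (eta : ell2 J) : ell2 (I * J)%type :=
  Ell2 (tens_subproof xi eta).

Definition l2norm I (xi : ell2 I) : R := Num.sqrt (fine (sqsum xi)).

Definition rsum I (f : I -> R) : R :=
  fine (\esum_(i in [set: I]) (Num.max (f i) 0)%:E)%E -
  fine (\esum_(i in [set: I]) (Num.max (- f i) 0)%:E)%E.

(* Linear in the second variable. *)
Definition ip I (xi eta : ell2 I) : R[i] :=
  let h i := (xi i)^*%C * eta i in
  Complex (rsum (fun i => complex.Re (h i))) (rsum (fun i => complex.Im (h i))).

Definition op I := ell2 I -> ell2 I.

Definition opnorm I (x : op I) : R :=
  sup [set l2norm (x xi) | xi in [set xi | l2norm xi <= 1]].

Definition bounded_op I : set (op I) :=
  [set x | linear x /\ exists M : R, forall xi, l2norm (x xi) <= M * l2norm xi].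

Definition adj I (x : op I) : op I :=
  xget 0 [set y | bounded_op y /\ forall xi eta, ip xi (x eta) = ip (y xi) eta].

Definition commutant I (S : set (op I)) : set (op I) :=
  [set y | bounded_op y /\ forall x, S x -> x \o y = y \o x].

(* The von Neumann algebra generated by S (double commutant theorem). *)
Definition vN I (S : set (op I)) : set (op I) :=
  commutant (commutant (S `|` [set adj x | x in S])).

Definition op_poly I (P : {poly R}) (x : op I) : op I :=
  fun xi => \sum_(k < size P) (P`_k)%:C%C *: iter k x xi.

(* Continuous functional calculus f(x) of a positive operator x: the limit in
   operator norm of P(x) as the polynomial P tends to f uniformly on
   [0, ||x||], which contains the spectrum of x. *)
Definition funcalc I (f : R -> R) (x : op I) : op I :=
  xget 0 [set y | bounded_op y /\ forall e : R, 0 < e -> exists P : {poly R},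
    (forall t, 0 <= t <= opnorm x -> `|P.[t] - f t| <= e) /\
    opnorm (op_poly P x - y) <= e].

(* |x|^p = (x^* x)^(p/2) *)
Definition abs_pow I (p : R) (x : op I) : op I :=
  funcalc (fun t => t `^ (p / 2)) (adj x \o x).

Definition diag_trace I (D : set I) (y : op I) : \bar R :=
  (\esum_(i in D) (complex.Re (ip (delta i) (y (delta i))))%:E)%E.

Definition tens_op I J (a : op I) (x : op J) : op (I * J)%type :=
  xget 0 [set y | bounded_op y /\
                  forall xi eta, y (tens xi eta) = tens (a xi) (x eta)].

End Ell2.

Arguments ell2 : clear implicits.
Arguments op : clear implicits.

(* A von Neumann algebra of operators on ell2 I, with a trace on its positive
   part. *)
Record tracial (R : realType) (I : choiceType) := Tracial {
  alg : set (op R I);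
  trace : op R I -> \bar R }.

Section Lp.
Context {R : realType} {I : choiceType}.
Variables (M : tracial R I) (p : R).

Definition pnorm (x : op R I) : \bar R := (trace M (abs_pow p x) `^ p^-1)%E.

Definition Lp_bounded : set (op R I) :=
  [set x | alg M x /\ (pnorm x < +oo)%E].

(* L_p(M) is the completion of [Lp_bounded]: its elements are the classes of
   Cauchy sequences modulo null sequences. *)
Definition opseq := nat -> op R I.

Definition Lp_cauchy (u : opseq) : Prop :=
  (forall n, Lp_bounded (u n)) /\
  forall e : R, 0 < e -> exists N, forall m n, (N <= m)%N -> (N <= n)%N ->
    (pnorm (u m - u n)%R < e%:E)%E.

Definition Lp_class (u : opseq) : set opseq :=
  [set v | Lp_cauchy v /\ (fun n => pnorm (u n - v n)) @ \oo --> 0%E].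

Definition Lp : set (set opseq) := [set Lp_class u | u in Lp_cauchy].

Definition Lp_emb (x : op R I) : set opseq := Lp_class (fun=> x).

Definition Lp_add (X Y : set opseq) : set opseq :=
  [set w | exists u v, [/\ X u, Y v & Lp_class (u + v) w]].

Definition Lp_scale (a : R[i]) (X : set opseq) : set opseq :=
  [set w | exists2 u, X u & Lp_class (fun n => a *: u n) w].

Definition Lp_norm (X : set opseq) : R :=
  limn (fun n => fine (pnorm (xget 0 X n))).

Definition Lp_linear (T : set opseq -> set opseq) : Prop :=
  (forall X, Lp X -> Lp (T X)) /\
  forall a X Y, Lp X -> Lp Y ->
    T (Lp_add (Lp_scale a X) Y) = Lp_add (Lp_scale a (T X)) (T Y).

Definition Lp_norm_le (C : R) (T : set opseq -> set opseq) : Prop :=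
  Lp_linear T /\ forall X, Lp X -> Lp_norm (T X) <= C * Lp_norm X.

End Lp.

Arguments opseq : clear implicits.

Definition Bell2 (R : realType) : tracial R nat :=
  Tracial (@bounded_op R nat) (diag_trace [set: nat]).

Section FreeGroupVN.
Context {R : realType}.

Lemma lambda_subproof (g : freegroup) (xi : ell2 R freegroup) :
  (fun h => xi (g^-1 * h)%g) \in @sq_summable R freegroup.
Proof.
have /sq_summableP xis := valP xi; apply/sq_summableP; move: xis.
rewrite /sqsum (reindex_esum [set: freegroup] [set: freegroup] (fun h => (g^-1 * h)%g)) //.
split=> // [h k _ _|h _]; first exact: mulgI.
by exists (g * h)%g; rewrite ?mulKg.
Qed.

(* lambda(g) maps delta_h to delta_(gh). *)
Definition lambda (g : freegroup) : op R freegroup :=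
  fun xi => Ell2 (lambda_subproof g xi).

Definition vNF : tracial R freegroup :=
  Tracial (vN (range lambda))
    (fun y => (complex.Re (ip (delta 1%g) (y (delta 1%g))))%:E).

(* B(ell2) tensor vNF, with the trace Tr tensor tau, which on a positive y is
   the sum over n of <delta_n x delta_e, y (delta_n x delta_e)>. *)
Definition Bell2_vNF : tracial R (nat * freegroup)%type :=
  Tracial (vN [set tens_op a x | a in alg (Bell2 R) & x in alg vNF])
    (diag_trace [set k | k.2 = 1%g]).

Definition Lp_tens (p : R) (a : op R nat) (X : set (opseq R freegroup)) :
    set (opseq R (nat * freegroup)%type) :=
  [set w | exists2 u, X u &
     Lp_class Bell2_vNF p (fun n => tens_op a (u n)) w].

(* T is completely bounded on L_p(vNF) with cb-norm at most C; B is the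
   extension of Id_(S_p) tensor T to L_p(B(ell2) tensor vNF), the Schatten
   class S_p being [Lp_bounded (Bell2 R) p], which is already complete. *)
Definition cb_norm_le (p C : R)
    (T : set (opseq R freegroup) -> set (opseq R freegroup)) : Prop :=
  Lp_linear vNF p T /\
  exists2 B, Lp_norm_le Bell2_vNF p C B &
    forall a X, Lp_bounded (Bell2 R) p a -> Lp vNF p X ->
      B (Lp_tens p a X) = Lp_tens p a (T X).

Definition torus (d : nat) : set ('I_d -> nat -> R[i]) :=
  [set z | forall j i, `|z j i| = 1].

(* z_(1,i_1)^(k_1) ... z_(d,i_d)^(k_d) for g = g_(i_1)^(k_1) ... g_(i_n)^(k_n);
   indices start at 0, and the default syllable (0, 0) contributes z^0 = 1. *)
Definition symbol_Ld (d : nat) (z : 'I_d -> nat -> R[i]) (g : freegroup) : R[i] :=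
  \prod_(j < d) (let s := nth (0%N, 0) (word g) j in z j s.1 ^ s.2).

(* The finite family c represents the element sum_s c_s lambda(g_s) of the
   group algebra. *)
Definition galg (c : seq (R[i] * freegroup)) : op R freegroup :=
  \sum_(s <- c) s.1 *: lambda s.2.

Definition alpha_Ld (d : nat) (z : 'I_d -> nat -> R[i])
    (c : seq (R[i] * freegroup)) : op R freegroup :=
  \sum_(s <- c) s.1 *: (symbol_Ld z s.2 *: lambda s.2).

Definition extends_alpha_Ld (p : R) (d : nat) (z : 'I_d -> nat -> R[i])
    (T : set (opseq R freegroup) -> set (opseq R freegroup)) : Prop :=
  forall c, T (Lp_emb vNF p (galg c)) = Lp_emb vNF p (alpha_Ld z c).

End FreeGroupVN.

Arguments vNF : clear implicits.

(* Main.v *)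
(* The algebra of matrices over C[F_oo] with finitely many entries is dense in
   the Lp-space of B(l_2) (x) vN(F_oo), so it suffices to bound the symbol
   z_(i_l)^(k_l) of the l-th syllable, for every l, on these matrices; the
   symbol of the theorem is a product of d of them.  At p = 2 the multiplier is
   an isometry.  A bound at p gives one at 2p as in Cotlar's identity:
   ||T x||_(2p)^2 = ||(T x)(T x)^*||_p, and on g h^-1 the symbol
   m(g) m(h)^* is 1, or is expressed by m(g h^-1), except for finitely many
   types of cancellation between g and h, which are separated by averaging
   multipliers over roots of unity and treated by induction on l.  Exponents in
   ]2, 4[ are reached by a Marcinkiewicz-type interpolation in which the
   decomposition of x is x k(x^* x) + x (1 - k(x^* x)) with k(t) = 1 / (1 + c t),
   the trace of phi(c x^* x), phi(t) = t^2 / (1 + t), is bounded by Klein's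
   inequality, and t^(p/2) is comparable with a sum of dilates of phi.
   Exponents below 2 follow by duality. *)

From HB Require Import structures.
Require Import Defs.
From mathcomp Require Import all_boot all_order all_algebra.
From mathcomp Require Import complex.
From mathcomp Require Import all_classical all_reals all_analysis.
From mathcomp Require Import ring lra zify.
From mathcomp Require cyclic separable cyclotomic.

Set Implicit Arguments.
Unset Strict Implicit.
Unset Printing Implicit Defensive.

Import Order.TTheory GRing.Theory Num.Theory.
Import numFieldNormedType.Exports.

Local Open Scope classical_set_scope.
Local Open Scope ring_scope.

(** * Sums of nonnegative families *)

(** No spectral measure is used. Positivity of polynomials in an operator comes from the Bernstein
    basis, and its two-variable form turns a scalar inequality in [f u] and [g v] into a trace
    inequality for operators that need not commute; the inequalities of Young (hence of Hoelder) and
    of Klein are instances. As the trace is infinite, norm inequalities are proved under projections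
    of finite trace and passed to the limit by lower semicontinuity. In the doubling step the kernel
    [m(g) m(h)^*] is a sum of terms that contain at most one of [m(g)] and [m(h)^*], plus an error
    supported on cancellations that reach letter l. With A and T the norms of the argument and of
    its image, this gives [T^2 <= c (A^2 + A T)], and T is absorbed. Separating the types of
    cancellation means comparing letters of [g h^-1] with letters of g and of h up to position l,
    which itself takes multipliers of the same kind at the exponent 2p. Circularity is avoided by an
    auxiliary symbol that reads only the generator of a letter: at each position it is bounded
    first, from earlier positions, and then serves to bound the full symbol. *)

Lemma maxB0 {R : realDomainType} (x : R) : Num.max x 0 - Num.max (- x) 0 = x.
Proof. by case: (leP x 0); case: (leP (- x) 0); lra. Qed.

Section Sums.
Context {R : realType} {I : choiceType}.
Implicit Types f g : I -> R.

Definition nnsum f : \bar R := (\esum_(i in [set: I]) (f i)%:E)%E.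

Lemma nnsum_ge0 f : (forall i, 0 <= f i) -> (0 <= nnsum f)%E.
Proof. by move=> f0; apply: esum_ge0 => i _; rewrite lee_fin. Qed.

Lemma le_nnsum f g : (forall i, f i <= g i) -> (nnsum f <= nnsum g)%E.
Proof. by move=> fg; apply: le_esum => i _; rewrite lee_fin. Qed.

Lemma nnsumD f g : (forall i, 0 <= f i) -> (forall i, 0 <= g i) ->
  nnsum (fun i => f i + g i) = (nnsum f + nnsum g)%E.
Proof. by move=> f0 g0; rewrite /nnsum -esumD // => i _; rewrite lee_fin. Qed.

Lemma nnsumZ (c : R) f : 0 <= c -> (forall i, 0 <= f i) ->
  nnsum (fun i => c * f i) = (c%:E * nnsum f)%E.
Proof.
move=> c0 f0; have [->|cN0] := eqVneq c 0.
  by rewrite mul0e /nnsum esum1 // => i _; rewrite mul0r.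
have cp : 0 < c by rewrite lt_neqAle eq_sym cN0.
apply/eqP; rewrite eq_le; apply/andP; split.
  rewrite /nnsum; under eq_esum => i _ do rewrite EFinM.
  by apply: esumZ_le => // i; rewrite lee_fin.
rewrite -lee_pdivlMl //.
rewrite [X in (X <= _)%E](_ : _ = nnsum (fun i => c^-1 * (c * f i))); last first.
  by apply: eq_esum => i _; rewrite mulKf.
rewrite /nnsum; under eq_esum => i _ do rewrite EFinM.
by apply: esumZ_le; [rewrite invr_ge0|move=> i; rewrite lee_fin mulr_ge0].
Qed.

Definition summb f := (nnsum (fun i => `|f i|%R) < +oo)%E.

Lemma fin_nnsum f : (forall i, 0 <= f i) -> (nnsum f < +oo)%E ->
  nnsum f = (fine (nnsum f))%:E.
Proof. by move=> f0 fo; rewrite fineK // ge0_fin_numE // nnsum_ge0. Qed.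

(** The positive and negative parts [a], [b] of [f] satisfy [a + v = u + b] pointwise, so every
    summable decomposition gives the same value. Additivity and homogeneity of [rsum] reduce to
    this. *)
Lemma rsum_sub f u v : (forall i, 0 <= u i) -> (forall i, 0 <= v i) ->
  (nnsum u < +oo)%E -> (nnsum v < +oo)%E -> (forall i, f i = u i - v i) ->
  rsum f = fine (nnsum u) - fine (nnsum v).
Proof.
move=> u0 v0 uo vo fuv.
pose a i := Num.max (f i) 0; pose b i := Num.max (- f i) 0.
have a0 i : 0 <= a i by rewrite le_max lexx orbT.
have b0 i : 0 <= b i by rewrite le_max lexx orbT.
have ab i : f i = a i - b i by rewrite maxB0.
have au i : a i <= u i.
  by rewrite /a ge_max u0 andbT fuv; have := v0 i; lra.
have bv i : b i <= v i.
  by rewrite /b ge_max v0 andbT fuv; have := u0 i; lra.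
have ao : (nnsum a < +oo)%E by apply: le_lt_trans (le_nnsum au) uo.
have bo : (nnsum b < +oo)%E by apply: le_lt_trans (le_nnsum bv) vo.
rewrite /rsum -/(nnsum a) -/(nnsum b).
have e : (nnsum a + nnsum v = nnsum u + nnsum b)%E.
  rewrite -!nnsumD //; apply: eq_esum => i _; congr (_%:E).
  by have := fuv i; have := ab i; lra.
move: e; rewrite (fin_nnsum a0) // (fin_nnsum b0) // (fin_nnsum u0) //.
rewrite (fin_nnsum v0) // -!EFinD => -[]; lra.
Qed.

Lemma summb_pos f : summb f -> (nnsum (fun i => Num.max (f i) 0)%R < +oo)%E.
Proof.
apply: le_lt_trans; apply: le_nnsum => i.
by rewrite ge_max normr_ge0 andbT ler_norm.
Qed.

Lemma summb_neg f : summb f -> (nnsum (fun i => Num.max (- f i) 0)%R < +oo)%E.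
Proof.
apply: le_lt_trans; apply: le_nnsum => i.
by rewrite ge_max normr_ge0 andbT -normrN ler_norm.
Qed.

Lemma rsumD f g : summb f -> summb g ->
  rsum (fun i => f i + g i) = rsum f + rsum g.
Proof.
move=> sf sg.
pose f1 i := Num.max (f i) 0; pose f2 i := Num.max (- f i) 0.
pose g1 i := Num.max (g i) 0; pose g2 i := Num.max (- g i) 0.
have f10 i : 0 <= f1 i by rewrite le_max lexx orbT.
have f20 i : 0 <= f2 i by rewrite le_max lexx orbT.
have g10 i : 0 <= g1 i by rewrite le_max lexx orbT.
have g20 i : 0 <= g2 i by rewrite le_max lexx orbT.
have f1o := summb_pos sf; have f2o := summb_neg sf.
have g1o := summb_pos sg; have g2o := summb_neg sg.
rewrite (@rsum_sub _ (fun i => f1 i + g1 i) (fun i => f2 i + g2 i)) //.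
- rewrite !nnsumD // (fin_nnsum f10) // (fin_nnsum f20) //.
  rewrite (fin_nnsum g10) // (fin_nnsum g20) // -!EFinD /=.
  by rewrite /rsum -/(nnsum f1) -/(nnsum f2) -/(nnsum g1) -/(nnsum g2); lra.
- by move=> i; rewrite addr_ge0.
- by move=> i; rewrite addr_ge0.
- by rewrite nnsumD // lte_add_pinfty.
- by rewrite nnsumD // lte_add_pinfty.
- by move=> i; have := maxB0 (f i); have := maxB0 (g i); rewrite /f1 /f2 /g1 /g2; lra.
Qed.

Lemma rsumN f : rsum (fun i => - f i) = - rsum f.
Proof.
rewrite /rsum opprB; congr (_ - fine _).
by apply: eq_esum => i _; rewrite opprK.
Qed.

Lemma rsumZ (c : R) f : summb f -> rsum (fun i => c * f i) = c * rsum f.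
Proof.
wlog c0 : c / 0 <= c => [hw|].
  have [/hw//|c0] := leP 0 c => sf.
  have -> : (fun i => c * f i) = (fun i => - ((- c) * f i)).
    by apply/funext => i; rewrite mulNr opprK.
  by rewrite rsumN hw // ?oppr_ge0 ?ltW // mulNr opprK.
move=> sf.
pose f1 i := Num.max (f i) 0; pose f2 i := Num.max (- f i) 0.
have f10 i : 0 <= f1 i by rewrite le_max lexx orbT.
have f20 i : 0 <= f2 i by rewrite le_max lexx orbT.
have f1o := summb_pos sf; have f2o := summb_neg sf.
rewrite (@rsum_sub _ (fun i => c * f1 i) (fun i => c * f2 i)) //.
- by rewrite !nnsumZ // (fin_nnsum f10) // (fin_nnsum f20) //= mulrBr.
- by move=> i; rewrite mulr_ge0.
- by move=> i; rewrite mulr_ge0.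
- by rewrite nnsumZ // (fin_nnsum f10) // -EFinM ltry.
- by rewrite nnsumZ // (fin_nnsum f20) // -EFinM ltry.
- by move=> i; rewrite -mulrBr maxB0.
Qed.

Lemma rsum_ge0E f : (forall i, 0 <= f i) -> rsum f = fine (nnsum f).
Proof.
move=> f0; rewrite /rsum (_ : (\esum_(i in _) (Num.max (- f i) 0)%:E = 0)%E).
  by rewrite subr0; congr fine; apply: eq_esum => i _; rewrite max_l.
by apply: esum1 => i _; rewrite max_r // oppr_le0.
Qed.

End Sums.

Section Sums2.
Context {R : realType} {I : choiceType}.
Implicit Types f g : I -> R.

Lemma nnsum_le f (M : R) :
  (forall s : seq I, uniq s -> \sum_(i <- s) f i <= M) -> (nnsum f <= M%:E)%E.
Proof.
move=> fM; rewrite ge_ereal_sup => //= _ [X [finX _]] <-.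
by rewrite fsbig_finite //= sumEFin lee_fin fM ?finmap.fset_uniq.
Qed.

Lemma nnsum_approx f (e : R) : 0 < e -> (forall i, 0 <= f i) ->
  (nnsum f < +oo)%E ->
  exists2 s : seq I, uniq s & fine (nnsum f) - e < \sum_(i <- s) f i.
Proof.
move=> e0 f0 fo; have := fin_nnsum f0 fo => E.
have : (nnsum f - e%:E < nnsum f)%E by rewrite {1}E E lte_fin; lra.
rewrite {2}/nnsum => /ereal_sup_gt [_ [X [finX _]] <-].
rewrite fsbig_finite //= sumEFin E -EFinB lte_fin => h.
by exists (finmap.enum_fset (fset_set X)) => //; exact: finmap.fset_uniq.
Qed.

Lemma nnsum1 (i : I) f : 0 <= f i -> (forall j, j != i -> f j = 0) ->
  nnsum f = (f i)%:E.
Proof.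
move=> f0 fz; rewrite /nnsum (eq_esum (b := fun j => if j \in [set i] then (f j)%:E else 0%E)).
  by rewrite -esum_mkcond esum_set1 // lee_fin.
move=> j _; case: (eqVneq j i) => [->|ne]; first by rewrite mem_set.
by rewrite memNset ?fz // => /= e; rewrite e eqxx in ne.
Qed.

Lemma rsum1 (i : I) f : (forall j, j != i -> f j = 0) -> rsum f = f i.
Proof.
move=> fz; rewrite /rsum -/(nnsum (fun i => Num.max (f i) 0)).
rewrite -/(nnsum (fun i => Num.max (- f i) 0)).
by rewrite !(@nnsum1 i) ?le_max ?lexx ?orbT //= ?maxB0 // => j /fz ->;
  rewrite ?oppr0 max_r.
Qed.
End Sums2.

(** * Square-summable families and the inner product *)

#[global] Arguments ip : simpl never.

Section InnerProduct.
Context {R : realType} {I : choiceType}.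
Implicit Types (xi eta zeta : ell2 R I) (a c : R[i]).

Notation Re := complex.Re.
Notation Im := complex.Im.

Definition nsq xi : R := fine (sqsum xi).

Lemma sqsumE xi : sqsum xi = (nsq xi)%:E.
Proof.
rewrite /nsq -[sqsum xi]/(nnsum (fun i => sqmod (xi i))) -fin_nnsum //.
  by move=> i; exact: sqmod_ge0.
by have /sq_summableP := valP xi.
Qed.

Lemma nsq_ge0 xi : 0 <= nsq xi.
Proof. by rewrite -lee_fin -sqsumE sqsum_ge0. Qed.

Lemma l2normE xi : l2norm xi = Num.sqrt (nsq xi). Proof. by []. Qed.

Lemma sqr_l2norm xi : l2norm xi ^+ 2 = nsq xi.
Proof. by rewrite sqr_sqrtr ?nsq_ge0. Qed.

Lemma ell2_ext xi eta : xi =1 eta -> xi = eta.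
Proof. by move=> e; apply/val_inj/funext. Qed.

Lemma ell2D xi eta i : (xi + eta) i = xi i + eta i. Proof. by []. Qed.
Lemma ell2N xi i : (- xi) i = - xi i. Proof. by []. Qed.
Lemma ell2Z a xi i : (a *: xi) i = a * xi i. Proof. by []. Qed.
Lemma ell2_sum (J : Type) (s : seq J) (F : J -> ell2 R I) i :
  (\sum_(j <- s) F j) i = \sum_(j <- s) F j i.
Proof. by elim/big_ind2: _ => // x1 x2 y1 y2 <- <-. Qed.
Lemma deltaE (i j : I) : (delta i : ell2 R I) j = (j == i)%:R. Proof. by []. Qed.

Lemma sqmod_eq0 c : (sqmod c == 0) = (c == 0).
Proof.
case: c => a b; rewrite /sqmod /= paddr_eq0 ?sqr_ge0 // !sqrf_eq0.
by rewrite eq_complex.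
Qed.

Lemma sqmodJ c : sqmod c^*%C = sqmod c.
Proof. by case: c => a b; rewrite /sqmod /= sqrrN. Qed.

Lemma Re_conjM c a : `|Re (c^*%C * a)| <= sqmod c + sqmod a.
Proof.
case: c a => [x y] [z t]; rewrite /sqmod /= ler_norml; apply/andP; split;
 have := sqr_ge0 (x - z); have := sqr_ge0 (x + z); have := sqr_ge0 (y - t);
 have := sqr_ge0 (y + t); have := sqr_ge0 x; have := sqr_ge0 z;
 have := sqr_ge0 y; have := sqr_ge0 t; rewrite !expr2; lra.
Qed.

Lemma Im_conjM c a : `|Im (c^*%C * a)| <= sqmod c + sqmod a.
Proof.
case: c a => [x y] [z t]; rewrite /sqmod /= ler_norml; apply/andP; split;
 have := sqr_ge0 (x - t); have := sqr_ge0 (x + t); have := sqr_ge0 (y - z);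
 have := sqr_ge0 (y + z); have := sqr_ge0 x; have := sqr_ge0 z;
 have := sqr_ge0 y; have := sqr_ge0 t; rewrite !expr2; lra.
Qed.

Lemma summb_sqmod2 xi eta (f : I -> R) :
  (forall i, `|f i| <= sqmod (xi i) + sqmod (eta i)) -> summb f.
Proof.
move=> fle; apply: le_lt_trans (le_nnsum fle) _.
rewrite nnsumD => [|i|i]; try exact: sqmod_ge0.
by rewrite -[nnsum _]/(sqsum xi) -[X in (_ + X)%E]/(sqsum eta) !sqsumE -EFinD ltry.
Qed.

Lemma summb_Re xi eta : summb (fun i => Re ((xi i)^*%C * eta i)).
Proof. by apply: (summb_sqmod2 (xi := xi) (eta := eta)) => i; exact: Re_conjM. Qed.
Lemma summb_Im xi eta : summb (fun i => Im ((xi i)^*%C * eta i)).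
Proof. by apply: (summb_sqmod2 (xi := xi) (eta := eta)) => i; exact: Im_conjM. Qed.

Lemma ReD a c : Re (a + c) = Re a + Re c. Proof. by case: a c => ? ? []. Qed.
Lemma ImD a c : Im (a + c) = Im a + Im c. Proof. by case: a c => ? ? []. Qed.
Lemma ReN a : Re (- a) = - Re a. Proof. by case: a. Qed.
Lemma ImN a : Im (- a) = - Im a. Proof. by case: a. Qed.
Lemma ReM a c : Re (a * c) = Re a * Re c - Im a * Im c. Proof. by case: a c => ? ? []. Qed.
Lemma ImM a c : Im (a * c) = Re a * Im c + Im a * Re c. Proof. by case: a c => ? ? []. Qed.
Lemma complex_ext a c : Re a = Re c -> Im a = Im c -> a = c.
Proof. by case: a c => ? ? [? ?] /= -> ->. Qed.

Lemma ipDr xi eta zeta : ip xi (eta + zeta) = ip xi eta + ip xi zeta.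
Proof.
apply: complex_ext; rewrite ?ReD ?ImD.
  transitivity (rsum (fun i => Re ((xi i)^*%C * eta i) + Re ((xi i)^*%C * zeta i))).
    by congr rsum; apply/funext => i; rewrite -ReD -mulrDr.
  by rewrite rsumD //; exact: summb_Re.
transitivity (rsum (fun i => Im ((xi i)^*%C * eta i) + Im ((xi i)^*%C * zeta i))).
  by congr rsum; apply/funext => i; rewrite -ImD -mulrDr.
by rewrite rsumD //; exact: summb_Im.
Qed.

Lemma summbZ (c : R) (f : I -> R) : summb f -> summb (fun i => c * f i).
Proof.
move=> sf; rewrite /summb (_ : (fun i => _) = (fun i => `|c| * `|f i|)).
  by rewrite nnsumZ // fin_nnsum // -EFinM ltry.
by apply/funext => i; rewrite normrM.
Qed.

Lemma ipZr xi c eta : ip xi (c *: eta) = c * ip xi eta.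
Proof.
have sR := summb_Re xi eta; have sI := summb_Im xi eta.
apply: complex_ext; rewrite ?ReM ?ImM -?mulNr.
  transitivity (rsum (fun i => Re c * Re ((xi i)^*%C * eta i) +
                               - Im c * Im ((xi i)^*%C * eta i))).
    by congr rsum; apply/funext => i; rewrite -[LHS]/(Re ((xi i)^*%C * (c * eta i))) !ReM !ImM; ring.
  by rewrite rsumD ?rsumZ //; exact: summbZ.
transitivity (rsum (fun i => Re c * Im ((xi i)^*%C * eta i) +
                             Im c * Re ((xi i)^*%C * eta i))).
  by congr rsum; apply/funext => i; rewrite -[LHS]/(Im ((xi i)^*%C * (c * eta i))) !ImM !ReM; ring.
by rewrite rsumD ?rsumZ //; exact: summbZ.
Qed.

Lemma cjD a c : (a + c)^*%C = a^*%C + c^*%C. Proof. exact: rmorphD. Qed.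
Lemma cjM a c : (a * c)^*%C = a^*%C * c^*%C. Proof. exact: rmorphM. Qed.
Lemma cjN c : (- c)^*%C = - c^*%C. Proof. exact: rmorphN. Qed.
Lemma cj0 : (0 : R[i])^*%C = 0. Proof. exact: rmorph0. Qed.
Lemma cj1 : (1 : R[i])^*%C = 1. Proof. exact: rmorph1. Qed.
Lemma ReJ c : Re c^*%C = Re c. Proof. by case: c. Qed.
Lemma ImJ c : Im c^*%C = - Im c. Proof. by case: c. Qed.

Lemma ipC xi eta : ip eta xi = (ip xi eta)^*%C.
Proof.
apply: complex_ext; rewrite ?ReJ ?ImJ.
  by congr rsum; apply/funext => i; rewrite -[RHS]/(Re ((xi i)^*%C * eta i)) !ReM !ReJ !ImJ; ring.
rewrite -rsumN; congr rsum; apply/funext => i.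
by rewrite -[X in - X]/(Im ((xi i)^*%C * eta i)) !ImM !ReJ !ImJ; ring.
Qed.

Lemma ipDl xi eta zeta : ip (eta + zeta) xi = ip eta xi + ip zeta xi.
Proof. by rewrite ipC ipDr cjD -!ipC. Qed.
Lemma ipZl xi c eta : ip (c *: eta) xi = c^*%C * ip eta xi.
Proof. by rewrite ipC ipZr cjM -ipC. Qed.
Lemma ip0r xi : ip xi 0 = 0.
Proof. by have := ipZr xi 0 0; rewrite scale0r mul0r. Qed.
Lemma ip0l xi : ip 0 xi = 0.
Proof. by rewrite ipC ip0r cj0. Qed.
Lemma ipNr xi eta : ip xi (- eta) = - ip xi eta.
Proof. by rewrite -scaleN1r ipZr mulN1r. Qed.
Lemma ipNl xi eta : ip (- xi) eta = - ip xi eta.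
Proof. by rewrite ipC ipNr cjN -ipC. Qed.
Lemma ipBr xi eta zeta : ip xi (eta - zeta) = ip xi eta - ip xi zeta.
Proof. by rewrite ipDr ipNr. Qed.
Lemma ipBl xi eta zeta : ip (eta - zeta) xi = ip eta xi - ip zeta xi.
Proof. by rewrite ipDl ipNl. Qed.
Lemma ip_suml (J : Type) (s : seq J) (F : J -> ell2 R I) xi :
  ip (\sum_(j <- s) F j) xi = \sum_(j <- s) ip (F j) xi.
Proof. by elim/big_ind2: _ => [|x1 x2 y1 y2 <- <-|//]; rewrite ?ip0l ?ipDl. Qed.

Lemma conjM_sqmod c : c^*%C * c = (sqmod c)%:C%C.
Proof. by case: c => x y; rewrite /sqmod; simpc; congr (_ +i* _)%C; ring. Qed.

Lemma ip_nsq xi : ip xi xi = (nsq xi)%:C%C.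
Proof.
apply/eqP; rewrite eq_complex /ip /=; apply/andP; split; apply/eqP.
  rewrite rsum_ge0E; last by move=> i; rewrite conjM_sqmod /= sqmod_ge0.
  by congr fine; apply: eq_esum => i _; rewrite conjM_sqmod.
rewrite (_ : (fun i => _) = (fun=> 0)) ?rsum_ge0E // /nnsum ?esum1 //.
by apply/funext => i; rewrite conjM_sqmod.
Qed.

Lemma nsqE xi : nsq xi = Re (ip xi xi). Proof. by rewrite ip_nsq. Qed.

Lemma ip_deltal i xi : ip (delta i) xi = xi i.
Proof.
have z j : j != i -> (delta i j)^*%C * xi j = 0.
  by move=> /negbTE ne; rewrite deltaE ne cj0 mul0r.
have o : (delta i i)^*%C * xi i = xi i by rewrite deltaE eqxx cj1 mul1r.
apply: complex_ext.
  by rewrite -[LHS]/(rsum (fun j => Re ((delta i j)^*%C * xi j))) (rsum1 (i := i)) ?o // => j /z ->.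
by rewrite -[LHS]/(rsum (fun j => Im ((delta i j)^*%C * xi j))) (rsum1 (i := i)) ?o // => j /z ->.
Qed.

Lemma nsq_delta i : nsq (delta i) = 1.
Proof. by rewrite nsqE ip_deltal deltaE eqxx. Qed.

Lemma nsqN xi : nsq (- xi) = nsq xi.
Proof. by rewrite !nsqE ipNl ipNr opprK. Qed.
Lemma nsqZ c xi : nsq (c *: xi) = sqmod c * nsq xi.
Proof.
by rewrite nsqE ipZl ipZr mulrA conjM_sqmod ip_nsq -rmorphM.
Qed.
Lemma nsq0 : nsq 0 = 0. Proof. by rewrite nsqE ip0l. Qed.
Lemma nsqD xi eta : nsq (xi + eta) = nsq xi + nsq eta + 2 * Re (ip xi eta).
Proof.
rewrite !nsqE ipDl !ipDr (ipC xi eta) !ReD ReJ; ring.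
Qed.
Lemma nsqB xi eta : nsq (xi - eta) = nsq xi + nsq eta - 2 * Re (ip xi eta).
Proof. by rewrite nsqD nsqN ipNr ReN mulrN. Qed.

Lemma nsqD_le xi eta : nsq (xi + eta) <= 2 * nsq xi + 2 * nsq eta.
Proof.
have := nsq_ge0 (xi - eta); rewrite nsqB nsqD; lra.
Qed.

(** The quadratic [nsq (eta - t w xi)] in real [t], with [w] the inner product, is nonnegative;
    [t = 1 / nsq xi] is its minimum. *)
Lemma cauchy_schwarz xi eta : sqmod (ip xi eta) <= nsq xi * nsq eta.
Proof.
pose w := ip xi eta; have key (t : R) : 0 <= nsq eta - 2 * t * sqmod w + t ^+ 2 * sqmod w * nsq xi.
  have := nsq_ge0 (eta - (t%:C%C * w) *: xi); congr (_ <= _).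
  rewrite nsqB nsqZ ipZr (ipC xi eta) -/w sqmodM.
  by case: (w) => x y; rewrite /sqmod /=; ring.
have [x0|xN0] := eqVneq (nsq xi) 0.
  rewrite x0 mul0r -/w; rewrite leNgt; apply/negP => w0.
  (* When [nsq xi] vanishes the quadratic is affine in [t], and this [t] gives it the value -1. *)
  have := key ((nsq eta + 1) / (2 * sqmod w)).
  rewrite x0 mulr0 addr0; rewrite (_ : 2 * _ * _ = nsq eta + 1); first lra.
  by field; lra.
have xp : 0 < nsq xi by rewrite lt_neqAle eq_sym xN0 nsq_ge0.
have := key (nsq xi)^-1; rewrite (_ : _ + _ = nsq eta - sqmod w / nsq xi); last by field; lra.
by rewrite subr_ge0 ler_pdivrMr // mulrC.
Qed.

Lemma Re_sqmod_le c : `|Re c| <= Num.sqrt (sqmod c).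
Proof.
case: c => x y; rewrite -sqrtr_sqr ler_sqrt /sqmod /= ?addr_ge0 ?sqr_ge0 //.
by rewrite lerDl sqr_ge0.
Qed.

Lemma Re_ip_le xi eta : Re (ip xi eta) <= l2norm xi * l2norm eta.
Proof.
apply: le_trans (le_trans (ler_norm _) (Re_sqmod_le _)) _.
by rewrite !l2normE -sqrtrM ?nsq_ge0 // ler_wsqrtr ?cauchy_schwarz.
Qed.

Lemma l2norm_ge0 xi : 0 <= l2norm xi. Proof. exact: sqrtr_ge0. Qed.

Lemma l2normD xi eta : l2norm (xi + eta) <= l2norm xi + l2norm eta.
Proof.
rewrite -ler_sqr ?nnegrE ?addr_ge0 ?l2norm_ge0 // sqr_l2norm nsqD sqrrD !sqr_l2norm.
have := Re_ip_le xi eta; rewrite -mulr_natl; lra.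
Qed.
Lemma l2normZ c xi : l2norm (c *: xi) = Num.sqrt (sqmod c) * l2norm xi.
Proof. by rewrite l2normE nsqZ sqrtrM ?sqmod_ge0. Qed.
Lemma l2norm0 : l2norm (0 : ell2 R I) = 0. Proof. by rewrite l2normE nsq0 sqrtr0. Qed.
Lemma l2normN xi : l2norm (- xi) = l2norm xi. Proof. by rewrite !l2normE nsqN. Qed.

Lemma coord_le xi i : sqmod (xi i) <= nsq xi.
Proof. by rewrite -ip_deltal; apply: le_trans (cauchy_schwarz _ _) _; rewrite nsq_delta mul1r. Qed.

Lemma nsq_eq0 xi : nsq xi = 0 -> xi = 0.
Proof.
move=> x0; apply: ell2_ext => i; apply/eqP; rewrite -sqmod_eq0 eq_le sqmod_ge0 andbT.
by rewrite -x0 coord_le.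
Qed.

Definition finpart (f : I -> R[i]) (s : seq I) : ell2 R I :=
  \sum_(i <- s) f i *: delta i.

Lemma finpart_coord (f : I -> R[i]) s i : uniq s ->
  finpart f s i = if i \in s then f i else 0.
Proof.
move=> us; rewrite ell2_sum; have [si|si] := boolP (i \in s).
  rewrite (bigD1_seq i si us) big1 => [|j /negbTE ne].
    by rewrite ell2Z deltaE eqxx mulr1 /= addr0.
  by rewrite ell2Z deltaE eq_sym ne mulr0.
rewrite big_seq big1 // => j sj; rewrite ell2Z deltaE; case: eqVneq => [e|]; rewrite ?mulr0 //.
by rewrite -e in sj; rewrite sj in si.
Qed.

Lemma ip_finpart (f : I -> R[i]) s eta :
  ip (finpart f s) eta = \sum_(i <- s) (f i)^*%C * eta i.
Proof. by rewrite ip_suml; apply: eq_bigr => i _; rewrite ipZl ip_deltal. Qed.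

Lemma ip_finpart_sqmod (f : I -> R[i]) s eta : (forall i, i \in s -> eta i = f i) ->
  ip (finpart f s) eta = (\sum_(i <- s) sqmod (f i))%:C%C.
Proof.
move=> h; rewrite ip_finpart rmorph_sum /=; apply: eq_big_seq => i si.
by rewrite h // conjM_sqmod.
Qed.

Lemma nsq_finpart0 (f : I -> R[i]) s : uniq s ->
  nsq (finpart f s) = \sum_(i <- s) sqmod (f i).
Proof.
move=> us; rewrite nsqE ip_finpart_sqmod // => i si.
by rewrite finpart_coord // si.
Qed.

Lemma nsq_finpart xi s : uniq s -> nsq (xi - finpart xi s) = nsq xi - \sum_(i <- s) sqmod (xi i).
Proof.
move=> us.
by rewrite nsqB (ipC (finpart xi s)) ip_finpart_sqmod // conjc_real nsq_finpart0 //=; ring.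
Qed.

Lemma finpart_approx xi (e : R) : 0 < e ->
  exists2 s : seq I, uniq s & nsq (xi - finpart xi s) < e.
Proof.
move=> e0; have [] := @nnsum_approx R I (fun i => sqmod (xi i)) e e0.
- by move=> i; exact: sqmod_ge0.
- by rewrite -[nnsum _]/(sqsum xi) sqsumE ltry.
move=> s us; rewrite -[fine _]/(nsq xi) => h; exists s => //.
by rewrite nsq_finpart //; lra.
Qed.

Lemma nsq_le_of_fin (f : I -> R[i]) (M : R) :
  (forall s : seq I, uniq s -> \sum_(i <- s) sqmod (f i) <= M) ->
  exists xi, (forall i, xi i = f i) /\ nsq xi <= M.
Proof.
move=> fM; have := nnsum_le fM; rewrite -[nnsum _]/(sqsum f) => fle.
have fs : f \in @sq_summable R I by apply/sq_summableP/(le_lt_trans fle); rewrite ltry.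
by exists (Ell2 fs); split => //; rewrite -lee_fin -sqsumE.
Qed.

End InnerProduct.

(** * Completeness of l_2 *)

Section Completeness.
Context {R : realType}.

Lemma real_complete (u : nat -> R) :
  (forall e, 0 < e -> exists N, forall m n, (N <= m)%N -> (N <= n)%N -> `|u m - u n| <= e) ->
  exists l, forall e, 0 < e -> exists N, forall n, (N <= n)%N -> `|u n - l| <= e.
Proof.
move=> cu; have /cauchy_cvgP uc : cauchy (u @ \oo).
  apply/cauchyP => e e0 /=; have e2 : 0 < e / 2 by rewrite divr_gt0.
  have [N hN] := cu _ e2; exists (u N); exists N => // n /= Nn.
  by rewrite /ball /=; apply: le_lt_trans (hN _ _ (leqnn N) Nn) _; lra.
exists (limn u) => e e0; have /cvgrPdist_le /(_ _ e0) [N _ hN] := uc.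
by exists N => n Nn; rewrite distrC; exact: hN.
Qed.

Lemma sqmod_ReIm (c : R[i]) (e : R) : `|complex.Re c| <= e -> `|complex.Im c| <= e ->
  sqmod c <= 2 * e ^+ 2.
Proof.
rewrite /sqmod => h1 h2.
rewrite -[complex.Re c ^+ 2]real_normK ?num_real // -[complex.Im c ^+ 2]real_normK ?num_real //.
have := @ler_sqr _ `|complex.Re c| e; have := @ler_sqr _ `|complex.Im c| e.
rewrite !nnegrE !normr_ge0 (le_trans _ h1) //= => /(_ isT isT) i1 /(_ isT isT) i2.
by rewrite mulr2n mulrDl !mul1r lerD // ?i1 ?i2.
Qed.

Lemma sqmod_le_ReIm (c : R[i]) (e : R) : 0 <= e -> sqmod c <= e ^+ 2 ->
  `|complex.Re c| <= e /\ `|complex.Im c| <= e.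
Proof.
rewrite /sqmod => e0 h; split; rewrite -ler_sqr ?nnegrE // real_normK ?num_real //;
  apply: le_trans h; rewrite ?lerDl ?lerDr sqr_ge0 //.
Qed.

Context {I : choiceType}.

(** Coordinates converge; on a finite set of them [u m] is compared with the limit through some
    [u n] with [n] large ([key]), which yields a bound independent of the finite set. *)
Lemma ell2_complete (u : nat -> ell2 R I) :
  (forall e, 0 < e -> exists N, forall m n, (N <= m)%N -> (N <= n)%N -> nsq (u m - u n) <= e) ->
  exists l, forall e, 0 < e -> exists N, forall n, (N <= n)%N -> nsq (u n - l) <= e.
Proof.
move=> cu.
have cui i : exists c : R[i], forall e, 0 < e -> exists N, forall n, (N <= n)%N ->
    sqmod (u n i - c) <= e.
  have h e : 0 < e -> exists N, forall m n, (N <= m)%N -> (N <= n)%N ->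
      `|complex.Re (u m i) - complex.Re (u n i)| <= e /\
      `|complex.Im (u m i) - complex.Im (u n i)| <= e.
    move=> e0; have e2 : 0 < e ^+ 2 by rewrite exprn_gt0.
    have [N hN] := cu _ e2; exists N => m n Nm Nn.
    rewrite -ReN -ImN -ReD -ImD; apply: sqmod_le_ReIm (ltW e0) _.
    exact: le_trans (coord_le (u m - u n) i) (hN _ _ Nm Nn).
  have [a ha] : exists a, forall e, 0 < e -> exists N, forall n, (N <= n)%N ->
      `|complex.Re (u n i) - a| <= e.
    by apply: real_complete => e /h [N hN]; exists N => m n Nm Nn; have [] := hN m n Nm Nn.
  have [b hb] : exists b, forall e, 0 < e -> exists N, forall n, (N <= n)%N ->
      `|complex.Im (u n i) - b| <= e.
    by apply: real_complete => e /h [N hN]; exists N => m n Nm Nn; have [] := hN m n Nm Nn.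
  exists (Complex a b) => e e0; pose d := Num.min 1 (e / 2).
  have d0 : 0 < d by rewrite lt_min ltr01 divr_gt0.
  have [N1 h1] := ha _ d0; have [N2 h2] := hb _ d0.
  exists (maxn N1 N2) => n; rewrite geq_max => /andP[/h1 k1 /h2 k2].
  have := @sqmod_ReIm (u n i - Complex a b) d; rewrite ReD ImD ReN ImN => /(_ k1 k2).
  move/le_trans; apply; have d1 : d <= 1 by rewrite ge_min lexx.
  have d2 : d <= e / 2 by rewrite ge_min lexx orbT.
  have : d ^+ 2 <= d by rewrite expr2 ler_piMl // ltW.
  lra.
pose f i := projT1 (cid (cui i)).
have fP i := projT2 (cid (cui i)).
have hconv (s : seq I) (eps : R) : 0 < eps -> exists N', forall n, (N' <= n)%N ->
    \sum_(i <- s) 2 * sqmod (u n i - f i) <= eps.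
  elim: s eps => [|i s IH] eps eps0; first by exists 0%N => n _; rewrite big_nil ltW.
  have [N3 h3] := IH (eps / 2) ltac:(lra); have [N2 h2] := fP i (eps / 4) ltac:(lra).
  exists (maxn N3 N2) => n; rewrite geq_max => /andP[/h3 k1 /h2 k2].
  by rewrite big_cons; lra.
have key m M : (exists N, forall n, (N <= n)%N -> nsq (u m - u n) <= M) ->
    forall s : seq I, uniq s -> \sum_(i <- s) sqmod (u m i - f i) <= 2 * M.
  move=> [N hN] s us; apply/ler_addgt0Pr => eps /(hconv s) [N' hN'].
  pose n := maxn N N'.
  apply: (@le_trans _ _ (\sum_(i <- s) (2 * sqmod ((u m - u n) i) + 2 * sqmod (u n i - f i)))).
    apply: ler_sum => i _; rewrite ell2D ell2N.
    by apply: le_trans (sqmodD_le _ _); rewrite addrA subrK.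
  rewrite big_split /= lerD ?hN' ?leq_maxr //.
  rewrite -mulr_sumr; have := hN n (leq_maxl _ _).
  have := nsq_ge0 ((u m - u n) - finpart (u m - u n) s); rewrite nsq_finpart //; lra.
have [N1 h1] := cu 1 ltr01.
(* The bound available is on [u N1 - f], so this difference is made a vector [d] and the limit is
   written [u N1 - d]. *)
have [d [dE _]] := @nsq_le_of_fin R I (fun i => u N1 i - f i) _
  (key N1 1 (ex_intro _ N1 (fun n Nn => h1 N1 n (leqnn _) Nn))).
exists (u N1 - d) => e e0.
have fE i : (u N1 - d) i = f i by rewrite ell2D ell2N dE opprB addrC subrK.
have [N hN] := cu (e / 2) ltac:(lra).
exists N => m Nm; rewrite -lee_fin -sqsumE; apply: nnsum_le => s us.
have := key m (e / 2) (ex_intro _ N (fun n Nn => hN m n Nm Nn)) s us.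
rewrite mulrC divfK //; apply: le_trans; rewrite le_eqVlt; apply/orP; left; apply/eqP.
by apply: eq_bigr => i _; rewrite ell2D ell2N fE.
Qed.

End Completeness.

(** * Bounded operators on l_2 *)

Section BoundedOp.
Context {R : realType} {I : choiceType}.
Implicit Types (x y : op R I) (xi eta : ell2 R I).

Definition opbd x (c : R) := forall xi, nsq (x xi) <= c * nsq xi.

Lemma bounded_opP x : bounded_op x <-> linear x /\ exists2 c, 0 <= c & opbd x c.
Proof.
split=> -[lx]; last first.
  move=> [c c0 xc]; split=> //; exists (Num.sqrt c) => xi.
  by rewrite !l2normE -sqrtrM // ler_wsqrtr.
move=> [M xM]; split=> //; exists (M ^+ 2); rewrite ?sqr_ge0 // => xi.
rewrite -!sqr_l2norm -exprMn ler_sqr ?nnegrE ?l2norm_ge0 //.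
exact: le_trans (l2norm_ge0 _) (xM _).
Qed.

Definition bounded_pred : {pred op R I} := fun x => `[< bounded_op x >].

Lemma bounded_predP x : reflect (bounded_op x) (x \in bounded_pred).
Proof. exact: asboolP. Qed.

Lemma bounded_submod : submod_closed bounded_pred.
Proof.
split=> [|c x y /bounded_predP/bounded_opP[lx [a a0 xa]] /bounded_predP/bounded_opP[ly [b b0 yb]]].
  apply/bounded_predP/bounded_opP; split=> [k u v|]; first by rewrite /= scaler0 addr0.
  by exists 0 => // xi; rewrite mul0r nsq0.
apply/bounded_predP/bounded_opP; split=> [k u v|].
  have E w : (c *: x + y) w = c *: x w + y w by [].
  by rewrite !E lx ly !scalerDr !scalerA (mulrC c k) addrACA.
exists (2 * sqmod c * a + 2 * b).
  by rewrite addr_ge0 ?mulr_ge0 ?sqmod_ge0.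
move=> xi; apply: le_trans (nsqD_le (c *: x xi) (y xi)) _; rewrite nsqZ.
have := ler_wpM2l (sqmod_ge0 c) (xa xi); have := yb xi; lra.
Qed.

HB.instance Definition _ := GRing.isSubmodClosed.Build _ _ bounded_pred bounded_submod.

Record bop := Bop {bfun :> ell2 R I -> ell2 R I; _ : bfun \in bounded_pred}.

HB.instance Definition _ := [isSub for bfun].
HB.instance Definition _ := [Choice of bop by <:].
HB.instance Definition _ := [SubChoice_isSubLmodule of bop by <:].

Implicit Types a b c : bop.

Lemma bopP a : bounded_op a. Proof. exact/bounded_predP/valP. Qed.
Lemma bop_ext a b : (forall xi, a xi = b xi) -> a = b.
Proof. by move=> e; apply/val_inj/funext. Qed.
Lemma bop_linear a : linear a. Proof. by case: (bopP a). Qed.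
Lemma bop_bd a : exists2 c, 0 <= c & opbd a c.
Proof. by have /bounded_opP[] := bopP a. Qed.

Lemma bopD a xi eta : a (xi + eta) = a xi + a eta.
Proof. by have := bop_linear a 1 xi eta; rewrite !scale1r. Qed.
Lemma bop0 a : a 0 = 0.
Proof. by apply: (addrI (a 0)); rewrite -bopD !addr0. Qed.
Lemma bopZ a k xi : a (k *: xi) = k *: a xi.
Proof. by have := bop_linear a k xi 0; rewrite !addr0 bop0 addr0. Qed.
Lemma bopN a xi : a (- xi) = - a xi.
Proof. by rewrite -scaleN1r bopZ scaleN1r. Qed.
Lemma bopB a xi eta : a (xi - eta) = a xi - a eta.
Proof. by rewrite bopD bopN. Qed.
Lemma bop_sum a (J : Type) (s : seq J) (F : J -> ell2 R I) :
  a (\sum_(j <- s) F j) = \sum_(j <- s) a (F j).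
Proof. by elim/big_ind2: _ => [|x1 x2 y1 y2 <- <-|//]; rewrite ?bop0 ?bopD. Qed.

Lemma bopDE a b xi : (a + b) xi = a xi + b xi. Proof. by []. Qed.
Lemma bopNE a xi : (- a) xi = - a xi. Proof. by []. Qed.
Lemma bopZE k a xi : (k *: a) xi = k *: a xi. Proof. by []. Qed.
Lemma bop0E xi : (0 : bop) xi = 0. Proof. by []. Qed.
Lemma bop_sumE (J : Type) (s : seq J) (F : J -> bop) xi :
  (\sum_(j <- s) F j) xi = \sum_(j <- s) F j xi.
Proof. by elim/big_ind2: _ => // x1 x2 y1 y2 <- <-. Qed.

Definition toBop x (h : bounded_op x) : bop := Bop (introT (bounded_predP x) h).

Lemma bounded_comp a b : bounded_op (a \o b).
Proof.
apply/bounded_opP; split=> [k u v /=|]; first by rewrite !bop_linear.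
have [c c0 ac] := bop_bd a; have [d d0 bd] := bop_bd b.
exists (c * d); rewrite ?mulr_ge0 // => xi /=.
by apply: le_trans (ac _) _; rewrite -mulrA ler_wpM2l.
Qed.
Definition bmul a b : bop := toBop (bounded_comp a b).

Lemma bounded_id : bounded_op (id : op R I).
Proof.
apply/bounded_opP; split; first by [].
by exists 1 => // xi; rewrite mul1r.
Qed.
Definition bone : bop := toBop bounded_id.

Lemma bmulE a b xi : bmul a b xi = a (b xi). Proof. by []. Qed.
Lemma boneE xi : bone xi = xi. Proof. by []. Qed.
Lemma bmulA : associative bmul. Proof. by move=> a b c; apply: bop_ext => xi; rewrite !bmulE. Qed.
Lemma bmul1 : left_id bone bmul.
Proof. by move=> a; apply: bop_ext => xi; rewrite bmulE boneE. Qed.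
Lemma bmulr1 : right_id bone bmul.
Proof. by move=> a; apply: bop_ext => xi; rewrite bmulE boneE. Qed.
Lemma bmulDl : left_distributive bmul +%R.
Proof. by move=> a b c; apply: bop_ext => xi; rewrite bopDE !bmulE bopDE. Qed.
Lemma bmulDr : right_distributive bmul +%R.
Proof. by move=> a b c; apply: bop_ext => xi; rewrite bopDE !bmulE bopDE bopD. Qed.

HB.instance Definition _ := GRing.Zmodule_isPzRing.Build bop
  bmulA bmul1 bmulr1 bmulDl bmulDr.

Lemma bopM a b xi : (a * b) xi = a (b xi). Proof. by []. Qed.
Lemma bop1 xi : (1 : bop) xi = xi. Proof. by []. Qed.
Lemma bscaleAl k a b : (k *: a) * b = k *: (a * b).
Proof. by apply: bop_ext => xi; rewrite bopM !bopZE bopM. Qed.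
Lemma bscaleAr k a b : a * (k *: b) = k *: (a * b).
Proof. by apply: bop_ext => xi; rewrite bopM !bopZE bopZ bopM. Qed.

Lemma sqmod_small (z : R[i]) (C : R) : (forall e : R, 0 < e -> sqmod z <= C * e) -> z = 0.
Proof.
move=> h; apply/eqP; rewrite -sqmod_eq0 eq_le sqmod_ge0 andbT; apply/ler_addgt0Pr => e e0.
have C0 : 0 <= Num.max C 1 by rewrite le_max ler01 orbT.
have C1 : 0 < Num.max C 1 by rewrite lt_max ltr01 orbT.
have d0 : 0 < e / Num.max C 1 by rewrite divr_gt0.
apply: le_trans (h _ d0) _; rewrite add0r mulrCA ger_pMr // ler_pdivrMr // mul1r le_max lexx //.
Qed.

Lemma bop_ext_delta a b : (forall i, a (delta i) = b (delta i)) -> a = b.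
Proof.
move=> e; apply/eqP; rewrite -subr_eq0; apply/eqP/bop_ext => xi.
pose d := a - b; have [c c0 dc] := bop_bd d.
have d0 s : d (finpart xi s) = 0.
  rewrite bop_sum big1 // => i _; rewrite bopZ.
  by rewrite (_ : d (delta i) = a (delta i) - b (delta i)) // e subrr scaler0.
apply: ell2_ext => i; apply: (@sqmod_small _ c) => eps e0.
have [s us hs] := finpart_approx xi e0.
apply: le_trans (coord_le (d xi) i) _.
rewrite -[d xi]subr0 -(d0 s) -bopB; apply: le_trans (dc _) _.
by rewrite ler_wpM2l // ltW.
Qed.

(** The formula dictates the coordinates of the adjoint. Testing [a] on the finite vector with these
    coordinates gives [S^2 <= c S (nsq eta)] for the partial sum [S] of squares, hence
    square-summability. *)
Lemma adj_exists a eta : exists zeta : ell2 R I, forall i, zeta i = ip (a (delta i)) eta.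
Proof.
have [c c0 ac] := bop_bd a.
suff hs (s : seq I) : uniq s -> \sum_(i <- s) sqmod (ip (a (delta i)) eta) <= c * nsq eta.
  by have [zeta [h _]] := nsq_le_of_fin hs; exists zeta.
move=> us; pose f i := ip (a (delta i)) eta; set S := \sum_(i <- s) _.
have S0 : 0 <= S by apply: sumr_ge0 => i _; exact: sqmod_ge0.
have E : ip (a (finpart f s)) eta = S%:C%C.
  rewrite bop_sum ip_suml rmorph_sum /=; apply: eq_bigr => i _.
  by rewrite bopZ ipZl -/(f i) conjM_sqmod.
have := cauchy_schwarz (a (finpart f s)) eta; rewrite E.
rewrite {1}/sqmod /= expr0n addr0 => h.
have := ac (finpart f s); rewrite nsq_finpart0 // -/S => h2.
have {}h : S * S <= S * (c * nsq eta).
  rewrite -expr2; apply: le_trans h _; rewrite mulrCA mulrA ler_wpM2r ?nsq_ge0 //.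
have [->|SN0] := eqVneq S 0; first by rewrite mulr_ge0 ?nsq_ge0.
by move: h; rewrite ler_pM2l // lt_neqAle eq_sym SN0.
Qed.

Definition adjf a eta : ell2 R I := projT1 (cid (adj_exists a eta)).
Lemma adjfE a eta i : adjf a eta i = ip (a (delta i)) eta.
Proof. exact: (projT2 (cid (adj_exists a eta))). Qed.

Lemma ip_adjf a xi eta : ip xi (adjf a eta) = ip (a xi) eta.
Proof.
apply/eqP; rewrite -subr_eq0; apply/eqP.
have [c c0 ac] := bop_bd a.
apply: (@sqmod_small _ (2 * nsq (adjf a eta) + 2 * (c * nsq eta))) => e e0.
have [s us hs] := finpart_approx xi e0; set d := xi - finpart xi s in hs.
have -> : ip xi (adjf a eta) - ip (a xi) eta = ip d (adjf a eta) - ip (a d) eta.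
  rewrite bopB !ipBl; suff -> : ip (finpart xi s) (adjf a eta) = ip (a (finpart xi s)) eta.
    by ring.
  rewrite ip_finpart bop_sum ip_suml; apply: eq_bigr => i _.
  by rewrite bopZ ipZl adjfE.
apply: le_trans (sqmodD_le _ _) _.
have -> : sqmod (- ip (a d) eta) = sqmod (ip (a d) eta).
  by rewrite /sqmod ReN ImN !sqrrN.
have := cauchy_schwarz d (adjf a eta); have := cauchy_schwarz (a d) eta.
have := ac d; have := ler_wpM2r (nsq_ge0 eta) (ac d).
have := ler_wpM2r (nsq_ge0 (adjf a eta)) (ltW hs).
have := ler_wpM2l (mulr_ge0 c0 (nsq_ge0 eta)) (ltW hs); lra.
Qed.

Lemma bounded_adjf a : bounded_op (adjf a).
Proof.
apply/bounded_opP; split=> [k u v|].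
  by apply: ell2_ext => i; rewrite adjfE ipDr ipZr ell2D ell2Z !adjfE.
have [c c0 ac] := bop_bd a; exists c => // eta.
have := cauchy_schwarz (a (adjf a eta)) eta; rewrite -ip_adjf ip_nsq.
rewrite {1}/sqmod /= expr0n addr0 expr2 => h.
have := ler_wpM2r (nsq_ge0 eta) (ac (adjf a eta)) => h2.
have [->|n0] := eqVneq (nsq (adjf a eta)) 0; first by rewrite mulr_ge0 ?nsq_ge0.
have np : 0 < nsq (adjf a eta) by rewrite lt_neqAle eq_sym n0 nsq_ge0.
by rewrite -(ler_pM2l np); apply: le_trans h _; apply: le_trans h2 _; rewrite le_eqVlt; apply/orP; left; apply/eqP; ring.
Qed.

Definition star a : bop := toBop (bounded_adjf a).

Lemma ip_star a xi eta : ip xi (star a eta) = ip (a xi) eta.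
Proof. exact: ip_adjf. Qed.
Lemma ip_starl a xi eta : ip (star a xi) eta = ip xi (a eta).
Proof. by rewrite ipC ip_star -ipC. Qed.

Lemma ell2_ipP xi eta : (forall zeta, ip zeta xi = ip zeta eta) -> xi = eta.
Proof. by move=> h; apply: ell2_ext => i; rewrite -!ip_deltal. Qed.
Lemma bop_ipP a b : (forall xi eta, ip xi (a eta) = ip xi (b eta)) -> a = b.
Proof. by move=> h; apply: bop_ext => xi; apply: ell2_ipP. Qed.

Lemma starK : involutive star.
Proof. by move=> a; apply: bop_ipP => xi eta; rewrite ip_star ip_starl. Qed.
Lemma starM a b : star (a * b) = star b * star a.
Proof. by apply: bop_ipP => xi eta; rewrite ip_star !bopM !ip_star. Qed.
Lemma starD a b : star (a + b) = star a + star b.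
Proof. by apply: bop_ipP => xi eta; rewrite ip_star bopDE ipDr ipDl !ip_star. Qed.
Lemma starZ k a : star (k *: a) = k^*%C *: star a.
Proof. by apply: bop_ipP => xi eta; rewrite ip_star !bopZE ipZr ipZl !ip_star. Qed.
Lemma starN a : star (- a) = - star a.
Proof. by apply: bop_ipP => xi eta; rewrite ip_star bopNE ipNr ipNl !ip_star. Qed.
Lemma starB a b : star (a - b) = star a - star b.
Proof. by rewrite starD starN. Qed.
Lemma star0 : star 0 = 0.
Proof. by apply: bop_ipP => xi eta; rewrite ip_star !bop0E ip0r ip0l. Qed.
Lemma star1 : star 1 = 1.
Proof. by apply: bop_ipP => xi eta; rewrite ip_star !bop1. Qed.
Lemma star_sum (J : Type) (s : seq J) (F : J -> bop) :
  star (\sum_(j <- s) F j) = \sum_(j <- s) star (F j).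
Proof. by elim/big_ind2: _ => [|x1 x2 y1 y2 <- <-|//]; rewrite ?star0 ?starD. Qed.
Lemma starX a n : star (a ^+ n) = star a ^+ n.
Proof. by elim: n => [|n IH]; rewrite ?expr0 ?star1 // exprS exprSr starM IH. Qed.

Lemma opbd_star a (c : R) : 0 <= c -> opbd a c -> opbd (star a) c.
Proof.
move=> c0 ac eta.
have := cauchy_schwarz (a (star a eta)) eta; rewrite -ip_star ip_nsq.
rewrite {1}/sqmod /= expr0n addr0 expr2 => h.
have := ler_wpM2r (nsq_ge0 eta) (ac (star a eta)) => h2.
have [->|n0] := eqVneq (nsq (star a eta)) 0; first by rewrite mulr_ge0 ?nsq_ge0.
have np : 0 < nsq (star a eta) by rewrite lt_neqAle eq_sym n0 nsq_ge0.
by rewrite -(ler_pM2l np); apply: le_trans h _; apply: le_trans h2 _; rewrite le_eqVlt; apply/orP; left; apply/eqP; ring.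
Qed.

Lemma adjE x (h : bounded_op x) : adj x = star (toBop h).
Proof.
rewrite /adj; apply: xget_unique => [|y [yb hy]].
  by split=> [|xi eta]; [exact: bopP|rewrite ip_starl].
apply/funext => xi; apply: ell2_ipP => zeta; rewrite ip_star.
by rewrite ipC -hy -ipC.
Qed.
Lemma adj_bop a : adj a = star a.
Proof.
rewrite (adjE (bopP a)); congr (bfun (star _)).
exact: val_inj.
Qed.

Lemma opnorm_le x (e : R) : 0 <= e -> opbd x (e ^+ 2) -> opnorm x <= e.
Proof.
move=> e0 xe; rewrite /opnorm; apply: ge_sup.
  by exists (l2norm (x 0)), 0 => //=; rewrite l2norm0.
move=> _ [xi /= x1 <-]; rewrite -ler_sqr ?nnegrE ?l2norm_ge0 // sqr_l2norm.
apply: le_trans (xe _) _; rewrite -[leRHS]mulr1 ler_wpM2l ?sqr_ge0 //.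
by rewrite -sqr_l2norm expr_le1 ?l2norm_ge0.
Qed.

Lemma opbd_opnorm a : opbd a (opnorm a ^+ 2).
Proof.
move=> xi; have [->|x0] := eqVneq xi 0; first by rewrite bop0 nsq0 mulr0.
have n0 : 0 < nsq xi.
  by rewrite lt_neqAle nsq_ge0 andbT eq_sym; apply: contra x0 => /eqP/nsq_eq0 ->.
have l0 : 0 < l2norm xi by rewrite l2normE sqrtr_gt0.
have [c c0 ac] := bop_bd a.
have : l2norm (a (((l2norm xi)^-1)%:C%C *: xi)) <= opnorm a.
  apply: ub_le_sup; first exists (Num.sqrt c).
    move=> _ [eta /= e1 <-]; rewrite l2normE ler_wsqrtr //; apply: le_trans (ac _) _.
    by rewrite -[leRHS]mulr1 ler_wpM2l // -sqr_l2norm expr_le1 ?l2norm_ge0.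
  exists (((l2norm xi)^-1)%:C%C *: xi) => //=.
  by rewrite l2normZ /sqmod /= expr0n addr0 sqrtr_sqr ger0_norm ?invr_ge0 ?l2norm_ge0 // mulVf // gt_eqF.
rewrite bopZ l2normZ /sqmod /= expr0n addr0 sqrtr_sqr ger0_norm ?invr_ge0 ?l2norm_ge0 //.
rewrite ler_pdivrMl // mulrC => h.
have h0 : 0 <= opnorm a * l2norm xi := le_trans (l2norm_ge0 _) h.
by rewrite -!sqr_l2norm -exprMn ler_sqr ?nnegrE ?l2norm_ge0.
Qed.

Lemma opnorm_ge0 a : 0 <= opnorm a.
Proof.
have [c c0 ac] := bop_bd a.
apply: le_trans (_ : l2norm (a 0) <= _); first exact: l2norm_ge0.
apply: ub_le_sup; last by exists 0; rewrite //= l2norm0.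
exists (Num.sqrt c) => _ [eta /= e1 <-]; rewrite l2normE ler_wsqrtr //; apply: le_trans (ac _) _.
by rewrite -[leRHS]mulr1 ler_wpM2l // -sqr_l2norm expr_le1 ?l2norm_ge0.
Qed.

End BoundedOp.
Arguments bop : clear implicits.

(** * Bernstein and Weierstrass approximation *)

Lemma ffact_bin n m k : (m + k <= n)%N ->
  ((m + k) ^_ m * 'C(n, m + k) = n ^_ m * 'C(n - m, k))%N.
Proof.
move=> mkn; have mn : (m <= n)%N by apply: leq_trans mkn; rewrite leq_addr.
have kn : (k <= n - m)%N by rewrite leq_subRL.
apply/eqP; rewrite -(eqn_pmul2r (fact_gt0 k)) -(eqn_pmul2r (fact_gt0 (n - m - k))).
have -> : ((m + k) ^_ m * 'C(n, m + k) * k`! * (n - m - k)`! = n`!)%N.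
  rewrite -(bin_fact mkn) -(ffact_fact (leq_addr k m)) addKn subnDA; nia.
by rewrite -(ffact_fact mn) -(bin_fact kn); apply/eqP; nia.
Qed.

Section Bernstein.
Context {R : realType}.
Implicit Types (P Q : {poly R}) (n m k l : nat) (s t : R).

Definition bern n k : {poly R} := 'X^k * (1 - 'X) ^+ (n - k).

(** The coefficients of ['X^m] with respect to the polynomials ['C(n, k) * bern n k]; they tend to
    [(k / n)^m] as [n] grows. *)
Definition ffrac n m k : R := (k ^_ m)%:R / (n ^_ m)%:R.

(** The terms with [k < m] vanish. In the others [ffact_bin] leaves [X^m] times the binomial
    expansion of [((1 - X) + X)^(n - m)]. *)
Lemma bern_ffact n m : (m <= n)%N ->
  \sum_(k < n.+1) (ffrac n m k * 'C(n, k)%:R) *: bern n k = 'X^m.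
Proof.
move=> mn; rewrite -(big_mkord xpredT (fun k => (ffrac n m k * 'C(n, k)%:R) *: bern n k)).
rewrite (big_cat_nat (n := m)) //=; last exact: leqW.
rewrite big_nat big1 ?add0r => [|k /andP[_ km]]; last first.
  by rewrite /ffrac ffact_small // mul0r mul0r scale0r.
rewrite -{1}[m]add0n big_addn big_mkord subSn //.
transitivity ('X^m * ((1 - 'X) + 'X) ^+ (n - m) : {poly R}); last by rewrite subrK expr1n mulr1.
rewrite exprDn mulr_sumr; apply: eq_bigr => -[k /=]; rewrite ltnS => kn _.
have mkn : (m + k <= n)%N by rewrite -leq_subRL.
have nm0 : (n ^_ m)%:R != 0 :> R by rewrite pnatr_eq0 -lt0n ffact_gt0.
have -> : ffrac n m (k + m) * 'C(n, k + m)%:R = 'C(n - m, k)%:R.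
  apply: (mulfI nm0); rewrite /ffrac mulrA mulrCA divff // mulr1 -!natrM mulnC.
  by rewrite addnC mulnC ffact_bin.
rewrite scaler_nat /bern -mulrnAr addnC exprD -subnDA; ring.
Qed.

Lemma bern_sum1 n : \sum_(k < n.+1) ('C(n, k)%:R) *: bern n k = 1.
Proof.
rewrite -[RHS](expr0 'X) -(@bern_ffact n 0) //; apply: eq_bigr => k _.
by rewrite /ffrac !ffactn0 divr1 mul1r.
Qed.

Definition bcoef P n k : R := \sum_(m < size P) P`_m * ffrac n m k.

Lemma bern_poly P n : (size P <= n.+1)%N ->
  P = \sum_(k < n.+1) (bcoef P n k * 'C(n, k)%:R) *: bern n k.
Proof.
move=> sP; rewrite {1}[P](_ : _ = \sum_(m < size P) P`_m *: 'X^m); last by rewrite -poly_def coefK.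
under [RHS]eq_bigr => k _ do rewrite /bcoef mulr_suml scaler_suml.
rewrite exchange_big /=; apply: eq_bigr => m _.
rewrite -(@bern_ffact n m); last by rewrite -ltnS (leq_trans _ sP).
by rewrite scaler_sumr; apply: eq_bigr => k _; rewrite scalerA mulrA.
Qed.

(** Passing from [m] to [m + 1] multiplies the ratio of falling factorials by [(k - m) / (n - m)],
    which lies within [m / n] of [k / n]; for [k < m] the truncated subtraction makes it 0 and the
    estimate persists. *)
Lemma ffrac_approx m (e : R) : 0 < e -> exists N, forall n k, (N <= n)%N -> (k <= n)%N ->
  `|ffrac n m k - (k%:R / n%:R) ^+ m| <= e.
Proof.
elim: m e => [|m IH] e e0.
  by exists 0%N => n k _ _; rewrite /ffrac !ffactn0 expr0 divr1 subrr normr0 ltW.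
have [N hN] := IH (e / 2) ltac:(lra).
have [N2 hN2] : exists N2 : nat, m.+1%:R * 2 / e <= N2%:R.
  exists (Num.trunc (m.+1%:R * 2 / e)).+1; rewrite ltW // truncnS_gt //.
exists (maxn N (maxn N2 m.+1)) => n k; rewrite !geq_max => /and3P[Nn N2n mn] kn.
have n0 : 0 < n%:R :> R by rewrite ltr0n (leq_ltn_trans _ mn).
rewrite /ffrac !ffactnSr !natrM -mulf_div exprSr.
set q := (k ^_ m)%:R / (n ^_ m)%:R; set x : R := k%:R / n%:R.
set f : R := (k - m)%:R / (n - m)%:R.
have nm0 : 0 < (n - m)%:R :> R by rewrite ltr0n subn_gt0.
have f0 : 0 <= f by rewrite divr_ge0.
have f1 : f <= 1 by rewrite ler_pdivrMr // mul1r ler_nat leq_sub2r.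
have x0 : 0 <= x by rewrite divr_ge0.
have x1 : x <= 1 by rewrite ler_pdivrMr // mul1r ler_nat.
have fx : `|f - x| <= m%:R / n%:R.
  have [mk|km] := leqP m k; last first.
    have -> : f = 0 by rewrite /f (eqP (ltnW km)) mul0r.
    by rewrite sub0r normrN ger0_norm // ler_pM2r ?invr_gt0 // ler_nat ltnW.
  rewrite distrC ger0_norm /f /x !natrB ?(ltnW mn) //; last first.
    rewrite subr_ge0 ler_pdivrMr -?natrB ?(ltnW mn) // mulrAC ler_pdivlMr // !natrB ?(ltnW mn) //.
    have : (k%:R : R) <= n%:R by rewrite ler_nat. 
    move=> h; have := ler_wpM2l (ler0n R m) h; lra.
  have nm1 : 0 < n%:R - m%:R :> R by rewrite -natrB ?(ltnW mn).
  rewrite lerBlDr -ler_pdivlMr ?invr_gt0 // invrK mulrDl divfK ?gt_eqF //.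
  rewrite mulrAC -lerBlDl ler_pdivlMr //.
  have : (k%:R : R) <= n%:R by rewrite ler_nat.
  have : (m%:R : R) <= k%:R by rewrite ler_nat.
  have : 0 <= (m%:R : R) by [].
  by move=> *; nra.
have mn2 : m%:R / n%:R <= e / 2.
  rewrite ler_pdivrMr // -ler_pdivrMl ?divr_gt0 // invf_div mulrC.
  have : (N2%:R : R) <= n%:R by rewrite ler_nat.
  apply: le_trans; apply: le_trans hN2; rewrite -mulrA ler_wpM2r ?ler_nat //.
  by rewrite divr_ge0 // ltW.
have -> : q * f - x ^+ m * x = (q - x ^+ m) * f + x ^+ m * (f - x) by ring.
apply: le_trans (ler_normD _ _) _; rewrite (normrM (q - x ^+ m)) (normrM (x ^+ m)) (ger0_norm f0) (ger0_norm (exprn_ge0 m x0)).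
have h1 : `|q - x ^+ m| * f <= e / 2.
  by apply: le_trans (hN _ _ Nn kn); rewrite ler_piMr.
have h2 : x ^+ m * `|f - x| <= e / 2.
  apply: le_trans mn2; apply: le_trans fx; rewrite ler_piMl // exprn_ile1 //.
by apply: le_trans (lerD h1 h2) _; lra.
Qed.

Lemma bcoef_approx P (e : R) : 0 < e -> exists N, forall n k, (N <= n)%N -> (k <= n)%N ->
  `|bcoef P n k - P.[k%:R / n%:R]| <= e.
Proof.
suff [C C0 hC] : exists2 C : R, 0 < C & forall d, 0 < d ->
    exists N, forall n k, (N <= n)%N -> (k <= n)%N -> `|bcoef P n k - P.[k%:R / n%:R]| <= C * d.
  move=> e0; have [M hM] := hC (e / C) ltac:(by rewrite divr_gt0).
  by exists M => n k Mn kn; apply: le_trans (hM _ _ Mn kn) _; rewrite mulrC divfK ?gt_eqF.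
exists (1 + \sum_(m < size P) `|P`_m|).
  by rewrite ltr_pwDl // sumr_ge0.
move=> d d0.
have [N hN] : exists N, forall m, (m < size P)%N -> forall n k, (N <= n)%N -> (k <= n)%N ->
    `|ffrac n m k - (k%:R / n%:R) ^+ m| <= d.
  elim: (size P) => [|S [N hN]]; first by exists 0%N.
  have [N1 h1] := ffrac_approx S d0; exists (maxn N N1) => m.
  rewrite ltnS leq_eqVlt => /orP[/eqP -> n k|mS n k]; rewrite geq_max => /andP[Nn N1n] kn.
    exact: h1.
  exact: hN.
exists N => n k Nn kn; rewrite /bcoef horner_coef -sumrB.
apply: le_trans (ler_norm_sum _ _ _) _; rewrite mulrDl mul1r mulr_suml.
apply: ler_wpDl; first exact: ltW.
apply: ler_sum => m _; rewrite -mulrBr normrM ler_wpM2l //; exact: hN.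
Qed.

Lemma horner_bound01 P : exists2 B : R, 0 <= B & forall t, 0 <= t <= 1 -> `|P.[t]| <= B.
Proof.
exists (\sum_(m < size P) `|P`_m|) => [|t /andP[t0 t1]]; first exact: sumr_ge0.
rewrite horner_coef; apply: le_trans (ler_norm_sum _ _ _) _; apply: ler_sum => m _.
by rewrite normrM ler_piMr // normrX exprn_ile1 // ger0_norm.
Qed.

Lemma bcoef2_approx (s : seq ({poly R} * {poly R})) (e : R) : 0 < e ->
  exists N, forall n k l, (N <= n)%N -> (k <= n)%N -> (l <= n)%N ->
  `|\sum_(w <- s) bcoef w.1 n k * bcoef w.2 n l -
    \sum_(w <- s) w.1.[k%:R / n%:R] * w.2.[l%:R / n%:R]| <= e.
Proof.
elim: s e => [|[P Q] s IH] e e0.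
  by exists 0%N => n k l _ _ _; rewrite !big_nil subrr normr0 ltW.
have [N hN] := IH (e / 2) ltac:(lra).
have [B B0 hB] := horner_bound01 P; have [C C0 hC] := horner_bound01 Q.
pose d := Num.min 1 (e / 2 / (B + C + 1)).
have BC : 0 < B + C + 1 by lra.
have d0 : 0 < d by rewrite lt_min ltr01 !divr_gt0.
have d1 : d <= 1 by rewrite ge_min lexx.
have d2 : d * (B + C + 1) <= e / 2 by rewrite -ler_pdivlMr // ge_min lexx orbT.
have [N1 h1] := bcoef_approx P d0; have [N2 h2] := bcoef_approx Q d0.
exists (maxn N (maxn 1 (maxn N1 N2))) => n k l; rewrite !geq_max => /and4P[Nn n0 N1n N2n] kn ln.
have n0R : 0 < n%:R :> R by rewrite ltr0n.
rewrite !big_cons /=.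
have {}hN := hN _ _ _ Nn kn ln; have {}h1 := h1 _ _ N1n kn; have {}h2 := h2 _ _ N2n ln.
have {}hB := hB (k%:R / n%:R) ltac:(by rewrite divr_ge0 //= ler_pdivrMr // mul1r ler_nat).
have {}hC := hC (l%:R / n%:R) ltac:(by rewrite divr_ge0 //= ler_pdivrMr // mul1r ler_nat).
move: hN h1 h2 hB hC; set S1 := \sum_(_ <- _) _; set S2 := \sum_(_ <- _) _.
set a := bcoef P n k; set b := bcoef Q n l; set u := P.[_]; set v := Q.[_].
move=> hN h1 h2 hB hC.
have -> : a * b + S1 - (u * v + S2) = (S1 - S2) + ((a - u) * (b - v) + (a - u) * v + u * (b - v)) by ring.
apply: le_trans (ler_normD _ _) _.
apply: le_trans (lerD hN (le_trans (ler_normD _ _) (lerD (ler_normD _ _) (lexx _)))) _.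
rewrite !normrM.
have k1 : `|a - u| * `|b - v| <= d * 1.
  by apply: ler_pM => //; apply: le_trans h2 d1.
have k2 : `|a - u| * `|v| <= d * C by apply: ler_pM.
have k3 : `|u| * `|b - v| <= B * d by apply: ler_pM.
lra.
Qed.

(* A functional on pairs of polynomials which is nonnegative on pairs of
   Bernstein polynomials is nonnegative on everything nonnegative on the
   square: the coefficients [bcoef] of P in the Bernstein basis of degree n
   tend to the values of P at k/n. *)
Lemma bernstein_positivity2 (Phi : {poly R} -> {poly R} -> R)
    (s : seq ({poly R} * {poly R})) :
  (forall P P' Q, Phi (P + P') Q = Phi P Q + Phi P' Q) ->
  (forall a P Q, Phi (a *: P) Q = a * Phi P Q) ->
  (forall P Q Q', Phi P (Q + Q') = Phi P Q + Phi P Q') ->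
  (forall a P Q, Phi P (a *: Q) = a * Phi P Q) ->
  (forall n k m l, 0 <= Phi (bern n k) (bern m l)) ->
  (forall u v : R, 0 <= u <= 1 -> 0 <= v <= 1 -> 0 <= \sum_(w <- s) w.1.[u] * w.2.[v]) ->
  0 <= \sum_(w <- s) Phi w.1 w.2.
Proof.
move=> PDl PZl PDr PZr Pb hs.
have P0l Q : Phi 0 Q = 0 by have := PZl 0 0 Q; rewrite scale0r mul0r.
have P0r P : Phi P 0 = 0 by have := PZr 0 P 0; rewrite scale0r mul0r.
have Psl n (F : 'I_n -> {poly R}) Q : Phi (\sum_k F k) Q = \sum_k Phi (F k) Q.
  by elim/big_ind2: _ => // x1 x2 y1 y2 <- <-.
have Psr n (F : 'I_n -> {poly R}) P : Phi P (\sum_k F k) = \sum_k Phi P (F k).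
  by elim/big_ind2: _ => // x1 x2 y1 y2 <- <-.
pose w n (k l : 'I_n.+1) := 'C(n, k)%:R * 'C(n, l)%:R * Phi (bern n k) (bern n l).
have w0 n (k l : 'I_n.+1) : 0 <= w n k l by rewrite !mulr_ge0.
have E11 n : Phi 1 1 = \sum_(k < n.+1) \sum_(l < n.+1) w n k l.
  rewrite -{1}(bern_sum1 n) Psl; apply: eq_bigr => k _.
  rewrite -(bern_sum1 n) Psr; apply: eq_bigr => l _.
  by rewrite PZl PZr mulrA.
have EPQ n P Q : (size P <= n.+1)%N -> (size Q <= n.+1)%N ->
    Phi P Q = \sum_(k < n.+1) \sum_(l < n.+1) bcoef P n k * bcoef Q n l * w n k l.
  move=> sP sQ; rewrite {1}(bern_poly sP) Psl; apply: eq_bigr => k _.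
  rewrite {1}(bern_poly sQ) Psr; apply: eq_bigr => l _.
  by rewrite PZl PZr /w; ring.
have P11 : 0 <= Phi 1 1 by rewrite (E11 0%N) sumr_ge0 // => k _; rewrite sumr_ge0.
rewrite -[leRHS]addr0; apply/ler_addgt0Pr => e e0; rewrite addr0.
(* The nonnegative weights [w n k l] sum to [Phi 1 1], so an error [d] in every coefficient costs at
   most [d * Phi 1 1 <= e]. *)
pose d := e / (Phi 1 1 + 1); have d0 : 0 < d by rewrite divr_gt0 // ltr_wpDl.
have [N hN] := bcoef2_approx s d0.
have [N2 hN2] : exists N2, forall n, (N2 <= n)%N -> forall w, w \in s ->
    (size w.1 <= n.+1)%N /\ (size w.2 <= n.+1)%N.
  exists (\sum_(w <- s) (size w.1 + size w.2))%N => n hn v vs.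
  have : (size v.1 + size v.2 <= n)%N by apply: leq_trans hn; rewrite (big_rem v) //= leq_addr.
  lia.
pose n := maxn 1 (maxn N N2).
have n1 : (0 < n)%N by rewrite leq_max.
have Nn : (N <= n)%N by rewrite !leq_max leqnn !orbT.
have N2n : (N2 <= n)%N by rewrite !leq_max leqnn !orbT.
have n0R : 0 < n%:R :> R by rewrite ltr0n.
have -> : \sum_(v <- s) Phi v.1 v.2 =
    \sum_(k < n.+1) \sum_(l < n.+1) (\sum_(v <- s) bcoef v.1 n k * bcoef v.2 n l) * w n k l.
  transitivity (\sum_(v <- s) \sum_(k < n.+1) \sum_(l < n.+1) bcoef v.1 n k * bcoef v.2 n l * w n k l).
    by apply: eq_big_seq => v /(hN2 _ N2n)[s1 s2]; exact: EPQ.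
  rewrite exchange_big /=; apply: eq_bigr => k _.
  by rewrite exchange_big /=; apply: eq_bigr => l _; rewrite mulr_suml.
apply: (@le_trans _ _ (\sum_(k < n.+1) \sum_(l < n.+1) (- d) * w n k l + e)).
  under eq_bigr => k _ do rewrite -mulr_sumr.
  rewrite -mulr_sumr -E11 mulNr addrC subr_ge0 /d mulrAC ler_pdivrMr ?ltr_wpDl //.
  by rewrite ler_wpM2l ?(ltW e0) // lerDl.
rewrite lerD2r; apply: ler_sum => k _; apply: ler_sum => l _.
rewrite ler_wpM2r //.
have kn : (k <= n)%N by rewrite -ltnS.
have ln : (l <= n)%N by rewrite -ltnS.
have := hN n k l Nn kn ln.
have := hs (k%:R / n%:R) (l%:R / n%:R); rewrite !divr_ge0 //= !ler_pdivrMr // !mul1r !ler_nat.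
move=> /(_ kn ln) h0 /ler_normlP[]; lra.
Qed.

Lemma bernstein_positivity (phi : {poly R} -> R) P :
  (forall P P', phi (P + P') = phi P + phi P') ->
  (forall a P, phi (a *: P) = a * phi P) ->
  (forall n k, 0 <= phi (bern n k)) ->
  (forall u : R, 0 <= u <= 1 -> 0 <= P.[u]) -> 0 <= phi P.
Proof.
move=> pD pZ pb hP.
have := @bernstein_positivity2 (fun P Q => phi P * Q.[0]) [:: (P, 1)].
rewrite !big_seq1 /= hornerC mulr1; apply.
- by move=> *; rewrite pD mulrDl.
- by move=> *; rewrite pZ mulrA.
- by move=> *; rewrite hornerD mulrDr.
- by move=> *; rewrite hornerZ mulrCA.
- move=> n k m l; rewrite mulr_ge0 // /bern hornerM mulr_ge0 //.
    by rewrite hornerXn exprn_ge0.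
  by rewrite horner_exp exprn_ge0 // !hornerE subr0.
- by move=> u v u01 _; rewrite big_seq1 /= hornerC mulr1 hP.
Qed.

End Bernstein.

(** * Continuous functions on the half-line and Weierstrass approximation *)

Section ContinuousFunctions.
Context {R : realType}.
Implicit Types (f g : R -> R) (t : R).

(* Continuity of the restriction of f to the half-line [0, +oo[. *)
Definition contp f := continuous (fun t : R => f `|t|).

Lemma contp_ext f g : (forall t, 0 <= t -> f t = g t) -> contp f -> contp g.
Proof.
move=> e; rewrite /contp (_ : (fun t => f `|t|) = (fun t => g `|t|)) //.
by apply/funext => t; rewrite e.
Qed.
Lemma contp_cst (c : R) : contp (fun=> c).
Proof. by move=> t; apply: cvg_cst. Qed.
Lemma contp_id : contp (fun t => t).
Proof. by move=> t; apply: norm_continuous. Qed.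
Lemma contpD f g : contp f -> contp g -> contp (fun t => f t + g t).
Proof. by move=> cf cg t; apply: cvgD; [exact: cf|exact: cg]. Qed.
Lemma contpM f g : contp f -> contp g -> contp (fun t => f t * g t).
Proof. by move=> cf cg t; apply: cvgM; [exact: cf|exact: cg]. Qed.
Lemma contpZ (c : R) f : contp f -> contp (fun t => c * f t).
Proof. by move=> cf; apply: contpM => //; exact: contp_cst. Qed.
Lemma contpN f : contp f -> contp (fun t => - f t).
Proof. by move=> cf t; apply: cvgN; exact: cf. Qed.
Lemma contpB f g : contp f -> contp g -> contp (fun t => f t - g t).
Proof. by move=> cf /contpN; exact: contpD. Qed.
Lemma contpX f n : contp f -> contp (fun t => f t ^+ n).
Proof.
move=> cf; elim: n => [|n IH]; first exact: contp_cst.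
apply: (@contp_ext (fun t => f t * f t ^+ n)); last exact: contpM.
by move=> t _; rewrite exprS.
Qed.
Lemma contp_comp f g : contp g -> contp f -> (forall t, 0 <= t -> 0 <= f t) ->
  contp (fun t => g (f t)).
Proof.
move=> cg cf f0; rewrite /contp.
rewrite (_ : (fun t => g (f `|t|)) = (fun u => g `|u|) \o (fun t => f `|t|)).
  by move=> t; apply: continuous_comp; [exact: cf|exact: cg].
by apply/funext => t /=; rewrite [in RHS]ger0_norm // f0.
Qed.

Lemma powR_continuous_at (r a : R) : 0 < a -> {for a, continuous (fun x : R => x `^ r)}.
Proof.
move=> a0; apply: differentiable_continuous; apply/derivable1_diffP.
by apply: derivable_powR; rewrite in_itv /= a0.
Qed.

Lemma contp_powR (r : R) : 0 < r -> contp (fun t => t `^ r).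
Proof.
move=> r0 t; have [->|t0] := eqVneq t 0.
  rewrite /continuous_at normr0 powR0 ?gt_eqF //.
  apply/cvgrPdist_le => e e0.
  have /cvgrPdist_le/(_ e e0) := powR_cvg0 r0.
  rewrite near_withinE => -[d /= d0 hd]; exists d => //= s /=.
  rewrite sub0r normrN => sd; have [->|s0] := eqVneq s 0.
    by rewrite normr0 powR0 ?gt_eqF // subrr normr0 ltW.
  by apply: hd; rewrite /= ?normr_gt0 // sub0r normrN normr_id.
apply: (@continuous_comp _ _ _ (fun t : R => `|t|) (fun x : R => x `^ r)).
  exact: norm_continuous.
by apply: powR_continuous_at; rewrite normr_gt0.
Qed.

Lemma contp_powR_max (e r : R) : 0 < e -> contp (fun t => Num.max t e `^ r).
Proof.
move=> e0 t; apply: (@continuous_comp _ _ _ (fun t : R => Num.max `|t| e) (fun x : R => x `^ r)).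
  apply: (@continuous_max _ _ (fun t : R => `|t|) (fun=> e)).
    exact: norm_continuous.
  exact: cvg_cst.
by apply: powR_continuous_at; rewrite lt_max e0 orbT.
Qed.

Lemma contp_inv f : contp f -> (forall t, 0 <= t -> 0 < f t) -> contp (fun t => (f t)^-1).
Proof. by move=> cf f0 t; apply: cvgV; [rewrite gt_eqF // f0|exact: cf]. Qed.

Lemma contp_sqrt f : contp f -> contp (fun t => Num.sqrt (f t)).
Proof.
move=> cf t; apply: (@continuous_comp _ _ _ (fun t : R => f `|t|) (@Num.sqrt R)).
  exact: cf.
exact: sqrt_continuous.
Qed.

(** Uniform continuity on [0, 1] by contradiction: by Bolzano-Weierstrass, pairs that violate it at
    distance [1 / (n + 1)] have subsequences with a common limit. *)
Lemma contp_unif f (e : R) : contp f -> 0 < e ->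
  exists2 d : R, 0 < d & forall s t : R, 0 <= s <= 1 -> 0 <= t <= 1 -> `|s - t| <= d -> `|f s - f t| <= e.
Proof.
move=> cf e0; apply: contrapT => H.
have {}H n : exists st : R * R, [/\ 0 <= st.1 <= 1, 0 <= st.2 <= 1,
    `|st.1 - st.2| <= n.+1%:R^-1 & e < `|f st.1 - f st.2| ].
  apply: contrapT => H2; apply: H; exists n.+1%:R^-1; first by rewrite invr_gt0.
  move=> s t s01 t01 st; rewrite leNgt; apply/negP => h; apply: H2.
  by exists (s, t).
pose u n := (projT1 (cid (H n))).1; pose v n := (projT1 (cid (H n))).2.
have uvP n : [/\ 0 <= u n <= 1, 0 <= v n <= 1, `|u n - v n| <= n.+1%:R^-1 & e < `|f (u n) - f (v n)| ].
  exact: projT2 (cid (H n)).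
have [k [ki kl]] : exists k : nat -> nat, (forall n, (n <= k n)%N) /\ cvgn (u \o k).
  have [|k ki kc] := @bolzano_weierstrass R u.
    exists 1; split; first exact: num_real.
    move=> x x1 n _; have [/andP[u0 u1] _ _ _] := uvP n.
    by rewrite /= ger0_norm // (le_trans u1) // ltW.
  exists k; split=> // n; elim: n => // n IH.
  apply: (leq_ltn_trans IH); rewrite ltnNge; apply/negP => h.
  by have : (n.+1 <= n)%N = true := etrans (esym (ki n.+1 n)) h; rewrite ltnn.
pose l := limn (u \o k); have ul : u (k n) @[n --> \oo] --> l by exact: kl.
have vl : v (k n) @[n --> \oo] --> l.
  rewrite -[l]subr0; rewrite (_ : (fun n => v (k n)) = (fun n => u (k n) - (u (k n) - v (k n)))).
    apply: cvgB => //; apply/cvgrPdist_le => d d0.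
    near=> n; rewrite sub0r normrN; have [_ _ h _] := uvP (k n); apply: le_trans h _.
    rewrite -[leRHS]invrK lef_pV2 ?posrE ?invr_gt0 //.
    apply: le_trans (_ : n%:R <= _); last by rewrite ler_nat (leq_trans (ki n)).
    by near: n; exact: nbhs_infty_ger.
  by apply/funext => n; rewrite opprB addrC subrK.
have fl w : w @ \oo --> l -> (forall n, 0 <= w n) -> f (w n) @[n --> \oo] --> f `|l|.
  move=> wl w0; rewrite (_ : (fun n => f (w n)) = (fun t => f `|t|) \o w).
    by apply: continuous_cvg => //; exact: cf.
  by apply/funext => n /=; rewrite ger0_norm.
have fu := fl _ ul (fun n => ltac:(by have [/andP[]] := uvP (k n))).
have fv := fl _ vl (fun n => ltac:(by have [_ /andP[]] := uvP (k n))).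
have : (f (u (k n)) - f (v (k n))) @[n --> \oo] --> 0 by rewrite -(subrr (f `|l|)); exact: cvgB.
move=> /cvgrPdist_lt/(_ e e0)[N _ /(_ N (leqnn N))] /=.
by rewrite sub0r normrN; have [_ _ _ h] := uvP (k N) => /lt_trans /(_ h); rewrite ltxx.
Unshelve. all: by end_near. Qed.

Lemma bern_ge0 n k (t : R) : 0 <= t <= 1 -> 0 <= (bern n k).[t].
Proof.
move=> /andP[t0 t1]; rewrite /bern hornerM mulr_ge0 ?hornerXn ?exprn_ge0 //.
by rewrite horner_exp exprn_ge0 // !hornerE subr_ge0.
Qed.

(** Bernstein's proof. The weights [w k t] form a binomial law with mean [t] and variance
    [t (1 - t) / n]; nodes within [d] of [t] contribute at most [e / 2], and the others are
    controlled by Chebyshev's inequality. *)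
Lemma weierstrass01 f (e : R) : contp f -> 0 < e ->
  exists P : {poly R}, forall t : R, 0 <= t <= 1 -> `|P.[t] - f t| <= e.
Proof.
move=> cf e0; have [d d0 hd] := contp_unif cf (e := e / 2) ltac:(lra).
have [D D0 hD] := contp_unif cf ltr01.
(* Boundedness: walking from 0 to [t] in [N] steps no longer than the modulus [D], the function
   moves by at most 1 at each step. *)
have [M hM] : exists M : R, forall t : R, 0 <= t <= 1 -> `|f t| <= M.
  pose N := (Num.trunc D^-1).+1; exists (`|f 0| + N%:R) => t /andP[t0 t1].
  have step (j : nat) : (j <= N)%N -> `|f (j%:R / N%:R * t)| <= `|f 0| + j%:R.
    elim: j => [|j IH] jN; first by rewrite mul0r mul0r addr0.
    have {}IH := IH (ltnW jN).
    have N0 : 0 < N%:R :> R by rewrite ltr0n.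
    have i01 (i : nat) : (i <= N)%N -> 0 <= i%:R / N%:R * t <= 1.
      move=> iN; rewrite mulr_ge0 ?divr_ge0 //= mulr_ile1 ?divr_ge0 //.
      by rewrite ler_pdivrMr // mul1r ler_nat.
    have := hD _ _ (i01 _ jN) (i01 _ (ltnW jN)).
    rewrite -mulrBl -mulrBl -natrB // subSn // subnn mul1r normrM ger0_norm ?invr_ge0 //.
    rewrite (ger0_norm t0) => /(_ _) h.
    have : `|f (j.+1%:R / N%:R * t) - f (j%:R / N%:R * t)| <= 1.
      apply: h; apply: (@le_trans _ _ N%:R^-1); first by rewrite ler_piMr // invr_ge0.
      rewrite -[leRHS]invrK lef_pV2 ?posrE ?invr_gt0 // ltW // /N truncnS_gt //.
    move=> h2; rewrite -[f (_.+1%:R / _ * _)](subrK (f (j%:R / N%:R * t))).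
    have E : j.+1%:R = j%:R + 1 :> R by rewrite -natr1.
    apply: le_trans (ler_normD _ _) _; lra.
  have := step N (leqnn N); rewrite divff ?pnatr_eq0 // mul1r //.
have M0 : 0 <= M by apply: le_trans (hM 0 _); rewrite ?lexx ?ler01.
(* This size makes the variance term [2 M / (d^2 n)] at most [e / 2]; adding 2 rather than 1 keeps
   [n - 1] nonzero, a denominator in the second moment [w3]. *)
pose n := (Num.trunc (4 * M / d ^+ 2 / e)).+2.
have nB : 4 * M / d ^+ 2 / e <= n%:R.
  by apply: ltW; apply: lt_le_trans (truncnS_gt _) _; rewrite ler_nat.
have n0 : 0 < n%:R :> R by rewrite ltr0n.
pose w k t : R := 'C(n, k)%:R * (bern n k).[t].
exists (\sum_(k < n.+1) (f (k%:R / n%:R) * 'C(n, k)%:R) *: bern n k) => t t01.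
have wE (c : nat -> R) : (\sum_(k < n.+1) (c k * 'C(n, k)%:R) *: bern n k).[t] = \sum_(k < n.+1) c k * w k t.
  by rewrite horner_sum; apply: eq_bigr => k _; rewrite hornerZ mulrA.
have w0 k : 0 <= w k t by rewrite mulr_ge0 // bern_ge0.
have ws m : (m <= n)%N -> \sum_(k < n.+1) ffrac n m k * w k t = t ^+ m.
  by move=> mn; rewrite -(wE (ffrac n m)) bern_ffact // hornerXn.
have w1 : \sum_(k < n.+1) w k t = 1.
  rewrite -[RHS](expr0 t) -(ws 0%N) //; apply: eq_bigr => k _.
  by rewrite /ffrac !ffactn0 divr1 mul1r.
have w2 : \sum_(k < n.+1) (k%:R / n%:R) * w k t = t.
  rewrite -[RHS](expr1 t) -(ws 1%N) //; apply: eq_bigr => k _.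
  by rewrite /ffrac !ffactn1.
have w3 : \sum_(k < n.+1) (k%:R / n%:R) ^+ 2 * w k t = t ^+ 2 + t * (1 - t) / n%:R.
  transitivity (\sum_(k < n.+1) ((1 - n%:R^-1) * (ffrac n 2 k * w k t) + n%:R^-1 * ((k%:R / n%:R) * w k t))).
    apply: eq_bigr => k _; rewrite !mulrA -mulrDl; congr (_ * _).
    rewrite /ffrac !ffactnSr !ffactn0 !mul1n !subn0 !natrM (natrB _ (isT : 1 <= n)%N).
    have [->|k0] := posnP k; first by rewrite !(mul0r, mulr0, expr0n, addr0).
    rewrite natrB //; have n1 : n%:R - 1 != 0 :> R by rewrite subr_eq0 (eqr_nat R n 1).
    by field; rewrite n1 gt_eqF.
  rewrite big_split /= -!mulr_sumr w2 ws //; field; by rewrite gt_eqF.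
have ft : f t = \sum_(k < n.+1) f t * w k t by rewrite -mulr_sumr w1 mulr1.
rewrite (wE (fun k => f (k%:R / n%:R))) ft -sumrB.
apply: le_trans (ler_norm_sum _ _ _) _.
pose C := 2 * M / d ^+ 2.
have C0 : 0 <= C by apply: divr_ge0; rewrite ?sqr_ge0 // mulr_ge0.
apply: (@le_trans _ _ (\sum_(k < n.+1) (e / 2 + C * (k%:R / n%:R - t) ^+ 2) * w k t)).
  apply: ler_sum => -[k /=]; rewrite ltnS => kn _.
  rewrite -mulrBl normrM (ger0_norm (w0 k)) ler_wpM2r //.
  have k01 : 0 <= (k%:R / n%:R : R) <= 1 by rewrite divr_ge0 //= ler_pdivrMr // mul1r ler_nat.
  have [kd|dk] := leP `|k%:R / n%:R - t| d.
    by apply: le_trans (hd _ _ k01 t01 kd) _; rewrite lerDl mulr_ge0 // sqr_ge0.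
  apply: (@le_trans _ _ (2 * M)).
    apply: le_trans (ler_normB _ _) _; have := hM _ k01; have := hM _ t01; lra.
  apply: (@le_trans _ _ (C * (k%:R / n%:R - t) ^+ 2)); last by rewrite lerDr; lra.
  rewrite /C -mulrA ler_peMr ?mulr_ge0 // mulrC ler_pdivlMr ?exprn_gt0 // mul1r.
  by rewrite -[leRHS]real_normK ?num_real // ler_sqr ?nnegrE // ltW.
have -> : \sum_(k < n.+1) (e / 2 + C * (k%:R / n%:R - t) ^+ 2) * w k t =
    e / 2 + C * (t * (1 - t) / n%:R).
  transitivity (\sum_(k < n.+1) ((e / 2 + C * t ^+ 2) * w k t + (C * ((k%:R / n%:R) ^+ 2 * w k t) +
      (- 2 * C * t) * ((k%:R / n%:R) * w k t)))).
    by apply: eq_bigr => k _; ring.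
  by rewrite !big_split /= -!mulr_sumr w1 w2 w3; ring.
have : C * (t * (1 - t) / n%:R) <= e / 2.
  rewrite mulrA ler_pdivrMr //; apply: (@le_trans _ _ C).
    rewrite ler_piMr //; case/andP: t01 => t0 t1; nra.
  rewrite -ler_pdivrMl ?divr_gt0 //; apply: le_trans nB; rewrite /C le_eqVlt.
  by apply/orP; left; apply/eqP; field; rewrite !gt_eqF.
lra.
Qed.

Lemma weierstrass f (K e : R) : contp f -> 0 < K -> 0 < e ->
  exists P : {poly R}, forall t : R, 0 <= t <= K -> `|P.[t] - f t| <= e.
Proof.
move=> cf K0 e0; have cg : contp (fun t => f (K * t)).
  apply: (@contp_comp (fun t => K * t) f) => //; first by apply: contpZ; exact: contp_id.
  by move=> t t0; rewrite mulr_ge0 // ltW.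
have [P hP] := weierstrass01 cg e0; exists (P \Po (K^-1 *: 'X)) => t /andP[t0 tK].
have := hP (K^-1 * t); rewrite mulrA divff ?gt_eqF // mul1r horner_comp !hornerE; apply.
by rewrite mulr_ge0 ?invr_ge0 ?(ltW K0) // mulrC ler_pdivrMr // mul1r.
Qed.

End ContinuousFunctions.

(** * Norm convergence and continuous functional calculus *)

Lemma lim_le {R : realFieldType} (a b : nat -> R) (l l' : R) :
  a @ \oo --> l -> b @ \oo --> l' -> (forall n, a n <= b n) -> l <= l'.
Proof. by move=> al bl h; apply: (ler_cvg_to al bl); exact: nearW. Qed.

Lemma lim_sq0 {R : realFieldType} (a b : nat -> R) :
  (forall n, `|a n| <= b n) -> b @ \oo --> (0 : R) -> a @ \oo --> (0 : R).
Proof.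
move=> h b0; apply: norm_cvg0; apply: (squeeze_cvgr _ (cvg_cst 0) b0).
by near=> n; rewrite normr_ge0 h.
Unshelve. all: by end_near. Qed.

Lemma bop_complete_aux {R : realFieldType} (e A B D X T s z : R) :
  T <= 2 * A + 2 * X -> X <= 2 * (s * B) + 2 * D ->
  s * B <= s * z -> A <= z -> D <= z -> e = (4 * s + 4 + 2) * z -> T <= e.
Proof. lra. Qed.

Section OperatorNorm.
Context {R : realType} {I : choiceType}.
Implicit Types (a b x y : bop R I) (xi eta : ell2 R I) (K c e : R).

Definition nrm a : R := opnorm a.

Lemma opbd_nrm a : opbd a (nrm a ^+ 2). Proof. exact: opbd_opnorm. Qed.
Lemma nrm_ge0 a : 0 <= nrm a. Proof. exact: opnorm_ge0. Qed.

Lemma nrmP a e : 0 <= e -> nrm a <= e <-> opbd a (e ^+ 2).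
Proof.
move=> e0; split=> [h xi|]; last exact: opnorm_le.
apply: le_trans (opbd_nrm a xi) _; rewrite ler_wpM2r ?nsq_ge0 //.
by rewrite ler_sqr ?nnegrE ?nrm_ge0.
Qed.

Lemma l2norm_bop a xi : l2norm (a xi) <= nrm a * l2norm xi.
Proof.
rewrite -ler_sqr ?nnegrE ?mulr_ge0 ?l2norm_ge0 ?nrm_ge0 //.
by rewrite exprMn !sqr_l2norm opbd_nrm.
Qed.

Lemma nrm_le_l2 a e : 0 <= e -> (forall xi, l2norm (a xi) <= e * l2norm xi) -> nrm a <= e.
Proof.
move=> e0 h; apply/nrmP => // xi; rewrite -!sqr_l2norm -exprMn ler_sqr //;
  rewrite ?nnegrE ?mulr_ge0 ?l2norm_ge0 //.
Qed.

Lemma nrmD a b : nrm (a + b) <= nrm a + nrm b.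
Proof.
apply: nrm_le_l2 => [|xi]; first by rewrite addr_ge0 ?nrm_ge0.
rewrite bopDE; apply: le_trans (l2normD _ _) _.
by rewrite mulrDl lerD ?l2norm_bop.
Qed.

Lemma nrmM a b : nrm (a * b) <= nrm a * nrm b.
Proof.
apply: nrm_le_l2 => [|xi]; first by rewrite mulr_ge0 ?nrm_ge0.
rewrite bopM; apply: le_trans (l2norm_bop _ _) _.
by rewrite -mulrA ler_wpM2l ?nrm_ge0 ?l2norm_bop.
Qed.

Lemma nrmZ_le (k : R[i]) a : nrm (k *: a) <= Num.sqrt (sqmod k) * nrm a.
Proof.
apply: nrm_le_l2 => [|xi]; first by rewrite mulr_ge0 ?nrm_ge0 ?sqrtr_ge0.
by rewrite bopZE l2normZ -mulrA ler_wpM2l ?sqrtr_ge0 ?l2norm_bop.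
Qed.

Lemma nrmN a : nrm (- a) = nrm a.
Proof.
apply/eqP; rewrite eq_le; apply/andP; split.
  by apply: nrm_le_l2 => [|xi]; rewrite ?nrm_ge0 // bopNE l2normN l2norm_bop.
rewrite -{1}(opprK a).
by apply: nrm_le_l2 => [|xi]; rewrite ?nrm_ge0 // bopNE l2normN l2norm_bop.
Qed.

Lemma nrm_distC a b : nrm (a - b) = nrm (b - a).
Proof. by rewrite -nrmN opprB. Qed.

Lemma nrm0 : nrm (0) = 0.
Proof.
apply/eqP; rewrite eq_le nrm_ge0 andbT; apply/nrmP => // xi.
by rewrite bop0E nsq0 expr0n mul0r.
Qed.

Lemma nrm_eq0 a : nrm a <= 0 -> a = 0.
Proof.
move=> /(nrmP _ (lexx 0)) h; apply: bop_ext => xi; apply: nsq_eq0; apply/eqP.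
by rewrite eq_le nsq_ge0 andbT; apply: le_trans (h xi) _; rewrite expr0n mul0r.
Qed.

Lemma nrm_star a : nrm (star a) = nrm a.
Proof.
suff h b : nrm (star b) <= nrm b.
  by apply/eqP; rewrite eq_le h -{1}(starK a) h.
apply/nrmP; rewrite ?nrm_ge0 //; apply: opbd_star; rewrite ?sqr_ge0 //.
exact: opbd_nrm.
Qed.

Lemma nrm1_le : nrm (1) <= 1.
Proof. by apply: nrm_le_l2 => // xi; rewrite bop1 mul1r. Qed.

Definition olim (u : nat -> bop R I) y := nrm (u n - y) @[n --> \oo] --> (0 : R).

Lemma olim_le (u : nat -> bop R I) y (w : nat -> R) :
  (forall n, nrm (u n - y) <= w n) -> w @ \oo --> (0 : R) -> olim u y.
Proof.
move=> h w0; apply: (squeeze_cvgr _ (cvg_cst 0) w0).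
by near=> n; rewrite nrm_ge0 h.
Unshelve. all: by end_near. Qed.

Lemma olim_cst a : olim (fun=> a) a.
Proof. by rewrite /olim subrr nrm0; apply: cvg_cst. Qed.

Lemma olimD (u v : nat -> bop R I) x y : olim u x -> olim v y -> olim (fun n => u n + v n) (x + y).
Proof.
move=> ux vy; apply: (@olim_le _ _ (fun n => nrm (u n - x) + nrm (v n - y))).
  by move=> n; rewrite opprD addrACA; exact: nrmD.
by rewrite -[X in _ --> X]addr0; apply: cvgD.
Qed.

Lemma olimN (u : nat -> bop R I) x : olim u x -> olim (fun n => - u n) (- x).
Proof.
move=> ux; apply: (olim_le _ ux) => n.
by rewrite -opprD nrmN.
Qed.
Lemma olimB (u v : nat -> bop R I) x y : olim u x -> olim v y -> olim (fun n => u n - v n) (x - y).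
Proof. by move=> ux /olimN; exact: olimD. Qed.

Lemma olimM (u v : nat -> bop R I) x y : olim u x -> olim v y -> olim (fun n => u n * v n) (x * y).
Proof.
move=> ux vy.
pose d n := nrm (u n - x); pose e n := nrm (v n - y).
apply: (@olim_le _ _ (fun n => d n * e n + d n * nrm y + nrm x * e n)).
  move=> n; have -> : u n * v n - x * y = (u n - x) * (v n - y) + (u n - x) * y + x * (v n - y).
    by rewrite -mulrDr subrK mulrBl mulrBr addrA subrK.
  apply: le_trans (nrmD _ _) _; apply: lerD; last exact: nrmM.
  by apply: le_trans (nrmD _ _) _; apply: lerD; exact: nrmM.
rewrite -[X in _ --> X](_ : 0 * 0 + 0 * nrm y + nrm x * 0 = 0); last by rewrite !mul0r mulr0 !addr0.
by apply: cvgD; first apply: cvgD; apply: cvgM => //; exact: cvg_cst.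
Qed.

Lemma olim_star (u : nat -> bop R I) x : olim u x -> olim (fun n => star (u n)) (star x).
Proof. by move=> ux; apply: (olim_le _ ux) => n; rewrite -starB nrm_star. Qed.

Lemma olim_unique (u : nat -> bop R I) x y : olim u x -> olim u y -> x = y.
Proof.
move=> ux uy; apply/eqP; rewrite -subr_eq0; apply/eqP/nrm_eq0.
have h : (fun n => nrm (u n - x) + nrm (u n - y)) @ \oo --> (0 : R).
  by rewrite -[X in _ --> X]addr0; apply: cvgD.
apply: (@lim_le R (fun=> nrm (x - y)) _ _ _ (cvg_cst _) h) => n.
by rewrite (nrm_distC (u n) x); apply: le_trans (nrmD _ _); rewrite addrA subrK.
Qed.

Lemma olim_l2 (u : nat -> bop R I) x xi : olim u x -> l2norm (u n xi - x xi) @[n --> \oo] --> (0 : R).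
Proof.
move=> ux; apply: (squeeze_cvgr _ (cvg_cst 0)).
  near=> n; rewrite l2norm_ge0 /=; exact: (l2norm_bop (u n - x) xi).
by rewrite -[X in _ --> X](mul0r (l2norm xi)); apply: cvgM => //; exact: cvg_cst.
Unshelve. all: by end_near. Qed.

Lemma abs_Re_ip_le xi eta : `|complex.Re (ip xi eta)| <= l2norm xi * l2norm eta.
Proof.
rewrite ler_norml Re_ip_le andbT lerNl; have := Re_ip_le (- xi) eta.
by rewrite ipNl ReN l2normN.
Qed.

Lemma cvg_Re_ip (w : nat -> ell2 R I) eta xi : l2norm (w n - eta) @[n --> \oo] --> (0 : R) ->
  complex.Re (ip xi (w n)) @[n --> \oo] --> complex.Re (ip xi eta).
Proof.
move=> h; apply/subr_cvg0; apply: (@lim_sq0 _ _ (fun n => l2norm xi * l2norm (w n - eta))) => [n|].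
  rewrite -[X in `|X|]/(complex.Re (ip xi (w n)) - complex.Re (ip xi eta)) -ReN -ReD -ipBr.
  exact: abs_Re_ip_le.
by rewrite -[X in _ --> X](mulr0 (l2norm xi)); apply: cvgM => //; exact: cvg_cst.
Qed.

Lemma olim_ip (u : nat -> bop R I) x xi eta : olim u x ->
  complex.Re (ip xi (u n eta)) @[n --> \oo] --> complex.Re (ip xi (x eta)).
Proof. by move=> ux; apply: cvg_Re_ip; exact: olim_l2. Qed.

(** The limit is taken vector by vector, and [key] carries the Cauchy estimate to it with a loss of
    a factor 2 in squares, which starting from [e / 2] absorbs. *)
Lemma bop_complete (u : nat -> bop R I) :
  (forall e, 0 < e -> exists N, forall m n, (N <= m)%N -> (N <= n)%N -> nrm (u m - u n) <= e) ->
  exists y, olim u y.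
Proof.
move=> cu.
have lim xi : exists l, forall e, 0 < e -> exists N, forall n, (N <= n)%N -> nsq (u n xi - l) <= e.
  apply: ell2_complete => e e0.
  pose d := Num.sqrt (e / (nsq xi + 1)).
  have x1 : 0 < nsq xi + 1 by rewrite ltr_wpDl ?nsq_ge0.
  have d0 : 0 < d by rewrite sqrtr_gt0 divr_gt0.
  have [N hN] := cu d d0; exists N => m n Nm Nn.
  have h := (nrmP _ (ltW d0)).1 (hN m n Nm Nn) xi.
  apply: (le_trans h); rewrite sqr_sqrtr ?divr_ge0 ?(ltW e0) ?(ltW x1) //.
  by rewrite mulrAC ler_pdivrMr // ler_wpM2l ?(ltW e0) // lerDl.
pose y xi := projT1 (cid (lim xi)).
have yP xi : forall e, 0 < e -> exists N, forall n, (N <= n)%N -> nsq (u n xi - y xi) <= e.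
  exact: projT2 (cid (lim xi)).
have key m xi (d : R) : 0 <= d -> (exists N, forall n, (N <= n)%N -> nrm (u m - u n) <= d) ->
    nsq (u m xi - y xi) <= 2 * (d ^+ 2 * nsq xi).
  move=> d0 [N hN]; apply/ler_addgt0Pr => e e0; have [N2 hN2] := yP xi (e / 2) ltac:(lra).
  pose n := maxn N N2.
  have h1 := (nrmP _ d0).1 (hN n (leq_maxl _ _)) xi.
  have h2 := hN2 n (leq_maxr _ _).
  rewrite -[_ - y xi](subrKA (u n xi)); apply: le_trans (nsqD_le _ _) _.
  have -> : u m xi - u n xi = (u m - u n) xi by [].
  have {}h1 : nsq ((u m - u n) xi) <= d ^+ 2 * nsq xi := h1.
  by lra.
have yb : bounded_op (y : op R I).
  apply/bounded_opP; split.
    move=> k v w; apply/eqP; rewrite -subr_eq0; apply/eqP/nsq_eq0/eqP.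
    rewrite eq_le nsq_ge0 andbT; apply/ler_addgt0Pr => e e0; rewrite add0r.
    pose C := 4 * sqmod k + 4 + 2; have C0 : 0 < C.
      by have := sqmod_ge0 k; rewrite /C; lra.
    have [N1 h1] := yP (k *: v + w) (e / C) ltac:(by rewrite divr_gt0).
    have [N2 h2] := yP v (e / C) ltac:(by rewrite divr_gt0).
    have [N3 h3] := yP w (e / C) ltac:(by rewrite divr_gt0).
    pose n := maxn N1 (maxn N2 N3).
    have {}h1 := h1 n (leq_maxl _ _).
    have {}h2 := h2 n ltac:(by rewrite !leq_max leqnn orbT).
    have {}h3 := h3 n ltac:(by rewrite !leq_max leqnn !orbT).
    have -> : y (k *: v + w) - (k *: y v + y w) =
      - (u n (k *: v + w) - y (k *: v + w)) + (k *: (u n v - y v) + (u n w - y w)).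
      by rewrite bopD bopZ scalerBr opprB (addrACA (k *: u n v)) -opprD addrA subrK.
    have E : e = C * (e / C) by rewrite mulrC divfK ?gt_eqF.
    have X := nsqD_le (k *: (u n v - y v)) (u n w - y w); rewrite nsqZ in X.
    have T := nsqD_le (- (u n (k *: v + w) - y (k *: v + w))) (k *: (u n v - y v) + (u n w - y w)).
    rewrite nsqN in T.
    have S := ler_wpM2l (sqmod_ge0 k) h2.
    exact: (bop_complete_aux T X S h1 h3 E).
  have [N hN] := cu 1 ltr01; have [c c0 hc] := bop_bd (u N).
  exists (2 * 2 + 2 * c); first lra.
  move=> xi; have := key N xi 1 ler01 (ex_intro _ N (fun n Nn => hN N n (leqnn _) Nn)).
  rewrite expr1n mul1r => h; rewrite -[y xi](subKr (u N xi)) addrC.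
  apply: le_trans (nsqD_le _ _) _; rewrite nsqN; have := hc xi; lra.
exists (toBop yb); apply/cvgrPdist_le => e e0; have e2 : 0 < e / 2 by rewrite divr_gt0.
have [N hN] := cu (e / 2) e2; exists N => // n Nn.
have h : nrm (u n - toBop yb) <= e.
  apply: opnorm_le; first exact: ltW.
  move=> xi; have k := key n xi (e / 2) (ltW e2) (ex_intro _ N (fun m Nm => hN n m Nn Nm)).
  apply: (le_trans k); rewrite mulrA ler_wpM2r ?nsq_ge0 //.
  by rewrite exprMn mulrCA ler_piMr ?sqr_ge0 //; lra.
change (`|0 - nrm (u n - toBop yb)| <= e).
by rewrite sub0r normrN (ger0_norm (nrm_ge0 (u n - toBop yb))).
Qed.

End OperatorNorm.

(** * Polynomials in a positive operator *)

Section PolynomialCalculus.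
Context {R : realType} {I : choiceType}.
Implicit Types (a b x y : bop R I) (xi eta : ell2 R I) (K c e : R) (P Q : {poly R}).

Definition rs c a : bop R I := c%:C%C *: a.

Lemma rsE c a : rs c a = c%:C%C *: a. Proof. by []. Qed.
Lemma rsB c a b : rs c (a - b) = rs c a - rs c b. Proof. exact: scalerBr. Qed.
Lemma rsDl c e a : rs (c + e) a = rs c a + rs e a.
Proof. by rewrite /rs rmorphD scalerDl. Qed.
Lemma rsA c e a : rs c (rs e a) = rs (c * e) a. Proof. by rewrite /rs rmorphM scalerA. Qed.
Lemma rs1 a : rs 1 a = a. Proof. by rewrite /rs rmorph1 scale1r. Qed.
Lemma rs0 a : rs 0 a = 0. Proof. by rewrite /rs rmorph0 scale0r. Qed.
Lemma rs0r c : rs c 0 = 0. Proof. exact: scaler0. Qed.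
Lemma rsN1 a : rs (-1) a = - a. Proof. by rewrite /rs rmorphN1 scaleN1r. Qed.
Lemma rsMl c a b : rs c a * b = rs c (a * b). Proof. exact: bscaleAl. Qed.
Lemma rsMr c a b : a * rs c b = rs c (a * b). Proof. exact: bscaleAr. Qed.
Lemma star_rs c a : star (rs c a) = rs c (star a). Proof. by rewrite /rs starZ conjc_real. Qed.

Definition pev P a : bop R I := \sum_(k < size P) (P`_k)%:C%C *: a ^+ k.

Lemma pevE n P a : (size P <= n)%N -> pev P a = \sum_(k < n) (P`_k)%:C%C *: a ^+ k.
Proof.
move=> sn; rewrite /pev.
rewrite -(big_mkord xpredT (fun k => (P`_k)%:C%C *: a ^+ k)).
rewrite -(big_mkord xpredT (fun k => (P`_k)%:C%C *: a ^+ k)).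
rewrite (big_cat_nat (n := size P) (leq0n _) sn) /= [X in _ = _ + X]big_nat.
rewrite [X in _ = _ + X]big1 ?addr0 // => k /andP[sk _].
by rewrite nth_default // rmorph0 scale0r.
Qed.

Lemma pevD P Q a : pev (P + Q) a = pev P a + pev Q a.
Proof.
pose n := maxn (size P) (size Q).
rewrite (@pevE n) ?size_polyD // (@pevE n P) ?leq_maxl // (@pevE n Q) ?leq_maxr //.
by rewrite -big_split; apply: eq_bigr => k _; rewrite coefD rmorphD scalerDl.
Qed.

Lemma pevZ c P a : pev (c *: P) a = rs c (pev P a).
Proof.
rewrite (@pevE (size P)) ?size_scale_leq // /rs scaler_sumr; apply: eq_bigr => k _.
by rewrite coefZ rmorphM scalerA.
Qed.

Lemma pev0 a : pev 0 a = 0. Proof. by rewrite /pev size_poly0 big_ord0. Qed.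

Lemma pevN P a : pev (- P) a = - pev P a.
Proof. by rewrite -scaleN1r pevZ rsN1. Qed.
Lemma pevB P Q a : pev (P - Q) a = pev P a - pev Q a.
Proof. by rewrite pevD pevN. Qed.

Lemma pev_sum (J : Type) (s : seq J) (F : J -> {poly R}) a :
  pev (\sum_(j <- s) F j) a = \sum_(j <- s) pev (F j) a.
Proof. by elim/big_ind2: _ => [|x1 x2 y1 y2 <- <-|//]; rewrite ?pev0 ?pevD. Qed.

Lemma pevXn n a : pev 'X^n a = a ^+ n.
Proof.
rewrite (@pevE n.+1) ?size_polyXn // big_ord_recr /= big1 ?add0r => [|k _].
  by rewrite coefXn eqxx rmorph1 scale1r.
by rewrite coefXn ltn_eqF ?ltn_ord // rmorph0 scale0r.
Qed.

Lemma pev1 a : pev 1 a = 1.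
Proof. by rewrite -(expr0 'X) pevXn expr0. Qed.
Lemma pevC c a : pev c%:P a = rs c 1.
Proof. by rewrite -[c%:P]mulr1 mul_polyC pevZ pev1. Qed.
Lemma pevX a : pev 'X a = a.
Proof. by rewrite -(expr1 'X) pevXn expr1. Qed.

Lemma poly_sumXn P : P = \sum_(k < size P) P`_k *: 'X^k.
Proof. by rewrite -poly_def coefK. Qed.

Lemma pevM P Q a : pev (P * Q) a = pev P a * pev Q a.
Proof.
rewrite {1}(poly_sumXn P) mulr_suml pev_sum [pev P a]/pev mulr_suml.
apply: eq_bigr => k _; rewrite -scalerAl pevZ bscaleAl; congr (_ *: _).
rewrite {1}(poly_sumXn Q) mulr_sumr pev_sum [pev Q a]/pev mulr_sumr.
apply: eq_bigr => l _; rewrite -scalerAr pevZ bscaleAr; congr (_ *: _).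
by rewrite -(exprD 'X) pevXn exprD.
Qed.

Lemma pevXp P n a : pev (P ^+ n) a = pev P a ^+ n.
Proof. by elim: n => [|n IH]; rewrite ?expr0 ?pev1 // !exprS pevM IH. Qed.

Lemma pev_intertwine x a b P : x * a = b * x -> x * pev P a = pev P b * x.
Proof.
move=> xab; rewrite /pev mulr_sumr mulr_suml; apply: eq_bigr => k _.
rewrite bscaleAl bscaleAr; congr (_ *: _).
elim: (k : nat) => [|n IH]; first by rewrite !expr0 mul1r mulr1.
by rewrite exprSr mulrA IH -mulrA xab mulrA -exprSr.
Qed.

Lemma star_pev P a : star a = a -> star (pev P a) = pev P a.
Proof.
move=> sa; rewrite /pev star_sum; apply: eq_bigr => k _.
by rewrite starZ starX sa conjc_real.
Qed.

Lemma pev_scale c P a : pev (P \Po (c *: 'X)) a = pev P (rs c a).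
Proof.
rewrite {1}(poly_sumXn P) raddf_sum pev_sum [RHS]/pev.
apply: eq_bigr => k _; rewrite /= comp_polyZ comp_Xn_poly.
by rewrite pevZ pevXp pevZ pevX.
Qed.

Definition posop a := star a = a /\ forall xi, 0 <= complex.Re (ip xi (a xi)).

Lemma posop0 : posop 0.
Proof. by split=> [|xi]; rewrite ?star0 // bop0E ip0r. Qed.
Lemma posop1 : posop 1.
Proof. by split=> [|xi]; rewrite ?star1 // bop1 -nsqE nsq_ge0. Qed.
Lemma posopD a b : posop a -> posop b -> posop (a + b).
Proof.
move=> [sa pa] [sb pb]; split=> [|xi]; first by rewrite starD sa sb.
by rewrite bopDE ipDr ReD addr_ge0.
Qed.
Lemma Re_realM c (z : R[i]) : complex.Re (c%:C%C * z) = c * complex.Re z.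
Proof. by case: z => u v /=; rewrite mul0r subr0. Qed.
Lemma posopZ c a : 0 <= c -> posop a -> posop (rs c a).
Proof.
move=> c0 [sa pa]; split=> [|xi]; first by rewrite starZ sa conjc_real.
by rewrite bopZE ipZr Re_realM mulr_ge0.
Qed.
Lemma posop_conj y a : posop a -> posop (star y * a * y).
Proof.
move=> [sa pa]; split=> [|xi]; first by rewrite !starM starK sa mulrA.
by rewrite !bopM ip_star.
Qed.
Lemma posop_star y : posop (star y * y).
Proof. by have := posop_conj y posop1; rewrite mulr1. Qed.
Lemma posop_starr y : posop (y * star y).
Proof. by have := posop_star (star y); rewrite starK. Qed.

Lemma posop_nrm a K : posop a -> nrm a <= K -> posop (rs K 1 - a).
Proof.
move=> [sa pa] aK; split=> [|xi]; first by rewrite starB starZ star1 sa conjc_real.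
rewrite bopDE bopNE bopZE bop1 ipBr ReD ReN ipZr Re_realM -nsqE subr_ge0.
apply: le_trans (Re_ip_le _ _) _; rewrite -sqr_l2norm expr2 mulrCA ler_wpM2l ?l2norm_ge0 //.
apply: le_trans (l2norm_bop _ _) _; by rewrite ler_wpM2r ?l2norm_ge0.
Qed.

(** Halving the exponents writes the polynomial as [Y C Y], with [C] one of 1, X, 1 - X and X (1 -
    X). The last is positive at [a] because [a (1 - a) = a (1 - a) a + (1 - a) a (1 - a)]. *)
Lemma posop_bern a n k : posop a -> posop (1 - a) -> posop (pev (bern n k) a).
Proof.
move=> pa pb; set m := (n - k)%N.
pose Y : {poly R} := 'X^(k./2) * (1 - 'X) ^+ (m./2).
pose C : {poly R} := 'X^(odd k) * (1 - 'X) ^+ (odd m).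
have -> : bern n k = Y * C * Y.
  rewrite /bern -/m /Y /C -{1}(odd_double_half k) -{1}(odd_double_half m).
  by rewrite -!addnn !exprD; ring.
have sY : star (pev Y a) = pev Y a by apply: star_pev; case: pa.
rewrite (pevM (Y * C) Y) (pevM Y C) -{1}sY; apply: posop_conj.
rewrite pevM !pevXp pevB pev1 pevX.
case: (odd k) (odd m) => [] []; rewrite /= ?expr0 ?expr1 ?mul1r ?mulr1 //; last exact: posop1.
have [sa _] := pa; have [sb _] := pb.
have -> : a * (1 - a) = star a * (1 - a) * a + star (1 - a) * a * (1 - a).
  have cm : (1 - a) * a = a * (1 - a) by rewrite mulrBr mulrBl mulr1 mul1r.
  by rewrite sa sb cm -mulrDr (addrC a) subrK mulr1.
by apply: posopD; exact: posop_conj.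
Qed.

(** After rescaling to [0, 1], [bernstein_positivity] applies to the functional sending [Q] to the
    real part of [ip xi (Q b xi)], which is nonnegative on Bernstein polynomials by [posop_bern].
    This does the work of the spectral mapping theorem. *)
Lemma posop_pev a K P : posop a -> nrm a <= K ->
  (forall t : R, 0 <= t <= K -> 0 <= P.[t]) -> posop (pev P a).
Proof.
move=> pa aK hP; split=> [|xi]; first by apply: star_pev; case: pa.
have K0 : 0 <= K by apply: le_trans aK; exact: nrm_ge0.
have [K00|KN0] := eqVneq K 0.
  have -> : a = 0 by apply: nrm_eq0; rewrite -K00.
  have -> : pev P 0 = rs P.[0] 1.
    rewrite -{1}[P](subrK (P.[0])%:P) pevD pevC [pev (P - _) _]/pev big1 ?add0r //.
    move=> -[[|k] _] _ /=; last by rewrite exprS mul0r scaler0.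
    by rewrite coefB coefC eqxx -horner_coef0 subrr rmorph0 scale0r.
  rewrite bopZE ipZr Re_realM bop1 -nsqE mulr_ge0 ?nsq_ge0 // hP //.
  by rewrite lexx.
have Kp : 0 < K by rewrite lt_neqAle eq_sym KN0.
pose b := rs K^-1 a.
have aE : a = rs K b by rewrite rsA mulfV // rs1.
have pb : posop b by apply: posopZ; rewrite ?invr_ge0.
have pb1 : posop (1 - b).
  rewrite (_ : 1 - b = rs K^-1 (rs K 1 - a)).
    by apply: posopZ; rewrite ?invr_ge0 //; exact: posop_nrm.
  by rewrite rsB rsA mulVf // rs1.
rewrite aE -pev_scale.
apply: (bernstein_positivity (phi := fun Q => complex.Re (ip xi (pev Q b xi)))).
- by move=> Q Q'; rewrite pevD bopDE ipDr ReD.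
- by move=> c Q; rewrite pevZ bopZE ipZr Re_realM.
- by move=> n k; have [_] := posop_bern n k pb pb1.
- move=> u /andP[u0 u1]; rewrite horner_comp !hornerE hP //.
  by rewrite mulr_ge0 //= ler_piMr.
Qed.

(** Positivity of [c^2 - P^2] at [a], since [P(a)] is self-adjoint. *)
Lemma nrm_pev a K P c : posop a -> nrm a <= K -> 0 <= c ->
  (forall t : R, 0 <= t <= K -> `|P.[t]| <= c) -> nrm (pev P a) <= c.
Proof.
move=> pa aK c0 hP; apply/nrmP => // xi.
have hc (t : R) : 0 <= t <= K -> 0 <= ((c ^+ 2)%:P - P * P).[t].
  move=> tK; rewrite !hornerE subr_ge0 -expr2 -[leLHS]real_normK ?num_real //.
  by rewrite ler_sqr ?nnegrE // hP.
have [_ /(_ xi)] := posop_pev pa aK hc.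
rewrite pevB pevC pevM bopDE bopNE bopZE bop1 bopM ipBr ReD ReN ipZr Re_realM -nsqE.
have [sa _] := pa; rewrite -{1}(star_pev P sa) ip_star -nsqE.
lra.
Qed.

Lemma iter_bop a k xi : iter k a xi = (a ^+ k) xi.
Proof. by elim: k => // k IH; rewrite iterS IH exprS bopM. Qed.

Lemma op_polyE P a : op_poly P a = pev P a :> op R I.
Proof.
apply/funext => xi; rewrite /op_poly /pev bop_sumE; apply: eq_bigr => k _.
by rewrite bopZE iter_bop.
Qed.

End PolynomialCalculus.

(** * Continuous functional calculus of a positive operator *)

Section FunctionalCalculus.
Context {R : realType} {I : choiceType}.
Implicit Types (a b x y : bop R I) (xi eta : ell2 R I) (K c e : R) (P Q : {poly R}).
Implicit Types (f g : R -> R).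

Lemma cvg_invS : (fun n : nat => n.+1%:R^-1 : R) @ \oo --> (0 : R).
Proof. exact: cvg_harmonic. Qed.

Lemma contp_poly f P : contp f -> contp (fun t => P.[f t]).
Proof.
move=> cf; elim/poly_ind: P => [|P c IH].
  by apply: (@contp_ext R (fun=> 0)) => [t _|]; [rewrite horner0|exact: contp_cst].
apply: (@contp_ext R (fun t => P.[f t] * f t + c)) => [t _|]; first by rewrite !hornerE.
by apply: contpD; [exact: contpM|exact: contp_cst].
Qed.

Lemma weierstrass_seq f K : contp f ->
  exists P_ : nat -> {poly R}, forall n (t : R), 0 <= t <= K -> `|(P_ n).[t] - f t| <= n.+1%:R^-1.
Proof.
move=> cf; have K1 : 0 < Num.max K 1 by rewrite lt_max ltr01 orbT.
have h n := weierstrass cf K1 (ltac:(by rewrite invr_gt0) : 0 < n.+1%:R^-1).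
exists (fun n => projT1 (cid (h n))) => n t /andP[t0 tK].
by apply: (projT2 (cid (h n))); rewrite t0 /= le_max tK.
Qed.

Lemma contp_bounded f K : contp f -> exists2 B : R, 0 <= B & forall t : R, 0 <= t <= K -> `|f t| <= B.
Proof.
move=> cf; have [P hP] := weierstrass_seq K cf.
have K0 : 0 <= Num.max K 0 by rewrite le_max lexx orbT.
exists (1 + \sum_(m < size (P 0%N)) `|(P 0%N)`_m| * Num.max K 0 ^+ m).
  by rewrite addr_ge0 // sumr_ge0 // => m _; rewrite mulr_ge0 ?exprn_ge0.
move=> t tK; have := hP 0%N t tK; rewrite invr1 distrC => h.
rewrite -[f t](subrK (P 0%N).[t]); apply: le_trans (ler_normD _ _) _; apply: lerD => //.
rewrite horner_coef; apply: le_trans (ler_norm_sum _ _ _) _; apply: ler_sum => m _.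
case/andP: tK => t0 tK.
by rewrite normrM ler_wpM2l // normrX lerXn2r ?nnegrE // ger0_norm // le_max tK.
Qed.

Definition fc_def f a : bop R I := xget 0 [set y | forall e, 0 < e -> exists P,
  (forall t : R, 0 <= t <= nrm a -> `|P.[t] - f t| <= e) /\ nrm (pev P a - y) <= e].

(* Sealed: unfolding [fc] makes failing unification problems explode. *)
Fact fc_seal : {F : (R -> R) -> bop R I -> bop R I | F = fc_def}. Proof. by exists fc_def. Qed.
Definition fc := sval fc_seal.
Lemma fcE : fc = fc_def. Proof. exact: svalP fc_seal. Qed.

(** By [nrm_pev], uniform approximants of [f] on [0, nrm a] evaluate to a Cauchy sequence of
    operators. *)
Lemma fc_exists f a : contp f -> posop a -> exists y, forall e, 0 < e -> exists P,
  (forall t : R, 0 <= t <= nrm a -> `|P.[t] - f t| <= e) /\ nrm (pev P a - y) <= e.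
Proof.
move=> cf pa; have [P hP] := weierstrass_seq (nrm a) cf.
have near e : 0 < e -> exists N, forall n : nat, (N <= n)%N -> n.+1%:R^-1 <= e.
  move=> e0; have /cvgrPdist_le/(_ _ e0)[N _ hN] := cvg_invS.
  by exists N => n /hN /=; rewrite sub0r normrN ger0_norm.
have [y yP] : exists y, olim (fun n => pev (P n) a) y.
  apply: bop_complete => e e0; have [N hN] := near (e / 2) ltac:(by rewrite divr_gt0).
  exists N => m n /hN h1 /hN h2; rewrite -pevB.
  apply: (nrm_pev pa (lexx _) (ltW e0)) => t tK; rewrite hornerD hornerN.
  have := hP m t tK; have := hP n t tK; rewrite (distrC (P n).[t]) => h3 h4.
  rewrite -[X in X - _](subrK (f t)) -addrA.
  apply: le_trans (ler_normD _ _) _; apply: le_trans (lerD (le_trans h4 h1) (le_trans h3 h2)) _; lra.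
exists y => e e0; have [N hN] := near e e0.
have /cvgrPdist_le/(_ _ e0)[M _ hM] := yP.
exists (P (maxn N M)); split=> [t tK|].
  by apply: le_trans (hP _ t tK) _; apply: hN; exact: leq_maxl.
by have := hM (maxn N M) (leq_maxr _ _); rewrite /= sub0r normrN ger0_norm ?nrm_ge0.
Qed.

Lemma fcP f a : contp f -> posop a -> forall e, 0 < e -> exists P,
  (forall t : R, 0 <= t <= nrm a -> `|P.[t] - f t| <= e) /\ nrm (pev P a - fc f a) <= e.
Proof. by move=> cf pa; have [y yP] := fc_exists cf pa; rewrite fcE /fc_def; case: xgetP => [z _ //|/(_ y)]. Qed.

(** Any polynomial close to [f] may be used, not only those that come with [fc f a]: two polynomials
    close to [f] are close to each other, so [nrm_pev] compares their values at [a]. *)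
Lemma fc_near f a P c : contp f -> posop a -> 0 <= c ->
  (forall t : R, 0 <= t <= nrm a -> `|P.[t] - f t| <= c) -> nrm (pev P a - fc f a) <= c.
Proof.
move=> cf pa c0 hP; apply/ler_addgt0Pr => e e0.
have [Q [hQ hQ2]] := fcP cf pa (e := e / 2) ltac:(by rewrite divr_gt0).
rewrite -[pev P a](subrK (pev Q a)) -addrA; apply: le_trans (nrmD _ _) _.
have : nrm (pev P a - pev Q a) <= c + e / 2.
  rewrite -pevB; apply: (nrm_pev pa (lexx _)); first by rewrite addr_ge0 // divr_ge0 // ltW.
  move=> t tK; rewrite hornerD hornerN -[X in X - _](subrK (f t)) -addrA.
  by apply: le_trans (ler_normD _ _) _; rewrite (distrC (f t)) lerD ?hP ?hQ.
lra.
Qed.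

Lemma fc_lim f a K (P : nat -> {poly R}) (w : nat -> R) : contp f -> posop a -> nrm a <= K ->
  (forall n (t : R), 0 <= t <= K -> `|(P n).[t] - f t| <= w n) -> w @ \oo --> (0 : R) ->
  olim (fun n => pev (P n) a) (fc f a).
Proof.
move=> cf pa aK hP w0; apply: (olim_le _ w0) => n.
have K0 : 0 <= K by apply: le_trans aK; exact: nrm_ge0.
apply: fc_near => //; first by apply: le_trans (hP n 0 _); rewrite ?lexx.
by move=> t /andP[t0 tK]; apply: hP; rewrite t0 (le_trans tK).
Qed.

Lemma fc_ext f g a : contp f -> posop a -> (forall t, 0 <= t <= nrm a -> f t = g t) -> fc f a = fc g a.
Proof.
move=> cf pa fg; rewrite fcE /fc_def; congr xget; apply/seteqP; split=> y /= h e /h [P [h1 h2]];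
 by exists P; split=> // t tK; rewrite ?fg ?h1 // -?fg ?h1.
Qed.

Lemma fc_poly P a : posop a -> fc (fun t => P.[t]) a = pev P a.
Proof.
move=> pa; apply/esym/eqP; rewrite -subr_eq0; apply/eqP/nrm_eq0.
apply: fc_near => //; last by move=> t _; rewrite subrr normr0.
exact: contp_poly contp_id.
Qed.

Lemma fcD f g a : contp f -> contp g -> posop a -> fc (fun t => f t + g t) a = fc f a + fc g a.
Proof.
move=> cf cg pa; have [P hP] := weierstrass_seq (nrm a) cf; have [Q hQ] := weierstrass_seq (nrm a) cg.
apply: olim_unique (olimD (fc_lim cf pa (lexx _) hP cvg_invS) (fc_lim cg pa (lexx _) hQ cvg_invS)).
rewrite (_ : (fun n => _) = (fun n => pev (P n + Q n) a)); last by apply/funext => n; rewrite pevD.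
apply: (@fc_lim (fun t => f t + g t) a (nrm a) (fun n => P n + Q n) (fun n => n.+1%:R^-1 + n.+1%:R^-1)) => //.
  exact: contpD.
  move=> n t tK; rewrite hornerD opprD addrACA.
  by apply: le_trans (ler_normD _ _) _; rewrite lerD ?hP ?hQ.
by rewrite -[X in _ --> X]addr0; apply: cvgD; exact: cvg_invS.
Qed.

Lemma fcM f g a : contp f -> contp g -> posop a -> fc (fun t => f t * g t) a = fc f a * fc g a.
Proof.
move=> cf cg pa; have [P hP] := weierstrass_seq (nrm a) cf; have [Q hQ] := weierstrass_seq (nrm a) cg.
apply: olim_unique (olimM (fc_lim cf pa (lexx _) hP cvg_invS) (fc_lim cg pa (lexx _) hQ cvg_invS)).
have [B B0 hB] := contp_bounded (nrm a) cf; have [C C0 hC] := contp_bounded (nrm a) cg.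
rewrite (_ : (fun n => _) = (fun n => pev (P n * Q n) a)); last by apply/funext => n; rewrite pevM.
apply: (@fc_lim (fun t => f t * g t) a (nrm a) (fun n => P n * Q n)
  (fun n => n.+1%:R^-1 * n.+1%:R^-1 + n.+1%:R^-1 * C + B * n.+1%:R^-1)) => //; first exact: contpM.
  move=> n t tK; rewrite hornerM.
  have -> : (P n).[t] * (Q n).[t] - f t * g t =
     ((P n).[t] - f t) * ((Q n).[t] - g t) + ((P n).[t] - f t) * g t + f t * ((Q n).[t] - g t) by ring.
  apply: le_trans (ler_normD _ _) _; apply: lerD; last by rewrite normrM ler_pM ?hB ?hQ.
  by apply: le_trans (ler_normD _ _) _; apply: lerD; rewrite normrM ler_pM ?hP ?hQ ?hC.
rewrite -[X in _ --> X](_ : 0 * 0 + 0 * C + B * 0 = 0); last by rewrite !mul0r mulr0 !addr0.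
have c0 := cvg_invS.
apply: cvgD; first apply: cvgD; apply: cvgM => //; exact: cvg_cst.
Qed.

Lemma fc_cst c a : posop a -> fc (fun=> c) a = rs c 1.
Proof.
move=> pa; rewrite -(pevC c a) -fc_poly //; apply: fc_ext => //; first exact: contp_cst.
by move=> t _; rewrite hornerC.
Qed.
Lemma fc_id a : posop a -> fc (fun t => t) a = a.
Proof.
move=> pa; rewrite -[RHS](pevX a) -fc_poly //; apply: fc_ext => //; first exact: contp_id.
by move=> t _; rewrite hornerX.
Qed.
Lemma fcZ c f a : contp f -> posop a -> fc (fun t => c * f t) a = rs c (fc f a).
Proof.
move=> cf pa; rewrite (fcM (@contp_cst R c) cf pa) (fc_cst c pa) rsMl; congr rs; exact: mul1r.
Qed.
Lemma fcN f a : contp f -> posop a -> fc (fun t => - f t) a = - fc f a.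
Proof.
move=> cf pa; rewrite -rsN1 -fcZ //.
apply: fc_ext => //; first exact: contpN.
by move=> t _; rewrite mulN1r.
Qed.
Lemma fcB f g a : contp f -> contp g -> posop a -> fc (fun t => f t - g t) a = fc f a - fc g a.
Proof. by move=> cf cg pa; rewrite fcD ?fcN //; exact: contpN. Qed.

Lemma posop_lim (u : nat -> bop R I) y : (forall n, posop (u n)) -> olim u y -> posop y.
Proof.
move=> pu uy; split=> [|xi].
  apply: (olim_unique (u := u)) => //.
  have -> : u = (fun n => star (u n)) by apply/funext => n; case: (pu n).
  exact: olim_star.
apply: (@lim_le R (fun=> 0) _ 0 _ (cvg_cst (0 : R)) (olim_ip (xi := xi) (eta := xi) uy)) => n.
by have [_] := pu n.
Qed.

Lemma fc_star f a : contp f -> posop a -> star (fc f a) = fc f a.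
Proof.
move=> cf pa; have [P hP] := weierstrass_seq (nrm a) cf.
have h := fc_lim cf pa (lexx _) hP cvg_invS.
apply: olim_unique h; have := olim_star (fc_lim cf pa (lexx _) hP cvg_invS).
by rewrite (_ : (fun n => star _) = (fun n => pev (P n) a)) //;
  apply/funext => n; rewrite star_pev //; case: pa.
Qed.

Lemma fc_pos f a : contp f -> posop a -> (forall t, 0 <= t <= nrm a -> 0 <= f t) -> posop (fc f a).
Proof.
move=> cf pa f0; have [P hP] := weierstrass_seq (nrm a) cf.
(* The approximants of a nonnegative function may be slightly negative; the added constant
   [1 / (n + 1)] makes them nonnegative on [0, nrm a]. *)
apply: (@posop_lim (fun n => pev (P n + (n.+1%:R^-1)%:P) a)).
  move=> n; apply: (posop_pev pa (lexx _)) => t tK; rewrite hornerD hornerC.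
  have := hP n t tK; have := f0 t tK; move: (n.+1%:R^-1) => w h1 /ler_normlP[]; lra.
apply: (@fc_lim f a (nrm a) _ (fun n => n.+1%:R^-1 + n.+1%:R^-1)) => //.
  move=> n t tK; rewrite hornerD hornerC addrAC; apply: le_trans (ler_normD _ _) _.
  by rewrite lerD ?hP // ger0_norm.
by rewrite -[X in _ --> X]addr0; apply: cvgD; exact: cvg_invS.
Qed.

Lemma fc_nrm f a c : contp f -> posop a -> 0 <= c -> (forall t : R, 0 <= t <= nrm a -> `|f t| <= c) ->
  nrm (fc f a) <= c.
Proof.
move=> cf pa c0 hf; rewrite -[fc f a]opprK nrmN -[- fc f a]add0r -(pev0 a).
apply: fc_near => // t tK; rewrite horner0 sub0r normrN; exact: hf.
Qed.

Lemma fc_intertwine x a b f : contp f -> posop a -> posop b -> x * a = b * x ->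
  x * fc f a = fc f b * x.
Proof.
move=> cf pa pb xab; pose K := Num.max (nrm a) (nrm b).
have [P hP] := weierstrass_seq K cf.
have h1 := fc_lim cf pa (ltac:(by rewrite le_max lexx) : nrm a <= K) hP cvg_invS.
have h2 := fc_lim cf pb (ltac:(by rewrite le_max lexx orbT) : nrm b <= K) hP cvg_invS.
apply: olim_unique (olimM h2 (olim_cst x)).
have := olimM (olim_cst x) h1.
by rewrite (_ : (fun n => _) = (fun n => pev (P n) b * x)) //; apply/funext => n; exact: pev_intertwine.
Qed.

Lemma fc_swap x f : contp f -> x * fc f (star x * x) = fc f (x * star x) * x.
Proof.
move=> cf; apply: fc_intertwine => //; [exact: posop_star|exact: posop_starr|].
by rewrite mulrA.
Qed.

Lemma fc_comm_id f a : contp f -> posop a -> a * fc f a = fc f a * a.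
Proof. by move=> cf pa; apply: fc_intertwine. Qed.

Lemma pev_fc P f a : contp f -> posop a -> pev P (fc f a) = fc (fun t => P.[f t]) a.
Proof.
move=> cf pa.
have cP Q : contp (fun t => Q.[f t]) by exact: contp_poly.
elim/poly_ind: P => [|P c IH].
  rewrite pev0 (fc_ext (g := fun=> 0)) ?fc_cst ?rs0 //.
  by move=> t _; rewrite horner0.
rewrite pevD pevM pevX IH pevC -fcM // -(fc_cst _ pa) -fcD //; last exact: contp_cst.
  apply: fc_ext => //; first by apply: contpD; [exact: contpM|exact: contp_cst].
  by move=> t _; rewrite !hornerE.
exact: contpM.
Qed.

Lemma fc_comp f g a : contp f -> contp g -> posop a -> (forall t, 0 <= t -> 0 <= f t) ->
  fc g (fc f a) = fc (fun t => g (f t)) a.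
Proof.
move=> cf cg pa f0.
have pf : posop (fc f a) by apply: fc_pos => // t /andP[t0 _]; exact: f0.
have [B B0 hB] := contp_bounded (nrm a) cf.
pose K := Num.max B (nrm (fc f a)).
have [Q hQ] := weierstrass_seq K cg.
have h := fc_lim cg pf (ltac:(by rewrite le_max lexx orbT) : nrm (fc f a) <= K) hQ cvg_invS.
apply: (olim_unique h); apply: (olim_le _ cvg_invS) => n.
have cQ : contp (fun t => (Q n).[f t]) by exact: contp_poly.
have cgf : contp (fun t => g (f t)) by exact: contp_comp.
rewrite pev_fc // -fcB //; apply: fc_nrm => //; first exact: contpB.
move=> t tK; apply: hQ; case/andP: (tK) => t0 _; rewrite f0 //= le_max.
by have := hB t tK => /(le_trans (ler_norm _)) ->.
Qed.

Lemma bfunB a b : bfun (a - b) = (bfun a : op R I) - (bfun b : op R I).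
Proof. by apply/funext => xi; rewrite bopDE. Qed.

Lemma funcalcE f a : contp f -> posop a -> funcalc f a = fc f a :> op R I.
Proof.
move=> cf pa; rewrite /funcalc; apply: xget_unique.
  split; first exact: bopP.
  move=> e /(fcP cf pa)[P [h1 h2]]; exists P; split; first exact: h1.
  by rewrite op_polyE -bfunB; exact: h2.
move=> y [yb hy]; rewrite -[y]/(bfun (toBop yb)); congr bfun.
apply/eqP; rewrite -subr_eq0; apply/eqP/nrm_eq0.
apply/ler_addgt0Pr => e e0; rewrite add0r.
have e2 : 0 < e / 2 by rewrite divr_gt0.
have [P [h1 h2]] := hy (e / 2) e2.
have h3 := fc_near cf pa (ltW e2) h1.
rewrite op_polyE -[y]/(bfun (toBop yb)) -bfunB in h2.
rewrite -(subrKA (pev P a)); apply: le_trans (nrmD _ _) _; rewrite (nrm_distC (toBop yb)).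
by rewrite [leRHS]splitr; apply: lerD.
Qed.

Lemma abs_powE (p : R) x : 0 < p -> abs_pow p x = fc (fun t => t `^ (p / 2)) (star x * x) :> op R I.
Proof.
move=> p0; rewrite /abs_pow adj_bop -funcalcE //; last exact: posop_star.
by apply: contp_powR; rewrite divr_gt0.
Qed.

End FunctionalCalculus.

#[global] Opaque star bmul bone fc nrm ip nsq l2norm rs.

(** * Two-variable positivity *)

Section TwoVariable.
Context {R : realType} {I : choiceType}.
Implicit Types (A B x y : bop R I) (K c e : R) (f g : R -> R).

Definition wpoly K f : nat -> {poly R} := xget (fun=> 0) [set P : nat -> {poly R} |
  forall n (t : R), 0 <= t <= K -> `|(P n).[t] - f t| <= n.+1%:R^-1].

Lemma wpolyP K f : contp f -> forall n (t : R), 0 <= t <= K -> `|(wpoly K f n).[t] - f t| <= n.+1%:R^-1.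
Proof. by move=> cf; have [P hP] := weierstrass_seq K cf; rewrite /wpoly; case: xgetP => [Q _ //|/(_ P)]. Qed.

Lemma wpoly_olim K f A : contp f -> posop A -> nrm A <= K -> olim (fun n => pev (wpoly K f n) A) (fc f A).
Proof. by move=> cf pA AK; apply: (fc_lim cf pA AK (wpolyP cf) cvg_invS). Qed.

Lemma wpoly_approx2 K (s : seq ((R -> R) * (R -> R))) :
  (forall h, h \in (s : seq ((R -> R) * (R -> R))) -> contp h.1 /\ contp h.2) ->
  exists2 C : R, 0 <= C & forall n (u v : R), 0 <= u <= K -> 0 <= v <= K ->
  `|\sum_(h <- s) (wpoly K h.1 n).[u] * (wpoly K h.2 n).[v] - \sum_(h <- s) h.1 u * h.2 v|
    <= C * n.+1%:R^-1.
Proof.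
elim: s => [|[f g] s IH] hs.
  by exists 0 => // n u v _ _; rewrite !big_nil subrr normr0 mul0r.
have [C C0 hC] := IH (fun h hin => hs h (ltac:(by rewrite inE hin orbT))).
have [/= cf cg] := hs (f, g) (mem_head _ _).
have [Bf Bf0 hf] := contp_bounded K cf; have [Bg Bg0 hg] := contp_bounded K cg.
exists (C + (1 + Bf + Bg)); first by rewrite !addr_ge0.
move=> n u v uK vK; rewrite !big_cons /=.
have h1 := wpolyP cf n uK; have h2 := wpolyP cg n vK.
have h3 := hf u uK; have h4 := hg v vK; have h5 := hC n u v uK vK.
have w1 : (n.+1%:R^-1 : R) <= 1 by rewrite invf_le1 // ler1n.
have w0 : 0 <= (n.+1%:R^-1 : R) by [].
move: w0 w1 h1 h2 h3 h4 h5; move: (n.+1%:R^-1) => w.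
set a := (wpoly K f n).[u]; set b := (wpoly K g n).[v].
set S1 := \sum_(_ <- _) _; set S2 := \sum_(_ <- _) _; move: a b S1 S2 (f u) (g v).
clear -Bf0 Bg0 C0 => a b S1 S2 p q w0 w1 h1 h2 h3 h4 h5.
have -> : a * b + S1 - (p * q + S2) = (S1 - S2) + ((a - p) * (b - q) + (a - p) * q + p * (b - q)) by ring.
apply: le_trans (ler_normD _ _) _.
apply: le_trans (lerD h5 (le_trans (ler_normD _ _) (lerD (ler_normD _ _) (lexx _)))) _.
rewrite !normrM.
have k1 : `|a - p| * `|b - q| <= w * 1 by apply: ler_pM => //; apply: le_trans h2 w1.
have k2 : `|a - p| * `|q| <= w * Bg by apply: ler_pM.
have k3 : `|p| * `|b - q| <= Bf * w by apply: ler_pM.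
lra.
Qed.

(* Two commuting positive operators or a trace give functionals omega for
   which the hypothesis on omega holds. *)
Lemma two_variable_positivity (omega : bop R I -> R) (M : R) A B K
    (s : seq ((R -> R) * (R -> R))) :
  0 < K -> posop A -> posop B -> nrm A <= K -> nrm B <= K ->
  (forall x y, omega (x + y) = omega x + omega y) ->
  (forall c x, omega (rs c x) = c * omega x) ->
  (forall x, `|omega x| <= M * nrm x) ->
  (forall f g, contp f -> contp g -> (forall t : R, 0 <= t <= K -> 0 <= g t) ->
     0 <= omega (fc f A * fc f A * fc g B)) ->
  (forall h, h \in (s : seq ((R -> R) * (R -> R))) -> contp h.1 /\ contp h.2) ->
  (forall u v : R, 0 <= u <= K -> 0 <= v <= K -> 0 <= \sum_(h <- s) h.1 u * h.2 v) ->
  0 <= omega (\sum_(h <- s) fc h.1 A * fc h.2 B).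
Proof.
move=> K0 pA pB AK BK oD oZ oM opos cs hs.
have o0 : omega 0 = 0 by have := oZ 0 0; rewrite rs0r mul0r.
have oN x : omega (- x) = - omega x.
  by apply/eqP; rewrite -addr_eq0 -oD addNr o0.
have osum (J : Type) (r : seq J) (F : J -> bop R I) : omega (\sum_(j <- r) F j) = \sum_(j <- r) omega (F j).
  by elim/big_ind2: _ => // x1 x2 y1 y2 <- <-.
have olim_omega u y : olim u y -> omega (u n) @[n --> \oo] --> omega y.
  move=> uy; apply/subr_cvg0; apply: (@lim_sq0 _ _ (fun n => M * nrm (u n - y))) => [n|].
    by apply: le_trans (oM _); rewrite oD oN.
  by rewrite -[X in _ --> X](mulr0 M); apply: cvgM => //; exact: cvg_cst.
pose Phi (P Q : {poly R}) := omega (pev P (rs K^-1 A) * pev Q (rs K^-1 B)).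
have bernE n k (X : bop R I) : posop X -> exists f, [/\ contp f, (forall t : R, 0 <= t <= K -> 0 <= f t) &
    pev (bern n k) (rs K^-1 X) = fc f X].
  move=> pX; exists (fun t => (bern n k \Po (K^-1 *: 'X)).[t]); split.
  - exact: contp_poly contp_id.
  - move=> t /andP[t0 tK]; rewrite horner_comp bern_ge0 // !hornerE.
    by rewrite mulr_ge0 ?invr_ge0 ?(ltW K0) //= mulrC ler_pdivrMr // mul1r.
  - by rewrite fc_poly // pev_scale.
have poly_pos (r : seq ({poly R} * {poly R})) :
    (forall u v : R, 0 <= u <= K -> 0 <= v <= K -> 0 <= \sum_(w <- r) w.1.[u] * w.2.[v]) ->
    0 <= \sum_(w <- r) omega (pev w.1 A * pev w.2 B).
  move=> hr; pose sc (P : {poly R}) := P \Po (K *: 'X).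
  have scE P (X : bop R I) : pev (sc P) (rs K^-1 X) = pev P X.
    by rewrite pev_scale rsA divff ?gt_eqF // rs1.
  rewrite (_ : \sum_(w <- r) _ = \sum_(w <- [seq (sc v.1, sc v.2) | v <- r]) Phi w.1 w.2); last first.
    by rewrite big_map; apply: eq_bigr => w _; rewrite /Phi !scE.
  apply: bernstein_positivity2.
  - by move=> P P' Q; rewrite /Phi pevD mulrDl oD.
  - by move=> a P Q; rewrite /Phi pevZ rsMl oZ.
  - by move=> P Q Q'; rewrite /Phi pevD mulrDr oD.
  - by move=> a P Q; rewrite /Phi pevZ rsMr oZ.
  - move=> n k m l; rewrite /Phi; have [f [cf f0 ->]] := bernE n k A pA.
    have [g [cg g0 ->]] := bernE m l B pB.
    (* The hypothesis on [omega] speaks of the square [fc f A * fc f A], hence the square root of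
       the Bernstein polynomial. *)
    rewrite (fc_ext (g := fun t => Num.sqrt (f t) * Num.sqrt (f t)) cf pA).
      by rewrite fcM ?opos //; exact: contp_sqrt.
    move=> t /andP[t0 tA]; rewrite -expr2 sqr_sqrtr // f0 // t0 /=.
    exact: le_trans AK.
  - move=> u v /andP[u0 u1] /andP[v0 v1]; rewrite big_map /=.
    have := hr (K * u) (K * v).
    rewrite !mulr_ge0 ?(ltW K0) //= !ler_piMr ?(ltW K0) // => /(_ isT isT).
    by congr (0 <= _); apply: eq_bigr => w _; rewrite !horner_comp !hornerE.
have [C C0 hC] := wpoly_approx2 K cs.
(* The constant term [C / (n + 1)] outweighs the approximation error, so that the perturbed
   polynomial sum is nonnegative on the whole square. *)
have key n : 0 <= omega (\sum_(h <- s) pev (wpoly K h.1 n) A * pev (wpoly K h.2 n) B) + C * n.+1%:R^-1 * omega 1.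
  have := poly_pos (((C * n.+1%:R^-1)%:P, 1) :: [seq (wpoly K h.1 n, wpoly K h.2 n) | h <- s]).
  rewrite big_cons big_map /= pevC pev1 mulr1 oZ addrC osum; apply.
  move=> u v uK vK; rewrite big_cons big_map /= !hornerC mulr1.
  have := hC n u v uK vK; have := hs u v uK vK.
  move: (C * _) => w; set X := \sum_(_ <- _) _; set Y := \sum_(_ <- _) _.
  by move: X Y; clear => X Y h0 /ler_normlP[]; lra.
have l1 : olim (fun n => \sum_(h <- s) pev (wpoly K h.1 n) A * pev (wpoly K h.2 n) B)
    (\sum_(h <- s) fc h.1 A * fc h.2 B).
  elim: s cs {hs hC key} => [|h s IH] cs.
    rewrite big_nil (_ : (fun n => _) = fun=> 0); first exact: olim_cst.
    by apply/funext => n; rewrite big_nil.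
  rewrite big_cons (_ : (fun n => _) = (fun n => pev (wpoly K h.1 n) A * pev (wpoly K h.2 n) B +
    \sum_(h <- s) pev (wpoly K h.1 n) A * pev (wpoly K h.2 n) B)); last by apply/funext => n; rewrite big_cons.
  have [c1 c2] := cs h (mem_head _ _).
  apply: olimD; first by apply: olimM; exact: wpoly_olim.
  by apply: IH => k ks; apply: cs; rewrite inE ks orbT.
have lk : (fun n => omega (\sum_(h <- s) pev (wpoly K h.1 n) A * pev (wpoly K h.2 n) B) +
    C * n.+1%:R^-1 * omega 1) @ \oo --> omega (\sum_(h <- s) fc h.1 A * fc h.2 B) + C * 0 * omega 1.
  have c0 := cvg_invS; apply: cvgD; first exact: olim_omega.
  apply: (@cvgM _ _ _ _ (fun n : nat => C * n.+1%:R^-1) (fun=> omega 1)); last exact: cvg_cst.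
  by apply: cvgM; [exact: cvg_cst|exact: c0].
rewrite mulr0 mul0r addr0 in lk.
exact: (@lim_le R (fun=> 0) _ 0 _ (cvg_cst (0 : R)) lk key).
Qed.

End TwoVariable.

(** * Traces on corners *)

Lemma addr_dbl {R : realFieldType} (a b : R) : a + a = b + b -> a = b.
Proof. lra. Qed.

Lemma addr_mid {R : realFieldType} (p q a b c d : R) :
  p + d + (c + q) = p + b + (a + q) -> c + d = b + a.
Proof. lra. Qed.

Section StarAlgebra.
Context {R : realType} {I : choiceType}.
Implicit Types (N : set (bop R I)) (x y z : bop R I).

Record cstar_alg N : Prop := CstarAlg {
  calg1 : N 1;
  calgD : forall x y, N x -> N y -> N (x + y);
  calgZ : forall k x, N x -> N (k *: x);
  calgM : forall x y, N x -> N y -> N (x * y);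
  calg_star : forall x, N x -> N (star x);
  calg_lim : forall u y, (forall n, N (u n)) -> olim u y -> N y }.

Variable N : set (bop R I).
Hypothesis hN : cstar_alg N.

Lemma calg_rs c x : N x -> N (rs c x). Proof. by rewrite rsE; exact: (calgZ hN). Qed.

Lemma calg0 : N 0.
Proof. by rewrite -(scale0r (1 : bop R I)); apply: (calgZ hN); exact: (calg1 hN). Qed.
Lemma calgN x : N x -> N (- x).
Proof. by move=> Nx; rewrite -scaleN1r; apply: (calgZ hN). Qed.
Lemma calgB x y : N x -> N y -> N (x - y).
Proof. by move=> Nx Ny; apply: (calgD hN) => //; exact: calgN. Qed.
Lemma calg_sum (J : Type) (s : seq J) (F : J -> bop R I) : (forall j, N (F j)) -> N (\sum_(j <- s) F j).
Proof. by move=> h; elim/big_ind: _ => //; [exact: calg0|exact: (calgD hN)]. Qed.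
Lemma calgX x n : N x -> N (x ^+ n).
Proof. by move=> Nx; elim: n => [|n IH]; rewrite ?expr0 ?exprS; [exact: (calg1 hN)|exact: (calgM hN)]. Qed.
Lemma calg_pev P x : N x -> N (pev P x).
Proof. by move=> Nx; apply: calg_sum => k; apply: (calgZ hN) => //; exact: calgX. Qed.
Lemma calg_fc f x : contp f -> posop x -> N x -> N (fc f x).
Proof.
move=> cf px Nx; apply: (calg_lim hN _ (wpoly_olim cf px (lexx _))) => n; exact: calg_pev.
Qed.
End StarAlgebra.

Section Trace.
Context {R : realType} {I : choiceType}.
Implicit Types (x y z a b : bop R I).

Definition tr (s : seq I) x : R[i] := \sum_(i <- s) ip (delta i) (x (delta i)).
Definition rtr s x : R := complex.Re (tr s x).

Lemma trD s x y : tr s (x + y) = tr s x + tr s y.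
Proof. by rewrite /tr -big_split; apply: eq_bigr => i _; rewrite bopDE ipDr. Qed.
Lemma trZ s k x : tr s (k *: x) = k * tr s x.
Proof. by rewrite /tr mulr_sumr; apply: eq_bigr => i _; rewrite bopZE ipZr. Qed.
Lemma tr_star s x : tr s (star x) = (tr s x)^*%C.
Proof.
rewrite /tr (big_morph _ cjD cj0); apply: eq_bigr => i _.
by rewrite ip_star ipC.
Qed.
Lemma trN s x : tr s (- x) = - tr s x.
Proof. by rewrite -scaleN1r trZ mulN1r. Qed.
Lemma rtrD s x y : rtr s (x + y) = rtr s x + rtr s y.
Proof. by rewrite /rtr trD ReD. Qed.
Lemma rtrN s x : rtr s (- x) = - rtr s x.
Proof. by rewrite /rtr trN ReN. Qed.
Lemma rtrB s x y : rtr s (x - y) = rtr s x - rtr s y.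
Proof. by rewrite rtrD rtrN. Qed.
Lemma rtrZ s (c : R) x : rtr s (rs c x) = c * rtr s x.
Proof. by rewrite /rtr rsE trZ Re_realM. Qed.
Lemma rtrE s x : rtr s x = \sum_(i <- s) complex.Re (ip (delta i) (x (delta i))).
Proof. by rewrite /rtr /tr (big_morph _ (@ReD R) (erefl : complex.Re (0 : R[i]) = 0)). Qed.
Lemma rtr_le s x : `|rtr s x| <= (size s)%:R * nrm x.
Proof.
rewrite rtrE; apply: le_trans (ler_norm_sum _ _ _) _.
rewrite -sum1_size natr_sum mulr_suml; apply: ler_sum => i _; rewrite mul1r.
apply: le_trans (abs_Re_ip_le _ _) _; apply: le_trans (ler_wpM2l (l2norm_ge0 _) (l2norm_bop _ _)) _.
by rewrite l2normE nsq_delta sqrtr1 mul1r mulr1.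
Qed.
Lemma rtr_pos s x : posop x -> 0 <= rtr s x.
Proof. by move=> [_ px]; rewrite rtrE; apply: sumr_ge0. Qed.
Lemma rtr_olim s (u : nat -> bop R I) y : olim u y -> rtr s (u n) @[n --> \oo] --> rtr s y.
Proof.
move=> uy; apply/subr_cvg0; apply: (@lim_sq0 _ _ (fun n => (size s)%:R * nrm (u n - y))) => [n|].
  by apply: le_trans (rtr_le _ _); rewrite rtrB.
by rewrite -[X in _ --> X](mulr0 (size s)%:R); apply: cvgM => //; exact: cvg_cst.
Qed.
Lemma rtr_nsq s x : rtr s (star x * x) = \sum_(i <- s) nsq (x (delta i)).
Proof. by rewrite rtrE; apply: eq_bigr => i _; rewrite bopM ip_star -nsqE. Qed.

Lemma tr_cauchy s x y : sqmod (tr s (star x * y)) <= rtr s (star x * x) * rtr s (star y * y).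
Proof.
pose w := tr s (star x * y).
have key (t : R) : 0 <= rtr s (star y * y) - 2 * t * sqmod w + t ^+ 2 * sqmod w * rtr s (star x * x).
  have := rtr_pos s (posop_star (y - (t%:C%C * w) *: x)); congr (_ <= _).
  rewrite starB starZ !(mulrBl, mulrBr) !(bscaleAl, bscaleAr) scalerA.
  rewrite !(rtrB, rtrD, rtrN) /rtr !trZ -/w.
  have -> : tr s (star y * x) = w^*%C by rewrite /w -tr_star starM starK.
  have : complex.Im (tr s (star x * x)) = 0.
    have := tr_star s (star x * x); rewrite starM starK => e.
    have := congr1 (@complex.Im R) e; rewrite ImJ; lra.
  case: (tr s (star x * x)) (tr s (star y * y)) w => [x1 x2] [y1 y2] [w1 w2] /= ->.
  by rewrite /sqmod /=; ring.
have X0 := rtr_pos s (posop_star x).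
move: key X0; rewrite -/w; move: (rtr s (star y * y)) (rtr s (star x * x)) (sqmod w) (sqmod_ge0 w).
clear => Y X W W0 key X0.
have [x0|xN0] := eqVneq X 0.
  rewrite x0 mul0r leNgt; apply/negP => w0.
  have := key ((Y + 1) / (2 * W)); rewrite x0 mulr0 addr0.
  by rewrite (_ : 2 * _ * _ = Y + 1); [lra|field; lra].
have xp : 0 < X by rewrite lt_neqAle eq_sym xN0.
have := key X^-1; rewrite (_ : _ + _ = Y - W / X); last by field; lra.
by rewrite subr_ge0 ler_pdivrMr // mulrC.
Qed.

(* [e] is a projection of finite trace: the basis vectors indexed by D lie
   either in its range (these are listed by s) or in its kernel. *)
Record corner (N : set (bop R I)) (D : set I) (e : bop R I) (s : seq I) : Prop := Corner {
  cornerN : N e;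
  corner_star : star e = e;
  corner_id : e * e = e;
  corner_uniq : uniq s;
  corner_in : forall i, i \in s -> D i /\ e (delta i) = delta i;
  corner_out : forall i, D i -> i \notin s -> e (delta i) = 0 }.

(** The identity [Tr (x^* x) = Tr (x x^* )] for the diagonal sum over [D]; it makes sense for
    infinite values too. *)
Definition tracial_on (N : set (bop R I)) (D : set I) := forall x, N x ->
  (\esum_(i in D) (nsq (x (delta i)))%:E = \esum_(i in D) (nsq (star x (delta i)))%:E)%E.

Variables (N : set (bop R I)) (D : set I) (e : bop R I) (s : seq I).
Hypotheses (hN : cstar_alg N) (hD : tracial_on N D) (he : corner N D e s).

Lemma esum_corner (F : I -> R) : (forall i, 0 <= F i) -> (forall i, D i -> i \notin s -> F i = 0) ->
  (\esum_(i in D) (F i)%:E = (\sum_(i <- s) F i)%:E)%E.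
Proof.
move=> F0 Fz; rewrite -sumEFin fsbig_seq ?(corner_uniq he) //.
rewrite -esum_fset //; last by move=> i _; rewrite lee_fin.
rewrite esum_mkcond [RHS]esum_mkcond; apply: eq_esum => i _.
case: (pselect (D i)) => Di; case: (boolP (i \in s)) => si.
- by rewrite !mem_set.
- by rewrite mem_set // memNset ?Fz // => /= h; rewrite h in si.
- by have [] := corner_in he si.
- by rewrite !memNset // => /= h; rewrite h in si.
Qed.

Lemma tr_e x : tr s (e * x) = tr s x.
Proof.
apply: eq_big_seq => i si; have [_ ei] := corner_in he si.
by rewrite bopM -{1}ei -ip_star (corner_star he) -bopM (corner_id he) -{1}(corner_star he) ip_star ei.
Qed.
Lemma tr_er x : tr s (x * e) = tr s x.
Proof. by apply: eq_big_seq => i si; have [_ ei] := corner_in he si; rewrite bopM ei. Qed.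

(** Traciality of [N] applied to the compression [e z e], for which both diagonal sums reduce to the
    finite list [s]. *)
Lemma tr_nsq_e z : N z -> rtr s (star z * e * z) = rtr s (z * e * star z).
Proof.
move=> Nz; pose w := e * z * e.
have Nw : N w by apply: (calgM hN); [apply: (calgM hN)|]; rewrite //; exact: cornerN he.
have sw : star w = e * star z * e by rewrite !starM (corner_star he) mulrA.
have := hD Nw; rewrite !esum_corner; last first.
- by move=> i Di si; rewrite bopM (corner_out he) // bop0 nsq0.
- by move=> i; exact: nsq_ge0.
- by move=> i Di si; rewrite sw bopM (corner_out he) // bop0 nsq0.
- by move=> i; exact: nsq_ge0.
move=> [h].
have ee := corner_id he; have se := corner_star he.
have E1 x : rtr s (star (e * x * e) * (e * x * e)) = rtr s (star x * e * x).
  rewrite !starM se /rtr -!mulrA tr_e !mulrA tr_er -!mulrA.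
  by rewrite (mulrA e e) ee.
have h1 := E1 z; rewrite rtr_nsq in h1.
have h2 := E1 (star z); rewrite rtr_nsq starK in h2.
by rewrite -h1 -h2 -/w -sw.
Qed.

(** Polarisation of [tr_nsq_e]: the sum of two elements gives the real parts, and multiplying one of
    them by i gives the imaginary parts. *)
Lemma tr_cyc x y : N x -> N y -> tr s (x * e * y) = tr s (y * e * x).
Proof.
suff H y0 z : N y0 -> N z -> tr s (star y0 * e * z) = tr s (z * e * star y0).
  by move=> Nx Ny; rewrite -(starK x); apply: H => //; exact: (calg_star hN).
move=> Ny Nz.
have R1 a b : N a -> N b -> rtr s (star a * e * b) + rtr s (star b * e * a) =
    rtr s (b * e * star a) + rtr s (a * e * star b).
  move=> Na Nb; have := tr_nsq_e (calgD hN Na Nb).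
  rewrite starD !(mulrDl, mulrDr) !rtrD (tr_nsq_e Na) (tr_nsq_e Nb).
  set p := rtr s (a * e * star a); set q := rtr s (b * e * star b).
  exact: addr_mid.
have S a b : rtr s (star b * e * a) = rtr s (star a * e * b).
  by rewrite -[LHS]ReJ -tr_star !starM starK (corner_star he) mulrA.
have S2 a b : rtr s (a * e * star b) = rtr s (b * e * star a).
  by rewrite -[LHS]ReJ -tr_star !starM starK (corner_star he) mulrA.
have RE a b : N a -> N b -> rtr s (star a * e * b) = rtr s (b * e * star a).
  move=> Na Nb; have := R1 a b Na Nb; rewrite (S a b) (S2 a b).
  exact: addr_dbl.
apply: complex_ext; first exact: RE.
have := RE y0 ('i%C *: z) Ny (calgZ hN _ Nz).
rewrite bscaleAr !bscaleAl /rtr !trZ.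
by case: (tr s _) (tr s _) => [a b] [c d] /=; rewrite !mul0r !mul1r !sub0r => /oppr_inj.
Qed.

Definition comm_e x := x * e = e * x.

(** The truncated trace keeps a projection [e] between the factors; a factor commuting with [e] lets
    it be moved to the outside, where it is invisible. This is why [comm_e] recurs below. *)
Lemma tr_comm x y : N x -> N y -> comm_e x -> tr s (x * y) = tr s (y * x).
Proof.
move=> Nx Ny xe; rewrite -(tr_e (x * y)) mulrA -xe tr_cyc //.
by rewrite -mulrA -xe mulrA tr_er.
Qed.

Lemma comm_fc f A : contp f -> posop A -> comm_e A -> comm_e (fc f A).
Proof. by move=> cf pA h; rewrite /comm_e [RHS](fc_intertwine cf pA pA) // h. Qed.

Lemma rtr_pos2 f A B : contp f -> posop A -> N A -> comm_e A -> posop B -> N B ->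
  0 <= rtr s (fc f A * fc f A * B).
Proof.
move=> cf pA NA Ae pB NB; have Nf := calg_fc hN cf pA NA.
rewrite -mulrA /rtr tr_comm //; [|exact: (calgM hN)|exact: comm_fc].
have := posop_conj (fc f A) pB; rewrite fc_star // => h.
by have := rtr_pos s h.
Qed.

(** The trace of [f(A) g(B)] behaves like the integral of [f(u) g(v)] against a positive measure,
    even if [A] and [B] do not commute: the trace of [f(A)^2 g(B)] is that of the positive operator
    [f(A) g(B) f(A)]. *)
Lemma rtr_two_variable A B (r : seq ((R -> R) * (R -> R))) :
  posop A -> N A -> comm_e A -> posop B -> N B ->
  (forall h, h \in (r : seq ((R -> R) * (R -> R))) -> contp h.1 /\ contp h.2) ->
  (forall u v : R, 0 <= u -> 0 <= v -> 0 <= \sum_(h <- r) h.1 u * h.2 v) ->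
  0 <= \sum_(h <- r) rtr s (fc h.1 A * fc h.2 B).
Proof.
move=> pA NA Ae pB NB cr hr.
pose K := Num.max 1 (Num.max (nrm A) (nrm B)).
have := @two_variable_positivity R I (rtr s) (size s)%:R A B K r.
rewrite (big_morph _ (rtrD s) (_ : rtr s 0 = 0)); last first.
  by have := rtrZ s 0 0; rewrite rs0r mul0r.
apply=> //.
- by rewrite lt_max ltr01.
- by rewrite !le_max lexx !orbT.
- by rewrite !le_max lexx !orbT.
- exact: rtrD.
- exact: rtrZ.
- exact: rtr_le.
- move=> f g cf cg g0; apply: rtr_pos2 => //; last exact: (calg_fc hN).
  apply: fc_pos => // t /andP[t0 tB]; apply: g0; rewrite t0 /=.
  by apply: le_trans tB _; rewrite !le_max lexx !orbT.
- by move=> u v /andP[u0 _] /andP[v0 _]; exact: hr.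
Qed.

End Trace.

(** * Trace inequalities *)

Lemma trE {R : realType} {I : choiceType} (s : seq I) (x : bop R I) :
  tr s x = \sum_(i <- s) ip (delta i) (x (delta i)).
Proof. by []. Qed.
Lemma rtr_tr {R : realType} {I : choiceType} (s : seq I) (x : bop R I) : rtr s x = complex.Re (tr s x).
Proof. by []. Qed.

#[global] Opaque powR rtr tr.

Lemma addZ_sub_ge0 {R : realFieldType} (a b x y z : R) : 0 <= a * x + b * y - z -> z <= x * a + y * b.
Proof. by rewrite subr_ge0 (mulrC a) (mulrC b). Qed.

(** Scaling by [c^-1] brings a quantity of degree [q] below 1; the margin [h] avoids dividing by
    zero when [X = 0] and is sent to 0 afterwards. *)
Lemma powR_normalise {R : realType} (q X h : R) : 0 < q -> 0 <= X -> 0 < h ->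
  exists c : R, [/\ c = (X + h) `^ q^-1, 0 < c, 0 <= c^-1 & c^-1 `^ q * X <= 1].
Proof.
move=> q0 X0 h0; set al := (_ + _) `^ _; have al0 : 0 < al by rewrite powR_gt0 // ltr_wpDl.
exists al; split=> //; first by rewrite invr_ge0 ltW.
rewrite -powR_inv1 ?(ltW al0) // -powRrM mulN1r powRN /al -powRrM mulVf ?gt_eqF //.
by rewrite powRr1 ?addr_ge0 ?(ltW h0) // mulrC ler_pdivrMr ?ltr_wpDl // mul1r lerDl ltW.
Qed.

Section Hoelder.
Context {R : realType} {I : choiceType}.
Implicit Types (x y z a b w : bop R I) (f g : R -> R) (p q r : R).

Lemma contp_max f g : contp f -> contp g -> contp (fun t => Num.max (f t) (g t)).
Proof.
move=> cf cg t; apply: (@continuous_max _ _ (fun t : R => f `|t|) (fun t : R => g `|t|)).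
  exact: cf.
exact: cg.
Qed.

Lemma powR_cvg_seq r (u : nat -> R) (l : R) : 0 < r -> (forall n, 0 <= u n) -> 0 <= l ->
  u @ \oo --> l -> u n `^ r @[n --> \oo] --> l `^ r.
Proof.
move=> r0 u0 l0 ul; rewrite (_ : (fun n => _) = (fun t => `|t| `^ r) \o u).
  by rewrite -(ger0_norm l0); apply: continuous_cvg => //; exact: contp_powR.
by apply/funext => n /=; rewrite ger0_norm.
Qed.

Lemma fc_scale f (c : R) x : contp f -> posop x -> 0 <= c ->
  fc f (rs c x) = fc (fun t => f (c * t)) x.
Proof.
move=> cf px c0; have ci := @contp_id R.
have -> : rs c x = fc (fun t => c * t) x by rewrite (fcZ c ci px) (fc_id px).
by apply: fc_comp => //; [exact: contpZ|move=> t t0; rewrite mulr_ge0].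
Qed.

Lemma fc_le_pos f g x : contp f -> contp g -> posop x -> (forall t, 0 <= t <= nrm x -> f t <= g t) ->
  posop (fc g x - fc f x).
Proof.
move=> cf cg px fg; rewrite -(fcB cg cf px); apply: (fc_pos (contpB cg cf) px) => t tx.
by rewrite subr_ge0 fg.
Qed.

Definition dg x i : R := complex.Re (ip (delta i) (x (delta i))).

Lemma dg_pos x i : posop x -> 0 <= dg x i. Proof. by move=> [_]; apply. Qed.
Lemma dgB x y i : dg (x - y) i = dg x i - dg y i.
Proof. by rewrite /dg bopDE bopNE ipBr ReD ReN. Qed.
Lemma dg_le x y i : posop (y - x) -> dg x i <= dg y i.
Proof. by move=> /dg_pos -/(_ i); rewrite dgB subr_ge0. Qed.
Lemma dg_star x i : dg (star x * x) i = nsq (x (delta i)).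
Proof. by rewrite /dg bopM ip_star -nsqE. Qed.
Lemma dg_olim u y i : olim u y -> dg (u n) i @[n --> \oo] --> dg y i.
Proof. exact: olim_ip. Qed.
Lemma dg_sum_olim (s : seq I) u y : olim u y ->
  \sum_(i <- s) dg (u n) i @[n --> \oo] --> \sum_(i <- s) dg y i.
Proof.
move=> uy; elim: s => [|i s IH].
  by rewrite big_nil (_ : (fun n => _) = fun=> 0); [exact: cvg_cst|apply/funext => n; rewrite big_nil].
rewrite big_cons (_ : (fun n => _) = (fun n => dg (u n) i + \sum_(j <- s) dg (u n) j)).
  by apply: cvgD => //; exact: dg_olim.
by apply/funext => n; rewrite big_cons.
Qed.

Definition dsum (D : set I) x : \bar R := (\esum_(i in D) (dg x i)%:E)%E.

Lemma dsum_ge0 D x : posop x -> (0 <= dsum D x)%E.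
Proof. by move=> px; apply: esum_ge0 => i _; rewrite lee_fin dg_pos. Qed.

Lemma sum_dg_le_dsum (D : set I) x (s : seq I) : uniq s -> (forall i, i \in s -> D i) ->
  ((\sum_(i <- s) dg x i)%:E <= dsum D x)%E.
Proof.
move=> us sD; apply: esum_ge; exists [set` s]; first by split.
by rewrite -fsbig_seq // sumEFin.
Qed.

Lemma dsum_le (D : set I) x (M : \bar R) :
  (forall s : seq I, uniq s -> (forall i, i \in s -> D i) -> ((\sum_(i <- s) dg x i)%:E <= M)%E) ->
  (dsum D x <= M)%E.
Proof.
move=> h; rewrite ge_ereal_sup => //= _ [X [finX XD]] <-.
rewrite fsbig_finite //= sumEFin; apply: h; first exact: finmap.fset_uniq.
by move=> i; rewrite in_fset_set // inE; exact: XD.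
Qed.

Variables (N : set (bop R I)) (D : set I).
Hypotheses (hN : cstar_alg N) (hD : tracial_on N D).

Notation pw r := (fun t : R => (t `^ r)%R).

(* f(x^* x) and f(x x^* ) have the same trace: if f(t) = t k(t)^2 then they
   are y^* y and y y^* for y = x k(x^* x); cutting t^r off below eta makes k
   continuous at 0. *)
Lemma dsum_powR_star r x : 0 < r -> N x ->
  dsum D (fc (pw r) (star x * x)) = dsum D (fc (pw r) (x * star x)).
Proof.
move=> r0 Nx; suff H z : N z -> (dsum D (fc (pw r) (z * star z)%R) <= dsum D (fc (pw r) (star z * z)%R))%E.
  have h2 := H _ (calg_star hN Nx); rewrite starK in h2.
  exact: le_anti (introT andP (conj h2 (H _ Nx))).
move=> {x Nx} Nx; set x := z; have cr := contp_powR r0.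
have pl := posop_star x; have pr := posop_starr x.
pose f (n : nat) (t : R) := Num.max (t `^ r - n.+1%:R^-1) 0.
have cf n : contp (f n) by apply: contp_max; [apply: contpB => //|]; exact: contp_cst.
have f0 n t : 0 <= f n t by rewrite le_max lexx orbT.
have fle n t : 0 <= t -> f n t <= t `^ r.
  by move=> t0; rewrite ge_max powR_ge0 andbT gerBl.
have fl (X : bop R I) : posop X -> olim (fun n => fc (f n) X) (fc (pw r) X).
  move=> pX; apply: (olim_le _ cvg_invS) => n; rewrite -fcB //.
  apply: fc_nrm => //; first exact: contpB.
  move=> t _; rewrite /f; set c := _ `^ _; have c0 : 0 <= c := powR_ge0 _ _.
  have w0 : 0 <= (n.+1%:R^-1 : R) by [].
  by move: w0; move: (n.+1%:R^-1) => w w0; rewrite ler_norml; case: (leP (c - w) 0) => h; apply/andP; split; lra.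
have key n : (dsum D (fc (f n) (x * star x)%R) <= dsum D (fc (pw r) (star x * x)%R))%E.
  pose d : R := n.+1%:R^-1 `^ r^-1; have d0 : 0 < d by rewrite powR_gt0 // invr_gt0.
  pose k t := Num.sqrt (f n t * (Num.max t d)^-1).
  have ck : contp k.
    apply: contp_sqrt; apply: contpM => //; apply: contp_inv.
      by apply: contp_max; [exact: contp_id|exact: contp_cst].
    by move=> t _; rewrite lt_max d0 orbT.
  have kE t : 0 <= t -> t * (k t * k t) = f n t.
    move=> t0; rewrite -expr2 sqr_sqrtr; last by rewrite mulr_ge0 // invr_ge0 le_max t0.
    have [dt|td] := leP d t; first by rewrite mulrCA mulfV ?mulr1 // gt_eqF // (lt_le_trans d0).
    rewrite (_ : f n t = 0) ?mul0r ?mulr0 //; rewrite /f max_r // subr_le0.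
    have dE : d `^ r = n.+1%:R^-1 by rewrite /d -powRrM mulVf ?lt0r_neq0 // powRr1.
    by rewrite -dE; apply: ge0_ler_powR; rewrite ?nnegrE ?(ltW r0) ?(ltW td) ?(ltW d0).
  pose y := x * fc k (star x * x).
  have Ny : N y.
    apply: (calgM hN) => //; apply: (calg_fc hN) => //.
    by apply: (calgM hN) => //; exact: (calg_star hN).
  have ckk : contp (fun t => k t * k t) by exact: contpM.
  have ci := @contp_id R.
  have y1 : star y * y = fc (f n) (star x * x).
    rewrite /y starM (fc_star ck pl) mulrA -(mulrA (fc k _) (star x)) -(fc_comm_id ck pl).
    rewrite -mulrA -(fcM ck ck pl) -{1}(fc_id pl) -(fcM ci ckk pl).
    apply: (fc_ext (contpM ci ckk) pl) => t /andP[t0 _]; exact: kE.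
  have y2 : y * star y = fc (f n) (x * star x).
    rewrite /y starM (fc_star ck pl) mulrA -(mulrA x) -(fcM ck ck pl) (fc_swap x ckk) -mulrA.
    rewrite -[X in _ * X](fc_id pr) -(fcM ckk ci pr).
    by apply: (fc_ext (contpM ckk ci) pr) => t /andP[t0 _]; rewrite mulrC kE.
  rewrite -y2 (_ : dsum D _ = dsum D (star y * y)).
    rewrite y1; apply: le_esum => i _; rewrite lee_fin; apply: dg_le.
    by apply: fc_le_pos => // t /andP[t0 _]; exact: fle.
  rewrite /dsum; have := hD (calg_star hN Ny); rewrite starK => h.
  under eq_esum => i _ do rewrite -{1}(starK y) dg_star.
  by rewrite h; apply: eq_esum => i _; rewrite dg_star.
apply: dsum_le => s us sD; have lim := dg_sum_olim (s := s) (fl _ pr).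
have h n : ((\sum_(i <- s) dg (fc (f n) (x * star x)%R) i)%:E <= dsum D (fc (pw r) (star x * x)%R))%E.
  by apply: le_trans (key n); exact: sum_dg_le_dsum.
have := dsum_ge0 D (fc_pos cr pl (fun t _ => powR_ge0 t r)).
case: (dsum D (fc _ (star x * x))) h => [M|_ _|_ h0]; first last.
- by have := h0; rewrite leeNy_eq.
- by rewrite leey.
move=> h _; rewrite lee_fin; apply: (lim_le lim (cvg_cst M)) => n.
by have := h n; rewrite lee_fin.
Qed.

Variables (e : bop R I) (s : seq I).
Hypothesis he : corner N D e s.

Notation rt := (rtr s).

Lemma rtr_dg x : rt x = \sum_(i <- s) dg x i. Proof. exact: rtrE. Qed.

Lemma rtr_two_variable3 A B f1 g1 f2 g2 f3 g3 :
  posop A -> N A -> comm_e e A -> posop B -> N B ->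
  contp f1 -> contp g1 -> contp f2 -> contp g2 -> contp f3 -> contp g3 ->
  (forall u v : R, 0 <= u -> 0 <= v -> 0 <= f1 u * g1 v + f2 u * g2 v + f3 u * g3 v) ->
  0 <= rt (fc f1 A * fc g1 B) + rt (fc f2 A * fc g2 B) + rt (fc f3 A * fc g3 B).
Proof.
move=> pA NA Ae pB NB c1 d1 c2 d2 c3 d3 h.
have E (V : zmodType) (F : (R -> R) * (R -> R) -> V) :
    \sum_(k <- [:: (f1, g1); (f2, g2); (f3, g3)]) F k = F (f1, g1) + F (f2, g2) + F (f3, g3).
  by rewrite !big_cons big_nil addr0 addrA.
have := @rtr_two_variable R I N D e s hN hD he A B [:: (f1, g1); (f2, g2); (f3, g3)]
  pA NA Ae pB NB.
rewrite (E _ (fun k => rt (fc k.1 A * fc k.2 B))); apply.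
  by move=> k; rewrite !inE => /or3P[] /eqP ->.
by move=> u v u0 v0; rewrite (E _ (fun k => k.1 u * k.2 v)); exact: h.
Qed.

(** The two-variable principle applied to [u^q / q + v^p / p - u v >= 0]. *)
Lemma rtr_young A B p q : 0 < p -> 0 < q -> p^-1 + q^-1 = 1 ->
  posop A -> N A -> comm_e e A -> posop B -> N B ->
  rt (A * B) <= rt (fc (pw q) A) / q + rt (fc (pw p) B) / p.
Proof.
move=> p0 q0 pq pA NA Ae pB NB.
have c1 := @contp_cst R 1; have ci := @contp_id R.
have cp := contp_powR p0; have cq := contp_powR q0.
have dq : contp (fun t => q^-1 * t `^ q) by exact: contpZ.
have dp : contp (fun t => p^-1 * t `^ p) by exact: contpZ.
have dn : contp (fun t : R => - t) by exact: contpN.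
have := rtr_two_variable3 (f1 := fun t => q^-1 * t `^ q) (g1 := fun=> 1) (f2 := fun=> 1)
  (g2 := fun t => p^-1 * t `^ p) (f3 := fun t => - t) (g3 := fun t => t) pA NA Ae pB NB
  dq c1 c1 dp dn ci.
have -> : rt (fc (fun t => q^-1 * t `^ q) A * fc (fun=> 1) B) = q^-1 * rt (fc (pw q) A).
  by rewrite (fcZ q^-1 cq pA) (fc_cst 1 pB) rs1 mulr1; exact: rtrZ.
have -> : rt (fc (fun=> 1) A * fc (fun t => p^-1 * t `^ p) B) = p^-1 * rt (fc (pw p) B).
  apply: etrans (rtrZ s p^-1 (fc (pw p) B)); congr (rt _).
  rewrite (fc_cst 1 pA) rs1 (fcZ p^-1 cp pB); exact: mul1r.
have -> : rt (fc (fun t => - t) A * fc (fun t => t) B) = - rt (A * B).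
  apply: etrans (rtrN s (A * B)); congr (rt _).
  exact: etrans (congr2 *%R (etrans (fcN ci pA) (congr1 -%R (fc_id pA))) (fc_id pB)) (mulNr _ _).
move=> H.
have {}H : 0 <= q^-1 * rt (fc (pw q) A) + p^-1 * rt (fc (pw p) B) - rt (A * B).
  apply: H => u v u0 v0.
  have := conjugate_powR u0 v0 q0 p0 (etrans (addrC _ _) pq).
  by rewrite (mulrC _ q^-1) (mulrC _ p^-1) mulr1 mul1r mulNr subr_ge0.
exact: addZ_sub_ge0 H.
Qed.

(** [A] and [B] are normalised up to a margin [1 / (n + 1)], so that the right side of Young's
    inequality is at most [1 / q + 1 / p = 1]; then [n] tends to infinity. *)
Lemma rtr_hoelder A B p q : 0 < p -> 0 < q -> p^-1 + q^-1 = 1 ->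
  posop A -> N A -> comm_e e A -> posop B -> N B ->
  rt (A * B) <= rt (fc (pw q) A) `^ q^-1 * rt (fc (pw p) B) `^ p^-1.
Proof.
move=> p0 q0 pq pA NA Ae pB NB.
set X := rt (fc (pw q) A); set Y := rt (fc (pw p) B).
have X0 : 0 <= X by apply/rtr_pos/fc_pos => //; [exact: contp_powR|move=> t _; exact: powR_ge0].
have Y0 : 0 <= Y by apply/rtr_pos/fc_pos => //; [exact: contp_powR|move=> t _; exact: powR_ge0].
have key (n : nat) : rt (A * B) <= (X + n.+1%:R^-1) `^ q^-1 * (Y + n.+1%:R^-1) `^ p^-1.
  have : 0 < (n.+1%:R^-1 : R) by rewrite invr_gt0.
  move: (n.+1%:R^-1) => h h0.
  have [al [<- al0 ia h1]] := powR_normalise q0 X0 h0.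
  have [be [<- be0 ib h2]] := powR_normalise p0 Y0 h0.
  have := @rtr_young (rs al^-1 A) (rs be^-1 B) p q p0 q0 pq
    (posopZ ia pA) (calg_rs hN _ NA) _ (posopZ ib pB) (calg_rs hN _ NB).
  rewrite !fc_scale //; try exact: contp_powR.
  have E c r (x : bop R I) : 0 <= c -> 0 < r -> posop x -> rt (fc (fun t => (c * t) `^ r) x) = c `^ r * rt (fc (pw r) x).
    move=> c0 r0 px; rewrite -rtrZ -fcZ //; last exact: contp_powR.
    congr (rt _); apply: fc_ext => //; last by move=> t /andP[t0 _]; rewrite powRM.
    apply: (@contp_comp R (fun t => c * t) (pw r)); first exact: contp_powR.
      by apply: contpZ; exact: contp_id.
    by move=> t t0; rewrite mulr_ge0.
  rewrite !E // -/X -/Y rsMl rsMr rsA rtrZ => H.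
  rewrite -[leRHS]mulr1 -(ler_pdivrMl _ _ (mulr_gt0 al0 be0)) invfM; apply: le_trans (H _) _.
    by rewrite /comm_e rsMl Ae rsMr.
  rewrite -pq addrC; apply: lerD; rewrite -[leRHS]mul1r; apply: ler_wpM2r => //; by rewrite invr_ge0 ltW.
have lX (Z : R) : 0 <= Z -> (fun n : nat => Z + n.+1%:R^-1) @ \oo --> Z.
  by move=> Z0; rewrite -[X in _ --> X]addr0; apply: cvgD; [exact: cvg_cst|exact: cvg_invS].
apply: (@lim_le R (fun=> rt (A * B)) _ _ _ (cvg_cst _) _ key).
apply: cvgM; apply: powR_cvg_seq; rewrite ?invr_gt0 //; try (by move=> n; rewrite addr_ge0);
  exact: lX.
Qed.

End Hoelder.

(** * Hoelder's inequality for operators that are not positive *)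

Section Split.
Context {R : realType} {I : choiceType}.
Implicit Types (x y z a b w : bop R I) (f : R -> R) (p q r : R).

Notation pw r := (fun t : R => (t `^ r)%R).

Definition apow p x : bop R I := fc (pw (p / 2)) (star x * x).

Lemma apow_pos p x : 0 < p -> posop (apow p x).
Proof.
move=> p0; apply: fc_pos => [||t _]; [by apply: contp_powR; rewrite divr_gt0|exact: posop_star|exact: powR_ge0].
Qed.

Lemma maxR_powR_near (t d r : R) : 0 < r -> 0 <= t -> 0 < d ->
  `|Num.max t d `^ r - t `^ r| <= d `^ r.
Proof.
move=> r0 t0 d0; have [td|dt] := leP t d; last by rewrite subrr normr0 powR_ge0.
have h : t `^ r <= d `^ r by apply: ge0_ler_powR; rewrite ?nnegrE // ltW.
by rewrite ger0_norm ?subr_ge0 // gerBl powR_ge0.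
Qed.

Lemma olim_powR_max r x : 0 < r -> posop x ->
  olim (fun n => fc (fun t => Num.max t n.+1%:R^-1 `^ r) x) (fc (pw r) x).
Proof.
move=> r0 px; have d0 n : 0 < (n.+1%:R^-1 : R) by rewrite invr_gt0.
apply: (olim_le (w := fun n => n.+1%:R^-1 `^ r)) => [n|]; last first.
  rewrite -[X in _ --> X](@powR0 _ r) ?gt_eqF //.
  by apply: powR_cvg_seq => //; exact: cvg_invS.
have cm := @contp_powR_max R _ r (d0 n); have cr := contp_powR r0.
have cmr : contp (fun t => Num.max t n.+1%:R^-1 `^ r - t `^ r) by exact: contpB.
rewrite -(fcB cm cr px); apply: fc_nrm => //.
by move=> t /andP[t0 _]; exact: maxR_powR_near.
Qed.

Variables (N : set (bop R I)) (D : set I).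
Hypotheses (hN : cstar_alg N) (hD : tracial_on N D).

Section Sub.
Variables (e f : bop R I) (s sf : seq I).
Hypotheses (he : corner N D e s) (hf : corner N D f sf) (ef : e * f = f).

Lemma corner_sub i : i \in sf -> i \in s.
Proof.
move=> si; have [Di fi] := corner_in hf si; apply: contraT => ns.
have : delta i = 0 :> ell2 R I by rewrite -[LHS]fi -ef bopM fi (corner_out he).
by move/(congr1 (@nsq R I)); rewrite nsq_delta nsq0 => /eqP; rewrite oner_eq0.
Qed.

Lemma sum_corner_sub (V : nmodType) (F : I -> V) : \sum_(i <- s | i \in sf) F i = \sum_(i <- sf) F i.
Proof.
rewrite -big_filter; apply: perm_big; apply: uniq_perm.
- exact/filter_uniq/(corner_uniq he).
- exact: corner_uniq hf.
by move=> i; rewrite mem_filter; apply: andb_idr; exact: corner_sub.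
Qed.

Lemma tr_subr z : tr s (z * f) = tr sf z.
Proof.
rewrite !trE (bigID (fun i => i \in sf)) /= [X in _ + X]big1_seq ?addr0; last first.
  move=> i /andP[ni si]; have [Di _] := corner_in he si.
  by rewrite bopM (corner_out hf Di ni) bop0 ip0r.
rewrite sum_corner_sub; by apply: eq_big_seq => i si; rewrite bopM (corner_in hf si).2.
Qed.

Lemma tr_subl z : tr s (f * z) = tr sf z.
Proof.
by rewrite -(starK (f * z)) tr_star starM (corner_star hf) tr_subr -tr_star starK.
Qed.

Lemma rtr_sub_le z : posop z -> rtr sf z <= rtr s z.
Proof.
move=> pz; rewrite !rtr_dg [leRHS](bigID (fun i => i \in sf)) /= sum_corner_sub.
by rewrite lerDl sumr_ge0 // => i _; exact: dg_pos.
Qed.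

End Sub.

Section SplitIneq.
Variables (e f g : bop R I) (s sf sg : seq I).
Hypotheses (he : corner N D e s) (hf : corner N D f sf) (hg : corner N D g sg).
Hypotheses (ef : e * f = f) (eg : e * g = g).

Lemma mul_fc_outer (l : R -> R) z : contp l ->
  z * fc l (star z * z) * star (z * fc l (star z * z)) = fc (fun t => t * (l t * l t)) (z * star z).
Proof.
move=> cl; have pz := posop_star z; have pz' := posop_starr z.
have cll : contp (fun t => l t * l t) by exact: contpM.
have ci := @contp_id R.
rewrite starM (fc_star cl pz) mulrA -(mulrA z) -(fcM cl cl pz) (fc_swap z cll) -mulrA.
rewrite -[X in _ * X](fc_id pz') -(fcM cll ci pz').
by apply: (fc_ext (contpM cll ci) pz') => t _; rewrite mulrC.
Qed.

Lemma mul_fc_cancel (k l : R -> R) z : contp k -> contp l -> (forall t, 0 <= t -> l t * k t = 1) ->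
  z * fc l (star z * z) * fc k (star z * z) = z.
Proof.
move=> ck cl lk; have pz := posop_star z; rewrite -mulrA -(fcM cl ck pz) (fc_ext (g := fun=> 1)) //.
- by rewrite (fc_cst 1 pz) rs1 mulr1.
- exact: contpM.
- by move=> t /andP[t0 _]; exact: lk.
Qed.

(** The factorisation [w = (w l(w^* w)) k(w^* w)] distributes [w] over both ends: by cyclicity the
    trace becomes that of [(w2 x1) (x2 w1)], and Cauchy-Schwarz separates [x1] from [x2]. The right
    and left supports [f], [g] of [w] localise the two factors. *)
Lemma split_ineq (k l : R -> R) x1 x2 w : contp k -> contp l -> (forall t, 0 <= t -> l t * k t = 1) ->
  N x1 -> N x2 -> N w -> g * w = w -> w * f = w ->
  sqmod (tr s (x1 * x2 * w)) <=
    rtr sf (fc (fun t => k t * k t) (star w * w) * (x1 * star x1)) *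
    rtr sg (fc (fun t => t * (l t * l t)) (w * star w) * (star x2 * x2)).
Proof.
move=> ck cl lk Nx1 Nx2 Nw gw wf.
have ckk : contp (fun t => k t * k t) by exact: contpM.
have pA := posop_star w.
have Nsw := calg_star hN Nw; have Nsx2 := calg_star hN Nx2.
have NA : N (star w * w) by exact: (calgM hN).
have fac := mul_fc_cancel w ck cl lk.
set w2 := fc k (star w * w) in fac *; set w1 := w * fc l (star w * w) in fac *.
have Nw2 : N w2 by exact: (calg_fc hN).
have Nw1 : N w1 by apply: (calgM hN) => //; exact: (calg_fc hN).
have sw2 : star w2 = w2 by exact: fc_star.
have fw : f * star w = star w by rewrite -{1}(corner_star hf) -starM wf.
have cA : comm_e f (star w * w) by rewrite /comm_e -mulrA wf mulrA fw.
have w1f : w1 * f = w1 by rewrite /w1 -mulrA (comm_fc cl pA cA) mulrA wf.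
have gw1 : g * w1 = w1 by rewrite /w1 mulrA gw.
have cw2 : comm_e f w2 by exact: comm_fc.
have -> : tr s (x1 * x2 * w) = tr sf (star (star (w2 * x1)) * (x2 * w1)).
  rewrite starK (_ : w2 * x1 * (x2 * w1) = w2 * (x1 * x2 * w1)); last by rewrite !mulrA.
  rewrite (tr_comm hN hD hf Nw2 _ cw2); last by apply: (calgM hN) => //; exact: (calgM hN).
  by rewrite -(tr_subr he hf ef) -(mulrA _ w1) fac -(mulrA _ w f) wf.
apply: le_trans (tr_cauchy _ _ _) _; rewrite starK le_eqVlt; apply/orP; left; apply/eqP; congr (_ * _).
  have Nxx : N (x1 * star x1) by apply: (calgM hN) => //; exact: (calg_star hN).
  have -> : w2 * x1 * star (w2 * x1) = w2 * (x1 * star x1 * w2) by rewrite starM sw2 !mulrA.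
  have cww : comm_e f (w2 * w2) by rewrite /comm_e -mulrA cw2 mulrA cw2 mulrA.
  rewrite !rtr_tr (fcM ck ck pA) -/w2 (tr_comm hN hD hf Nw2 (calgM hN Nxx Nw2) cw2).
  by rewrite (tr_comm hN hD hf (calgM hN Nw2 Nw2) Nxx cww) mulrA.
have Nsw1 := calg_star hN Nw1.
have -> : star (x2 * w1) * (x2 * w1) = star w1 * (star x2 * x2) * w1 by rewrite starM !mulrA.
rewrite !rtr_tr -(mul_fc_outer w cl) -/w1 -(tr_subr he hf ef) -(tr_subl he hg eg).
have -> : g * (w1 * star w1 * (star x2 * x2)) = w1 * (star w1 * (star x2 * x2)).
  by rewrite -[w1 * star w1 * _]mulrA mulrA gw1.
rewrite -mulrA w1f.
have fe : f * e = f by rewrite -(corner_star he) -(corner_star hf) -starM ef.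
have we : comm_e e w1 by rewrite /comm_e -{1}w1f -mulrA fe w1f -gw1 mulrA eg.
by rewrite (tr_comm hN hD he Nw1 _ we) //; apply: (calgM hN) => //; exact: (calgM hN).
Qed.

Lemma fc_powR_max (d r : R) z : 0 < d -> 0 < r -> posop z ->
  fc (pw r) (fc (fun t => Num.max t d `^ 4^-1 * Num.max t d `^ 4^-1) z) =
  fc (fun t => Num.max t d `^ (r / 2)) z.
Proof.
move=> d0 r0 pz; have c4 := @contp_powR_max R d 4^-1 d0.
have c : contp (fun t => Num.max t d `^ 4^-1 * Num.max t d `^ 4^-1) by exact: contpM.
have cr := contp_powR r0.
rewrite (fc_comp c cr pz) => [|t _]; last by rewrite mulr_ge0 ?powR_ge0.
apply: (fc_ext _ pz) => [|t _].
  by apply: (@contp_comp R _ (pw r)) => // t _; rewrite mulr_ge0 ?powR_ge0.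
have m0 : 0 < Num.max t d by rewrite lt_max d0 orbT.
rewrite -powRD; last by apply/implyP => _; rewrite gt_eqF.
by rewrite -powRrM; congr (_ `^ _); lra.
Qed.

Lemma fc_powR_max_le (d r : R) z : 0 < d -> 0 < r -> posop z ->
  posop (fc (pw (r / 2)) z -
    fc (pw r) (fc (fun t => t * (Num.max t d `^ (- 4^-1) * Num.max t d `^ (- 4^-1))) z)).
Proof.
move=> d0 r0 pz; have c4 := @contp_powR_max R d (- 4^-1) d0.
have c : contp (fun t => t * (Num.max t d `^ (- 4^-1) * Num.max t d `^ (- 4^-1))).
  by apply: contpM; [exact: contp_id|exact: contpM].
have cr := contp_powR r0; have c0 t : 0 <= t -> 0 <= t * (Num.max t d `^ (- 4^-1) * Num.max t d `^ (- 4^-1)).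
  by move=> t0; rewrite !mulr_ge0 ?powR_ge0.
rewrite (fc_comp c cr pz) //; apply: (fc_le_pos _ _ pz).
- by apply: (@contp_comp R _ (pw r)).
- by apply: contp_powR; rewrite divr_gt0.
move=> t /andP[t0 _]; have m0 : 0 < Num.max t d by rewrite lt_max d0 orbT.
rewrite (_ : r / 2 = 2^-1 * r); last by rewrite mulrC.
rewrite powRrM; apply: ge0_ler_powR; rewrite ?nnegrE ?powR_ge0 ?c0 ?(ltW r0) //.
rewrite -powRD; last by apply/implyP => _; rewrite gt_eqF.
rewrite -opprD (_ : 4^-1 + 4^-1 = 2^-1 :> R); last by field.
rewrite powRN ler_pdivrMr ?powR_gt0 // -{1}(@powRr1 _ t) //.
rewrite {1}(_ : 1 = 2^-1 + 2^-1 :> R); last by lra.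
rewrite powRD; last by apply/implyP => /eqP h; exfalso; lra.
rewrite ler_wpM2l ?powR_ge0 //; apply: ge0_ler_powR; rewrite ?nnegrE //.
- by rewrite ltW.
- by rewrite le_max lexx.
Qed.

Lemma rtr_mono (r : seq I) x y : posop (y - x) -> rtr r x <= rtr r y.
Proof. by move=> /(rtr_pos r); rewrite rtrB subr_ge0. Qed.

Lemma rtr_pos_fc (r : seq I) c h A B : corner N D c r -> contp h -> (forall t, 0 <= t -> 0 <= h t) ->
  posop A -> N A -> comm_e c A -> posop B -> N B -> 0 <= rtr r (fc h A * B).
Proof.
move=> hc ch h0 pA NA cA pB NB; have cs := contp_sqrt ch.
rewrite (_ : fc h A = fc (fun t => Num.sqrt (h t)) A * fc (fun t => Num.sqrt (h t)) A).
  exact: (rtr_pos2 hN hD hc).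
rewrite -(fcM cs cs pA); apply: (fc_ext ch pA) => t /andP[t0 _].
by rewrite -expr2 sqr_sqrtr // h0.
Qed.

Lemma rtr_powR_mono (c : seq I) r x y : 0 < r -> posop x -> posop (y - x) ->
  rtr c x `^ r^-1 <= rtr c y `^ r^-1.
Proof.
move=> r0 px xy; have h := rtr_mono c xy; have h0 := rtr_pos c px.
by apply: ge0_ler_powR; rewrite ?nnegrE ?invr_ge0 ?(ltW r0) // (le_trans h0).
Qed.

Lemma cvg_rtr_powR_max (c : seq I) r z : 0 < r -> posop z ->
  rtr c (fc (fun t => Num.max t n.+1%:R^-1 `^ (r / 2)) z) `^ r^-1 @[n --> \oo] -->
  rtr c (fc (pw (r / 2)) z) `^ r^-1.
Proof.
move=> r0 pz; have r2 : 0 < r / 2 by rewrite divr_gt0.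
have d0 (n : nat) : 0 < (n.+1%:R^-1 : R) by rewrite invr_gt0.
apply: powR_cvg_seq; rewrite ?invr_gt0 //; last exact: rtr_olim (olim_powR_max r2 pz).
  move=> n; apply/rtr_pos/fc_pos => //; last by move=> t _; exact: powR_ge0.
  by apply: contp_powR_max; exact: d0.
by apply/rtr_pos/fc_pos => //; [exact: contp_powR|move=> t _; exact: powR_ge0].
Qed.

(** [split_ineq] with [k(t) = t^(1/4)] leaves [|w|] against [x1 x1^*] and [|w^*|] against [x2^* x2],
    and [rtr_hoelder] applies to each pair. Replacing [t] by [max t d] keeps [l = 1 / k] continuous
    at 0; then [d] tends to 0. *)
Lemma split_hoelder2 p q x1 x2 w : 0 < p -> 0 < q -> p^-1 + q^-1 = 1 ->
  N x1 -> N x2 -> N w -> g * w = w -> w * f = w ->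
  sqmod (tr s (x1 * x2 * w)) <=
    (rtr s (apow q w) `^ q^-1 * rtr sf (fc (pw p) (x1 * star x1)) `^ p^-1) *
    (rtr s (apow q (star w)) `^ q^-1 * rtr sg (fc (pw p) (star x2 * x2)) `^ p^-1).
Proof.
move=> p0 q0 pq Nx1 Nx2 Nw gw wf.
have Nsw := calg_star hN Nw.
have pA := posop_star w; have pX := posop_star x2; have pB := posop_starr w; have pY := posop_starr x1.
have NA : N (star w * w) by exact: (calgM hN).
have NX : N (star x2 * x2) by apply: (calgM hN) => //; exact: (calg_star hN).
have NB : N (w * star w) by exact: (calgM hN).
have NY : N (x1 * star x1) by apply: (calgM hN) => //; exact: (calg_star hN).
have cA : comm_e f (star w * w).
  have fw : f * star w = star w by rewrite -{1}(corner_star hf) -starM wf.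
  by rewrite /comm_e -mulrA wf mulrA fw.
have cB : comm_e g (w * star w).
  have wg : star w * g = star w by rewrite -{1}(corner_star hg) -starM gw.
  by rewrite /comm_e -mulrA wg mulrA gw.
set a := rtr sf (fc (pw p) (x1 * star x1)) `^ p^-1; set b := rtr s (apow q (star w)) `^ q^-1.
set c := rtr sg (fc (pw p) (star x2 * x2)) `^ p^-1.
have key n : sqmod (tr s (x1 * x2 * w)) <=
    (rtr sf (fc (fun t => Num.max t n.+1%:R^-1 `^ (q / 2)) (star w * w)) `^ q^-1 * a) * (b * c).
  have : 0 < (n.+1%:R^-1 : R) by rewrite invr_gt0.
  move: (n.+1%:R^-1) => d d0.
  have c4 := @contp_powR_max R d 4^-1 d0; have c4' := @contp_powR_max R d (- 4^-1) d0.
  have ckk : contp (fun t => Num.max t d `^ 4^-1 * Num.max t d `^ 4^-1) by exact: contpM.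
  have cll : contp (fun t => t * (Num.max t d `^ (- 4^-1) * Num.max t d `^ (- 4^-1))).
    by apply: contpM; [exact: contp_id|exact: contpM].
  have ckp : forall t, 0 <= t -> 0 <= Num.max t d `^ 4^-1 * Num.max t d `^ 4^-1.
    by move=> t _; rewrite mulr_ge0 ?powR_ge0.
  have ll0 t : 0 <= t -> 0 <= t * (Num.max t d `^ (- 4^-1) * Num.max t d `^ (- 4^-1)).
    by move=> t0; rewrite !mulr_ge0 ?powR_ge0.
  apply: le_trans (split_ineq c4 c4' _ Nx1 Nx2 Nw gw wf) _.
    move=> t t0; rewrite powRN mulVf // gt_eqF // powR_gt0 //.
    by rewrite lt_max d0 orbT.
  have pos z h : contp h -> posop z -> (forall t, 0 <= t -> 0 <= h t) -> posop (fc h z).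
    by move=> ch pz h0; apply: fc_pos => // t /andP[t0 _]; exact: h0.
  apply: ler_pM.
  - exact: (rtr_pos_fc hf ckk ckp pA NA cA pY NY).
  - exact: (rtr_pos_fc hg cll ll0 pB NB cB pX NX).
  - apply: le_trans (rtr_hoelder hN hD hf p0 q0 pq (pos _ _ ckk pA ckp) (calg_fc hN ckk pA NA)
      (comm_fc ckk pA cA) pY NY) _.
    by rewrite (fc_powR_max d0 q0 pA).
  apply: le_trans (rtr_hoelder hN hD hg p0 q0 pq (pos _ _ cll pB ll0) (calg_fc hN cll pB NB)
    (comm_fc cll pB cB) pX NX) _.
  apply: (ler_wpM2r (powR_ge0 _ _)).
  apply: le_trans (_ : rtr sg (apow q (star w)) `^ q^-1 <= _).
    apply: (rtr_powR_mono _ q0).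
      exact: (pos _ _ (contp_powR q0) (pos _ _ cll pB ll0) (fun t _ => powR_ge0 t q)).
    by have := fc_powR_max_le d0 q0 pB; rewrite /apow starK.
  have h0 := rtr_pos sg (apow_pos (star w) q0).
  have h1 := rtr_sub_le he hg eg (apow_pos (star w) q0).
  by apply: ge0_ler_powR; rewrite ?nnegrE ?invr_ge0 ?(ltW q0) // (le_trans h0).
have L : (rtr sf (fc (fun t => Num.max t n.+1%:R^-1 `^ (q / 2)) (star w * w)) `^ q^-1 * a) * (b * c)
    @[n --> \oo] --> (rtr sf (apow q w) `^ q^-1 * a) * (b * c).
  by apply: cvgM; [apply: cvgM; [exact: cvg_rtr_powR_max|exact: cvg_cst]|exact: cvg_cst].
have h := @lim_le R (fun=> sqmod (tr s (x1 * x2 * w))) _ _ _ (cvg_cst (sqmod (tr s (x1 * x2 * w)) : R)) L key.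
apply: (le_trans (h _)); apply: ler_wpM2r; first by rewrite mulr_ge0 ?powR_ge0.
apply: (ler_wpM2r (powR_ge0 _ _)).
have h0 := rtr_pos sf (apow_pos w q0); have h1 := rtr_sub_le he hf ef (apow_pos w q0).
by apply: ge0_ler_powR; rewrite ?nnegrE ?invr_ge0 ?(ltW q0) // (le_trans h0).
Qed.

(** The same device is applied to [x]: it is factored as [x1 x2] with [x1 x1^*] close to [|x^*|] and
    [x2^* x2] close to [|x|]. *)
Lemma split_hoelder p q x w : 0 < p -> 0 < q -> p^-1 + q^-1 = 1 ->
  N x -> N w -> g * w = w -> w * f = w ->
  sqmod (tr s (x * w)) <=
    (rtr s (apow q w) `^ q^-1 * rtr sf (apow p (star x)) `^ p^-1) *
    (rtr s (apow q (star w)) `^ q^-1 * rtr sg (apow p x) `^ p^-1).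
Proof.
move=> p0 q0 pq Nx Nw gw wf; have Nsx := calg_star hN Nx.
have pX := posop_star x; have pY := posop_starr x.
have NX : N (star x * x) by exact: (calgM hN).
set a := rtr s (apow q w) `^ q^-1; set b := rtr s (apow q (star w)) `^ q^-1.
set c := rtr sf (apow p (star x)) `^ p^-1.
have key n : sqmod (tr s (x * w)) <=
    (a * c) * (b * rtr sg (fc (fun t => Num.max t n.+1%:R^-1 `^ (p / 2)) (star x * x)) `^ p^-1).
  have : 0 < (n.+1%:R^-1 : R) by rewrite invr_gt0.
  move: (n.+1%:R^-1) => d d0.
  have c4 := @contp_powR_max R d 4^-1 d0; have c4' := @contp_powR_max R d (- 4^-1) d0.
  have cll : contp (fun t => t * (Num.max t d `^ (- 4^-1) * Num.max t d `^ (- 4^-1))).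
    by apply: contpM; [exact: contp_id|exact: contpM].
  have ll0 t : 0 <= t -> 0 <= t * (Num.max t d `^ (- 4^-1) * Num.max t d `^ (- 4^-1)).
    by move=> t0; rewrite !mulr_ge0 ?powR_ge0.
  have lk t : 0 <= t -> Num.max t d `^ (- 4^-1) * Num.max t d `^ 4^-1 = 1.
    by move=> t0; rewrite powRN mulVf // gt_eqF // powR_gt0 // lt_max d0 orbT.
  have N2 : N (fc (fun t => Num.max t d `^ 4^-1) (star x * x)) by exact: (calg_fc hN).
  have N1 : N (x * fc (fun t => Num.max t d `^ (- 4^-1)) (star x * x)).
    by apply: (calgM hN) => //; exact: (calg_fc hN).
  have := split_hoelder2 p0 q0 pq N1 N2 Nw gw wf.
  rewrite (mul_fc_cancel x c4 c4' lk) (mul_fc_outer x c4') (fc_star c4 pX) -(fcM c4 c4 pX).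
  rewrite (fc_powR_max d0 p0 pX) => h; apply: (le_trans h); apply: ler_wpM2r.
    by rewrite mulr_ge0 ?powR_ge0.
  apply: (ler_wpM2l (powR_ge0 _ _)); apply: (rtr_powR_mono _ p0).
    apply: (fc_pos (contp_powR p0)) => [|t _]; last exact: powR_ge0.
    by apply: (fc_pos cll pY) => t /andP[t0 _]; exact: ll0.
  by have := fc_powR_max_le d0 p0 pY; rewrite /apow starK.
have L : (a * c) * (b * rtr sg (fc (fun t => Num.max t n.+1%:R^-1 `^ (p / 2)) (star x * x)) `^ p^-1)
    @[n --> \oo] --> (a * c) * (b * rtr sg (apow p x) `^ p^-1).
  by apply: cvgM; [exact: cvg_cst|apply: cvgM; [exact: cvg_cst|exact: cvg_rtr_powR_max]].
have h := @lim_le R (fun=> sqmod (tr s (x * w))) _ _ _ (cvg_cst (sqmod (tr s (x * w)) : R)) L key.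
exact: h.
Qed.

End SplitIneq.
End Split.

Lemma Re_le_sqmod {R : realType} (z : R[i]) c : 0 <= c -> sqmod z <= c ^+ 2 -> complex.Re z <= c.
Proof.
move=> c0 h; apply: le_trans (ler_norm _) _; rewrite -(ler_pXn2r (n := 2)) ?nnegrE //.
by apply: le_trans h; rewrite real_normK ?num_real // lerDl sqr_ge0.
Qed.

Lemma powR_self_bound {R : realType} (p q V C : R) : 0 < p -> p^-1 + q^-1 = 1 -> 0 <= C -> 0 <= V ->
  V <= C * V `^ q^-1 -> V `^ p^-1 <= C.
Proof.
move=> p0 pq C0 V0 h; have [->|Vn] := eqVneq V 0; first by rewrite powR0 ?invr_neq0 // gt_eqF.
have Vp : 0 < V by rewrite lt_def Vn.
rewrite -(ler_pM2r (_ : 0 < V `^ q^-1)) ?powR_gt0 // -powRD ?pq ?powRr1 //.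
by rewrite oner_eq0.
Qed.

Lemma hoelder_collect {R : realType} (S a a' b b' : R) : a' = a -> b' = b ->
  S <= (a * b') * (a' * b) -> S <= (b * a) ^+ 2.
Proof. by move=> -> -> h; apply: le_trans h _; rewrite le_eqVlt; apply/orP; left; apply/eqP; ring. Qed.

Lemma hoelder_collect2 {R : realType} (S a a' b c : R) : 0 <= b -> 0 <= c -> a' = a ->
  S <= (a * b) * (a' * c) -> S <= (Num.sqrt (b * c) * a) ^+ 2.
Proof.
move=> b0 c0 -> h; apply: le_trans h _; rewrite exprMn sqr_sqrtr ?mulr_ge0 //.
rewrite le_eqVlt; apply/orP; left; apply/eqP; ring.
Qed.

Lemma hoelder_collect3 {R : realType} (S a a' b b' b2 c c' c2 : R) : a' = a -> b' = b -> c' = c ->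
  b2 = b' ^+ 2 -> c2 = c' ^+ 2 -> S <= (a * b2) * (a' * c2) -> S <= (b * c * a) ^+ 2.
Proof.
move=> -> -> -> -> -> h; apply: le_trans h _; rewrite le_eqVlt; apply/orP; left; apply/eqP; ring.
Qed.

(** * Duality, triangle inequality and products in a corner *)

Section Duality.
Context {R : realType} {I : choiceType}.
Implicit Types (x y z a b w : bop R I) (p q r : R).

Notation pw r := (fun t : R => (t `^ r)%R).

Lemma olim_pev P (u : nat -> bop R I) y : olim u y -> olim (fun n => pev P (u n)) (pev P y).
Proof.
move=> uy; elim/poly_ind: P => [|P c IH].
  by rewrite (_ : (fun n => _) = fun=> 0) ?pev0; [exact: olim_cst|apply/funext => n; rewrite pev0].
rewrite (_ : (fun n => _) = fun n => pev P (u n) * u n + rs c 1); last first.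
  by apply/funext => n; rewrite pevD pevM pevX pevC.
by rewrite pevD pevM pevX pevC; apply: olimD; [exact: olimM|exact: olim_cst].
Qed.

Lemma fc_olim f (u : nat -> bop R I) y : contp f -> (forall n, posop (u n)) -> olim u y ->
  olim (fun n => fc f (u n)) (fc f y).
Proof.
move=> cf pu uy; have py := posop_lim pu uy.
pose K := nrm y + 1; have K0 : 0 < K by rewrite ltr_wpDl ?nrm_ge0.
rewrite /olim; apply/cvgrPdist_le => e e0; have e3 : 0 < e / 3 by rewrite divr_gt0.
have [P hP] := weierstrass cf K0 e3.
have h1 : \forall n \near \oo, nrm (u n - y) <= 1.
  have /cvgrPdist_le/(_ _ ltr01) := uy; apply: filterS => n /=.
  by rewrite sub0r normrN ger0_norm ?nrm_ge0.
have h2 : \forall n \near \oo, nrm (pev P (u n) - pev P y) <= e / 3.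
  have /cvgrPdist_le/(_ _ e3) := olim_pev P uy; apply: filterS => n /=.
  by rewrite sub0r normrN ger0_norm ?nrm_ge0.
near=> n; rewrite sub0r normrN ger0_norm ?nrm_ge0 //.
have uK : nrm (u n) <= K.
  rewrite -[u n](subrK y); apply: le_trans (nrmD _ _) _; rewrite addrC lerD2l.
  by near: n.
have yK : nrm y <= K by rewrite /K lerDl.
have a1 : nrm (pev P (u n) - fc f (u n)) <= e / 3.
  apply: (fc_near cf (pu n) (ltW e3)) => t /andP[t0 tu]; apply: hP; rewrite t0 /=.
  exact: le_trans uK.
have a2 : nrm (pev P y - fc f y) <= e / 3.
  apply: (fc_near cf py (ltW e3)) => t /andP[t0 tu]; apply: hP; rewrite t0 /=.
  exact: le_trans yK.
have a3 : nrm (pev P (u n) - pev P y) <= e / 3 by near: n.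
rewrite (_ : fc f (u n) - fc f y = - (pev P (u n) - fc f (u n)) + (pev P (u n) - pev P y) + (pev P y - fc f y)).
  apply: le_trans (nrmD _ _) _; rewrite (_ : e = e / 3 + e / 3 + e / 3); last by field.
  by apply: lerD => //; apply: le_trans (nrmD _ _) _; rewrite nrmN; exact: lerD.
by rewrite opprB !addrA !subrK.
Unshelve. all: by end_near.
Qed.

Lemma fc_zero f : fc f (0 : bop R I) = rs (f 0) 1.
Proof.
rewrite -(fc_cst (f 0) (posop0 : posop (0 : bop R I))).
apply/esym; apply: fc_ext; [exact: contp_cst|exact: posop0|].
by move=> t; rewrite nrm0 => /le_anti ->.
Qed.

(** The hypothesis [a * e = a] says that [1 - e] intertwines 0 and [a]; hence it intertwines
    [f(0) = 0] and [f(a)]. *)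
Lemma fc_supp f a e : contp f -> posop a -> f 0 = 0 -> a * e = a -> fc f a * e = fc f a.
Proof.
move=> cf pa f0 ae.
have h : (1 - e) * 0 = a * (1 - e) by rewrite mulr0 mulrBr mulr1 ae subrr.
have := fc_intertwine cf posop0 pa h.
by rewrite fc_zero f0 rs0 mulr0 mulrBr mulr1 => /esym/eqP; rewrite subr_eq0 => /eqP <-.
Qed.

Variables (N : set (bop R I)) (D : set I).
Hypotheses (hN : cstar_alg N) (hD : tracial_on N D).

Definition np p (s : seq I) x : R := rtr s (apow p x) `^ p^-1.

Lemma np_ge0 p s x : 0 <= np p s x. Proof. exact: powR_ge0. Qed.

Definition inc e x := e * x = x /\ x * e = x.

Lemma inc_star e s x : corner N D e s -> inc e x -> inc e (star x).
Proof. by move=> he [ex xe]; split; rewrite -{1}(corner_star he) -starM ?ex ?xe. Qed.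
Lemma incD e x y : inc e x -> inc e y -> inc e (x + y).
Proof. by move=> [h1 h2] [h3 h4]; split; rewrite ?mulrDr ?mulrDl ?h1 ?h2 ?h3 ?h4. Qed.
Lemma incM e x y : inc e x -> inc e y -> inc e (x * y).
Proof. by move=> [h1 h2] [h3 h4]; split; rewrite ?mulrA ?h1 // -mulrA h4. Qed.

Lemma dsum_corner e s a : corner N D e s -> posop a -> a * e = a -> dsum D a = (rtr s a)%:E.
Proof.
move=> he pa ae; rewrite rtr_dg; apply: (esum_corner he) => [i|i Di si]; first exact: dg_pos.
by rewrite /dg -ae bopM (corner_out he Di si) bop0 ip0r.
Qed.

Lemma apow_supp e p x : 0 < p -> x * e = x -> apow p x * e = apow p x.
Proof.
move=> p0 xe; apply: fc_supp; [by apply: contp_powR; rewrite divr_gt0|exact: posop_star| |].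
  by rewrite powR0 // mulf_neq0 ?invr_neq0 // gt_eqF.
by rewrite -mulrA xe.
Qed.

Lemma rtr_apow_star e s p x : corner N D e s -> 0 < p -> N x -> inc e x ->
  rtr s (apow p (star x)) = rtr s (apow p x).
Proof.
move=> he p0 Nx ix; have [_ xe] := ix; have [_ sxe] := inc_star he ix.
have p2 : 0 < p / 2 by rewrite divr_gt0.
have := dsum_powR_star hN hD p2 Nx.
have := dsum_corner he (apow_pos x p0) (apow_supp p0 xe).
have := dsum_corner he (apow_pos (star x) p0) (apow_supp p0 sxe).
by rewrite /apow starK => -> -> [].
Qed.

Lemma np_star e s p x : corner N D e s -> 0 < p -> N x -> inc e x -> np p s (star x) = np p s x.
Proof. by move=> *; rewrite /np (@rtr_apow_star e). Qed.

(** For [P(t)] close to [t^((p - 2) / 2)] this is [y^* |y^*|^(p - 2)], the element of L_q that norms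
    [y] up to a scalar. A polynomial [P] keeps it in the algebra generated by [y] and [y^*], so that
    for a finite matrix [y] over the group algebra only such matrices need testing. *)
Definition dual_elt P y := star y * pev P (y * star y).

(** Along polynomials tending to [k], the pairing tends to the trace of [t k(t)] at [y y^*], and the
    L_q-norm to the one given by [(t k(t)^2)^(q / 2)]; the third hypothesis bounds the latter by
    [t k(t)] again. *)
Lemma duality_weight e s q y (k : R -> R) C : corner N D e s -> 0 < q -> contp k ->
  (forall t, 0 <= t -> 0 <= k t) ->
  (forall t, 0 <= t -> (t * (k t * k t)) `^ (q / 2) <= t * k t) -> 0 <= C ->
  (forall P, rtr s (y * dual_elt P y) <= C * np q s (dual_elt P y)) ->
  rtr s (fc (fun t => t * k t) (y * star y)) <= C * rtr s (fc (fun t => t * k t) (y * star y)) `^ q^-1.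
Proof.
move=> he q0 ck k0 hk C0 H; set Y := y * star y; have pY : posop Y := posop_starr y.
have ci := @contp_id R; have q2 : 0 < q / 2 by rewrite divr_gt0.
have ckk : contp (fun t => k t * k t) by exact: contpM.
have ctkk : contp (fun t => t * (k t * k t)) by exact: contpM.
have ctk : contp (fun t => t * k t) by exact: contpM.
have [P_ hP] := weierstrass_seq (nrm Y) ck.
have lk : olim (fun n => pev (P_ n) Y) (fc k Y) := fc_lim ck pY (lexx _) hP cvg_invS.
have wE P : star (dual_elt P y) * dual_elt P y = pev P Y * Y * pev P Y.
  by rewrite /dual_elt starM starK (star_pev _ (proj1 pY)) -/Y !mulrA.
have L1 : olim (fun n => y * dual_elt (P_ n) y) (fc (fun t => t * k t) Y).
  rewrite (fcM ci ck pY) (fc_id pY) (_ : (fun n => _) = fun n => Y * pev (P_ n) Y).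
    by apply: olimM => //; exact: olim_cst.
  by apply/funext => n; rewrite /dual_elt mulrA.
have L2 : olim (fun n => apow q (dual_elt (P_ n) y)) (fc (fun t => (t * (k t * k t)) `^ (q / 2)) Y).
  rewrite -(fc_comp ctkk (contp_powR q2) pY) => [|t t0]; last by rewrite !mulr_ge0 ?k0.
  apply: fc_olim => [|n|]; [exact: contp_powR|exact: posop_star|].
  rewrite (_ : (fun n => _) = fun n => pev (P_ n) Y * Y * pev (P_ n) Y); last by apply/funext => n; exact: wE.
  rewrite (_ : fc _ Y = fc k Y * Y * fc k Y); first by apply: olimM => //; apply: olimM => //; exact: olim_cst.
  have ckt : contp (fun t => k t * t) by exact: contpM.
  have -> : fc k Y * Y * fc k Y = fc (fun t => k t * t * k t) Y.
    by rewrite (fcM ckt ck pY) (fcM ck ci pY) (fc_id pY).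
  by apply: (fc_ext ctkk pY) => t _; rewrite mulrA (mulrC t).
have cpw : contp (fun t => (t * (k t * k t)) `^ (q / 2)).
  by apply: (@contp_comp R _ (pw (q / 2))) => // [|t t0]; [exact: contp_powR|rewrite !mulr_ge0 ?k0].
have pE : posop (fc (fun t => (t * (k t * k t)) `^ (q / 2)) Y).
  by apply: (fc_pos cpw pY) => t _; exact: powR_ge0.
apply: le_trans (_ : C * rtr s (fc (fun t => (t * (k t * k t)) `^ (q / 2)) Y) `^ q^-1 <= _); last first.
  apply: (ler_wpM2l C0); apply: (rtr_powR_mono _ q0 pE); apply: (fc_le_pos cpw ctk pY) => t /andP[t0 _].
  exact: hk.
have L3 : C * np q s (dual_elt (P_ n) y) @[n --> \oo] -->
    C * rtr s (fc (fun t => (t * (k t * k t)) `^ (q / 2)) Y) `^ q^-1.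
  apply: cvgM; first exact: cvg_cst.
  apply: powR_cvg_seq; [by rewrite invr_gt0| |exact: rtr_pos|exact: rtr_olim L2].
  by move=> n; apply/rtr_pos/apow_pos.
exact: (lim_le (rtr_olim L1) L3 (fun n => H (P_ n))).
Qed.

Lemma conj_exp p q : 1 < p -> p^-1 + q^-1 = 1 -> 0 < q /\ (p - 1) * q = p.
Proof.
move=> p1 pq; have p0 : p != 0 by rewrite gt_eqF // (lt_trans ltr01).
have qE : q^-1 = (p - 1) / p by rewrite mulrBl mulfV // mul1r -pq addrC addKr.
have q0 : 0 < q by rewrite -invr_gt0 qE divr_gt0 ?subr_gt0 // (lt_trans ltr01).
by split=> //; apply: (mulIf (invr_neq0 p0)); rewrite mulfV // mulrAC -qE mulVf // gt_eqF.
Qed.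

(** With [k(t) = t^((p - 2) / 2)], [duality_weight] reads [V <= C V^(1/q)], where [V] is the p-th
    power of the norm of [y^*], which is that of [y]. *)
Lemma duality e s p q y C : corner N D e s -> 1 < p -> p^-1 + q^-1 = 1 -> N y -> inc e y -> 0 <= C ->
  (forall P, rtr s (y * dual_elt P y) <= C * np q s (dual_elt P y)) -> np p s y <= C.
Proof.
move=> he p1 pq Ny iy C0 H; have [q0 pqE] := conj_exp p1 pq; have p0 := lt_trans ltr01 p1.
rewrite -(np_star he p0 Ny iy) /np /apow starK; set Y := y * star y.
have pY : posop Y := posop_starr y.
have [p2|p2] := ltP 2 p.
  have e0 : 0 < (p - 2) / 2 by rewrite divr_gt0 ?subr_gt0.
  have kE (t : R) : 0 <= t -> t * t `^ ((p - 2) / 2) = t `^ (p / 2).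
    move=> t0; rewrite -{1}(powRr1 t0) -powRD; first by congr (_ `^ _); field.
    by apply/implyP => /eqP h; lra.
  rewrite -(fc_ext (f := fun t => t * t `^ ((p - 2) / 2)) _ pY) => [||t /andP[t0 _]]; last 2 first.
  - by apply: contpM; [exact: contp_id|exact: contp_powR].
  - exact: kE.
  apply: (powR_self_bound p0 pq C0).
    apply: rtr_pos; apply: (fc_pos _ pY) => [|t /andP[t0 _]]; last by rewrite mulr_ge0 ?powR_ge0.
    by apply: contpM; [exact: contp_id|exact: contp_powR].
  apply: (duality_weight he q0 (contp_powR e0) _ _ C0 H) => [t _|t t0]; first exact: powR_ge0.
  have [->|tn] := eqVneq t 0; first by rewrite !mul0r powR0 // mulf_neq0 ?invr_neq0 // gt_eqF.
  have tp : 0 < t by rewrite lt_def tn.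
  rewrite kE // mulrA kE // -powRD; last by rewrite tn implybT.
  rewrite -powRrM le_eqVlt; apply/orP; left; apply/eqP; congr (_ `^ _).
  by rewrite -[in RHS]pqE; field.
(* For [p <= 2] the exponent is not positive, so the weight is cut off below [d]. The required
   inequality survives because [q >= 2], and [t k(t)] tends uniformly to [t^(p / 2)] as [d] tends to
   0. *)
pose k (d t : R) := Num.max t d `^ ((p - 2) / 2).
have q2 : 2 <= q.
  have p10 : 0 < p - 1 by rewrite subr_gt0.
  by rewrite -(ler_pM2r p10) (mulrC q) pqE; lra.
have key d : 0 < d -> rtr s (fc (fun t => t * k d t) Y) `^ p^-1 <= C.
  move=> d0; have ck : contp (k d) by exact: contp_powR_max.
  apply: (powR_self_bound p0 pq C0).
    apply: rtr_pos; apply: (fc_pos _ pY) => [|t /andP[t0 _]]; last by rewrite mulr_ge0 ?powR_ge0.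
    by apply: contpM => //; exact: contp_id.
  apply: (duality_weight he q0 ck _ _ C0 H) => [t _|t t0]; first exact: powR_ge0.
  rewrite /k; have tm : t <= Num.max t d by rewrite le_max lexx.
  have : 0 < Num.max t d by rewrite lt_max d0 orbT.
  move: (Num.max t d) tm => m tm m0.
  have [->|tn] := eqVneq t 0; first by rewrite !mul0r powR0 // mulf_neq0 ?invr_neq0 // gt_eqF.
  have tp : 0 < t by rewrite lt_def tn.
  have mD u v : m `^ u * m `^ v = m `^ (u + v) by rewrite powRD //; apply/implyP => _; rewrite gt_eqF.
  rewrite mD powRM ?powR_ge0 // -powRrM.
  rewrite {1}(_ : q / 2 = 1 + (q / 2 - 1)); last by ring.
  rewrite powRD ?tn ?implybT // powRr1 // -mulrA; apply: ler_wpM2l => //.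
  apply: le_trans (_ : m `^ (q / 2 - 1) * m `^ (((p - 2) / 2 + (p - 2) / 2) * (q / 2)) <= _).
    apply: ler_wpM2r; first exact: powR_ge0.
    by apply: ge0_ler_powR; rewrite ?nnegrE ?(ltW m0) //; lra.
  rewrite mD le_eqVlt; apply/orP; left; apply/eqP; congr (_ `^ _).
  have -> : ((p - 2) / 2 + (p - 2) / 2) * (q / 2) = ((p - 1) * q - q) / 2 by field.
  by rewrite pqE; field.
have p20 : 0 < p / 2 by rewrite divr_gt0.
have d0 (n : nat) : 0 < (n.+1%:R^-1 : R) by rewrite invr_gt0.
have ctk d : 0 < d -> contp (fun t => t * k d t).
  by move=> dd0; apply: contpM; [exact: contp_id|exact: contp_powR_max].
have L : olim (fun n => fc (fun t => t * k n.+1%:R^-1 t) Y) (fc (pw (p / 2)) Y).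
  apply: (olim_le (w := fun n => n.+1%:R^-1 `^ (p / 2))) => [n|]; last first.
    rewrite -[X in _ --> X](@powR0 _ (p / 2)) ?gt_eqF //.
    by apply: powR_cvg_seq => //; exact: cvg_invS.
  have cb : contp (fun t => t * k n.+1%:R^-1 t - t `^ (p / 2)).
    by apply: contpB; [exact: ctk|exact: contp_powR].
  have cp2 := contp_powR p20; have cn := ctk _ (d0 n).
  rewrite -(fcB cn cp2 pY); apply: (fc_nrm cb pY); first exact: powR_ge0.
  move=> t /andP[t0 _]; rewrite /k; move: (n.+1%:R^-1) (d0 n) => d {}d0.
  have mE m : 0 < m -> m * m `^ ((p - 2) / 2) = m `^ (p / 2).
    move=> m0; rewrite -{1}(powRr1 (ltW m0)) -powRD; first by congr (_ `^ _); field.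
    by apply/implyP => _; rewrite gt_eqF.
  have [dt|td] := leP d t.
    by rewrite mE ?subrr ?normr0 ?powR_ge0 // (lt_le_trans d0).
  have h1 : t * d `^ ((p - 2) / 2) <= d `^ (p / 2).
    by rewrite -mE //; apply: ler_wpM2r; [exact: powR_ge0|exact: ltW].
  have h2 : t `^ (p / 2) <= d `^ (p / 2) by apply: ge0_ler_powR; rewrite ?nnegrE ?(ltW p20) ?(ltW td) ?(ltW d0).
  have h3 : 0 <= t * d `^ ((p - 2) / 2) by rewrite mulr_ge0 ?powR_ge0.
  have h4 := powR_ge0 t (p / 2); rewrite ler_norml.
  by apply/andP; split; lra.
have Lr : rtr s (fc (fun t => t * k n.+1%:R^-1 t) Y) `^ p^-1 @[n --> \oo] --> rtr s (fc (pw (p / 2)) Y) `^ p^-1.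
  apply: powR_cvg_seq; [by rewrite invr_gt0| | |exact: rtr_olim L].
    move=> n; apply: rtr_pos; apply: (fc_pos (ctk _ (d0 n)) pY) => t /andP[t0 _].
    by rewrite mulr_ge0 ?powR_ge0.
  by apply: rtr_pos; apply: (fc_pos (contp_powR p20) pY) => t _; exact: powR_ge0.
exact: (lim_le Lr (cvg_cst C) (fun n => key _ (d0 n))).
Qed.

Section Norm.
Variables (e : bop R I) (s : seq I).
Hypothesis he : corner N D e s.
Variables (p q : R).
Hypotheses (p1 : 1 < p) (pq : p^-1 + q^-1 = 1).

Let p0 : 0 < p. Proof. exact: lt_trans p1. Qed.
Let q0 : 0 < q. Proof. by have [] := conj_exp p1 pq. Qed.

Lemma calg_dual P y : N y -> N (dual_elt P y).
Proof.
move=> Ny; have Nsy := calg_star hN Ny.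
by apply: (calgM hN) => //; apply: (calg_pev hN); exact: (calgM hN).
Qed.

Lemma dual_supp f g y P : star g = g -> star f = f -> f * y = y -> y * g = y ->
  g * dual_elt P y = dual_elt P y /\ dual_elt P y * f = dual_elt P y.
Proof.
move=> sg sf fy yg; have gy : g * star y = star y by rewrite -{1}sg -starM yg.
have yf : star y * f = star y by rewrite -{1}sf -starM fy.
split; rewrite /dual_elt; first by rewrite mulrA gy.
have h : f * (y * star y) = y * star y * f by rewrite mulrA fy -mulrA yf.
by rewrite -mulrA -(pev_intertwine P h) mulrA yf.
Qed.

Lemma inc_dual P y : inc e y -> inc e (dual_elt P y).
Proof. by move=> [ey ye]; exact: dual_supp (corner_star he) (corner_star he) ey ye. Qed.

Lemma rtr_pairing x w : N x -> inc e x -> N w -> inc e w -> rtr s (x * w) <= np p s x * np q s w.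
Proof.
move=> Nx ix Nw iw; rewrite rtr_tr; apply: Re_le_sqmod; first by rewrite mulr_ge0 ?np_ge0.
have ee := corner_id he; have [ew we] := iw.
exact: (hoelder_collect (np_star he q0 Nw iw) (np_star he p0 Nx ix)
  (split_hoelder hN hD he he he ee ee p0 q0 pq Nx Nw ew we)).
Qed.

Lemma np_triangle x y : N x -> inc e x -> N y -> inc e y -> np p s (x + y) <= np p s x + np p s y.
Proof.
move=> Nx ix Ny iy; have Nxy := calgD hN Nx Ny; have ixy := incD ix iy.
apply: (duality he p1 pq Nxy ixy) => [|P]; first by rewrite addr_ge0 ?np_ge0.
have Nw := calg_dual P Nxy; have iw := inc_dual P ixy.
rewrite [X in rtr s X]mulrDl rtrD mulrDl.
by apply: lerD; exact: rtr_pairing.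
Qed.

(** Smallness on one side suffices: [split_hoelder] with different supports bounds a compression by
    a geometric mean of a norm seen from [f] and one seen from [g]. With [f = g = e] it shows that
    compressions are contractive. *)
Lemma np_cut f g sf sg x : corner N D f sf -> corner N D g sg -> e * f = f -> e * g = g -> N x ->
  np p s (f * x * g) <= Num.sqrt (np p sf (star x) * np p sg x).
Proof.
move=> hf hg ef eg Nx; set y := f * x * g.
have Ny : N y by apply: (calgM hN); [apply: (calgM hN) => //; exact: cornerN hf|exact: cornerN hg].
have ge : g * e = g by rewrite -(corner_star he) -(corner_star hg) -starM eg.
have fe : f * e = f by rewrite -(corner_star he) -(corner_star hf) -starM ef.
have iy : inc e y by split; rewrite /y; [rewrite !mulrA ef|rewrite -mulrA ge].
have fy : f * y = y by rewrite /y !mulrA (corner_id hf).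
have yg : y * g = y by rewrite /y -mulrA (corner_id hg).
apply: (duality he p1 pq Ny iy) => [|P]; first exact: sqrtr_ge0.
have Nw := calg_dual P Ny; have iw := inc_dual P iy.
have [gw wf] := dual_supp P (corner_star hg) (corner_star hf) fy yg.
rewrite rtr_tr; apply: Re_le_sqmod; first by rewrite mulr_ge0 ?sqrtr_ge0 ?np_ge0.
have -> : tr s (y * dual_elt P y) = tr s (x * dual_elt P y).
  rewrite {1}/y -!mulrA gw (tr_comm hN hD he (cornerN hf)); last 2 first.
  - exact: (calgM hN).
  - by rewrite /comm_e ef fe.
  by rewrite -mulrA wf.
exact: (hoelder_collect2 (np_ge0 _ _ _) (np_ge0 _ _ _) (np_star he q0 Nw iw)
  (split_hoelder hN hD he hf hg ef eg p0 q0 pq Nx Nw gw wf)).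
Qed.

Lemma np_sq x : np p s (star x * x) = np (2 * p) s x ^+ 2.
Proof.
have px := posop_star x; rewrite /np /apow (proj1 px).
have c2 : contp (fun t : R => t * t) by apply: contpM; exact: contp_id.
have cp : contp (pw (p / 2)) by apply: contp_powR; rewrite divr_gt0.
have -> : star x * x * (star x * x) = fc (fun t => t * t) (star x * x).
  by rewrite (fcM (@contp_id R) (@contp_id R) px) (fc_id px).
rewrite (fc_comp c2 cp px) => [|t t0]; last exact: mulr_ge0.
rewrite (_ : 2 * p / 2 = p); last by field.
rewrite (fc_ext (g := pw p) _ px) => [||t /andP[t0 _]]; last 2 first.
- by apply: (@contp_comp R _ (pw (p / 2))) => // t t0; exact: mulr_ge0.
- by rewrite -expr2 -powR_mulrn // -powRrM; congr (_ `^ _); field.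
rewrite -powR_mulrn ?powR_ge0 // -powRrM; congr (_ `^ _); rewrite invfM mulrC mulrA mulfV ?mul1r //.
Qed.

(** Hoelder's inequality from L_2p times L_2p to L_p. By duality it suffices to bound the trace of
    [x y^* w], and in [split_hoelder2] the p-th powers of [x x^*] and of [y y^*] are 2p-th powers of
    [|x^*|] and [|y^*|]. *)
Lemma np_mul x y : N x -> inc e x -> N y -> inc e y ->
  np p s (x * star y) <= np (2 * p) s x * np (2 * p) s y.
Proof.
move=> Nx ix Ny iy; have Nsy := calg_star hN Ny; have isy := inc_star he iy.
have Nz : N (x * star y) by exact: (calgM hN).
have iz := incM ix isy.
apply: (duality he p1 pq Nz iz) => [|P]; first by rewrite mulr_ge0 ?np_ge0.
have Nw := calg_dual P Nz; have iw := inc_dual P iz; have [ew we] := iw.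
rewrite rtr_tr; apply: Re_le_sqmod; first by rewrite !mulr_ge0 ?np_ge0.
have ee := corner_id he; have p20 : 0 < 2 * p by rewrite mulr_gt0.
have E z : rtr s (fc (pw p) (z * star z)) `^ p^-1 = np (2 * p) s (star z) ^+ 2.
  rewrite -np_sq starK /np /apow (proj1 (posop_starr z)).
  congr (rtr s _ `^ _); have pz := posop_starr z.
  have c2 : contp (fun t : R => t * t) by apply: contpM; exact: contp_id.
  have cp : contp (pw (p / 2)) by apply: contp_powR; rewrite divr_gt0.
  have -> : z * star z * (z * star z) = fc (fun t => t * t) (z * star z).
    by rewrite (fcM (@contp_id R) (@contp_id R) pz) (fc_id pz).
  rewrite (fc_comp c2 cp pz) => [|t t0]; last exact: mulr_ge0.
  apply: (fc_ext (contp_powR p0) pz) => t /andP[t0 _].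
  by rewrite -expr2 -powR_mulrn // -powRrM; congr (_ `^ _); field.
have := split_hoelder2 hN hD he he he ee ee p0 q0 pq Nx Nsy Nw ew we; rewrite starK => h.
exact: (hoelder_collect3 (np_star he q0 Nw iw) (np_star he p20 Nx ix) (np_star he p20 Ny iy) (E x) (E y) h).
Qed.

End Norm.
End Duality.

(** * Semifinite Lp-norms *)

Section StrongLimit.
Context {R : realType} {I : choiceType}.
Implicit Types (x y z a b : bop R I) (u v : nat -> bop R I).

Definition slim u y := forall xi, l2norm (u n xi - y xi) @[n --> \oo] --> (0 : R).

Lemma cvg0_le (f g : nat -> R) : (forall n, 0 <= f n <= g n) -> g @ \oo --> (0 : R) -> f @ \oo --> (0 : R).
Proof. by move=> h; apply: lim_sq0 => n; have /andP[h0 h1] := h n; rewrite ger0_norm. Qed.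

Lemma slim_cst a : slim (fun=> a) a.
Proof. by move=> xi; rewrite (_ : (fun n => _) = fun=> 0); [exact: cvg_cst|apply/funext => n; rewrite subrr l2norm0]. Qed.

Lemma slimD u v y z : slim u y -> slim v z -> slim (fun n => u n + v n) (y + z).
Proof.
move=> uy vz xi; apply: (cvg0_le (g := fun n => l2norm (u n xi - y xi) + l2norm (v n xi - z xi))) => [n|].
  apply/andP; split; first exact: l2norm_ge0.
  have -> : (u n + v n) xi - (y + z) xi = (u n xi - y xi) + (v n xi - z xi) by rewrite !bopDE opprD addrACA.
  exact: l2normD.
by rewrite -[X in _ --> X]addr0; apply: cvgD.
Qed.

Lemma slimM u v y z K : (forall n, nrm (u n) <= K) -> slim u y -> slim v z -> slim (fun n => u n * v n) (y * z).
Proof.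
move=> uK uy vz xi.
apply: (cvg0_le (g := fun n => K * l2norm (v n xi - z xi) + l2norm (u n (z xi) - y (z xi)))) => [n|].
  apply/andP; split; first exact: l2norm_ge0.
  have -> : (u n * v n) xi - (y * z) xi = u n (v n xi) - u n (z xi) + (u n (z xi) - y (z xi)).
    by rewrite !bopM addrA subrK.
  apply: le_trans (l2normD _ _) _; apply: lerD => //; rewrite -bopB.
  by apply: le_trans (l2norm_bop _ _) _; apply: ler_wpM2r => //; exact: l2norm_ge0.
rewrite -[X in _ --> X]addr0 -[X in X + _](mulr0 K); apply: cvgD; last exact: uy.
by apply: cvgM; [exact: cvg_cst|exact: vz].
Qed.

Lemma slim_pev P u y K : (forall n, nrm (u n) <= K) -> slim u y -> slim (fun n => pev P (u n)) (pev P y).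
Proof.
move=> uK uy; elim/poly_ind: P => [|P c IH].
  by rewrite (_ : (fun n => _) = fun=> 0) ?pev0; [exact: slim_cst|apply/funext => n; rewrite pev0].
rewrite (_ : (fun n => _) = fun n => u n * pev P (u n) + rs c 1); last first.
  by apply/funext => n; rewrite mulrC pevD pevM pevX pevC.
rewrite mulrC pevD pevM pevX pevC; apply: slimD; [exact: slimM uK uy IH|exact: slim_cst].
Qed.

(** On norm-bounded sets multiplication, hence every polynomial, is strongly continuous, and [f] is
    a uniform limit of polynomials on the common interval [0, L]. *)
Lemma slim_fc f u y K : contp f -> (forall n, posop (u n)) -> posop y -> (forall n, nrm (u n) <= K) ->
  slim u y -> slim (fun n => fc f (u n)) (fc f y).
Proof.
move=> cf pu py uK uy xi; pose L := Num.max (Num.max K (nrm y)) 1.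
have L0 : 0 < L by rewrite lt_max ltr01 orbT.
apply/cvgrPdist_le => e e0; pose d := e / (2 * l2norm xi + 1).
have n0 : 0 <= l2norm xi := l2norm_ge0 xi.
have d0 : 0 < d by rewrite divr_gt0 // ltr_wpDl // mulr_ge0.
have [P hP] := weierstrass cf L0 d0.
have dE : 2 * (d * l2norm xi) + d = e.
  rewrite /d; have : 2 * l2norm xi + 1 != 0 by rewrite gt_eqF // ltr_wpDl // mulr_ge0.
  move: (l2norm xi) => w w0; field; exact: w0.
have := slim_pev P uK uy xi => /cvgrPdist_le/(_ _ d0); apply: filterS => n.
rewrite !sub0r !normrN !ger0_norm ?l2norm_ge0 // => h.
have a1 : nrm (pev P (u n) - fc f (u n)) <= d.
  apply: (fc_near cf (pu n) (ltW d0)) => t /andP[t0 tu]; apply: hP; rewrite t0 /=.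
  by apply: le_trans tu _; rewrite !le_max uK.
have a2 : nrm (pev P y - fc f y) <= d.
  apply: (fc_near cf py (ltW d0)) => t /andP[t0 tu]; apply: hP; rewrite t0 /=.
  by rewrite !le_max tu orbT.
have b1 : l2norm ((pev P (u n) - fc f (u n)) xi) <= d * l2norm xi.
  by apply: le_trans (l2norm_bop _ _) _; exact: ler_wpM2r.
have b2 : l2norm ((pev P y - fc f y) xi) <= d * l2norm xi.
  by apply: le_trans (l2norm_bop _ _) _; exact: ler_wpM2r.
have -> : fc f (u n) xi - fc f y xi = (pev P (u n) xi - pev P y xi) -
    (pev P (u n) - fc f (u n)) xi + (pev P y - fc f y) xi.
  rewrite !bopDE !bopNE; move: (pev P (u n) xi) (fc f (u n) xi) (pev P y xi) (fc f y xi) => A B C E.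
  by rewrite opprB [A - C + _]addrC !addrA !subrK.
apply: le_trans (l2normD _ _) _; rewrite -dE mulr_natl mulr2n [leRHS]addrAC; apply: lerD => //.
apply: le_trans (l2normD _ _) _; rewrite l2normN [leRHS]addrC; exact: (lerD h b1).
Qed.

Lemma slim_dg u y i : slim u y -> dg (u n) i @[n --> \oo] --> dg y i.
Proof.
move=> uy; apply/subr_cvg0; apply: (@lim_sq0 _ _ (fun n => l2norm (u n (delta i) - y (delta i)))) => [n|]; last exact: uy.
rewrite -dgB /dg bopDE bopNE; apply: le_trans (abs_Re_ip_le _ _) _.
by rewrite l2normE nsq_delta sqrtr1 mul1r.
Qed.

Lemma nrm_cstar a : nrm a ^+ 2 <= nrm (star a * a).
Proof.
rewrite -[leRHS]sqr_sqrtr ?nrm_ge0 // ler_sqr ?nnegrE ?nrm_ge0 ?sqrtr_ge0 //.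
apply/nrmP => [|xi]; first exact: sqrtr_ge0.
rewrite sqr_sqrtr ?nrm_ge0 // nsqE -ip_star -bopM.
apply: le_trans (ler_norm _) _; apply: le_trans (abs_Re_ip_le _ _) _.
apply: le_trans (ler_wpM2l (l2norm_ge0 _) (l2norm_bop _ _)) _.
by rewrite mulrCA -expr2 sqr_l2norm.
Qed.

Lemma nrm_proj (e : bop R I) : star e = e -> e * e = e -> nrm e <= 1.
Proof.
move=> se ee; have := nrm_cstar e; rewrite se ee; have := nrm_ge0 e; move: (nrm e) => t t0 h.
case: (leP t 1) => // t1; move: h; rewrite expr2 leNgt -[X in X < _]mulr1 ltr_pM2l ?t1 //.
exact: lt_trans t1.
Qed.
End StrongLimit.

Lemma powR_le_inj {R : realType} (r a b : R) : 0 < r -> 0 <= a -> 0 <= b -> a `^ r <= b `^ r -> a <= b.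
Proof.
move=> r0 a0 b0 h; have := ge0_ler_powR (ltW (_ : 0 < r^-1)) (powR_ge0 a r) (powR_ge0 b r) h.
by rewrite -!powRrM mulfV ?gt_eqF // !powRr1 //; apply; rewrite invr_gt0.
Qed.

Lemma powRK {R : realType} (r a : R) : 0 < r -> 0 <= a -> (a `^ r) `^ r^-1 = a.
Proof. by move=> r0 a0; rewrite -powRrM mulfV ?gt_eqF // powRr1. Qed.

Section Semifinite.
Context {R : realType} {I : choiceType}.
Implicit Types (x y z a b w : bop R I) (q r : R).

Record cuts (N : set (bop R I)) (D : set I) (e : nat -> bop R I) (s : nat -> seq I) : Prop := Cuts {
  cutsP : forall n, corner N D (e n) (s n);
  cuts_mono : forall m n, (m <= n)%N -> e n * e m = e m;
  cuts_cover : forall i, D i -> exists n, i \in s n;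
  cuts_lim : slim e 1 }.

Variables (N : set (bop R I)) (D : set I).
Hypotheses (hN : cstar_alg N) (hD : tracial_on N D).
Variables (e : nat -> bop R I) (s : nat -> seq I).
Hypothesis hc : cuts N D e s.
Variables (p q : R).
Hypotheses (p1 : 1 < p) (pq : p^-1 + q^-1 = 1).

Let p0 : 0 < p. Proof. exact: lt_trans p1. Qed.
Let p20 : 0 < p / 2. Proof. by rewrite divr_gt0. Qed.
Let ip0 : 0 < p^-1. Proof. by rewrite invr_gt0. Qed.

Definition Lb x := N x /\ (dsum D (apow p x) < +oo)%E.
Fact rn_seal : {f : bop R I -> R | forall x, f x = fine (dsum D (apow p x)) `^ p^-1}.
Proof. by exists (fun x => fine (dsum D (apow p x)) `^ p^-1). Qed.
Definition rn := sval rn_seal.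
Lemma rnE x : rn x = fine (dsum D (apow p x)) `^ p^-1. Proof. exact: svalP rn_seal x. Qed.

Lemma rn_ge0 x : 0 <= rn x. Proof. by rewrite rnE powR_ge0. Qed.

Lemma dsum_fin x : Lb x -> dsum D (apow p x) = (rn x `^ p)%:E.
Proof.
move=> [_ h]; have d0 := dsum_ge0 D (apow_pos x p0).
rewrite rnE -powRrM mulVf ?gt_eqF // powRr1 ?fine_ge0 //.
by rewrite fineK // ge0_fin_numE.
Qed.

Lemma Lb_le x C : N x -> 0 <= C -> (dsum D (apow p x) <= (C `^ p)%:E)%E -> Lb x /\ rn x <= C.
Proof.
move=> Nx C0 h; have fx : Lb x by split=> //; apply: le_lt_trans h _; exact: ltry.
split=> //; move: h; rewrite (dsum_fin fx) lee_fin => h.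
exact: powR_le_inj p0 (rn_ge0 x) C0 h.
Qed.

Lemma Lb_corner n x : N x -> inc (e n) x -> Lb x /\ rn x = np p (s n) x.
Proof.
move=> Nx [_ xe]; have h := dsum_corner (cutsP hc n) (apow_pos x p0) (apow_supp p0 xe).
by split; [split=> //; rewrite h ltry|rewrite rnE h].
Qed.

Lemma Lb_star x : Lb x -> Lb (star x) /\ rn (star x) = rn x.
Proof.
move=> [Nx h]; have E : dsum D (apow p (star x)) = dsum D (apow p x).
  by rewrite /apow starK (dsum_powR_star hN hD p20 Nx).
by split; [split; [exact: (calg_star hN)|rewrite E]|rewrite !rnE E].
Qed.

Lemma np_le_rn (r : seq I) x : uniq r -> (forall i, i \in r -> D i) -> Lb x -> np p r x <= rn x.
Proof.
move=> ur rD fx; have := sum_dg_le_dsum (apow p x) ur rD; rewrite (dsum_fin fx) lee_fin -rtr_dg => h.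
rewrite -[leRHS](powRK p0 (rn_ge0 x)).
by apply: ge0_ler_powR => //; rewrite ?nnegrE ?(ltW ip0) ?powR_ge0 //; exact/rtr_pos/apow_pos.
Qed.

Lemma np_s_le n x : Lb x -> np p (s n) x <= rn x.
Proof.
apply: np_le_rn; first exact: corner_uniq (cutsP hc n).
by move=> i si; have [] := corner_in (cutsP hc n) si.
Qed.

Definition cut n x := e n * x * e n.

Lemma calg_cut n x : N x -> N (cut n x).
Proof. by move=> Nx; have Ne := cornerN (cutsP hc n); do 2 apply: (calgM hN) => //. Qed.
Lemma inc_cut n x : inc (e n) (cut n x).
Proof. by split; rewrite /cut; [rewrite !mulrA|rewrite -mulrA]; rewrite (corner_id (cutsP hc n)). Qed.

Lemma rn_cut n x : Lb x -> Lb (cut n x) /\ rn (cut n x) <= rn x.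
Proof.
move=> fx; have [Nx _] := fx; have hn := cutsP hc n; have ee := corner_id hn.
have [fl E] := Lb_corner (calg_cut n Nx) (inc_cut n x); split=> //; rewrite E.
apply: le_trans (np_cut hN hD hn p1 pq hn hn ee ee Nx) _.
have [fsx Es] := Lb_star fx; rewrite -(ger0_norm (rn_ge0 x)) -sqrtr_sqr expr2.
apply: ler_wsqrtr; apply: ler_pM; [exact: np_ge0|exact: np_ge0|rewrite -{1}Es; exact: np_s_le|exact: np_s_le].
Qed.

Lemma slim_cut x : slim (fun n => cut n x) x.
Proof.
have e1 n : nrm (e n) <= 1 by apply: nrm_proj; [exact: corner_star (cutsP hc n)|exact: corner_id (cutsP hc n)].
have h := slimM (K := nrm x) _ (slimM e1 (cuts_lim hc) (slim_cst x)) (cuts_lim hc).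
rewrite mul1r mulr1 in h; apply: h => n.
by apply: le_trans (nrmM _ _) _; rewrite -[leRHS]mul1r; apply: ler_wpM2r; rewrite ?nrm_ge0.
Qed.

Lemma nrm_cut n x : nrm (cut n x) <= nrm x.
Proof.
have e1 : nrm (e n) <= 1 by apply: nrm_proj; [exact: corner_star (cutsP hc n)|exact: corner_id (cutsP hc n)].
apply: le_trans (nrmM _ _) _; rewrite -[leRHS]mulr1; apply: ler_pM; rewrite ?nrm_ge0 //.
by apply: le_trans (nrmM _ _) _; rewrite -[leRHS]mul1r; apply: ler_wpM2r; rewrite ?nrm_ge0.
Qed.

Lemma star_cut n x : star (cut n x) = cut n (star x).
Proof. by rewrite /cut !starM (corner_star (cutsP hc n)) mulrA. Qed.

(** The compressions converge strongly and boundedly to [x], so the diagonal entries of their p-th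
    powers converge by [slim_fc]; every finite partial sum for [x] is therefore at most [C^p]. *)
Lemma fatou n0 x C : N x -> 0 <= C -> (forall n, (n0 <= n)%N -> rn (cut n x) <= C) -> Lb x /\ rn x <= C.
Proof.
move=> Nx C0 h; apply: Lb_le => //; apply: dsum_le => r ur rD; rewrite lee_fin.
have L : slim (fun n => apow p (cut (n + n0) x)) (apow p x).
  have hs : slim (fun n => star (cut (n + n0) x) * cut (n + n0) x) (star x * x).
    apply: (slimM (K := nrm x)) => [n|xi|xi]; first by rewrite nrm_star nrm_cut.
      have -> : (fun n => l2norm (star (cut (n + n0) x) xi - star x xi)) =
        (fun n => l2norm (cut (n + n0) (star x) xi - star x xi)) by apply/funext => n; rewrite star_cut.
      by rewrite (cvg_shiftn n0 (fun n => l2norm (cut n (star x) xi - star x xi))); exact: slim_cut.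
    by rewrite (cvg_shiftn n0 (fun n => l2norm (cut n x xi - x xi))); exact: slim_cut.
  apply: (slim_fc (K := nrm x * nrm x)) => [|n||n|//]; [exact: contp_powR|exact: posop_star|exact: posop_star|].
  by apply: le_trans (nrmM _ _) _; rewrite nrm_star; apply: ler_pM; rewrite ?nrm_ge0 ?nrm_cut.
have Ls : \sum_(i <- r) dg (apow p (cut (n + n0) x)) i @[n --> \oo] --> \sum_(i <- r) dg (apow p x) i.
  elim: (r) => [|i t IH].
    by rewrite big_nil (_ : (fun n => _) = fun=> 0); [exact: cvg_cst|apply/funext => n; rewrite big_nil].
  rewrite big_cons (_ : (fun n => _) = (fun n => dg (apow p (cut (n + n0) x)) i + \sum_(j <- t) dg (apow p (cut (n + n0) x)) j)).
    by apply: cvgD => //; exact: slim_dg.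
  by apply/funext => n; rewrite big_cons.
apply: (lim_le Ls (cvg_cst (C `^ p))) => n.
have [fl _] := Lb_corner (calg_cut (n + n0) Nx) (inc_cut (n + n0) x).
rewrite -lee_fin; apply: le_trans (sum_dg_le_dsum _ ur rD) _; rewrite (dsum_fin fl) lee_fin.
by apply: ge0_ler_powR; rewrite ?nnegrE ?(ltW p0) ?rn_ge0 // h // leq_addl.
Qed.

Lemma rn_triangle x y : Lb x -> Lb y -> Lb (x + y) /\ rn (x + y) <= rn x + rn y.
Proof.
move=> fx fy; have [[Nx _] [Ny _]] := (fx, fy).
apply: (@fatou 0); [exact: (calgD hN)|by rewrite addr_ge0 ?rn_ge0|move=> n _].
have -> : cut n (x + y) = cut n x + cut n y by rewrite /cut mulrDr mulrDl.
have Nx' := calg_cut n Nx; have Ny' := calg_cut n Ny; have ix := inc_cut n x; have iy := inc_cut n y.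
have [_ ->] := Lb_corner (calgD hN Nx' Ny') (incD ix iy).
apply: le_trans (np_triangle hN hD (cutsP hc n) p1 pq Nx' ix Ny' iy) _.
have [_ <-] := Lb_corner Nx' ix; have [_ <-] := Lb_corner Ny' iy.
by apply: lerD; [have [] := rn_cut n fx|have [] := rn_cut n fy].
Qed.

Lemma apow_scale (k : R[i]) x : apow p (k *: x) = rs (Num.sqrt (sqmod k) `^ p) (apow p x).
Proof.
have px := posop_star x; have cp := contp_powR p20.
have E : star (k *: x) * (k *: x) = rs (sqmod k) (star x * x).
  rewrite starZ bscaleAl bscaleAr scalerA rsE; congr (_ *: _).
  by case: (k) => u v; apply/eqP; rewrite eq_complex /sqmod /=; apply/andP; split; apply/eqP; ring.
rewrite /apow E (fc_scale cp px (sqmod_ge0 k)).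
have ck : contp (fun t => sqmod k `^ (p / 2) * t `^ (p / 2)) by exact: contpZ.
rewrite -(fcZ _ cp px) -(fc_ext ck px (g := fun t => (sqmod k * t) `^ (p / 2))) => [|t /andP[t0 _]].
  congr (fc _ _); apply/funext => t; congr (_ * _).
  rewrite -{1}(sqr_sqrtr (sqmod_ge0 k)) -powR_mulrn ?sqrtr_ge0 // -powRrM.
  by congr (_ `^ _); field.
by rewrite powRM ?sqmod_ge0.
Qed.

Lemma dsum_rs c x : 0 <= c -> posop x -> dsum D (rs c x) = (c%:E * dsum D x)%E.
Proof.
move=> c0 px; rewrite /dsum [LHS]esum_mkcond [X in (_ * X)%E]esum_mkcond.
pose F i := if i \in D then dg x i else 0.
have F0 i : 0 <= F i by rewrite /F; case: (i \in D) => //; exact: dg_pos.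
have := nnsumZ c0 F0.
rewrite /nnsum => h; apply: etrans (etrans h _).
  apply: eq_esum => i _; rewrite /F; case: (i \in D); last by rewrite mulr0.
  by rewrite /dg rsE bopZE ipZr Re_realM.
by congr (_ * _)%E; apply: eq_esum => i _; rewrite /F; case: (i \in D).
Qed.

Lemma rn_scale (k : R[i]) x : Lb x -> Lb (k *: x) /\ rn (k *: x) = Num.sqrt (sqmod k) * rn x.
Proof.
move=> fx; have [Nx _] := fx.
have E : dsum D (apow p (k *: x)) = ((Num.sqrt (sqmod k) * rn x) `^ p)%:E.
  rewrite apow_scale (dsum_rs (powR_ge0 _ _) (apow_pos x p0)) (dsum_fin fx) -EFinM powRM ?sqrtr_ge0 ?rn_ge0 //.
split; first by split; [exact: (calgZ hN)|rewrite E ltry].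
by rewrite rnE E /= powRK // mulr_ge0 ?sqrtr_ge0 ?rn_ge0.
Qed.

Lemma s_mono m n i : (m <= n)%N -> i \in s m -> i \in s n.
Proof. by move=> mn; exact: corner_sub (cutsP hc n) (cutsP hc m) (cuts_mono hc mn) i. Qed.

Lemma sum_dg_sub (r t : seq I) x : posop x -> uniq r -> uniq t -> {subset r <= t} ->
  \sum_(i <- r) dg x i <= \sum_(i <- t) dg x i.
Proof.
move=> px ur ut rt; rewrite [leRHS](bigID (fun i => i \in r)) /=.
have -> : \sum_(i <- t | i \in r) dg x i = \sum_(i <- r) dg x i.
  rewrite -big_filter; apply: perm_big; apply: uniq_perm => [|//|i]; first exact: filter_uniq.
  by rewrite mem_filter; apply: andb_idr; exact: rt.
by rewrite lerDl sumr_ge0 // => i _; exact: dg_pos.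
Qed.

Lemma tail_small x d : Lb x -> 0 < d ->
  exists n0, forall n, (n0 <= n)%N -> rn x `^ p - rtr (s n) (apow p x) <= d.
Proof.
move=> fx d0; have pa := apow_pos x p0.
have [r [ur rD hr]] : exists r : seq I, [/\ uniq r, forall i, i \in r -> D i &
    rn x `^ p - d < \sum_(i <- r) dg (apow p x) i].
  apply: contrapT => h; have : (dsum D (apow p x) <= (rn x `^ p - d)%:E)%E.
    apply: dsum_le => r ur rD; rewrite lee_fin leNgt; apply/negP => hr; apply: h.
    by exists r.
  by rewrite (dsum_fin fx) lee_fin lerDl oppr_ge0 leNgt d0.
have [n0 hn0] : exists n0, {subset r <= s n0}.
  elim: (r) rD => [|i t IH] tD; first by exists 0%N.
  have [n1 h1] := IH (fun j jt => tD j (mem_behead (s := i :: t) jt)).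
  have [n2 h2] := cuts_cover hc (tD i (mem_head _ _)).
  exists (maxn n1 n2) => j; rewrite inE => /orP[/eqP ->|/h1 jt].
    by apply: s_mono h2; exact: leq_maxr.
  by apply: s_mono jt; exact: leq_maxl.
exists n0 => n nn; rewrite lerBlDr addrC -lerBlDr; apply: le_trans (ltW hr) _; rewrite rtr_dg.
apply: sum_dg_sub => //; first exact: corner_uniq (cutsP hc n).
by move=> i /hn0; exact: s_mono.
Qed.

Lemma corner_diff m n : (n <= m)%N -> corner N D (e m - e n) [seq i <- s m | i \notin s n].
Proof.
move=> nm; have hm := cutsP hc m; have hn := cutsP hc n; have mn := cuts_mono hc nm.
have nm' : e n * e m = e n by rewrite -(corner_star hn) -(corner_star hm) -starM mn.
split.
- by apply: (calgB hN); [exact: cornerN hm|exact: cornerN hn].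
- by rewrite starB (corner_star hm) (corner_star hn).
- by rewrite mulrBl !mulrBr mn nm' (corner_id hm) (corner_id hn) subrr subr0.
- exact/filter_uniq/(corner_uniq hm).
- move=> i; rewrite mem_filter => /andP[ni mi]; have [Di ei] := corner_in hm mi.
  by split=> //; rewrite bopDE bopNE ei (corner_out hn Di ni) subr0.
move=> i Di; rewrite mem_filter negb_and negbK bopDE bopNE => /orP[ni|mi].
  by rewrite (corner_in hm (s_mono nm ni)).2 (corner_in hn ni).2 subrr.
have ni : i \notin s n by apply: contra mi; exact: s_mono.
by rewrite (corner_out hm Di mi) (corner_out hn Di ni) subrr.
Qed.

Lemma np_diff_le m n x d : (n <= m)%N -> Lb x -> 0 <= d -> rn x `^ p - rtr (s n) (apow p x) <= d ->
  np p [seq i <- s m | i \notin s n] x <= d `^ p^-1.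
Proof.
move=> nm fx d0 h; have pa := apow_pos x p0; have hm := cutsP hc m.
apply: ge0_ler_powR; rewrite ?nnegrE ?(ltW ip0) ?rtr_pos //.
apply: le_trans h; rewrite lerBrDr !rtr_dg -big_cat /=.
rewrite -lee_fin -(dsum_fin fx); apply: sum_dg_le_dsum.
  rewrite cat_uniq filter_uniq ?(corner_uniq hm) //= (corner_uniq (cutsP hc n)) andbT.
  by apply/hasPn => i ni; rewrite /= mem_filter ni.
move=> i; rewrite mem_cat mem_filter => /orP[/andP[_]|].
  by move=> /(corner_in hm)[].
by move=> /(corner_in (cutsP hc n))[].
Qed.

(** For [m >= n] the compression of [x - cut n x] by [e m] is [(e m - e n) x (e m) + (e n) x (e m -
    e n)]. Each term has a small tail on one side, so [np_cut] makes it small, and [fatou] removes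
    [m]. *)
Lemma cut_approx x d : Lb x -> 0 < d ->
  exists n0, forall n, (n0 <= n)%N -> Lb (x - cut n x) /\ rn (x - cut n x) <= d.
Proof.
move=> fx d0; have [Nx _] := fx; have [fs Es] := Lb_star fx; have [Ns _] := fs.
pose X := rn x; have X0 : 0 <= X := rn_ge0 x.
(* The tails of [x] and of [x^*] will be at most [c]; the geometric mean [sqrt (c X)] from [np_cut]
   is then at most [d / 2]. *)
pose c := (d / 2) ^+ 2 / (X + 1); have c0 : 0 < c by rewrite divr_gt0 ?exprn_gt0 ?divr_gt0 ?ltr_wpDl.
have [n1 h1] := tail_small fx (powR_gt0 p c0); have [n2 h2] := tail_small fs (powR_gt0 p c0).
have cX : Num.sqrt (c * X) <= d / 2.
  have d2 : 0 <= d / 2 by rewrite divr_ge0 // ltW.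
  rewrite -[leRHS](ger0_norm d2) -sqrtr_sqr; apply: ler_wsqrtr; rewrite /c mulrAC ler_pdivrMr ?ltr_wpDl //.
  by apply: ler_wpM2l; [exact: sqr_ge0|rewrite lerDl].
have cE : (c `^ p) `^ p^-1 = c by rewrite powRK // ltW.
exists (maxn n1 n2) => n; rewrite geq_max => /andP[nn1 nn2].
apply: (@fatou n); [by apply: (calgB hN) => //; exact: calg_cut|exact: ltW|move=> m nm].
have hm := cutsP hc m; have hn := cutsP hc n; have mn := cuts_mono hc nm.
have nm' : e n * e m = e n by rewrite -(corner_star hn) -(corner_star hm) -starM mn.
have -> : cut m (x - cut n x) = (e m - e n) * x * e m + e n * x * (e m - e n).
  rewrite /cut mulrBr !mulrBl !mulrBr !mulrA mn -(mulrA _ (e n) (e m)) nm'.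
  by rewrite addrA subrK.
have hf := corner_diff nm.
have ef : e m * (e m - e n) = e m - e n by rewrite mulrBr mn (corner_id hm).
have fe : (e m - e n) * e m = e m - e n by rewrite mulrBl nm' (corner_id hm).
have N1 : N ((e m - e n) * x * e m) by exact: (calgM hN (calgM hN (cornerN hf) Nx) (cornerN hm)).
have N2 : N (e n * x * (e m - e n)) by exact: (calgM hN (calgM hN (cornerN hn) Nx) (cornerN hf)).
have i1 : inc (e m) ((e m - e n) * x * e m) by split; rewrite ?mulrA ?ef // -mulrA (corner_id hm).
have i2 : inc (e m) (e n * x * (e m - e n)) by split; rewrite ?mulrA ?mn // -mulrA fe.
have [_ ->] := Lb_corner (calgD hN N1 N2) (incD i1 i2).
apply: le_trans (np_triangle hN hD hm p1 pq N1 i1 N2 i2) _.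
have b1 := np_diff_le nm fx (powR_ge0 c p) (h1 n nn1); rewrite cE in b1.
have b2 := np_diff_le nm fs (powR_ge0 c p) (h2 n nn2); rewrite cE in b2.
rewrite (_ : d = d / 2 + d / 2); last by field.
apply: lerD.
  apply: le_trans (np_cut hN hD hm p1 pq hf hm ef (corner_id hm) Nx) _; apply: le_trans cX.
  by apply: ler_wsqrtr; apply: ler_pM; [exact: np_ge0|exact: np_ge0|exact: b2|exact: np_s_le].
apply: le_trans (np_cut hN hD hm p1 pq hn hf mn ef Nx) _; apply: le_trans cX.
rewrite (mulrC c); apply: ler_wsqrtr; apply: ler_pM; [exact: np_ge0|exact: np_ge0| |exact: b1].
rewrite /X -Es; exact: np_s_le.
Qed.

End Semifinite.

(** * Density of a weakly dense *-subalgebra *)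

Lemma mul_half_frac {R : realFieldType} (X S : R) : 0 <= S -> 0 < X -> X / (2 * (S + 1)) * S <= X / 2.
Proof.
move=> S0 X0; have S1 : 0 < S + 1 by rewrite ltr_wpDl.
rewrite (_ : X / (2 * (S + 1)) * S = X / 2 * (S / (S + 1))); last by field; apply: lt0r_neq0.
rewrite ler_piMr ?divr_ge0 ?(ltW X0) // ler_pdivrMr // mul1r lerDl //.
Qed.

Lemma sq_sum_le {R : realFieldType} (c u v w : R) : 0 <= c -> c <= u + v -> u ^+ 2 <= w -> v ^+ 2 <= w ->
  c ^+ 2 <= 4 * w.
Proof. by move=> c0 cuv uw vw; have := sqr_ge0 (u - v); nra. Qed.

Section L2Small.
Context {R : realType} {I : choiceType}.
Implicit Types (x y z a b w : bop R I) (q r : R).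
Variables (N : set (bop R I)) (D : set I) (e : bop R I) (s : seq I).
Hypotheses (hN : cstar_alg N) (hD : tracial_on N D) (he : corner N D e s).

Definition n2 x : R := rtr s (star x * x).

Lemma n2_ge0 x : 0 <= n2 x. Proof. exact/rtr_pos/posop_star. Qed.

Lemma inc_comm x : inc e x -> comm_e e x.
Proof. by move=> [ex xe]; rewrite /comm_e ex xe. Qed.

Lemma n2_star x : N x -> inc e x -> n2 (star x) = n2 x.
Proof.
move=> Nx ix; rewrite /n2 starK !rtr_tr (tr_comm hN hD he Nx (calg_star hN Nx)) //.
exact: inc_comm.
Qed.

Lemma n2_mull a x : n2 (a * x) <= nrm a ^+ 2 * n2 x.
Proof.
rewrite /n2 !rtr_nsq mulr_sumr; apply: ler_sum => i _.
by rewrite bopM; exact: opbd_nrm.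
Qed.

Lemma n2_mulr x a : N x -> inc e x -> N a -> comm_e e a -> n2 (x * a) <= n2 x * nrm a ^+ 2.
Proof.
move=> Nx ix Na ca; have [ex xe] := ix.
have ixa : inc e (x * a) by split; rewrite ?mulrA ?ex // -mulrA ca mulrA xe.
rewrite -(n2_star (calgM hN Nx Na) ixa) starM mulrC -(nrm_star a) -(n2_star Nx ix).
exact: n2_mull.
Qed.

Lemma n2_rs c x : n2 (rs c x) = c ^+ 2 * n2 x.
Proof. by rewrite /n2 star_rs rsMl rsMr rsA rtrZ. Qed.

Lemma n2D x y : n2 (x + y) <= 2 * n2 x + 2 * n2 y.
Proof.
rewrite /n2 !rtr_nsq !mulr_sumr -big_split /=; apply: ler_sum => i _.
exact: nsqD_le.
Qed.

Variables (p : R).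
Hypothesis p1 : 1 < p.
Let p0 : 0 < p. Proof. exact: lt_trans p1. Qed.
Let p20 : 0 < p / 2. Proof. by rewrite divr_gt0. Qed.

(** On [0, M] the function [t^(p/2)] lies below an affine function [h + C t]: [h] covers [t <= t0],
    and beyond [t0] the slope alone dominates [M^(p/2)]. The trace of the constant [h] is [h] times
    the size of [s], hence the choice of [h]. *)
Lemma np_small M d : 0 <= M -> 0 < d -> exists2 c, 0 < c &
  forall w, nrm (star w * w) <= M -> n2 w <= c -> np p s w <= d.
Proof.
move=> M0 d0; have dp : 0 < d `^ p := powR_gt0 p d0.
have ss : 0 <= (size s)%:R :> R by [].
pose h : R := d `^ p / (2 * ((size s)%:R + 1)).
have h0 : 0 < h by rewrite divr_gt0 // mulr_gt0 // ltr_wpDl.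
pose t0 := h `^ (p / 2)^-1; have t00 : 0 < t0 := powR_gt0 _ h0.
pose C := M `^ (p / 2) / t0; have C0 : 0 <= C by rewrite divr_ge0 ?powR_ge0 // ltW.
exists (d `^ p / (2 * (C + 1))) => [|w wM wc].
  by rewrite divr_gt0 // mulr_gt0 // ltr_wpDl.
have pw := posop_star w; have cp := contp_powR p20.
have cl : contp (fun t : R => h * 1 + C * t).
  by apply: contpD; [exact: contp_cst|apply: contpZ; exact: contp_id].
have H : rtr s (apow p w) <= h * (size s)%:R + C * n2 w.
  have -> : h * (size s)%:R + C * n2 w = rtr s (fc (fun t => h * 1 + C * t) (star w * w)).
    rewrite fcD //; [|exact: contp_cst|by apply: contpZ; exact: contp_id].
    rewrite rtrD (fcZ C (@contp_id R) pw) (fc_id pw) rtrZ; congr (_ + _).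
    rewrite (fc_cst (h * 1) pw) rtrZ mulr1 rtr_dg; congr (_ * _).
    rewrite -sum1_size natr_sum; apply: eq_bigr => i _.
    by rewrite /dg bop1 -nsqE nsq_delta.
  apply: rtr_mono; apply: (fc_le_pos cp cl pw) => t /andP[t00' tn]; rewrite mulr1.
  have [tt|tt] := leP t t0.
    apply: ler_wpDr; first by rewrite mulr_ge0.
    have ht : t0 `^ (p / 2) = h by rewrite /t0 -powRrM mulVf ?gt_eqF // powRr1 // ltW.
    by rewrite -[leRHS]ht; apply: ge0_ler_powR; rewrite ?nnegrE ?(ltW p20) ?(ltW t00).
  apply: ler_wpDl; first exact: ltW.
  apply: le_trans (_ : M `^ (p / 2) <= _).
    by apply: ge0_ler_powR; rewrite ?nnegrE ?(ltW p20) //; exact: le_trans wM.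
  by rewrite /C mulrAC ler_pdivlMr // ler_wpM2l ?powR_ge0 // ltW.
rewrite /np -(powRK p0 (ltW d0)); apply: ge0_ler_powR; rewrite ?nnegrE ?invr_ge0 ?(ltW p0) ?powR_ge0 //.
  exact/rtr_pos/apow_pos.
apply: (le_trans H); rewrite (_ : d `^ p = d `^ p / 2 + d `^ p / 2); last by field.
apply: lerD.
  exact: mul_half_frac.
by apply: le_trans (ler_wpM2l C0 wc) _; rewrite mulrC; exact: mul_half_frac.
Qed.

Lemma np_small_nrm d : 0 < d -> exists2 c, 0 < c & forall w, nrm w <= c -> np p s w <= d.
Proof.
move=> d0; have [c c0 hc] := np_small ler01 d0.
pose k := Num.min 1 (c / ((size s)%:R + 1)).
have s0 : 0 <= (size s)%:R :> R by [].
have k0 : 0 < k by rewrite lt_min ltr01 divr_gt0 // ltr_wpDl.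
have k1 : k <= 1 by rewrite ge_min lexx.
have kc : k <= c / ((size s)%:R + 1) by rewrite ge_min lexx orbT.
exists k => // w wk; have w0 := nrm_ge0 w.
have ww : nrm (star w * w) <= k.
  apply: le_trans (nrmM _ _) _; rewrite nrm_star.
  by apply: le_trans (ler_pM w0 w0 wk wk) _; apply: ler_piMr => //; exact: ltW.
apply: hc; first exact: le_trans ww k1.
apply: le_trans (ler_norm _) _; apply: le_trans (rtr_le _ _) _.
apply: le_trans (ler_wpM2l s0 (le_trans ww kc)) _.
by rewrite mulrA ler_pdivrMr ?ltr_wpDl // mulrC ler_wpM2l ?(ltW c0) // lerDl.
Qed.

(* L_2-approximants need not be bounded in norm; as in Kaplansky's density
   theorem they are replaced by z (1 + eps z^* z)^-1. *)
Variable eps : R.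
Hypothesis eps0 : 0 < eps.

Definition cinv (t : R) := (1 + eps * t)^-1.

Lemma cinv_contp : contp cinv.
Proof.
apply: contp_inv => [|t t0]; last by rewrite ltr_pwDl // mulr_ge0 // ltW.
by apply: contpD; [exact: contp_cst|apply: contpZ; exact: contp_id].
Qed.

Definition btrans z := z * fc cinv (star z * z).

Lemma cinv_pos t : 0 <= t -> 0 < 1 + eps * t.
Proof. by move=> t0; rewrite ltr_pwDl // mulr_ge0 // ltW. Qed.

Lemma nrm_cinv x : posop x -> nrm (fc cinv x) <= 1.
Proof.
move=> px; apply: (fc_nrm cinv_contp px) => // t /andP[t0 _]; have h := cinv_pos t0.
by rewrite /cinv ger0_norm ?invr_ge0 ?(ltW h) // invf_le1 // lerDl mulr_ge0 // ltW.
Qed.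

Lemma cinv_mul x : posop x -> fc cinv x * (1 + rs eps x) = 1 /\ (1 + rs eps x) * fc cinv x = 1.
Proof.
move=> px; have cc := cinv_contp; have ci := @contp_id R.
have cl : contp (fun t => 1 + eps * t) by apply: contpD; [exact: contp_cst|apply: contpZ].
have -> : 1 + rs eps x = fc (fun t => 1 + eps * t) x.
  rewrite (fcD (@contp_cst R 1) (contpZ (c := eps) ci) px).
  by rewrite (fc_cst 1 px) rs1 (fcZ eps ci px) (fc_id px).
rewrite -(fcM cc cl px) -(fcM cl cc px); split.
  rewrite (fc_ext (g := fun=> 1) (contpM cc cl) px) => [|t /andP[t0 _]]; first by rewrite (fc_cst 1 px) rs1.
  by rewrite /cinv mulVf // gt_eqF // cinv_pos.
rewrite (fc_ext (g := fun=> 1) (contpM cl cc) px) => [|t /andP[t0 _]]; first by rewrite (fc_cst 1 px) rs1.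
by rewrite /cinv mulfV // gt_eqF // cinv_pos.
Qed.

Lemma nrm_btrans z : nrm (btrans z) ^+ 2 <= eps^-1.
Proof.
apply: le_trans (nrm_cstar _) _; have pz := posop_star z; have cc := cinv_contp.
have ci := @contp_id R; have c2 : contp (fun t => cinv t * t) by exact: contpM.
have c3 : contp (fun t => cinv t * t * cinv t) by exact: contpM.
rewrite /btrans starM (fc_star cc pz) mulrA -(mulrA _ (star z)).
have -> : fc cinv (star z * z) * (star z * z) * fc cinv (star z * z) = fc (fun t => cinv t * t * cinv t) (star z * z).
  by rewrite (fcM c2 cc pz) (fcM cc ci pz) (fc_id pz).
apply: (fc_nrm c3 pz); first by rewrite invr_ge0 ltW.
move=> t /andP[t0 _]; have h := cinv_pos t0; rewrite /cinv.
have h1 : 0 <= (1 + eps * t)^-1 by rewrite invr_ge0 ltW.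
rewrite ger0_norm ?mulr_ge0 //.
apply: le_trans (_ : (1 + eps * t)^-1 * t * 1 <= _).
  apply: ler_wpM2l; first exact: mulr_ge0.
  by rewrite invf_le1 // lerDl mulr_ge0 // ltW.
by rewrite mulr1 mulrC ler_pdivrMr // mulrDr mulr1 mulrA mulVf ?gt_eqF // mul1r lerDr invr_ge0 ltW.
Qed.

Lemma calg_btrans z : N z -> N (btrans z).
Proof.
move=> Nz; have Nsz := calg_star hN Nz; apply: (calgM hN) => //.
by apply: (calg_fc hN cinv_contp (posop_star z)); exact: (calgM hN).
Qed.

Lemma comm_star_mul z : inc e z -> comm_e e (star z * z).
Proof. by move=> iz; apply: inc_comm; apply: incM => //; exact: inc_star he iz. Qed.

Lemma inc_btrans z : inc e z -> inc e (btrans z).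
Proof.
move=> iz; have [ez ze] := iz; split; rewrite /btrans; first by rewrite mulrA ez.
by rewrite -mulrA (comm_fc cinv_contp (posop_star z) (comm_star_mul iz)) mulrA ze.
Qed.

(** Resolvent identity: with F for [btrans], the difference [F z - F y] equals [hz (z - y) hy + eps
    (F z) (y - z)^* (F y)]. The first term is contractive in L_2, and so is the second, because the
    squares of the norms of [F z] and [F y] are at most [1 / eps]. *)
Lemma btrans_lip y z : N y -> inc e y -> N z -> inc e z -> n2 (btrans z - btrans y) <= 4 * n2 (z - y).
Proof.
move=> Ny iy Nz iz; have cc := cinv_contp.
have py := posop_star y; have pz := posop_starr z.
set hy := fc cinv (star y * y); set hz := fc cinv (z * star z).
have [_ hy1] := cinv_mul py; have [hz1 _] := cinv_mul pz; rewrite -/hy in hy1; rewrite -/hz in hz1.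
have zE : btrans z = hz * z by exact: fc_swap.
have E : btrans z - btrans y = hz * (z - y) * hy + rs eps (btrans z * star (y - z) * btrans y).
  have -> : rs eps (btrans z * star (y - z) * btrans y) = hz * (rs eps (z * star y * y) - rs eps (z * star z * y)) * hy.
    rewrite zE /btrans -/hy starB -rsB rsMr rsMl; congr (rs eps _).
    by rewrite !mulrBr !mulrBl !mulrA.
  rewrite -mulrDl -mulrDr.
  have -> : z - y + (rs eps (z * star y * y) - rs eps (z * star z * y)) =
      z * (1 + rs eps (star y * y)) - (1 + rs eps (z * star z)) * y.
    rewrite mulrDr mulr1 rsMr mulrA mulrDl mul1r rsMl opprD !addrA; congr (_ - _).
    by rewrite addrAC.
  rewrite mulrBr mulrBl -!mulrA hy1 mulr1 zE; congr (_ - _).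
  by rewrite [X in _ = X]mulrA hz1 mul1r /btrans -/hy.
have Nhy : N hy by apply: (calg_fc hN cc py); apply: (calgM hN) => //; exact: (calg_star hN).
have chy : comm_e e hy by apply: comm_fc cc py _; exact: comm_star_mul.
have Nd := calgB hN Nz Ny.
have id : inc e (z - y).
  by split; rewrite ?mulrBr ?mulrBl; [rewrite iz.1 iy.1|rewrite iz.2 iy.2].
have Nd' := calgB hN Ny Nz.
have id' : inc e (y - z).
  by split; rewrite ?mulrBr ?mulrBl; [rewrite iz.1 iy.1|rewrite iz.2 iy.2].
have dd : n2 (y - z) = n2 (z - y) by rewrite /n2 -opprB starN mulrNN.
have sq1 x : nrm x <= 1 -> nrm x ^+ 2 <= 1.
  by move=> h; rewrite expr2 -[leRHS]mulr1; apply: ler_pM => //; exact: nrm_ge0.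
rewrite E; apply: le_trans (n2D _ _) _.
have B1 : n2 (hz * (z - y) * hy) <= n2 (z - y).
  rewrite -mulrA; apply: le_trans (n2_mull _ _) _.
  apply: le_trans (_ : n2 ((z - y) * hy) <= _).
    by rewrite -[leRHS]mul1r; apply: ler_wpM2r; [exact: n2_ge0|exact/sq1/nrm_cinv].
  apply: le_trans (n2_mulr Nd id Nhy chy) _; rewrite -[leRHS]mulr1.
  by apply: ler_wpM2l; [exact: n2_ge0|exact/sq1/nrm_cinv].
have B2 : n2 (rs eps (btrans z * star (y - z) * btrans y)) <= n2 (z - y).
  have -> : n2 (rs eps (btrans z * star (y - z) * btrans y)) = eps ^+ 2 * n2 (btrans z * (star (y - z) * btrans y)).
    by rewrite n2_rs (mulrA (btrans z)).
  have h1 := n2_mull (btrans z) (star (y - z) * btrans y).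
  have h2 := n2_mulr (calg_star hN Nd') (inc_star he id') (calg_btrans Ny) (inc_comm (inc_btrans iy)).
  rewrite (n2_star Nd' id') dd in h2.
  have h3 := nrm_btrans z; have h4 := nrm_btrans y; have h5 := n2_ge0 (z - y).
  have e1 : 0 <= eps^-1 by rewrite invr_ge0 ltW.
  have h6 : n2 (btrans z * (star (y - z) * btrans y)) <= eps^-1 * (n2 (z - y) * eps^-1).
    apply: (le_trans h1); apply: (ler_pM (sqr_ge0 _) (n2_ge0 _) h3).
    exact: (le_trans h2 (ler_wpM2l h5 h4)).
  apply: le_trans (ler_wpM2l (sqr_ge0 eps) h6) _; rewrite le_eqVlt; apply/orP; left; apply/eqP.
  by move: (n2 _) => T; field; exact: lt0r_neq0.
rewrite (_ : 4 = 2 + 2 :> R); last by ring.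
by rewrite [leRHS]mulrDl; apply: lerD; apply: ler_wpM2l.
Qed.

End L2Small.

Section Density.
Context {R : realType} {I : choiceType}.
Implicit Types (x y z a b w : bop R I) (q r : R).
Variables (N : set (bop R I)) (D : set I).
Hypotheses (hN : cstar_alg N) (hD : tracial_on N D).
Variables (e : nat -> bop R I) (s : nat -> seq I).
Hypothesis hc : cuts N D e s.
Variables (p q : R).
Hypotheses (p1 : 1 < p) (pq : p^-1 + q^-1 = 1).
Variable A : set (bop R I).
Hypotheses (AN : forall z, A z -> N z) (AD : forall y z, A y -> A z -> A (y + z)).
Hypotheses (AZ : forall (k : R[i]) z, A z -> A (k *: z)) (AM : forall y z, A y -> A z -> A (y * z)).
Hypothesis AS : forall z, A z -> A (star z).
Hypothesis Adense : forall n y c, N y -> inc (e n) y -> 0 < c ->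
  exists z, [/\ A z, inc (e n) z & n2 (s n) (y - z) <= c].

Lemma alg_pev z P : A z -> A (z * pev P (star z * z)).
Proof.
move=> Az; elim/poly_ind: P => [|P c IH].
  by rewrite pev0 mulr0 -(scale0r z); exact: AZ.
rewrite pevD pevM pevX pevC mulrDr mulrA rsMr mulr1; apply: AD; last exact: AZ.
by apply: AM => //; apply: AM => //; exact: AS.
Qed.

Lemma inc_pev n z P : inc (e n) z -> inc (e n) (z * pev P (star z * z)).
Proof.
move=> iz; have [ez ze] := iz; split; first by rewrite mulrA ez.
have h : e n * (star z * z) = star z * z * e n by rewrite -(comm_star_mul (cutsP hc n) iz).
by rewrite -mulrA -(pev_intertwine P h) mulrA ze.
Qed.

(** Three moves of cost [d / 3]: [y] to [btrans y] in operator norm for small [eps], [btrans y] to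
    [btrans z] for an L_2-approximant [z] from [A], and [btrans z] to a polynomial in [z] and [z^*],
    which stays in [A]. *)
Lemma corner_dense n y d : N y -> inc (e n) y -> 0 < d ->
  exists z, [/\ A z, inc (e n) z & np p (s n) (y - z) <= d].
Proof.
move=> Ny iy d0; have hn := cutsP hc n; have d3 : 0 < d / 3 by rewrite divr_gt0.
have [t t0 ht] := np_small_nrm (s n) p1 d3.
have pyy := posop_star y; set K := nrm y * nrm (star y * y) + 1.
have K0 : 0 < K by rewrite ltr_wpDl // mulr_ge0 ?nrm_ge0.
have [eps eps0 epsK] : exists2 eps : R, 0 < eps & eps * K = t.
  by exists (t / K); [rewrite divr_gt0|rewrite divfK // gt_eqF].
have cc := cinv_contp eps0.
have step1 : nrm (y - btrans eps y) <= t.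
  have -> : y - btrans eps y = y * fc (fun t => 1 - cinv eps t) (star y * y).
    by rewrite (fcB (@contp_cst R 1) cc pyy) (fc_cst 1 pyy) rs1 mulrBr mulr1.
  have c1 : contp (fun t => 1 - cinv eps t) by apply: contpB => //; exact: contp_cst.
  apply: le_trans (nrmM _ _) _.
  apply: le_trans (_ : nrm y * (eps * nrm (star y * y)) <= _).
    apply: ler_wpM2l; first exact: nrm_ge0.
    apply: (fc_nrm c1 pyy); first by rewrite mulr_ge0 ?nrm_ge0 // ltW.
    move=> u /andP[u0 uK]; have h := cinv_pos eps0 u0; have eu : 0 <= eps * u by rewrite mulr_ge0 // ltW.
    have -> : 1 - cinv eps u = eps * u * (1 + eps * u)^-1.
      by rewrite /cinv; field; exact: lt0r_neq0.
    rewrite ger0_norm; last by rewrite divr_ge0 // ltW.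
    apply: le_trans (_ : eps * u <= _); last by apply: ler_wpM2l => //; exact: ltW.
    by rewrite ler_piMr // invf_le1 // lerDl.
  by rewrite -epsK mulrCA; apply: ler_wpM2l; [exact: ltW|rewrite /K lerDl].
pose M := 4 * eps^-1; have M0 : 0 <= M by rewrite mulr_ge0 // invr_ge0 ltW.
have [c c0 hcs] := np_small (s n) p1 M0 d3.
have [z [Az iz zc]] := Adense Ny iy (ltac:(by rewrite divr_gt0) : 0 < c / 4).
have Nz := AN Az; have pzz := posop_star z.
have step2 : np p (s n) (btrans eps y - btrans eps z) <= d / 3.
  apply: hcs.
    apply: le_trans (nrmM _ _) _; rewrite nrm_star -expr2.
    have h1 := nrm_btrans eps0 y; have h2 := nrm_btrans eps0 z.
    have h3 := nrmD (btrans eps y) (- btrans eps z); rewrite nrmN in h3.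
    have h4 := nrm_ge0 (btrans eps y - btrans eps z).
    exact: sq_sum_le h4 h3 h1 h2.
  apply: le_trans (btrans_lip hN hD hn eps0 Nz iz Ny iy) _.
  by rewrite mulrC -ler_pdivlMr.
have tz : 0 < t / (nrm z + 1) by rewrite divr_gt0 // ltr_wpDl // nrm_ge0.
have [P_ hP] := weierstrass_seq (nrm (star z * z)) cc.
have /cvgrPdist_le/(_ _ tz)[m _ hm] := @cvg_invS R.
have {}hm : m.+1%:R^-1 <= t / (nrm z + 1).
  by have := hm m (leqnn m); rewrite /= sub0r normrN ger0_norm.
pose z' := z * pev (P_ m) (star z * z).
have step3 : nrm (btrans eps z - z') <= t.
  rewrite /btrans /z' -mulrBr; apply: le_trans (nrmM _ _) _.
  rewrite nrm_distC; apply: le_trans (ler_wpM2l (nrm_ge0 z) (fc_near cc pzz _ (hP m))) _ => //.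
  apply: le_trans (ler_wpM2l (nrm_ge0 z) hm) _.
  rewrite mulrA ler_pdivrMr ?ltr_wpDl ?nrm_ge0 // mulrC ler_wpM2l ?(ltW t0) // lerDl //.
have Az' : A z' by exact: alg_pev.
have iz' : inc (e n) z' by exact: inc_pev.
exists z'; split=> //.
have NFy := calg_btrans hN eps0 Ny; have NFz := calg_btrans hN eps0 Nz.
have iFy := inc_btrans hn eps0 iy; have iFz := inc_btrans hn eps0 iz.
have incB u v : inc (e n) u -> inc (e n) v -> inc (e n) (u - v).
  by move=> [u1 u2] [v1 v2]; split; rewrite ?mulrBr ?mulrBl ?u1 ?u2 ?v1 ?v2.
have -> : y - z' = (y - btrans eps y) + ((btrans eps y - btrans eps z) + (btrans eps z - z')).
  by rewrite !addrA !subrK.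
have Nb := calgB hN NFy NFz; have Nc := calgB hN NFz (AN Az').
have ib := incB _ _ iFy iFz; have ic := incB _ _ iFz iz'.
apply: le_trans (np_triangle hN hD hn p1 pq (calgB hN Ny NFy) (incB _ _ iy iFy) (calgD hN Nb Nc) (incD ib ic)) _.
rewrite (_ : d = d / 3 + (d / 3 + d / 3)); last by field.
apply: lerD; first exact: (ht _ step1).
apply: le_trans (np_triangle hN hD hn p1 pq Nb ib Nc ic) _.
by apply: lerD; [exact: step2|exact: (ht _ step3)].
Qed.

Lemma Lb_dense x d : Lb N D p x -> 0 < d ->
  exists z, [/\ A z, Lb N D p (x - z) & rn D p (x - z) <= d].
Proof.
move=> fx d0; have [Nx _] := fx; have d2 : 0 < d / 2 by rewrite divr_gt0.
have [n hn] := cut_approx hN hD hc p1 pq fx d2; have [f1 r1] := hn n (leqnn n).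
have Ny := calg_cut hN hc n Nx; have iy := inc_cut hc n x.
have [z [Az iz hz]] := corner_dense Ny iy d2.
have Nyz := calgB hN Ny (AN Az).
have iyz : inc (e n) (cut e n x - z).
  by split; rewrite ?mulrBr ?mulrBl; [rewrite iy.1 iz.1|rewrite iy.2 iz.2].
have [f2 r2] := Lb_corner hc p1 Nyz iyz; rewrite -r2 in hz.
have [f3 r3] := rn_triangle hN hD hc p1 pq f1 f2.
move: f3 r3; rewrite addrA subrK => f3 r3; exists z; split=> //.
by apply: (le_trans r3); rewrite (_ : d = d / 2 + d / 2); [exact: lerD|field].
Qed.
End Density.

(** * Tensor products and von Neumann algebras *)

Section Tensor.
Context {R : realType}.
Implicit Types J K : choiceType.

Lemma sqsum_fibers J K (f : J * K -> R[i]) :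
  (\esum_(j in [set: J]) sqsum (fun k => f (j, k)) = sqsum f)%E.
Proof.
rewrite /sqsum (esum_esum (a := fun j k => (sqmod (f (j, k)))%:E)); last first.
  by move=> *; rewrite lee_fin sqmod_ge0.
have -> : [set: (J * K)%type] = [set: J] `*`` (fun _ => [set: K]) by apply/seteqP; split.
by apply: eq_esum => -[j k].
Qed.

Lemma esum_term_le J (a : J -> \bar R) j : (forall i, 0 <= a i)%E -> (a j <= \esum_(i in [set: J]) a i)%E.
Proof.
move=> a0; apply: esum_ge; exists [set j]; first by split.
by rewrite fsbig_set1.
Qed.

Lemma fiber_subproof J K (xi : ell2 R (J * K)%type) j : (fun k => xi (j, k)) \in @sq_summable R K.
Proof.
apply/sq_summableP; have /sq_summableP h := valP xi; apply: le_lt_trans h; rewrite -sqsum_fibers.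
by apply: (@esum_term_le _ (fun j => sqsum (fun k => ell2_val xi (j, k)))) => i; exact: sqsum_ge0.
Qed.
Definition fiber J K (xi : ell2 R (J * K)%type) j : ell2 R K := Ell2 (fiber_subproof xi j).

Lemma ampl_bound J K (x : bop R K) (xi : ell2 R (J * K)%type) :
  (sqsum (fun k => x (fiber xi k.1) k.2) <= (nrm x ^+ 2)%:E * sqsum xi)%E.
Proof.
rewrite -sqsum_fibers /= -(sqsum_fibers (ell2_val xi)).
apply: le_trans (esumZ_le (sqr_ge0 _) _); last by move=> j; exact: sqsum_ge0.
apply: le_esum => j _; have := opbd_nrm x (fiber xi j).
by rewrite -lee_fin EFinM -!sqsumE.
Qed.

Lemma ampl_subproof J K (x : bop R K) (xi : ell2 R (J * K)%type) :
  (fun k => x (fiber xi k.1) k.2) \in @sq_summable R (J * K)%type.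
Proof.
apply/sq_summableP; apply: le_lt_trans (ampl_bound x xi) _.
by rewrite sqsumE -EFinM ltry.
Qed.
Definition amplf J K (x : bop R K) (xi : ell2 R (J * K)%type) : ell2 R (J * K)%type :=
  Ell2 (ampl_subproof x xi).

Lemma nsq_ampl J K (x : bop R K) (xi : ell2 R (J * K)%type) : nsq (amplf x xi) <= nrm x ^+ 2 * nsq xi.
Proof. by rewrite -lee_fin EFinM -!sqsumE; exact: ampl_bound. Qed.

Lemma bounded_ampl J K (x : bop R K) : bounded_op (@amplf J K x).
Proof.
apply/bounded_opP; split=> [c xi eta|].
  apply: ell2_ext => -[j k] /=.
  have -> : fiber (c *: xi + eta) j = c *: fiber xi j + fiber eta j by apply: ell2_ext => k'.
  by rewrite bop_linear.
exists (nrm x ^+ 2) => [|xi]; first exact: sqr_ge0.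
exact: nsq_ampl.
Qed.
Definition ampl J K (x : bop R K) : bop R (J * K)%type := toBop (bounded_ampl J x).

Lemma swap_subproof J K (xi : ell2 R (J * K)%type) : (fun k => xi (k.2, k.1)) \in @sq_summable R (K * J)%type.
Proof.
apply/sq_summableP; have /sq_summableP := valP xi; rewrite /sqsum.
rewrite (reindex_esum [set: (K * J)%type] [set: (J * K)%type] (fun k => (k.2, k.1))) //.
split=> // [[j k] [j' k'] _ _ [-> ->] //|[j k] _]; by exists (k, j).
Qed.
Definition swap J K (xi : ell2 R (J * K)%type) : ell2 R (K * J)%type := Ell2 (swap_subproof xi).

Lemma nsq_swap J K (xi : ell2 R (J * K)%type) : nsq (swap xi) = nsq xi.
Proof.
suff : sqsum (swap xi) = sqsum xi by rewrite !sqsumE => -[].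
rewrite /sqsum [RHS](reindex_esum [set: (K * J)%type] [set: (J * K)%type] (fun k => (k.2, k.1))) //.
split=> // [[j k] [j' k'] _ _ [-> ->] //|[j k] _]; by exists (k, j).
Qed.

Lemma bounded_swap_ampl J K (a : bop R J) : bounded_op (fun xi : ell2 R (J * K)%type => swap (ampl K a (swap xi))).
Proof.
apply/bounded_opP; split=> [c xi eta|].
  have -> : swap (c *: xi + eta) = c *: swap xi + swap eta by apply: ell2_ext => -[].
  by rewrite bop_linear; apply: ell2_ext => -[].
exists (nrm (ampl K a) ^+ 2) => [|xi]; first exact: sqr_ge0.
by rewrite nsq_swap -(nsq_swap xi); exact: opbd_nrm.
Qed.

(** The operator [1 (x) x] acts on each fiber, and [a (x) 1] is such an amplification conjugated by
    the flip of the two factors. *)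
Definition tbop J K (a : bop R J) (x : bop R K) : bop R (J * K)%type :=
  toBop (bounded_swap_ampl K a) * ampl J x.

Lemma tbopE J K (a : bop R J) (x : bop R K) xi eta : tbop a x (tens xi eta) = tens (a xi) (x eta).
Proof.
have e1 : ampl J x (tens xi eta) = tens xi (x eta).
  apply: ell2_ext => -[j k] /=.
  have -> : fiber (tens xi eta) j = xi j *: eta by apply: ell2_ext.
  by rewrite bopZ.
rewrite bopM e1 /=; apply: ell2_ext => -[j k] /=.
have -> : fiber (swap (tens xi (x eta))) k = x eta k *: xi by apply: ell2_ext => j'; rewrite /= mulrC.
by rewrite bopZ /= mulrC.
Qed.

Lemma delta_tens J K (j : J) (k : K) : delta (j, k) = tens (delta j) (delta k) :> ell2 R _.
Proof.
by apply: ell2_ext => -[j' k'] /=; rewrite xpair_eqE; case: eqP; case: eqP; rewrite /= ?mulr1 ?mulr0 ?mul0r.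
Qed.

Lemma tbop_delta J K (a : bop R J) (x : bop R K) j k : tbop a x (delta (j, k)) = tens (a (delta j)) (x (delta k)).
Proof. by rewrite delta_tens tbopE. Qed.

Lemma bop_ext_deltas J (a b : bop R J) : (forall j, a (delta j) = b (delta j)) -> a = b.
Proof. exact: bop_ext_delta. Qed.

Lemma tens_opE J K (a : bop R J) (x : bop R K) : tens_op a x = tbop a x :> op R _.
Proof.
rewrite /tens_op; apply: xget_unique; first by split; [exact: bopP|exact: tbopE].
move=> y [yb hy]; rewrite (_ : y = toBop yb :> op R _) //; congr bfun; apply: bop_ext_deltas => -[j k].
by rewrite delta_tens tbopE -hy.
Qed.

Lemma ip_tens_delta J K (xi : ell2 R J) (eta : ell2 R K) j k :
  ip (delta (j, k)) (tens xi eta) = ip (delta j) xi * ip (delta k) eta.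
Proof. by rewrite !ip_deltal. Qed.

Lemma tbopM J K (a b : bop R J) (x y : bop R K) : tbop a x * tbop b y = tbop (a * b) (x * y).
Proof. by apply: bop_ext_deltas => -[j k]; rewrite bopM !tbop_delta tbopE !bopM. Qed.

Lemma tens_Dl J K (u v : ell2 R J) (w : ell2 R K) : tens (u + v) w = tens u w + tens v w.
Proof. by apply: ell2_ext => k; rewrite /= mulrDl. Qed.
Lemma tens_Dr J K (u v : ell2 R K) (w : ell2 R J) : tens w (u + v) = tens w u + tens w v.
Proof. by apply: ell2_ext => k; rewrite /= mulrDr. Qed.
Lemma tens_Zl J K c (u : ell2 R J) (w : ell2 R K) : tens (c *: u) w = c *: tens u w.
Proof. by apply: ell2_ext => k; exact/esym/mulrA. Qed.
Lemma tens_Zr J K c (u : ell2 R K) (w : ell2 R J) : tens w (c *: u) = c *: tens w u.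
Proof. by apply: ell2_ext => k; exact: mulrCA. Qed.

Lemma tbopDl J K (a b : bop R J) (x : bop R K) : tbop (a + b) x = tbop a x + tbop b x.
Proof. by apply: bop_ext_deltas => -[j k]; rewrite bopDE !tbop_delta bopDE tens_Dl. Qed.
Lemma tbopDr J K (a : bop R J) (x y : bop R K) : tbop a (x + y) = tbop a x + tbop a y.
Proof. by apply: bop_ext_deltas => -[j k]; rewrite bopDE !tbop_delta bopDE tens_Dr. Qed.
Lemma tbopZl J K c (a : bop R J) (x : bop R K) : tbop (c *: a) x = c *: tbop a x.
Proof. by apply: bop_ext_deltas => -[j k]; rewrite bopZE !tbop_delta bopZE tens_Zl. Qed.
Lemma tbopZr J K c (a : bop R J) (x : bop R K) : tbop a (c *: x) = c *: tbop a x.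
Proof. by apply: bop_ext_deltas => -[j k]; rewrite bopZE !tbop_delta bopZE tens_Zr. Qed.
Lemma tbop11 J K : tbop 1 1 = 1 :> bop R (J * K)%type.
Proof. by apply: bop_ext_deltas => -[j k]; rewrite tbop_delta !bop1 delta_tens. Qed.

Lemma bop_ent_ext J (a b : bop R J) : (forall i j, ip (delta i) (a (delta j)) = ip (delta i) (b (delta j))) -> a = b.
Proof.
move=> h; apply: bop_ext_deltas => j; apply: ell2_ext => i.
by have := h i j; rewrite !ip_deltal.
Qed.

Lemma star_tbop J K (a : bop R J) (x : bop R K) : star (tbop a x) = tbop (star a) (star x).
Proof.
apply: bop_ent_ext => -[i g] [j h].
by rewrite ip_star ipC tbop_delta ip_tens_delta tbop_delta ip_tens_delta !ip_star cjM -!ipC.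
Qed.

Lemma nrm_tbop J K (a : bop R J) (x : bop R K) : nrm (tbop a x) <= nrm a * nrm x.
Proof.
have nampl (L : choiceType) (y : bop R K) : nrm (ampl L y) <= nrm y.
  apply/nrmP => [|xi]; first exact: nrm_ge0.
  exact: nsq_ampl.
have nampl' (L : choiceType) (y : bop R J) : nrm (ampl L y) <= nrm y.
  apply/nrmP => [|xi]; first exact: nrm_ge0.
  exact: nsq_ampl.
apply: le_trans (nrmM _ _) _; apply: ler_pM; rewrite ?nrm_ge0 //.
apply/nrmP => [|xi]; first exact: nrm_ge0.
rewrite -[toBop _ xi]/(swap (ampl K a (swap xi))) nsq_swap -(nsq_swap xi).
by have := nampl' K a => /(nrmP _ (nrm_ge0 a)).
Qed.

End Tensor.

#[global] Opaque tbop.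

(** * Double commutants as norm-closed *-algebras *)

Section VonNeumann.
Context {R : realType} {I : choiceType}.
Implicit Types (x y z a : bop R I) (S : set (op R I)).

Definition vNset S : set (bop R I) := [set x | vN S x].

Lemma comp_bop x y : (x : op R I) \o (y : op R I) = (y : op R I) \o (x : op R I) <-> x * y = y * x.
Proof.
split=> [h|h]; first by apply: bop_ext => xi; exact: (congr1 (fun f => f xi) h).
by apply/funext => xi; have := congr1 (fun f : bop R I => f xi) h; rewrite !bopM.
Qed.

Definition comm_set S : set (bop R I) := [set x | commutant (S `|` [set adj y | y in S]) x].

Lemma vNsetP S x : vNset S x <-> forall y, comm_set S y -> y * x = x * y.
Proof.
split=> [[_ h] y hy|h]; first by apply/comp_bop; exact: h.
split=> [|y hy]; first exact: bopP.
have [yb _] := hy; have -> : y = toBop yb by [].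
by apply/comp_bop; apply: h.
Qed.

Lemma comm_setP S y : (forall x : op R I, S x -> bounded_op x) ->
  (comm_set S y <-> forall x : bop R I, S x -> x * y = y * x /\ star x * y = y * star x).
Proof.
move=> Sb; split=> [[_ h] x Sx|h].
  by split; apply/comp_bop; apply: h; [left|right; exists (x : op R I) => //; rewrite adj_bop].
split; first exact: bopP.
move=> z [Sz|[x Sx <-]].
  have -> : z = toBop (Sb _ Sz) by [].
  by apply/comp_bop; have [] := h (toBop (Sb _ Sz)) Sz.
have -> : x = toBop (Sb _ Sx) by [].
by rewrite adj_bop; apply/comp_bop; have [] := h (toBop (Sb _ Sx)) Sx.
Qed.

Lemma vN_cstar S : (forall x : op R I, S x -> bounded_op x) -> cstar_alg (vNset S).
Proof.
move=> Sb; split.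
- by apply/vNsetP => y _; rewrite mulr1 mul1r.
- by move=> x z /vNsetP hx /vNsetP hz; apply/vNsetP => y hy; rewrite mulrDr mulrDl hx // hz.
- by move=> k x /vNsetP hx; apply/vNsetP => y hy; rewrite bscaleAr bscaleAl hx.
- by move=> x z /vNsetP hx /vNsetP hz; apply/vNsetP => y hy; rewrite mulrA hx // -mulrA hz // mulrA.
- move=> x /vNsetP hx; apply/vNsetP => y hy; apply: (can_inj starK); rewrite !starM starK.
  apply/esym/hx/(comm_setP _ Sb) => z Sz; have [h1 h2] := (iffLR (comm_setP y Sb) hy) z Sz.
  by split; apply: (can_inj starK); rewrite !starM ?starK.
move=> u x hu ux; apply/vNsetP => y hy.
apply: (olim_unique (u := fun n => y * u n)); first by apply: olimM => //; exact: olim_cst.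
rewrite (_ : (fun n => _) = fun n => u n * y); first by apply: olimM => //; exact: olim_cst.
by apply/funext => n; exact: (iffLR (vNsetP S (u n)) (hu n)).
Qed.

Lemma vN_gen S x : (forall x : op R I, S x -> bounded_op x) -> S x -> vNset S x.
Proof. by move=> Sb Sx; apply/vNsetP => y /(comm_setP _ Sb)/(_ _ Sx)[]. Qed.

End VonNeumann.

(** * Matrices over the group von Neumann algebra *)

Section FreeGroupAlgebra.
Context {R : realType}.
Notation G := freegroup.
Notation I := (nat * freegroup)%type.
Implicit Types (g h : G) (c : R[i]).

Lemma nsq_reindex (J : choiceType) (f : J -> J) (xi eta : ell2 R J) : bijective f ->
  (forall j, eta j = xi (f j)) -> nsq eta = nsq xi.
Proof.
move=> [f' fK f'K] h; suff : sqsum eta = sqsum xi by rewrite !sqsumE => -[].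
rewrite /sqsum [RHS](reindex_esum [set: J] [set: J] f) //.
  by apply: eq_esum => j _; rewrite h.
by split=> // [j j' _ _ /(can_inj fK) //|j _]; exists (f' j).
Qed.

Lemma mulg_bij g : bijective (fun h => (g * h)%g).
Proof. by exists (fun h => (g^-1 * h)%g) => h; rewrite ?mulKg ?mulVKg. Qed.
Lemma mulg_bijr g : bijective (fun h : G => (h * g)%g).
Proof. by exists (fun h : G => (h * g^-1)%g) => h; rewrite ?mulgK ?mulgVK. Qed.

Lemma bounded_isometry (J : choiceType) (x : ell2 R J -> ell2 R J) :
  linear x -> (forall xi, nsq (x xi) = nsq xi) -> bounded_op x.
Proof. by move=> lx h; apply/bounded_opP; split=> //; exists 1 => // xi; rewrite h mul1r. Qed.

Lemma bounded_lambda g : bounded_op (lambda g : op R G).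
Proof.
apply: bounded_isometry => [c xi eta|xi]; first exact: ell2_ext.
by apply: (nsq_reindex (mulg_bij g^-1%g)) => h.
Qed.
Definition lam g : bop R G := toBop (bounded_lambda g).

Lemma rho_subproof h (xi : ell2 R G) : (fun g => xi (g * h)%g) \in @sq_summable R G.
Proof.
apply/sq_summableP; have /sq_summableP := valP xi; rewrite /sqsum.
rewrite (reindex_esum [set: G] [set: G] (fun g => (g * h)%g)) //.
have [f fK f'K] := mulg_bijr h.
by split=> // [j j' _ _ /(can_inj fK) //|j _]; exists (f j).
Qed.
Definition rhof h (xi : ell2 R G) : ell2 R G := Ell2 (rho_subproof h xi).
Lemma bounded_rho h : bounded_op (rhof h).
Proof.
apply: bounded_isometry => [c xi eta|xi]; first exact: ell2_ext.
by apply: (nsq_reindex (mulg_bijr h)) => g.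
Qed.
Definition rho h : bop R G := toBop (bounded_rho h).

Lemma eq_mulVg g k h : (g^-1 * k == h)%g = (k == g * h)%g.
Proof. by apply/eqP/eqP => [<-|->]; rewrite ?mulVKg ?mulKg. Qed.
Lemma eq_mulgV g k h : (k * g == h)%g = (k == h * g^-1)%g.
Proof. by apply/eqP/eqP => [<-|->]; rewrite ?mulgK ?mulgVK. Qed.

Lemma lam_delta g h : lam g (delta h) = delta (g * h)%g.
Proof.
by apply: ell2_ext => k; rewrite /= eq_mulVg.
Qed.
Lemma rho_delta h g : rho h (delta g) = delta (g * h^-1)%g.
Proof. by apply: ell2_ext => k; rewrite /= eq_mulgV. Qed.

Lemma lamM g h : lam g * lam h = lam (g * h)%g.
Proof. by apply: bop_ext_deltas => k; rewrite bopM !lam_delta mulgA. Qed.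
Lemma lam1 : lam 1%g = 1.
Proof. by apply: bop_ext_deltas => k; rewrite lam_delta mul1g bop1. Qed.
Lemma star_lam g : star (lam g) = lam g^-1%g.
Proof.
apply: bop_ent_ext => a b; rewrite ip_star ipC !lam_delta !ip_deltal !deltaE.
by rewrite [in RHS]eq_sym eq_mulVg; case: eqP; rewrite ?cj1 ?cj0.
Qed.
Lemma star_rho g : star (rho g) = rho g^-1%g.
Proof.
apply: bop_ent_ext => a b; rewrite ip_star ipC !rho_delta !ip_deltal !deltaE.
by rewrite invgK -(eq_mulgV g b a) eq_sym; case: eqP; rewrite ?cj1 ?cj0.
Qed.
Lemma lam_rho g h : lam g * rho h = rho h * lam g.
Proof. by apply: bop_ext_deltas => k; rewrite !bopM !rho_delta !lam_delta rho_delta mulgA. Qed.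

Definition SF : set (op R G) := range lambda.
Lemma SF_bounded (x : op R G) : SF x -> bounded_op x.
Proof. by move=> [g _ <-]; exact: bounded_lambda. Qed.
Definition NF := vNset SF.
Lemma NF_cstar : cstar_alg NF. Proof. exact: vN_cstar SF_bounded. Qed.
Lemma NF_lam g : NF (lam g). Proof. by apply: vN_gen; [exact: SF_bounded|exists g]. Qed.

Lemma NF_rho (x : bop R G) h : NF x -> rho h * x = x * rho h.
Proof.
move=> /vNsetP; apply; apply/(comm_setP _ SF_bounded) => y [g _ gy].
have -> : y = lam g by apply: bop_ext => xi; rewrite -gy.
by rewrite star_lam !lam_rho.
Qed.

Lemma elem_bounded (i j : nat) : bounded_op (fun xi : ell2 R nat => xi j *: delta i).
Proof.
apply/bounded_opP; split=> [c xi eta|]; first by rewrite scalerDl scalerA.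
by exists 1 => // xi; rewrite nsqZ nsq_delta mulr1 mul1r; exact: coord_le.
Qed.
Definition elem i j : bop R nat := toBop (elem_bounded i j).
Lemma elem_delta i j k : elem i j (delta k) = (j == k)%:R *: delta i. Proof. by []. Qed.
Lemma elemM i j k l : elem i j * elem k l = (j == k)%:R *: elem i l.
Proof.
apply: bop_ext_deltas => m; rewrite bopM bopZE !elem_delta bopZ elem_delta !scalerA mulrC //.
Qed.
Lemma star_elem i j : star (elem i j) = elem j i.
Proof.
apply: bop_ent_ext => a b; rewrite ip_star ipC !elem_delta !ipZr !ip_deltal !deltaE.
by rewrite (eq_sym b i) (eq_sym a j); do 2 case: eqP => _; rewrite ?mulr1 ?mulr0 ?mul0r ?cj0 ?cj1.
Qed.

Definition SM : set (op R I) := [set tens_op a x | a in alg (Bell2 R) & x in alg (vNF R)].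
Lemma SMP (y : op R I) : SM y <-> exists (a : bop R nat) (x : bop R G), NF x /\ y = tbop a x.
Proof.
split=> [[a ab [x hx <-]]|[a [x [hx ->]]]].
  have [xb _] := hx; exists (toBop ab), (toBop xb); split=> //.
  by rewrite -tens_opE.
by exists (a : op R nat); [exact: bopP|exists (x : op R G); [exact: hx|exact: tens_opE]].
Qed.
Lemma SM_bounded (y : op R I) : SM y -> bounded_op y.
Proof. by move=> /SMP[a [x [_ ->]]]; exact: bopP. Qed.
Definition NM := vNset SM.
Definition DM : set I := [set k | k.2 = 1%g].
Lemma NM_cstar : cstar_alg NM. Proof. exact: vN_cstar SM_bounded. Qed.
Lemma NM_tbop a x : NF x -> NM (tbop a x).
Proof. by move=> Nx; apply: vN_gen; [exact: SM_bounded|apply/SMP; exists a, x]. Qed.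

Lemma NM_rho (x : bop R I) h : NM x -> tbop 1 (rho h) * x = x * tbop 1 (rho h).
Proof.
move=> /vNsetP; apply; apply/(comm_setP _ SM_bounded) => y /SMP[a [z [Nz yE]]].
have -> : y = tbop a z by apply: bop_ext => xi; rewrite yE.
rewrite star_tbop !tbopM !mul1r !mulr1 (NF_rho h Nz); split=> //.
by rewrite (NF_rho h (calg_star NF_cstar Nz)).
Qed.

(** Elements of the tensor product commute with [1 (x) rho(h)], so the columns at [(j, 1)] determine
    all the others. *)
Lemma NM_entry (x : bop R I) k j h : NM x -> x (delta (j, h)) k = x (delta (j, 1%g)) (k.1, (k.2 * h^-1)%g).
Proof.
move=> Nx; have d1 : delta (j, h) = tbop 1 (rho h^-1%g) (delta (j, 1%g)) :> ell2 R I.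
  by rewrite tbop_delta bop1 rho_delta invgK mul1g delta_tens.
rewrite d1 -bopM -(NM_rho _ Nx) bopM -!ip_deltal; case: k => [i g].
have -> : delta ((i, g).1, ((i, g).2 * h^-1)%g) = tbop 1 (rho h) (delta (i, g)) :> ell2 R I.
  by rewrite tbop_delta bop1 rho_delta delta_tens.
by rewrite -[in RHS]ip_star star_tbop star1 star_rho.
Qed.

Lemma esum_DM (F : I -> \bar R) : (forall k, 0 <= F k)%E ->
  (\esum_(k in DM) F k = \esum_(n in [set: nat]) F (n, 1%g))%E.
Proof.
move=> F0; rewrite (reindex_esum [set: nat] DM (fun n => (n, 1%g))) //.
by split=> [n _ //|n m _ _ [] //|[n g] /= gE]; exists n => //; rewrite -gE.
Qed.

(** Both sides sum the squared moduli of the entries of the columns [(j, 1)]; by [NM_entry], taking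
    the adjoint permutes them through [(j, (i, g)) -> (i, (j, g^-1))]. *)
Lemma NM_tracial : tracial_on NM DM.
Proof.
move=> x Nx; have Nsx := calg_star NM_cstar Nx.
rewrite !esum_DM; try by move=> k; rewrite lee_fin nsq_ge0.
pose a (t : nat * I) := sqmod (x (delta (t.1, 1%g)) t.2).
have a0 t : (0 <= (a t)%:E)%E by rewrite lee_fin sqmod_ge0.
have E (b : nat * I -> R) : (forall t, 0 <= (b t)%:E)%E ->
    (\esum_(n in [set: nat]) \esum_(k in [set: I]) (b (n, k))%:E = \esum_(t in [set: nat * I]) (b t)%:E)%E.
  move=> b0; rewrite (esum_esum (a := fun n k => (b (n, k))%:E)) //.
  have -> : [set: nat * I] = [set: nat] `*`` (fun _ => [set: I]) by apply/seteqP; split.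
  by apply: eq_esum => -[n k].
have -> : (\esum_(n in [set: nat]) (nsq (x (delta (n, 1%g))))%:E = \esum_(t in [set: nat * I]) (a t)%:E)%E.
  by rewrite -E //; apply: eq_esum => n _; rewrite -sqsumE.
have -> : (\esum_(n in [set: nat]) (nsq (star x (delta (n, 1%g))))%:E =
    \esum_(t in [set: nat * I]) (a (t.2.1, (t.1, t.2.2^-1%g)))%:E)%E.
  rewrite -(E (fun t => a (t.2.1, (t.1, t.2.2^-1%g)))) //; apply: eq_esum => n _; rewrite -sqsumE /sqsum.
  apply: eq_esum => -[j g] _; congr (_%:E); rewrite -ip_deltal ip_star ipC sqmodJ ip_deltal.
  by rewrite (NM_entry _ _ _ Nx) /a /= mul1g.
have fK : involutive (fun t : nat * I => (t.2.1, (t.1, t.2.2^-1%g))) by move=> [n [j g]] /=; rewrite invgK.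
rewrite (reindex_esum [set: nat * I] [set: nat * I] (fun t => (t.2.1, (t.1, t.2.2^-1%g)))) //.
by split=> // [t t' _ _ /(can_inj fK) //|t _]; exists (t.2.1, (t.1, t.2.2^-1%g)) => //; exact: fK.
Qed.

Definition unit_elt i g j : bop R I := tbop (elem i j) (lam g).

Lemma unit_delta i g j k h : unit_elt i g j (delta (k, h)) = (j == k)%:R *: delta (i, (g * h)%g).
Proof. by rewrite /unit_elt tbop_delta elem_delta lam_delta tens_Zl delta_tens. Qed.
Lemma unitM i g j i' h j' : unit_elt i g j * unit_elt i' h j' = (j == i')%:R *: unit_elt i (g * h)%g j'.
Proof. by rewrite /unit_elt tbopM elemM lamM tbopZl. Qed.
Lemma star_unit i g j : star (unit_elt i g j) = unit_elt j g^-1%g i.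
Proof. by rewrite /unit_elt star_tbop star_elem star_lam. Qed.
Lemma NM_unit i g j : NM (unit_elt i g j). Proof. exact/NM_tbop/NF_lam. Qed.

Definition eM (n : nat) : bop R I := \sum_(i <- iota 0 n) unit_elt i 1%g i.
Definition sM (n : nat) : seq I := [seq (i, 1%g) | i <- iota 0 n].

Lemma eM_delta n k h : eM n (delta (k, h)) = (k < n)%N%:R *: delta (k, h).
Proof.
rewrite /eM bop_sumE; under eq_bigr do rewrite unit_delta mul1g.
have [kn|nk] := ltnP k n; last first.
  rewrite scale0r big1_seq // => i /andP[_]; rewrite mem_iota => /andP[_ i_n].
  by rewrite (_ : (i == k) = false) ?scale0r //; apply/negbTE; rewrite neq_ltn (leq_trans i_n).
rewrite (bigD1_seq k) ?mem_iota ?iota_uniq //= eqxx big1 ?addr0 // => i /negbTE ->.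
by rewrite scale0r.
Qed.

Lemma eM_corner n : corner NM DM (eM n) (sM n).
Proof.
split.
- by apply: (calg_sum NM_cstar) => i; exact: NM_unit.
- by rewrite /eM star_sum; apply: eq_bigr => i _; rewrite star_unit invg1.
- apply: bop_ext_deltas => -[k h]; rewrite bopM !eM_delta bopZ eM_delta scalerA.
  by case: (k < n)%N; rewrite ?mulr1 ?mulr0.
- by rewrite map_inj_uniq ?iota_uniq // => i j [].
- move=> i /mapP[k]; rewrite mem_iota => /andP[_ kn] ->; split=> //.
  by rewrite eM_delta kn scale1r.
move=> [k h] Dk ni; have hE : h = 1%g := Dk; subst h.
rewrite eM_delta; have [kn|_] := ltnP k n; last by rewrite scale0r.
by case/negP: ni; apply/mapP; exists k; rewrite ?mem_iota.
Qed.

Lemma eM_cuts : cuts NM DM eM sM.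
Proof.
split; first exact: eM_corner.
- move=> m n mn; apply: bop_ext_deltas => -[k h]; rewrite bopM !eM_delta bopZ eM_delta scalerA.
  have [km|km] := ltnP k m; last by rewrite mul0r.
  by rewrite (leq_trans km mn) mulr1.
- move=> [k h] Dk; have hE : h = 1%g := Dk; subst h; exists k.+1; apply/mapP; exists k => //.
  by rewrite mem_iota /= add0n.
move=> xi; apply/cvgrPdist_le => d d0.
have [s us hs] := finpart_approx xi (ltac:(by rewrite exprn_gt0 // divr_gt0) : 0 < (d / 2) ^+ 2).
have [m hm] : exists m, forall k, k \in s -> (k.1 < m)%N.
  exists (\sum_(k <- s) k.1).+1 => k ks; rewrite ltnS (big_rem k ks) /=; exact: leq_addr.
exists m => // n /= mn; rewrite sub0r normrN ger0_norm ?l2norm_ge0 // bop1.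
set eta := finpart xi s in hs.
have eE : eM n eta = eta.
  rewrite /eta /finpart bop_sum; apply: eq_big_seq => -[k h] ks; rewrite bopZ eM_delta.
  by rewrite (leq_trans (hm _ ks) mn) scale1r.
have h1 : l2norm (xi - eta) <= d / 2.
  have d2 : 0 <= d / 2 by rewrite divr_ge0 // ltW.
  by rewrite l2normE -(ger0_norm d2) -sqrtr_sqr ler_wsqrtr // ltW.
have -> : eM n xi - xi = eM n (xi - eta) - (xi - eta) by rewrite bopB eE opprB addrA subrK.
apply: le_trans (l2normD _ _) _; rewrite l2normN (_ : d = d / 2 + d / 2); last by field.
apply: lerD => //; apply: le_trans (l2norm_bop _ _) _.
have e1 : nrm (eM n) <= 1 by have he := eM_corner n; apply: nrm_proj; [exact: corner_star he|exact: corner_id he].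
rewrite -[leRHS]mul1r; apply: ler_pM => //; [exact: nrm_ge0|exact: l2norm_ge0].
Qed.

(* A finite family (c, (i, g, j)) stands for the sum of the c E_ij (x) lambda(g). *)
Definition Ix := seq (R[i] * (nat * G * nat)).
Definition val_ix (X : Ix) : bop R I := \sum_(t <- X) t.1 *: unit_elt t.2.1.1 t.2.1.2 t.2.2.

Lemma val_cat X Y : val_ix (X ++ Y) = val_ix X + val_ix Y.
Proof. by rewrite /val_ix big_cat. Qed.
Definition scale_ix c (X : Ix) : Ix := [seq (c * t.1, t.2) | t <- X].
Lemma val_scale c X : val_ix (scale_ix c X) = c *: val_ix X.
Proof. by rewrite /val_ix big_map scaler_sumr; apply: eq_bigr => t _; rewrite scalerA. Qed.
Definition star_ix (X : Ix) : Ix := [seq (t.1^*%C, (t.2.2, t.2.1.2^-1%g, t.2.1.1)) | t <- X].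
Lemma val_star X : val_ix (star_ix X) = star (val_ix X).
Proof. by rewrite /val_ix big_map star_sum; apply: eq_bigr => t _; rewrite starZ star_unit. Qed.
Definition mul_ix (X Y : Ix) : Ix :=
  [seq ((t.2.2 == v.2.1.1)%:R * t.1 * v.1, (t.2.1.1, (t.2.1.2 * v.2.1.2)%g, v.2.2)) | t <- X, v <- Y].
Lemma val_mul X Y : val_ix (mul_ix X Y) = val_ix X * val_ix Y.
Proof.
rewrite /val_ix big_allpairs_dep mulr_suml; apply: eq_bigr => t _; rewrite mulr_sumr; apply: eq_bigr => v _.
by rewrite bscaleAl bscaleAr unitM !scalerA /= -mulrA mulrC.
Qed.
Lemma NM_val X : NM (val_ix X).
Proof. by apply: (calg_sum NM_cstar) => t; apply: (calgZ NM_cstar); exact: NM_unit. Qed.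

Definition AM : set (bop R I) := range val_ix.

(** Only the [n] columns [y delta_(j, 1)] enter the L_2-norm. Each is truncated to finitely many
    entries with squared error below [c / (n + 1)], and compressing by [eM n] does not increase the
    error. *)
Lemma AM_dense n y (c : R) : NM y -> inc (eM n) y -> 0 < c ->
  exists z, [/\ AM z, inc (eM n) z & n2 (sM n) (y - z) <= c].
Proof.
move=> Ny [ey ye] c0; have he := eM_corner n; have cn : 0 < c / n.+1%:R by rewrite divr_gt0.
have H (j : nat) : exists s : seq I, uniq s /\ nsq (y (delta (j, 1%g)) - finpart (y (delta (j, 1%g))) s) < c / n.+1%:R.
  by have [s us hs] := finpart_approx (y (delta (j, 1%g))) cn; exists s.
pose S j := projT1 (cid (H j)); have hS j : uniq (S j) /\ _ := projT2 (cid (H j)).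
pose X : Ix := [seq (y (delta (j, 1%g)) k, (k.1, k.2, j)) | j <- iota 0 n, k <- S j].
have XE j : (j < n)%N -> val_ix X (delta (j, 1%g)) = finpart (y (delta (j, 1%g))) (S j).
  move=> jn; rewrite /val_ix big_allpairs_dep bop_sumE (bigD1_seq j) ?mem_iota ?iota_uniq //=.
  rewrite [X in _ + X]big1 ?addr0 => [|i /negbTE ij]; rewrite bop_sumE.
    by apply: eq_bigr => -[k g] _; rewrite bopZE unit_delta eqxx scale1r mulg1.
  by rewrite big1 // => k _; rewrite bopZE unit_delta ij scale0r scaler0.
have Ee : eM n = val_ix [seq (1, (i, 1%g, i)) | i <- iota 0 n].
  by rewrite /val_ix big_map; apply: eq_bigr => i _; rewrite scale1r.
exists (eM n * val_ix X * eM n); split.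
- by rewrite Ee; eexists (mul_ix (mul_ix _ X) _) => //; rewrite !val_mul.
- by split; [rewrite !mulrA|rewrite -mulrA]; rewrite (corner_id he).
rewrite -{1}ey -{1}ye !mulrA -!mulrBl -mulrBr /n2 rtr_nsq.
apply: le_trans (_ : \sum_(i <- sM n) c / n.+1%:R <= _); last first.
  rewrite big_const_seq count_predT size_map size_iota iter_addr addr0.
  by rewrite -[c / _ *+ n]mulr_natr mulrAC ler_pdivrMr // ler_wpM2l ?(ltW c0) // ler_nat.
rewrite [leLHS]big_seq [leRHS]big_seq; apply: ler_sum => i /mapP[j]; rewrite mem_iota => /andP[_ jn] ->.
rewrite !bopM eM_delta jn scale1r bopDE bopNE (XE _ jn).
have e1 : nrm (eM n) <= 1 by apply: nrm_proj; [exact: corner_star he|exact: corner_id he].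
apply: le_trans (opbd_nrm _ _) _.
apply: le_trans (_ : 1 * nsq (y (delta (j, 1%g)) - finpart (y (delta (j, 1%g))) (S j)) <= _).
  by apply: ler_wpM2r; rewrite ?nsq_ge0 // expr2 -[leRHS]mulr1; apply: ler_pM; rewrite ?nrm_ge0.
by rewrite mul1r; have [_ /ltW] := hS j.
Qed.

End FreeGroupAlgebra.

(** * Fourier multipliers on finite families *)

Section FamilyNorms.
Context {R : realType}.
Notation G := freegroup.
Notation I := (nat * freegroup)%type.
Implicit Types (g h : G) (c : R[i]) (X Y : @Ix R) (m : G -> R[i]) (kap : G -> G -> R[i]).

Lemma inc_val X : exists n0, forall n, (n0 <= n)%N -> inc (eM n) (val_ix X).
Proof.
exists (\sum_(t <- X) (t.2.1.1 + t.2.2)).+1 => n hn.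
have lt t : t \in X -> (t.2.1.1 < n)%N && (t.2.2 < n)%N.
  move=> tX; have : (t.2.1.1 + t.2.2 < n)%N.
    by apply: leq_trans hn; rewrite ltnS (big_rem t tX) /= leq_addr.
  by move=> h; rewrite (leq_ltn_trans _ h) ?leq_addr //= (leq_ltn_trans _ h) ?leq_addl.
split; rewrite /val_ix.
  rewrite mulr_sumr; apply: eq_big_seq => t /lt /andP[h1 h2]; rewrite bscaleAr; congr (_ *: _); apply: bop_ext_deltas => -[k h].
  by rewrite bopM unit_delta bopZ eM_delta h1 scale1r.
rewrite mulr_suml; apply: eq_big_seq => t /lt /andP[h1 h2].
rewrite bscaleAl; congr (_ *: _); apply: bop_ext_deltas => -[k h].
rewrite bopM eM_delta bopZ unit_delta scalerA; have [<-|_] := eqVneq t.2.2 k; last by rewrite mulr0.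
by rewrite h2 mul1r.
Qed.

Section Exponent.
Variables (p q : R).
Hypotheses (p1 : 1 < p) (pq : p^-1 + q^-1 = 1).
Let p0 : 0 < p. Proof. exact: lt_trans p1. Qed.
Let hN := @NM_cstar R.
Let hD := @NM_tracial R.
Let hc := @eM_cuts R.

Definition nm X : R := rn DM p (val_ix X).

Lemma nm_ge0 X : 0 <= nm X. Proof. exact: rn_ge0. Qed.

Lemma Lb_val X : Lb NM DM p (val_ix X).
Proof.
by have [n hn] := inc_val X; have [] := Lb_corner hc p1 (NM_val X) (hn n (leqnn n)).
Qed.

Lemma nm_sum (T : Type) (r : seq T) (F : T -> Ix) Y :
  val_ix Y = \sum_(t <- r) val_ix (F t) -> nm Y <= \sum_(t <- r) nm (F t).
Proof.
rewrite /nm => ->; suff [] : Lb NM DM p (\sum_(t <- r) val_ix (F t)) /\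
    rn DM p (\sum_(t <- r) val_ix (F t)) <= \sum_(t <- r) rn DM p (val_ix (F t)) by [].
elim: r => [|t r [IH1 IH2]]; last first.
  rewrite !big_cons; have [h1 h2] := rn_triangle hN hD hc p1 pq (Lb_val (F t)) IH1.
  by split=> //; apply: le_trans h2 _; rewrite lerD2l.
rewrite !big_nil; have [h1 h2] := rn_scale hN p1 0 (Lb_val [::]).
move: h1 h2; rewrite scale0r => h1 ->; split=> //.
by rewrite (_ : sqmod 0 = 0) ?sqrtr0 ?mul0r // /sqmod /= expr0n addr0.
Qed.

Lemma nmD X Y Z : val_ix Z = val_ix X + val_ix Y -> nm Z <= nm X + nm Y.
Proof.
move=> E; have := @nm_sum Ix [:: X; Y] id Z; rewrite !big_cons !big_nil !addr0; exact.
Qed.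

Lemma nmZ c X Y : val_ix Y = c *: val_ix X -> nm Y = Num.sqrt (sqmod c) * nm X.
Proof. by rewrite /nm => ->; have [] := rn_scale hN p1 c (Lb_val X). Qed.

Lemma nm_star X Y : val_ix Y = star (val_ix X) -> nm Y = nm X.
Proof. by rewrite /nm => ->; have [] := Lb_star hN hD p1 (Lb_val X). Qed.

End Exponent.

Lemma nm_mul p q X Y Z : 1 < p -> p^-1 + q^-1 = 1 -> val_ix Z = val_ix X * star (val_ix Y) ->
  nm p Z <= nm (2 * p) X * nm (2 * p) Y.
Proof.
move=> p1 pq E; have p2 : 1 < 2 * p by lra.
have [n1 h1] := inc_val X; have [n2 h2] := inc_val Y; pose n := maxn n1 n2.
have ix : inc (eM n) (val_ix X) by apply: h1; exact: leq_maxl.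
have iy : inc (eM n) (val_ix Y) by apply: h2; exact: leq_maxr.
have he := @eM_corner R n; have Ny := calg_star (@NM_cstar R) (NM_val Y).
have iz : inc (eM n) (val_ix X * star (val_ix Y)) by apply: incM => //; exact: inc_star he iy.
have Nz := calgM (@NM_cstar R) (NM_val X) Ny.
rewrite /nm E; have [_ ->] := Lb_corner (@eM_cuts R) p1 Nz iz.
have [_ ->] := Lb_corner (@eM_cuts R) p2 (NM_val X) ix.
have [_ ->] := Lb_corner (@eM_cuts R) p2 (NM_val Y) iy.
exact: (np_mul (@NM_cstar R) (@NM_tracial R) he p1 pq (NM_val X) ix (NM_val Y) iy).
Qed.

Lemma nm_sq p X Z : 1 < p -> val_ix Z = val_ix X * star (val_ix X) -> nm (2 * p) X ^+ 2 = nm p Z.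
Proof.
move=> p1 E; have p2 : 1 < 2 * p by lra.
have [n h1] := inc_val X; have ix := h1 n (leqnn n); have he := @eM_corner R n.
have isx := inc_star he ix.
have iz : inc (eM n) (val_ix X * star (val_ix X)) by apply: incM.
have Nsx := calg_star (@NM_cstar R) (NM_val X).
have Nz := calgM (@NM_cstar R) (NM_val X) Nsx.
rewrite /nm E; have [_ ->] := Lb_corner (@eM_cuts R) p1 Nz iz.
have [_ ->] := Lb_corner (@eM_cuts R) p2 (NM_val X) ix.
have <- := np_star (@NM_cstar R) (@NM_tracial R) he (lt_trans ltr01 p2) (NM_val X) ix.
by rewrite -(np_sq _ p1) starK.
Qed.

Definition mult m X : Ix := [seq (m t.2.1.2 * t.1, t.2) | t <- X].
(** The product [X Y^*] in which the contribution of [g] from [X] and [h] from [Y] is weighted by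
    the kernel [kap g h]. *)
Definition bil kap X Y : Ix :=
  [seq ((t.2.2 == v.2.2)%:R * kap t.2.1.2 v.2.1.2 * (t.1 * v.1^*%C),
        (t.2.1.1, (t.2.1.2 * v.2.1.2^-1)%g, v.2.1.1)) | t <- X, v <- Y].

Lemma val_bil kap X Y : val_ix (bil kap X Y) = \sum_(t <- X) \sum_(v <- Y)
  ((t.2.2 == v.2.2)%:R * kap t.2.1.2 v.2.1.2 * (t.1 * v.1^*%C)) *:
    unit_elt t.2.1.1 (t.2.1.2 * v.2.1.2^-1)%g v.2.1.1.
Proof. by rewrite /val_ix big_allpairs_dep. Qed.

Lemma val_bil_one X Y : val_ix (bil (fun _ _ => 1) X Y) = val_ix X * star (val_ix Y).
Proof.
rewrite val_bil -val_star mulr_suml; apply: eq_bigr => t _.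
rewrite /val_ix big_map mulr_sumr; apply: eq_bigr => v _.
rewrite bscaleAl bscaleAr unitM !scalerA /=; congr (_ *: _); ring.
Qed.

Lemma val_bilD k1 k2 kap X Y : (forall g h, kap g h = k1 g h + k2 g h) ->
  val_ix (bil kap X Y) = val_ix (bil k1 X Y) + val_ix (bil k2 X Y).
Proof.
move=> e; rewrite !val_bil -big_split; apply: eq_bigr => t _; rewrite -big_split; apply: eq_bigr => v _.
by rewrite e mulrDr mulrDl scalerDl.
Qed.

Lemma val_bilZ c k1 kap X Y : (forall g h, kap g h = c * k1 g h) ->
  val_ix (bil kap X Y) = c *: val_ix (bil k1 X Y).
Proof.
move=> e; rewrite !val_bil scaler_sumr; apply: eq_bigr => t _; rewrite scaler_sumr; apply: eq_bigr => v _.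
by rewrite e scalerA; congr (_ *: _); ring.
Qed.

(** The identity between kernels is required on the group elements of [X] and [Y] only: the averages
    it serves involve roots of unity whose order depends on these families. *)
Lemma val_bil_sum (T : Type) (r : seq T) (k : T -> G -> G -> R[i]) kap X Y :
  (forall t v, t \in X -> v \in Y -> kap t.2.1.2 v.2.1.2 = \sum_(a <- r) k a t.2.1.2 v.2.1.2) ->
  val_ix (bil kap X Y) = \sum_(a <- r) val_ix (bil (k a) X Y).
Proof.
move=> e; under [RHS]eq_bigr do rewrite val_bil.
rewrite val_bil [RHS]exchange_big; apply: eq_big_seq => t tX.
rewrite [RHS]exchange_big; apply: eq_big_seq => v vY.
by rewrite e // mulr_sumr mulr_suml scaler_suml.
Qed.

Lemma val_bil_mult kap n n' X Y :
  val_ix (bil kap (mult n X) (mult n' Y)) = val_ix (bil (fun g h => kap g h * n g * (n' h)^*%C) X Y).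
Proof.
rewrite !val_bil big_map; apply: eq_bigr => t _; rewrite big_map; apply: eq_bigr => v _ /=.
by congr (_ *: _); rewrite cjM; ring.
Qed.

Lemma val_mult_bil o kap X Y :
  val_ix (mult o (bil kap X Y)) = val_ix (bil (fun g h => o (g * h^-1)%g * kap g h) X Y).
Proof.
rewrite {1}/val_ix /mult big_map big_allpairs_dep val_bil; apply: eq_bigr => t _; apply: eq_bigr => v _ /=.
by congr (_ *: _); ring.
Qed.

Lemma val_bil_star kap X Y :
  star (val_ix (bil kap X Y)) = val_ix (bil (fun h g => (kap g h)^*%C) Y X).
Proof.
rewrite !val_bil star_sum; under eq_bigr do rewrite star_sum.
rewrite exchange_big; apply: eq_bigr => v _; apply: eq_bigr => t _.
rewrite starZ star_unit invgM invgK; congr (_ *: _); rewrite !cjM conjcK eq_sym.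
by rewrite (_ : ((v.2.2 == t.2.2)%:R)^*%C = (v.2.2 == t.2.2)%:R :> R[i]); [ring|case: eqP; rewrite ?cj0 ?cj1].
Qed.

Lemma val_mult_star m X : val_ix (mult (fun w => (m w^-1%g)^*%C) X) = star (val_ix (mult m (star_ix X))).
Proof.
rewrite -val_star /val_ix /mult /star_ix !big_map; apply: eq_bigr => t _ /=.
by rewrite invgK cjM conjcK.
Qed.

Definition bdd p C m := forall X, nm p (mult m X) <= C * nm p X.
Definition good p C kap := forall X Y, nm p (bil kap X Y) <= C * (nm (2 * p) X * nm (2 * p) Y).

Section Good.
Variables (p q : R).
Hypotheses (p1 : 1 < p) (pq : p^-1 + q^-1 = 1).

Lemma good_one : good p 1 (fun _ _ => 1).
Proof. by move=> X Y; rewrite mul1r; apply: nm_mul p1 pq _; exact: val_bil_one. Qed.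

Lemma goodD (C1 C2 : R) k1 k2 : good p C1 k1 -> good p C2 k2 -> good p (C1 + C2) (fun g h => k1 g h + k2 g h).
Proof.
move=> h1 h2 X Y; rewrite mulrDl; apply: le_trans (lerD (h1 X Y) (h2 X Y)).
by apply: (nmD p1 pq); exact: val_bilD.
Qed.

Lemma goodZ c (C : R) k1 : 0 <= C -> good p C k1 -> good p (Num.sqrt (sqmod c) * C) (fun g h => c * k1 g h).
Proof.
move=> C0 h1 X Y; rewrite (nmZ p1 (val_bilZ X Y (fun g h => erefl (c * k1 g h)))) -mulrA.
by apply: ler_wpM2l => //; exact: sqrtr_ge0.
Qed.

Lemma good_mul (C c1 c2 c3 : R) (o n n' : G -> R[i]) kap : 0 <= C -> 0 <= c1 -> 0 <= c2 -> 0 <= c3 ->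
  bdd p c1 o -> bdd (2 * p) c2 n -> bdd (2 * p) c3 n' -> good p C kap ->
  good p (c1 * C * c2 * c3) (fun g h => o (g * h^-1)%g * kap g h * n g * (n' h)^*%C).
Proof.
move=> C0 c10 c20 c30 ho hn hn' hk X Y.
have -> : nm p (bil (fun g h => o (g * h^-1)%g * kap g h * n g * (n' h)^*%C) X Y) =
    nm p (mult o (bil kap (mult n X) (mult n' Y))).
  by congr (rn _ _ _); rewrite val_mult_bil val_bil_mult.
apply: le_trans (ho _) _; rewrite -!mulrA; apply: ler_wpM2l => //.
apply: le_trans (hk _ _) _; apply: ler_wpM2l => //.
rewrite (_ : c2 * (c3 * _) = c2 * nm (2 * p) X * (c3 * nm (2 * p) Y)); last by ring.
by apply: ler_pM; rewrite ?nm_ge0.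
Qed.

Lemma good_star C kap : good p C kap -> good p C (fun h g => (kap g h)^*%C).
Proof.
move=> hk X Y; rewrite (nm_star p1 (esym (val_bil_star kap Y X))) (mulrC (nm _ X)); exact: hk.
Qed.

Lemma good_ext C k1 k2 : (forall g h, k1 g h = k2 g h) -> good p C k1 -> good p C k2.
Proof. by move=> e; have -> : k1 = k2 by apply/funext => g; apply/funext => h. Qed.

End Good.

Lemma bdd_star p C m : 1 < p -> bdd p C m -> bdd p C (fun w => (m w^-1%g)^*%C).
Proof.
move=> p1 hm X; rewrite (nm_star p1 (val_mult_star m X)); apply: le_trans (hm _) _.
by rewrite (nm_star p1 (val_star X)).
Qed.

Lemma bdd1 p : bdd p 1 (fun=> 1).
Proof. by move=> X; rewrite mul1r /mult (_ : map _ _ = X) // -[RHS]map_id; apply: eq_map => -[a b] /=; rewrite mul1r. Qed.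

End FamilyNorms.

(** * Cancellation in reduced words *)

Section Words.

Lemma reduced_glue u i (k m : int) v : reduced (rcons u (i, k)) -> reduced ((i, m) :: v) ->
  reduced (u ++ (i, m) :: v).
Proof.
elim: u => [|x u IH] //=; rewrite 2!(reduced_cons x) => /and3P[x0 xu /IH h] /h ->.
by rewrite x0 andbT; case: u xu {IH h} => [|y u].
Qed.

Lemma reduced_glue_neq u x y v : reduced (rcons u x) -> reduced (y :: v) -> x.1 != y.1 ->
  reduced (rcons u x ++ y :: v).
Proof.
elim: u => [|t u IH] /=; first by rewrite !reduced_cons => /andP[-> _] -> ->.
rewrite reduced_cons => /and3P[t0 tu /IH h] ry xy; rewrite reduced_cons t0 h // andbT.
by case: u tu {IH h} => [|r u].
Qed.

Lemma reduced_catl u v : reduced (u ++ v) -> reduced u.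
Proof.
elim: u => //= s u IH; rewrite !reduced_cons => /and3P[-> su /IH ->]; rewrite andbT.
by case: u su {IH}.
Qed.
Lemma reduced_catr u v : reduced (u ++ v) -> reduced v.
Proof. by elim: u => //= s u IH; rewrite reduced_cons => /and3P[_ _]. Qed.

Lemma wmul_reduced_cat u v : reduced (u ++ v) -> wmul u v = u ++ v.
Proof.
elim: u => //= s u IH ru; have := ru; rewrite reduced_cons => /and3P[_ _ /IH ->].
exact: push_id.
Qed.

Lemma wmul_cat u v w : wmul (u ++ v) w = wmul u (wmul v w).
Proof. by rewrite /wmul foldr_cat. Qed.

Lemma winvK : involutive winv.
Proof.
move=> u; rewrite /winv map_rev revK -map_comp -[RHS]map_id.
by apply: eq_map => -[i k] /=; rewrite opprK.
Qed.
Lemma winv_cat u v : winv (u ++ v) = winv v ++ winv u.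
Proof. by rewrite /winv map_cat rev_cat. Qed.
Lemma winv_rcons u s : winv (rcons u s) = (s.1, - s.2) :: winv u.
Proof. by rewrite -cats1 winv_cat. Qed.
Lemma winv_cons s u : winv (s :: u) = rcons (winv u) (s.1, - s.2).
Proof. by rewrite /winv /= rev_cons. Qed.
Lemma size_winv u : size (winv u) = size u.
Proof. by rewrite /winv size_rev size_map. Qed.

Lemma wmul_inj u v w : reduced v -> reduced w -> wmul u v = wmul u w -> v = w.
Proof. by move=> rv rw /(congr1 (wmul (winv u))); rewrite !wmulVw. Qed.

Lemma common_suffix (T : eqType) (u v : seq T) : exists u' v' c, [/\ u = u' ++ c, v = v' ++ c &
  u' = [::] \/ v' = [::] \/ exists a b x y, [/\ u' = rcons a x, v' = rcons b y & x != y]].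
Proof.
elim/last_ind: u v => [|u x IH] v.
  by exists [::], v, [::]; rewrite !cats0; split=> //; left.
case/lastP: v => [|v y].
  by exists (rcons u x), [::], [::]; rewrite !cats0; split=> //; right; left.
have [->|xy] := eqVneq x y; last first.
  by exists (rcons u x), (rcons v y), [::]; rewrite !cats0; split=> //; right; right; exists u, v, x, y.
have [u' [v' [c [-> -> h]]]] := IH v.
by exists u', v', (rcons c y); rewrite !rcons_cat.
Qed.

Implicit Types (g h : freegroup) (a j : nat).

(* The two ways in which cancellation can occur in g h^-1: with g = u c and
   h = v c the product is reduced after cancelling c, or two syllables with
   the same generator then merge. *)
Definition cancel0 u v c g h := [/\ word g = u ++ c, word h = v ++ c & word (g * h^-1)%g = u ++ winv v].
Definition cancel1 u v c (i : nat) (k l : int) g h := [/\ word g = u ++ (i, k) :: c,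
  word h = v ++ (i, l) :: c, k != l & word (g * h^-1)%g = u ++ (i, k - l) :: winv v].

(** The longest common suffix [c] of the two words cancels. What remains is either already reduced,
    or its two middle syllables carry the same generator with different exponents and merge into one
    nonzero syllable. *)
Lemma cancellation g h : (exists u v c, cancel0 u v c g h) \/
  (exists u v c i k l, cancel1 u v c i k l g h).
Proof.
have [u [v [c [gE hE H]]]] := common_suffix (word g) (word h).
have rg := freegroup_reduced g; have rh := freegroup_reduced h; rewrite gE in rg; rewrite hE in rh.
have ru := reduced_catl rg; have rv := reduced_catl rh.
have wE : word (g * h^-1)%g = wmul u (winv v).
  have -> : word (g * h^-1)%g = wmul (word g) (winv (word h)) by [].
  have := winv_reduced rh; rewrite gE hE winv_cat wmul_cat => rr.
  by rewrite -(wmul_reduced_cat rr) -{1}(winvK c) wmulVw // winv_reduced.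
have rwv := winv_reduced rv.
case: H => [u0|[v0|[a [b [x [y [uE vE xy]]]]]]].
- by left; exists u, v, c; split=> //; rewrite wE u0.
- by left; exists u, v, c; split=> //; rewrite wE v0 /= wmulw1 // cats0.
have [exy|nxy] := eqVneq x.1 y.1; last first.
  left; exists u, v, c; split=> //; rewrite wE; apply: wmul_reduced_cat.
  by move: ru rwv; rewrite uE vE winv_rcons => *; exact: reduced_glue_neq.
case: x y xy uE vE exy => [i k] [i' l] /= xy uE vE ei; subst i'.
have kl : k != l by apply: contra xy => /eqP ->.
right; exists a, b, c, i, k, l; split=> //; rewrite ?gE ?hE ?uE ?vE ?cat_rcons //.
rewrite wE uE vE winv_rcons /= -cats1 wmul_cat; move: ru rwv; rewrite uE vE winv_rcons /= => ru rwv.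
have k0 : k != 0 by have := reduced_catr (etrans (congr1 reduced (cats1 a (i, k))) ru); rewrite reduced_cons => /andP[].
have pE : push (i, k) ((i, - l) :: winv b) = (i, k - l) :: winv b.
  by rewrite /push /= (negbTE k0) eqxx subr_eq0 (negbTE kl).
rewrite /= pE; apply: wmul_reduced_cat; apply: reduced_glue ru _.
by rewrite -pE push_reduced //; move: rwv; rewrite reduced_cons => /and3P[].
Qed.

(* The letter at position l of g; only its generator is kept when b is false.
   Missing letters read (0, 0). *)
Definition dat (b : bool) (l : nat) g : nat * int :=
  let s := nth (0%N, 0) (word g) l in (s.1, if b then s.2 else (s.2 != 0)%:Z).

(** The two kinds of cancellation expressed by comparing letters of [g h^-1] and of its inverse with
    letters of [g] and of [h]. Each comparison can be made by averaging multipliers, which is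
    impossible for a condition on the unknown suffix. *)
Definition type0 (a b : nat) g h : bool := [&& size (word (g * h^-1)%g) == (a + b)%N,
  [forall l : 'I_a, dat true l (g * h^-1)%g == dat true l g] &
  [forall l : 'I_b, dat true l (g * h^-1)^-1%g == dat true l h]].
Definition type1 (a b : nat) g h : bool := [&& size (word (g * h^-1)%g) == (a + b).+1,
  [forall l : 'I_a, dat true l (g * h^-1)%g == dat true l g],
  [forall l : 'I_b, dat true l (g * h^-1)^-1%g == dat true l h],
  dat false a (g * h^-1)%g == dat false a g & dat false b (g * h^-1)^-1%g == dat false b h].

Lemma datT l g : dat true l g = nth (0%N, 0) (word g) l.
Proof. by rewrite /dat; case: nth. Qed.

Lemma nth_reduced_neq0 w l : reduced w -> (l < size w)%N -> (nth (0%N, 0) w l).2 != 0.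
Proof. by move=> /andP[/all_nthP h _] ls; exact: h. Qed.

Lemma lt_size_dat b l g : (dat b l g).2 != 0 = (l < size (word g))%N.
Proof.
rewrite /dat; have [ls|sl] := ltnP l (size (word g)); last by rewrite nth_default //=; case: b.
have := nth_reduced_neq0 (freegroup_reduced g) ls.
by case: b => //= ->.
Qed.

Lemma take_dat n w g : reduced w -> (n <= size w)%N ->
  (forall l, (l < n)%N -> nth (0%N, 0) w l = dat true l g) -> word g = take n w ++ drop n (word g).
Proof.
move=> rw nw h; have ng : (n <= size (word g))%N.
  case: n nw h => // n nw h; rewrite -(lt_size_dat true) -h //.
  exact: nth_reduced_neq0.
rewrite -{1}(cat_take_drop n (word g)); congr (_ ++ _).
apply: (@eq_from_nth _ (0%N, 0)) => [|l]; first by rewrite !size_takel.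
by rewrite size_takel // => ln; rewrite !nth_take // h // datT.
Qed.

Lemma word_inv g : word g^-1%g = winv (word g). Proof. by []. Qed.
Lemma word_mul g h : word (g * h)%g = wmul (word g) (word h). Proof. by []. Qed.

Lemma type0P a b g h : reflect (exists u v c, [/\ size u = a, size v = b & cancel0 u v c g h]) (type0 a b g h).
Proof.
apply: (iffP and3P) => [[/eqP sw /forallP ga /forallP hb]|[u [v [c [<- <- [gE hE wE]]]]]]; last first.
  split; first by rewrite wE size_cat size_winv.
    apply/forallP => l; rewrite !datT wE gE !nth_cat ltn_ord; exact: eqxx.
  apply/forallP => l; rewrite !datT word_inv wE hE winv_cat winvK !nth_cat ltn_ord; exact: eqxx.
set w := (g * h^-1)%g in sw ga hb *.
have rw := freegroup_reduced w.
pose u := take a (word w); pose v' := drop a (word w).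
have su : size u = a by rewrite size_takel // sw leq_addr.
have sv : size v' = b by rewrite size_drop sw addKn.
have wuv : word w = u ++ v' by rewrite cat_take_drop.
have gE : word g = u ++ drop a (word g).
  by apply: take_dat => // [|l la]; rewrite ?sw ?leq_addr // -datT; exact/eqP/(ga (Ordinal la)).
have hE : word h = winv v' ++ drop b (word h).
  have -> : winv v' = take b (winv (word w)) by rewrite wuv winv_cat take_cat size_winv sv ltnn subnn take0 cats0.
  apply: take_dat => [||l lb]; first exact: winv_reduced.
    by rewrite size_winv sw leq_addl.
  by rewrite -[winv _]/(word w^-1%g) -datT; exact/eqP/(hb (Ordinal lb)).
have rg := freegroup_reduced g; have rh := freegroup_reduced h.
(* The prefixes read off from [g h^-1] leave equal remainders: write [g] as [(g h^-1) h], multiply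
   out and cancel [u] on the left. *)
have cE : drop a (word g) = drop b (word h).
  move: rg rh; rewrite {1}gE {1}hE => rg rh.
  apply: (wmul_inj (u := u) (reduced_catr rg) (reduced_catr rh)).
  rewrite (wmul_reduced_cat rg) -gE.
  have -> : word g = wmul (word w) (word h).
    by rewrite -word_mul /w mulgVK.
  by rewrite wuv wmul_cat {1}hE -(wmul_reduced_cat rh) -{1}(winvK v') wmulVw //; exact: reduced_catr rh.
exists u, (winv v'), (drop a (word g)); rewrite size_winv; split=> //; split=> //.
  by rewrite cE.
by rewrite winvK.
Qed.

Lemma type1P a b g h : reflect (exists u v c i k l, [/\ size u = a, size v = b & cancel1 u v c i k l g h])
  (type1 a b g h).
Proof.
apply: (iffP and5P) => [[/eqP sw /forallP ga /forallP hb /eqP gi /eqP hi]|]; last first.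
  move=> [u [v [c [i [k [l [<- <- [gE hE kl wE]]]]]]]].
  have kl0 : k - l != 0 by rewrite subr_eq0.
  have k0 : k != 0 by have := reduced_catr (etrans (congr1 reduced (esym gE)) (freegroup_reduced g)); rewrite reduced_cons => /andP[].
  have l0 : l != 0 by have := reduced_catr (etrans (congr1 reduced (esym hE)) (freegroup_reduced h)); rewrite reduced_cons => /andP[].
  have wE' : word (g * h^-1)^-1%g = v ++ (i, l - k) :: winv u.
    by rewrite word_inv wE winv_cat winv_cons winvK /= cat_rcons opprB.
  split.
  - by rewrite wE size_cat /= size_winv addnS.
  - by apply/forallP => n; rewrite !datT wE gE !nth_cat ltn_ord; exact: eqxx.
  - by apply/forallP => n; rewrite !datT wE' hE !nth_cat ltn_ord; exact: eqxx.
  - by rewrite /dat wE gE !nth_cat ltnn subnn /= kl0 k0.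
  by rewrite /dat wE' hE !nth_cat ltnn subnn /= l0 -opprB oppr_eq0 kl0.
set w := (g * h^-1)%g in sw ga hb gi hi *.
have rw := freegroup_reduced w.
pose u := take a (word w); pose v' := drop a.+1 (word w); pose x := nth (0%N, 0) (word w) a.
have aw : (a < size (word w))%N by rewrite sw ltnS leq_addr.
have su : size u = a by rewrite size_takel // ltnW.
have sv : size v' = b by rewrite size_drop sw subSS addKn.
have wuv : word w = u ++ x :: v' by rewrite /u /x /v' -drop_nth // cat_take_drop.
have wvu : word w^-1%g = winv v' ++ (x.1, - x.2) :: winv u.
  by rewrite word_inv wuv winv_cat winv_cons cat_rcons.
have x0 : x.2 != 0 by exact: nth_reduced_neq0.
have gE : word g = u ++ drop a (word g).
  by apply: take_dat => // [|l la]; rewrite ?(ltnW aw) // -datT; exact/eqP/(ga (Ordinal la)).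
have hE : word h = winv v' ++ drop b (word h).
  have -> : winv v' = take b (winv (word w)).
    by rewrite -word_inv wvu take_cat size_winv sv ltnn subnn take0 cats0.
  apply: take_dat => [||l lb]; first exact: winv_reduced.
    by rewrite size_winv sw leqW // leq_addl.
  by rewrite -[winv _]/(word w^-1%g) -datT; exact/eqP/(hb (Ordinal lb)).
have datw : dat false a w = (x.1, 1) by rewrite /dat -/x x0.
have datw' : dat false b w^-1%g = (x.1, 1).
  by rewrite /dat wvu nth_cat size_winv sv ltnn subnn /= oppr_eq0 x0.
have ag : (a < size (word g))%N by rewrite -(lt_size_dat false) -gi datw.
have bh : (b < size (word h))%N by rewrite -(lt_size_dat false) -hi datw'.
rewrite (drop_nth (0%N, 0) ag) in gE; rewrite (drop_nth (0%N, 0) bh) in hE.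
move: gi hi; rewrite datw datw' /dat.
case: (nth _ (word g) a) gE => [i k] gE [xi _]; case: (nth _ (word h) b) hE => [i' l] hE [xi' _].
move: gE hE; rewrite /= -xi -xi'; case: (x) x0 wuv {wvu datw datw' xi xi'} => {i i'} i m; rewrite ![(_, _).1]/= ![(_, _).2]/= => m0 wuv gE hE.
have rg := freegroup_reduced g; have rh := freegroup_reduced h.
have E : (i, k) :: drop a.+1 (word g) = push (i, m) ((i, l) :: drop b.+1 (word h)).
  move: rg rh; rewrite {1}gE {1}hE => rg rh.
  apply: (wmul_inj (u := u) (reduced_catr rg)); first exact/push_reduced/reduced_catr/rh.
  rewrite (wmul_reduced_cat rg) -gE.
  have -> : word g = wmul (word w) (word h) by rewrite -word_mul /w mulgVK.
  rewrite wuv wmul_cat {1}hE -(wmul_reduced_cat rh) /= -{1}(winvK v') wmulVw //; exact: reduced_catr rh.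
(* If [m + l = 0], the word of [h] would continue after [(i, l)] with another syllable in the
   generator [i], contradicting reducedness. *)
move: E; rewrite /push /= (negbTE m0) eqxx; case: eqP => ml E.
  move: rh; rewrite hE -E => /reduced_catr; rewrite reduced_cons => /and3P[_].
  by rewrite /= eqxx.
case: E => kE cE; exists u, (winv v'), (drop a.+1 (word g)), i, k, l.
rewrite size_winv; split=> //; split=> //; first by rewrite cE.
  by rewrite kE -subr_eq0 addrK.
by rewrite winvK kE addrK.
Qed.

End Words.

(** * From p to 2p *)

Lemma leq_sum_abs (x y : int) : (`|x - y| <= `|x| + `|y|)%N.
Proof. lia. Qed.

Lemma sqrt_sqmod_invn {R : realType} (n : nat) : Num.sqrt (sqmod (n.+1%:R^-1 : R[i])) = n.+1%:R^-1.
Proof.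
have -> : (n.+1%:R^-1 : R[i]) = (n.+1%:R^-1 : R)%:C%C by rewrite fmorphV rmorph_nat.
by rewrite /sqmod /= expr0n addr0 sqrtr_sqr ger0_norm.
Qed.

Section Cotlar.
Context {R : realType}.
Notation G := freegroup.
Implicit Types (g h : G) (X Y : @Ix R) (z : nat -> R[i]).

Definition unim z := forall i, `|z i| = 1.

(** For [b] true this is the symbol of one syllable in the theorem. For [b] false it is [z_i] with
    [i] the generator of that syllable, and 1 past the end of the word: an auxiliary symbol that
    detects generators and lengths. *)
Definition lev z (b : bool) (l : nat) g : R[i] := z (dat b l g).1 ^ (dat b l g).2.

Lemma conj_unim (x : R[i]) : `|x| = 1 -> x^*%C = x^-1 /\ x != 0.
Proof.
move=> x1; have x0 : x != 0 by rewrite -normr_gt0 x1 ltr01.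
split=> //; apply: (mulfI x0); rewrite mulfV // -[LHS]/(x * (x^*)%C).
by have := normCK x; rewrite x1 expr1n => ->.
Qed.

Lemma cjXz (x : R[i]) (k : int) : (x ^ k)^*%C = (x^*%C) ^ k.
Proof. exact: (fmorphXz (@conjc R)). Qed.

Lemma unim_conj z : unim z -> unim (fun i => (z i)^*%C).
Proof. by move=> uz i; have [-> _] := conj_unim (uz i); rewrite normfV uz invr1. Qed.

Lemma lev_conj z b l g : (lev z b l g)^*%C = lev (fun i => (z i)^*%C) b l g.
Proof. exact: cjXz. Qed.

Lemma lev_conjM z b l g : unim z -> lev z b l g * (lev z b l g)^*%C = 1.
Proof.
move=> uz; rewrite cjXz; have [-> x0] := conj_unim (uz (dat b l g).1).
by rewrite /lev exprz_inv -expfzDr // subrr.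
Qed.

Lemma prim_root_complex n : (0 < n)%N -> exists w : R[i], n.-primitive_root w.
Proof.
move=> n0; have [r Dp] := closed_field_poly_normal ('X^n - 1 : {poly R[i]}).
rewrite (monicP _) ?monicXnsubC // scale1r in Dp.
have rn1 : all n.-unity_root r by apply/allP => w; rewrite -root_prod_XsubC -Dp.
have sr : (n < (size r).+1)%N by rewrite -(size_prod_XsubC r id) -Dp size_XnsubC.
have [|w] := hasP (cyclic.has_prim_root n0 rn1 _ sr); last by exists w.
by rewrite -separable.separable_prod_XsubC -Dp cyclotomic.separable_Xn_sub_1 // pnatr_eq0 -lt0n.
Qed.

Lemma root_sum n (w : R[i]) (d : int) : n.-primitive_root w -> (`|d| < n)%N ->
  \sum_(a < n) (w ^+ a) ^ d = n%:R * (d == 0)%:R.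
Proof.
move=> pw dn; have n0 := prim_order_gt0 pw.
have w0 : w != 0 by apply/eqP => w0; have := prim_expr_order pw; rewrite w0 expr0n eqn0Ngt n0 /= => /eqP; rewrite eq_sym oner_eq0.
have yE a : (w ^+ a) ^ d = (w ^ d) ^+ a by rewrite !exprnP !exprz_exp mulrC.
under eq_bigr do rewrite yE.
have [->|dn0] := eqVneq d 0.
  under eq_bigr do rewrite expr0z expr1n.
  by rewrite sumr_const card_ord mulr1.
have y1 : w ^ d != 1.
  have absd : w ^+ `|d|%N != 1.
    rewrite -(prim_order_dvd pw); apply/negP => /dvdn_leq; rewrite absz_gt0 dn0 => /(_ isT).
    by rewrite leqNgt dn.
  by case: (d) absd => k //; rewrite -[w ^ Negz k]/((w ^+ k.+1)^-1) invr_eq1.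
have h := subrX1 (w ^ d) n; have yn : (w ^ d) ^+ n = 1.
  by rewrite -yE (prim_expr_order pw) exp1rz.
move: h; rewrite yn subrr => /esym/eqP; rewrite mulf_eq0 subr_eq0 (negbTE y1) /= => /eqP ->.
by rewrite mulr0.
Qed.

Lemma prim_root_norm n (w : R[i]) : n.-primitive_root w -> `|w| = 1.
Proof.
move=> pw; have n0 := prim_order_gt0 pw; apply/eqP.
rewrite -(pexpr_eq1 n0 (normr_ge0 w)) -normrX (prim_expr_order pw) normr1 //.
Qed.

Lemma unim_root n (w : R[i]) a : n.-primitive_root w -> `|w ^+ a| = 1.
Proof. by move=> /prim_root_norm h; rewrite normrX h expr1n. Qed.

Section Double.
Variables (p q : R).
Hypotheses (p1 : 1 < p) (pq : p^-1 + q^-1 = 1).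

(** The mean of [(w^a)^(code (g h^-1) - code g)] over the L-th roots of unity is the indicator of
    equal codes once the difference is below [L] in absolute value. Each summand is a product of
    multipliers in [g h^-1] and in [g], so the bound does not depend on [L]. *)
Lemma good_avg (code : G -> int) (c1 c2 C : R) kap : 0 <= c1 -> 0 <= c2 -> 0 <= C ->
  (forall w, `|w| = 1 -> bdd p c1 (fun g => w ^ code g)) ->
  (forall w, `|w| = 1 -> bdd (2 * p) c2 (fun g => w ^ code g)) -> good p C kap ->
  good p (c1 * C * c2) (fun g h => kap g h * (code (g * h^-1)%g == code g)%:R).
Proof.
move=> c10 c20 C0 h1 h2 hk X Y.
(* Larger than every difference of codes that occurs for these two families. *)
pose L := (\sum_(t <- X) \sum_(v <- Y) (`|code (t.2.1.2 * v.2.1.2^-1)%g| + `|code t.2.1.2|)%N).+1.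
have [w pw] := prim_root_complex (ltn0Sn _ : (0 < L)%N).
pose k (a : 'I_L) g h : R[i] := L%:R^-1 * ((w ^+ a) ^ code (g * h^-1)%g * kap g h * ((w ^+ a)^-1) ^ code g * (1 : R[i])^*%C).
have E : val_ix (bil (fun g h => kap g h * (code (g * h^-1)%g == code g)%:R) X Y) =
    \sum_(a <- enum 'I_L) val_ix (bil (k a) X Y).
  apply: val_bil_sum => t v tX vY; rewrite big_enum /= /k cj1.
  set x := code _; set y := code t.2.1.2; set K := kap _ _.
  rewrite -mulr_sumr (eq_bigr (fun a : 'I_L => K * (w ^+ a) ^ (x - y))) => [|a _]; last first.
    have w0 : w ^+ a != 0 by rewrite -normr_gt0 (unim_root _ pw) ltr01.
    by rewrite exprz_inv mulr1 expfzDr //; ring.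
  rewrite -mulr_sumr root_sum //; last first.
    rewrite ltnS; apply: leq_trans (leq_sum_abs x y) _.
    by rewrite (big_rem t tX) /= (big_rem v vY) /= -addnA -addnA leq_add2l leq_addr.
  by rewrite subr_eq0 (mulrCA K) mulKf // pnatr_eq0.
apply: le_trans (nm_sum p1 pq E) _.
have b a : nm p (bil (k a) X Y) <= L%:R^-1 * (c1 * C * c2 * (nm (2 * p) X * nm (2 * p) Y)).
  have u1 := unim_root a pw; have u2 : `|(w ^+ a)^-1| = 1 by rewrite normfV u1 invr1.
  have g1 := good_mul C0 c10 c20 ler01 (h1 _ u1) (h2 _ u2) (@bdd1 R (2 * p)) hk.
  have Cc : 0 <= c1 * C * c2 * 1 by rewrite !mulr_ge0.
  have := goodZ p1 L%:R^-1 Cc g1 X Y; rewrite sqrt_sqmod_invn (mulr1 (c1 * C * c2)) -!mulrA; exact.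
apply: le_trans (ler_sum _ (fun a _ => b a)) _.
rewrite big_const_seq count_predT size_enum_ord iter_addr addr0 -[leLHS]mulr_natl mulVKf //.
by rewrite pnatr_eq0.
Qed.

Definition Bd r (M : (nat -> R[i]) -> G -> R[i]) := exists2 C, 0 <= C & forall z, unim z -> bdd r C (M z).
Definition Gd (K : (nat -> R[i]) -> G -> G -> R[i]) := exists2 C, 0 <= C & forall z, unim z -> good p C (K z).

Lemma Bd1 r : Bd r (fun _ _ => 1). Proof. by exists 1 => // z _; exact: bdd1. Qed.

Lemma Bd_conj r b l : Bd r (fun z => lev z b l) -> Bd r (fun z g => (lev z b l g)^*%C).
Proof.
move=> [C C0 h]; exists C => // z uz; have := h _ (unim_conj uz).
by congr (bdd _ _ _); apply/funext => g; rewrite lev_conj.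
Qed.

Lemma Gd_eq K K' : (forall z g h, unim z -> K z g h = K' z g h) -> Gd K -> Gd K'.
Proof. by move=> e [C C0 h]; exists C => // z uz; apply: (good_ext (fun g h => e z g h uz)); exact: h. Qed.

Lemma Gd1 : Gd (fun _ _ _ => 1). Proof. by exists 1 => // z _; exact: (good_one p1 pq). Qed.
Lemma Gd0 : Gd (fun _ _ _ => 0).
Proof.
have [C C0 h] := Gd1; exists (Num.sqrt (sqmod (0 : R[i])) * C) => [|z uz]; first by rewrite mulr_ge0 ?sqrtr_ge0.
by apply: (good_ext _ (goodZ p1 0 C0 (h z uz))) => g k; rewrite mul0r.
Qed.
Lemma GdD K K' : Gd K -> Gd K' -> Gd (fun z g h => K z g h + K' z g h).
Proof.
move=> [C C0 h] [C' C'0 h']; exists (C + C') => [|z uz]; first exact: addr_ge0.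
exact: (goodD p1 pq (h z uz) (h' z uz)).
Qed.
Lemma GdZ c K : Gd K -> Gd (fun z g h => c * K z g h).
Proof.
move=> [C C0 h]; exists (Num.sqrt (sqmod c) * C) => [|z uz]; first by rewrite mulr_ge0 ?sqrtr_ge0.
exact: (goodZ p1 c C0 (h z uz)).
Qed.
Lemma GdB K K' : Gd K -> Gd K' -> Gd (fun z g h => K z g h - K' z g h).
Proof. by move=> gK /(GdZ (-1)) gK'; apply: Gd_eq (GdD gK gK') => z g h _; rewrite mulN1r. Qed.
Lemma Gd_mul o n n' K : Bd p o -> Bd (2 * p) n -> Bd (2 * p) n' -> Gd K ->
  Gd (fun z g h => o z (g * h^-1)%g * K z g h * n z g * (n' z h)^*%C).
Proof.
move=> [c1 h10 h1] [c2 h20 h2] [c3 h30 h3] [C C0 h]; exists (c1 * C * c2 * c3) => [|z uz].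
  by rewrite !mulr_ge0.
exact: (good_mul C0 h10 h20 h30 (h1 z uz) (h2 z uz) (h3 z uz) (h z uz)).
Qed.
Lemma Gd_star K : Gd K -> Gd (fun z g h => (K z h g)^*%C).
Proof. by move=> [C C0 h]; exists C => // z uz; exact: (good_star p1 (h z uz)). Qed.

(** A condition on pairs whose indicator may multiply any bounded kernel; with [stable_and] and
    [stable_all] the types of cancellation are assembled from elementary comparisons. *)
Definition stable (t : G -> G -> bool) := forall K, Gd K -> Gd (fun z g h => K z g h * (t g h)%:R).

Lemma stable_and t t' : stable t -> stable t' -> stable (fun g h => t g h && t' g h).
Proof.
move=> h h' K gK; apply: Gd_eq (h' _ (h _ gK)) => z g k _.
by rewrite -mulrA; congr (_ * _); case: (t g k); case: (t' g k); rewrite ?mulr1 ?mulr0.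
Qed.
Lemma stable_ext t t' : (forall g h, t g h = t' g h) -> stable t -> stable t'.
Proof. by move=> e h K gK; apply: Gd_eq (h K gK) => z g k _; rewrite e. Qed.
Lemma stable_all (a : nat) (t : nat -> G -> G -> bool) : (forall n, (n < a)%N -> stable (t n)) ->
  stable (fun g h => [forall n : 'I_a, t n g h]).
Proof.
elim: a => [|a IH] ht.
  apply: (@stable_ext (fun _ _ => true)) => [g h|K gK]; first by apply/esym/forallP => -[].
  by apply: Gd_eq gK => z g h _; rewrite mulr1.
apply: stable_ext (stable_and (IH (fun n na => ht n (ltnW na : (n < a.+1)%N))) (ht a (ltnSn a))) => g h.
apply/andP/forallP => [[/forallP h1 h2] [n na]|h1].
  have : (n <= a)%N by rewrite -ltnS.
  by rewrite leq_eqVlt /= => /predU1P[-> //|na']; exact: (h1 (Ordinal na')).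
split; last exact: (h1 ord_max).
by apply/forallP => n; exact: (h1 (widen_ord (leqnSn a) n)).
Qed.
Lemma stable_star t : stable t -> stable (fun g h => t h g).
Proof.
move=> h K gK; apply: Gd_eq (Gd_star (h _ (Gd_star gK))) => z g k _.
by rewrite cjM conjcK; case: (t k g); rewrite ?cj1 ?cj0.
Qed.

Hypothesis Hp : forall l b, Bd p (fun z => lev z b l).

Lemma stable_size n : stable (fun g h => size (word (g * h^-1)%g) == n).
Proof.
have le m K : Gd K -> Gd (fun z g h => K z g h * (size (word (g * h^-1)%g) <= m)%N%:R).
  (* With all [z_i = -1] the generator symbol at position [m] is 1 when the length is at most [m]
     and -1 otherwise, so half its sum with 1 is the indicator of that event. *)
  move=> gK; have um : unim (fun=> -1) by move=> i; rewrite normrN1.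
  have o : Bd p (fun _ => lev (fun=> -1) false m) by have [C C0 h] := Hp m false; exists C => // z _; exact: h.
  apply: Gd_eq (GdZ 2^-1 (GdD gK (Gd_mul o (Bd1 _) (Bd1 _) gK))) => z g h _.
  have -> : lev (fun=> -1) false m (g * h^-1)%g = if (size (word (g * h^-1)%g) <= m)%N then 1 else -1.
    by rewrite /lev leqNgt -(lt_size_dat false) /dat /=; case: (_ == 0).
  rewrite cj1 !mulr1; case: (size _ <= m)%N; last by rewrite mulN1r subrr !mulr0.
  have two (x : R[i]) : 2^-1 * (x + x) = x by rewrite -mulr2n -[x *+ 2]mulr_natl mulKf // pnatr_eq0.
  by rewrite mul1r mulr1; exact: two.
move=> K gK; case: n => [|n].
  by apply: Gd_eq (le 0%N K gK) => z g h _; rewrite leqn0.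
apply: Gd_eq (GdB (le n.+1 K gK) (le n K gK)) => z g h _; rewrite -mulrBr; congr (_ * _).
rewrite (leq_eqVlt _ n.+1) ltnS; have [->|_] := eqVneq; first by rewrite ltnn subr0.
by rewrite subrr.
Qed.

Lemma stable_code (code : G -> int) :
  (exists2 c, 0 <= c & forall w, `|w| = 1 -> bdd p c (fun g => w ^ code g)) ->
  (exists2 c, 0 <= c & forall w, `|w| = 1 -> bdd (2 * p) c (fun g => w ^ code g)) ->
  stable (fun g h => code (g * h^-1)%g == code g).
Proof.
move=> [c1 h10 h1] [c2 h20 h2] K [C C0 h]; exists (c1 * C * c2) => [|z uz]; first by rewrite !mulr_ge0.
exact: (good_avg h10 h20 C0 h1 h2 (h z uz)).
Qed.

(** Taking [z_i = w^(i + 1)] turns the generator symbol into [w] raised to a code of the generator;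
    the shift by 1 reserves the code 0 for a missing letter. *)
Lemma stable_dat_false l : Bd (2 * p) (fun z => lev z false l) ->
  stable (fun g h => dat false l (g * h^-1)%g == dat false l g).
Proof.
move=> H2; pose code g : int := if (dat false l g).2 == 0 then 0 else (dat false l g).1.+1%:Z.
have cE g : forall w : R[i], w ^ code g = lev (fun i => w ^+ i.+1) false l g.
  by move=> w; rewrite /code /lev /dat /=; case: (_ != 0); rewrite /= ?expr0z ?expr1z.
have conv r : Bd r (fun z => lev z false l) ->
    exists2 c, 0 <= c & forall w, `|w| = 1 -> bdd r c (fun g => w ^ code g).
  move=> [c c0 h]; exists c => // w w1.
  have -> : (fun g => w ^ code g) = lev (fun i => w ^+ i.+1) false l by apply/funext => g; exact: cE.
  by apply: h => i; rewrite normrX w1 expr1n.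
apply: stable_ext (stable_code (conv _ (Hp l false)) (conv _ H2)) => g h; rewrite /code.
set w := (g * h^-1)%g; have z0 x : (dat false l x).2 == 0 -> dat false l x = (0%N, 0).
  move=> /eqP x0; have : ~~ ((dat false l x).2 != 0) by rewrite x0.
  by rewrite lt_size_dat -leqNgt /dat => hs; rewrite nth_default.
have z1 x : (dat false l x).2 != 0 -> (dat false l x).2 = 1 by rewrite /dat /=; case: (_ == 0).
have [/z0 e1|n1] := boolP ((dat false l w).2 == 0); have [/z0 e2|n2] := boolP ((dat false l g).2 == 0).
- by rewrite e1 e2 !eqxx.
- by rewrite e1; apply/esym/negbTE; apply: contra n2 => /eqP <-.
- by rewrite e2; apply/esym/negbTE; apply: contra n1 => /eqP ->.
rewrite eqz_nat eqSS [X in _ = (X == _)]surjective_pairing [X in _ = (_ == X)]surjective_pairing.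
by rewrite (z1 _ n1) (z1 _ n2) xpair_eqE eqxx andbT.
Qed.

Lemma stable_dat (l : nat) (b : bool) : (forall b' : bool, (b' <= b)%N -> Bd (2 * p) (fun z => lev z b' l)) ->
  stable (fun g h => dat b l (g * h^-1)%g == dat b l g).
Proof.
case: b => H; last exact: stable_dat_false (H false isT).
pose code g : int := (dat true l g).2.
have conv r : Bd r (fun z => lev z true l) ->
    exists2 c, 0 <= c & forall w, `|w| = 1 -> bdd r c (fun g => w ^ code g).
  by move=> [c c0 h]; exists c => // w w1; exact: (h (fun=> w)).
apply: stable_ext (stable_and (stable_dat_false (H false isT)) (stable_code (conv _ (Hp l true)) (conv _ (H true isT)))) => g h.
rewrite /code /dat /= !xpair_eqE; apply/andP/andP => [[/andP[-> _] -> //]|[-> /eqP ->]].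
by rewrite eqxx.
Qed.

Lemma stable_datr (l : nat) (b : bool) : (forall b' : bool, (b' <= b)%N -> Bd (2 * p) (fun z => lev z b' l)) ->
  stable (fun g h => dat b l (g * h^-1)^-1%g == dat b l h).
Proof. by move=> /stable_dat /stable_star; apply: stable_ext => g h; rewrite invgM invgK. Qed.

End Double.
End Cotlar.

(** * Induction on the position of the letter *)

Section Doubling.
Context {R : realType}.
Notation G := freegroup.
Implicit Types (g h : G) (X Y : @Ix R) (z : nat -> R[i]).

Lemma dat_nth (b : bool) (l l' : nat) g h :
  nth (0%N, 0) (word g) l = nth (0%N, 0) (word h) l' -> dat b l g = dat b l' h.
Proof. by rewrite /dat => ->. Qed.

Lemma dat_shift (b : bool) (j : nat) u v s s' c g h : word g = u ++ s ++ c -> word h = v ++ s' ++ c ->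
  size s = size s' -> (size u + size s <= j)%N -> dat b j g = dat b (j - size u + size v) h.
Proof.
move=> gE hE ss uj; apply: dat_nth; rewrite gE hE !catA !nth_cat !size_cat -ss.
rewrite ltnNge uj /= (_ : (j - size u + size v < size v + size s)%N = false); last by lia.
by rewrite [(_ + size v)%N]addnC subnDl subnDA.
Qed.

Lemma doubling_bound (c A T : R) : 0 <= c -> 0 <= A -> 0 <= T -> T ^+ 2 <= c * (A ^+ 2 + A * T) -> T <= (2 * c + 1) * A.
Proof.
move=> c0 A0 T0 h; have [TA|AT] := leP T A.
  by apply: le_trans TA _; rewrite -[leLHS]mul1r ler_wpM2r // lerDr mulr_ge0.
have T1 : 0 < T by apply: le_lt_trans AT.
have A2 : A ^+ 2 <= A * T by rewrite expr2 ler_wpM2l // ltW.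
have h2 : c * (A ^+ 2 + A * T) <= c * (A * T + A * T) by apply: ler_wpM2l => //; rewrite lerD2r.
rewrite -(ler_pM2r T1) -expr2; apply: (le_trans (le_trans h h2)).
by rewrite -subr_ge0 (_ : _ - _ = A * T); [exact: mulr_ge0|ring].
Qed.

Section Step.
Variables (p q : R).
Hypotheses (p1 : 1 < p) (pq : p^-1 + q^-1 = 1).
Hypothesis Hp : forall l b, Bd p (fun z => lev z b l).
Variables (l : nat) (b : bool).
Hypothesis Hlow : forall (l' : nat) b', (l' < l)%N -> Bd (2 * p) (fun z => lev z b' l').
Hypothesis Hsame : b -> Bd (2 * p) (fun z => lev z false l).

Notation m := (fun z g => lev z b l g).

(** Kernels at most linear in the unknown multiplier. With A and T the L_2p-norms of a family and of
    its image, the three terms contribute at most multiples of [A^2], [T A] and [A T]. *)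
Definition Ext (K : (nat -> R[i]) -> G -> G -> R[i]) := exists K1 K2 K3, [/\ Gd p K1, Gd p K2, Gd p K3 &
  forall z g h, unim z -> K z g h = K1 z g h + K2 z g h * m z g + K3 z g h * (m z h)^*%C].

Lemma Ext_eq K K' : (forall z g h, unim z -> K z g h = K' z g h) -> Ext K -> Ext K'.
Proof.
move=> e [K1 [K2 [K3 [h1 h2 h3 E]]]]; exists K1, K2, K3; split=> // z g h uz.
by rewrite -e // E.
Qed.
Lemma Ext1 K : Gd p K -> Ext K.
Proof.
move=> gK; have g0 := Gd0 p1 pq; exists K, (fun _ _ _ => 0), (fun _ _ _ => 0); split=> // z g h _.
by rewrite !mul0r !addr0.
Qed.
Lemma Ext2 K : Gd p K -> Ext (fun z g h => K z g h * m z g).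
Proof.
move=> gK; have g0 := Gd0 p1 pq; exists (fun _ _ _ => 0), K, (fun _ _ _ => 0); split=> // z g h _.
by rewrite mul0r addr0 add0r.
Qed.
Lemma Ext3 K : Gd p K -> Ext (fun z g h => K z g h * (m z h)^*%C).
Proof.
move=> gK; have g0 := Gd0 p1 pq; exists (fun _ _ _ => 0), (fun _ _ _ => 0), K; split=> // z g h _.
by rewrite mul0r add0r add0r.
Qed.
Lemma ExtD K K' : Ext K -> Ext K' -> Ext (fun z g h => K z g h + K' z g h).
Proof.
move=> [K1 [K2 [K3 [h1 h2 h3 E]]]] [K1' [K2' [K3' [h1' h2' h3' E']]]].
exists (fun z g h => K1 z g h + K1' z g h), (fun z g h => K2 z g h + K2' z g h),
  (fun z g h => K3 z g h + K3' z g h); split; try exact: (GdD p1 pq).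
by move=> z g h uz; rewrite E // E' //; ring.
Qed.
Lemma ExtB K K' : Ext K -> Ext K' -> Ext (fun z g h => K z g h - K' z g h).
Proof.
move=> [K1 [K2 [K3 [h1 h2 h3 E]]]] [K1' [K2' [K3' [h1' h2' h3' E']]]].
exists (fun z g h => K1 z g h - K1' z g h), (fun z g h => K2 z g h - K2' z g h),
  (fun z g h => K3 z g h - K3' z g h); split; try exact: (GdB p1 pq).
by move=> z g h uz; rewrite E // E' //; ring.
Qed.
Lemma Ext_stable t K : stable p t -> Ext K -> Ext (fun z g h => K z g h * (t g h)%:R).
Proof.
move=> st [K1 [K2 [K3 [h1 h2 h3 E]]]].
exists (fun z g h => K1 z g h * (t g h)%:R), (fun z g h => K2 z g h * (t g h)%:R),
  (fun z g h => K3 z g h * (t g h)%:R); split; try exact: st.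
by move=> z g h uz; rewrite E //; ring.
Qed.

(** The types cover the support of [K] but need not be disjoint: they are removed one at a time,
    replacing [K] by [K - K t], which is why the types must be stable too. *)
Lemma Ext_types (ts : seq (G -> G -> bool)) K : (forall z g h, K z g h != 0 -> has (fun t => t g h) ts) ->
  (forall n, (n < size ts)%N -> stable p (nth (fun _ _ => false) ts n) /\
     Ext (fun z g h => K z g h * (nth (fun _ _ => false) ts n g h)%:R)) -> Ext K.
Proof.
elim: ts K => [|t ts IH] K h0 hs.
  apply: Ext_eq (Ext1 (Gd0 p1 pq)) => z g h _; apply/esym/eqP; apply: contraT => /h0 //.
have [st e1] := hs 0%N isT; rewrite /= in st e1.
have e2 : Ext (fun z g h => K z g h - K z g h * (t g h)%:R).
  apply: IH => [z g h|n nts].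
    have := h0 z g h; rewrite /=; case: (t g h) => /=; first by rewrite mulr1 subrr eqxx.
    by rewrite mulr0 subr0.
  have [sn en] := hs n.+1 nts; split=> //.
  by apply: Ext_eq (ExtB en (Ext_stable st en)) => z g h _ /=; ring.
by apply: Ext_eq (ExtD e1 e2) => z g h _; ring.
Qed.

Lemma stable_type0 (a c : nat) : (a <= l)%N -> (c <= l)%N -> stable p (type0 a c).
Proof.
move=> al cl; have H1 := stable_size p1 pq Hp (a + c).
have H2 : stable p (fun g h => [forall n : 'I_a, dat true n (g * h^-1)%g == dat true n g]).
  apply: (stable_all (t := fun n g h => dat true n (g * h^-1)%g == dat true n g)) => n na.
  by apply: (stable_dat p1 pq Hp) => b' _; apply: Hlow; exact: leq_trans al.
have H3 : stable p (fun g h => [forall n : 'I_c, dat true n (g * h^-1)^-1%g == dat true n h]).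
  apply: (stable_all (t := fun n g h => dat true n (g * h^-1)^-1%g == dat true n h)) => n na.
  by apply: (stable_datr p1 pq Hp) => b' _; apply: Hlow; exact: leq_trans cl.
exact: (stable_and H1 (stable_and H2 H3)).
Qed.

Lemma Bd_false (a : nat) : (a < l + b)%N -> Bd (2 * p) (fun z => lev z false a).
Proof.
have [al _|la ab] := ltnP a l; first exact: Hlow.
have [bt aE] : b /\ a = l by move: ab; case: (b) => /= h; split=> //; lia.
by rewrite aE; exact: Hsame.
Qed.

Lemma stable_type1 (a c : nat) : (a < l + b)%N -> (c < l + b)%N -> stable p (type1 a c).
Proof.
move=> al cl; have le (x : nat) : (x < l + b)%N -> (x <= l)%N by case: (b) => /= h; lia.
have H1 := stable_size p1 pq Hp (a + c).+1.
have H2 : stable p (fun g h => [forall n : 'I_a, dat true n (g * h^-1)%g == dat true n g]).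
  apply: (stable_all (t := fun n g h => dat true n (g * h^-1)%g == dat true n g)) => n na.
  by apply: (stable_dat p1 pq Hp) => b' _; apply: Hlow; exact: leq_trans (le _ al).
have H3 : stable p (fun g h => [forall n : 'I_c, dat true n (g * h^-1)^-1%g == dat true n h]).
  apply: (stable_all (t := fun n g h => dat true n (g * h^-1)^-1%g == dat true n h)) => n na.
  by apply: (stable_datr p1 pq Hp) => b' _; apply: Hlow; exact: leq_trans (le _ cl).
have H4 : stable p (fun g h => dat false a (g * h^-1)%g == dat false a g).
  by apply: (stable_dat p1 pq Hp) => -[] // _; exact: Bd_false.
have H5 : stable p (fun g h => dat false c (g * h^-1)^-1%g == dat false c h).
  by apply: (stable_datr p1 pq Hp) => -[] // _; exact: Bd_false.
exact: (stable_and H1 (stable_and H2 (stable_and H3 (stable_and H4 H5)))).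
Qed.

Let S t (st : stable p t) : Gd p (fun _ g h => 1 * (t g h)%:R) := st _ (Gd1 p1 pq).

(** Inside the common suffix, letter [l] of one word is a letter of the other at a position shifted
    by [a - c]. If [a <> c], one of the two factors thus becomes a symbol at a position below [l],
    already bounded, and the other stays; if [a = c] the product is 1. *)
Lemma Ext_shift t (a c : nat) : stable p t -> (a <= l)%N -> (c <= l)%N ->
  (forall g h, t g h -> dat b l g = dat b (l - a + c) h /\ dat b l h = dat b (l - c + a) g) ->
  Ext (fun z g h => m z g * (m z h)^*%C * (t g h)%:R).
Proof.
move=> st al cl ht; have g1 := S st.
have [ac|ca|ac] := ltngtP a c.
- have lo : (l - c + a < l)%N by lia.
  have gK := Gd_mul (Bd1 p) (Bd_conj (Hlow b lo)) (Bd1 (2 * p)) g1.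
  apply: Ext_eq (Ext2 gK) => z g h uz; rewrite cj1; case tE: (t g h); rewrite ?mulr0 ?mul0r ?mulr1 ?mul1r //.
  by rewrite /lev (ht _ _ tE).2 mulrC.
- have lo : (l - a + c < l)%N by lia.
  have gK := Gd_mul (Bd1 p) (Bd1 (2 * p)) (Bd_conj (Hlow b lo)) g1.
  apply: Ext_eq (Ext3 gK) => z g h uz; rewrite conjcK; case tE: (t g h); rewrite ?mulr0 ?mul0r ?mulr1 ?mul1r //.
  by rewrite /lev (ht _ _ tE).1.
apply: Ext_eq (Ext1 g1) => z g h uz; case tE: (t g h); rewrite ?mulr0 ?mulr1 //.
have := (ht _ _ tE).1; rewrite ac subnK // => e.
have -> : lev z b l h = lev z b l g by rewrite /lev e.
by rewrite lev_conjM.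
Qed.

Lemma Ext_type0 (a c : nat) : (a <= l)%N -> (c <= l)%N ->
  Ext (fun z g h => m z g * (m z h)^*%C * (type0 a c g h)%:R).
Proof.
move=> al cl; apply: (Ext_shift (stable_type0 al cl) al cl) => g h /type0P[u [v [w [us vs [gE hE _]]]]].
rewrite -us -vs; split.
  by apply: (@dat_shift _ _ u v [::] [::] w) => //=; rewrite us addn0.
by apply: (@dat_shift _ _ v u [::] [::] w) => //=; rewrite vs addn0.
Qed.

(** If the merged letters lie before position [l] in both words, [Ext_shift] applies. Otherwise [b]
    is true and a merged letter is at position [l]: since [g h^-1] carries the exponent [k - k']
    there, the identity [z^k = z^(k - k') z^k'] replaces [m(g)] by [m(g h^-1)] times a symbol of
    [h], and symmetrically for [h]. If both are at [l], the product is [m(g h^-1)]. *)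
Lemma Ext_type1 (a c : nat) : (a < l + b)%N -> (c < l + b)%N ->
  Ext (fun z g h => m z g * (m z h)^*%C * (type1 a c g h)%:R).
Proof.
move=> al cl; have st := stable_type1 al cl; have g1 := S st.
have [[al' cl']|] := pselect ((a < l)%N /\ (c < l)%N).
  apply: (Ext_shift st (ltnW al') (ltnW cl')) => g h /type1P[u [v [w [i [k [k' [us vs [gE hE _ _]]]]]]]].
  rewrite -us -vs; split.
    by apply: (@dat_shift _ _ u v [:: (i, k)] [:: (i, k')] w) => //=; rewrite us addn1.
  by apply: (@dat_shift _ _ v u [:: (i, k')] [:: (i, k)] w) => //=; rewrite vs addn1.
move=> ncl; have bt : b by move: al cl ncl; case: (b) => //=; rewrite addn0 => h1 h2 [].
have le (x : nat) : (x < l + b)%N -> (x <= l)%N by case: (b) => /= h; lia.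
have rel g h : type1 a c g h -> exists i k k', [/\ dat true a g = (i, k), dat true c h = (i, k'),
    dat true a (g * h^-1)%g = (i, k - k') & dat true c (g * h^-1)^-1%g = (i, k' - k)].
  move=> /type1P[u [v [w [i [k [k' [<- <- [gE hE _ wE]]]]]]]]; exists i, k, k'.
  by rewrite !datT word_inv wE gE hE winv_cat winv_cons winvK cat_rcons !nth_cat !ltnn !subnn /= opprB.
have unz z i : unim z -> z i != 0 by move=> uz; have [] := conj_unim (uz i).
have cXN z i (k : int) : unim z -> (z i ^ k)^*%C = z i ^ (- k).
  by move=> uz; rewrite cjXz; have [-> _] := conj_unim (uz i); rewrite exprz_inv.
have [aE|aNE] := eqVneq a l; have [cE|cNE] := eqVneq c l.
- have gK := Gd_mul (Hp l b) (Bd1 (2 * p)) (Bd1 (2 * p)) g1.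
  apply: Ext_eq (Ext1 gK) => z g h uz; rewrite cj1 !mulr1 mul1r; case tE: (type1 a c g h); rewrite ?mulr0 ?mulr1 //.
  have [i [k [k' [e1 e2 e3 _]]]] := rel _ _ tE; subst a c.
  by rewrite /lev bt e1 e2 e3 /= cXN // -expfzDr // unz.
- have cl' : (c < l)%N by rewrite ltn_neqAle cNE le.
  have gK := Gd_mul (Hp l b) (Bd1 (2 * p)) (Bd_conj (Hlow true cl')) g1.
  apply: Ext_eq (Ext3 gK) => z g h uz; rewrite conjcK mulr1 mul1r; case tE: (type1 a c g h); rewrite ?mulr0 ?mul0r ?mulr1 //.
  have [i [k [k' [e1 e2 e3 _]]]] := rel _ _ tE; subst a.
  congr (_ * _); rewrite /lev bt e1 e3.
  by rewrite e2 /= -expfzDr ?unz // subrK.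
- have al' : (a < l)%N by rewrite ltn_neqAle aNE le.
  have o : Bd p (fun z w => (lev z b l w^-1%g)^*%C).
    by have [C C0 hC] := Hp l b; exists C => // z uz; exact: (bdd_star p1 (hC z uz)).
  have gK := Gd_mul o (Bd_conj (Hlow true al')) (Bd1 (2 * p)) g1.
  apply: Ext_eq (Ext2 gK) => z g h uz; rewrite cj1 mul1r mulr1; case tE: (type1 a c g h); rewrite ?mulr0 ?mul0r ?mulr1 //.
  have [i [k [k' [e1 e2 _ e4]]]] := rel _ _ tE; subst c.
  rewrite mulrC; congr (_ * _); rewrite /lev bt e2 e4 e1 /= !cXN // -expfzDr ?unz //.
  by congr (_ ^ _); ring.
case: ncl; split; rewrite ltn_neqAle ?aNE ?cNE; exact: le.
Qed.

(** The error in Cotlar's identity: expanding it expresses [m(g) m(h)^*] through products containing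
    [m(g h^-1)] or [m(h g^-1)^*]. It vanishes unless letter [l] is disturbed on both sides. *)
Definition deltas z g h : R[i] := let w := (g * h^-1)%g in
  (m z w - m z g) * ((m z w^-1%g)^*%C - (m z h)^*%C).

Definition type_of (c : bool * (nat * nat)) : G -> G -> bool :=
  if c.1 then type1 c.2.1 c.2.2 else type0 c.2.1 c.2.2.
(** The retained prefixes have lengths at most [l]. For merging syllables the bound is strict if [b]
    is false, because a merged syllable keeps its generator and so does not change that symbol. *)
Definition codes : seq (bool * (nat * nat)) :=
  [seq (false, (a, c)) | a <- iota 0 l.+1, c <- iota 0 l.+1] ++
  [seq (true, (a, c)) | a <- iota 0 (l + b), c <- iota 0 (l + b)].
Definition types := map type_of codes.

Lemma deltas_types z g h : deltas z g h != 0 -> has (fun t => t g h) types.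
Proof.
move=> dn; rewrite has_map; apply/hasP.
have eu : dat b l (g * h^-1)%g != dat b l g.
  by apply: contra dn => /eqP e; rewrite /deltas /lev e subrr mul0r.
have ev : dat b l (g * h^-1)^-1%g != dat b l h.
  by apply: contra dn => /eqP e; rewrite /deltas {3 4}/lev e subrr mulr0.
have [[u [v [c cc]]]|[u [v [c [i [k [k' cc]]]]]]] := cancellation g h.
  have [gE hE wE] := cc; exists (false, (size u, size v)); last by apply/type0P; exists u, v, c.
  rewrite mem_cat; apply/orP; left.
  apply: (allpairs_f (fun a c => (false, (a, c)))); rewrite mem_iota /= add0n ltnS leqNgt; [apply: contra eu => lu|apply: contra ev => lv].
    by apply/eqP/dat_nth; rewrite gE wE !nth_cat lu.
  by apply/eqP/dat_nth; rewrite hE word_inv wE winv_cat winvK !nth_cat lv.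
have [gE hE kk wE] := cc; exists (true, (size u, size v)).
  have kn : k - k' != 0 by rewrite subr_eq0.
  have kn' : k' - k != 0 by rewrite subr_eq0 eq_sym.
  have k0 : k != 0 by have := reduced_catr (etrans (congr1 reduced (esym gE)) (freegroup_reduced g)); rewrite reduced_cons => /andP[].
  have k0' : k' != 0 by have := reduced_catr (etrans (congr1 reduced (esym hE)) (freegroup_reduced h)); rewrite reduced_cons => /andP[].
  have wE' : word (g * h^-1)^-1%g = v ++ (i, k' - k) :: winv u.
    by rewrite word_inv wE winv_cat winv_cons winvK cat_rcons /= opprB.
  rewrite mem_cat; apply/orP; right.
  apply: (allpairs_f (fun a c => (true, (a, c)))); rewrite mem_iota /= add0n ltnNge; [apply: contra eu => lu|apply: contra ev => lv].
    have [lu'|ul] := ltnP l (size u); first by apply/eqP/dat_nth; rewrite gE wE !nth_cat lu'.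
    have [bf lE] : b = false /\ l = size u by move: lu ul; case: (b) => /= h1 h2; split=> //; lia.
    by rewrite bf lE /dat gE wE !nth_cat ltnn subnn /= kn k0.
  have [lv'|vl] := ltnP l (size v); first by apply/eqP/dat_nth; rewrite hE wE' !nth_cat lv'.
  have [bf lE] : b = false /\ l = size v by move: lv vl; case: (b) => /= h1 h2; split=> //; lia.
  by rewrite bf lE /dat hE wE' !nth_cat ltnn subnn /= kn' k0'.
by apply/type1P; exists u, v, c, i, k, k'.
Qed.

Lemma Ext_products : [/\ Ext (fun z g h => m z (g * h^-1)%g * (m z h)^*%C),
  Ext (fun z g h => m z g * (m z (g * h^-1)^-1%g)^*%C) &
  Ext (fun z g h => m z (g * h^-1)%g * (m z (g * h^-1)^-1%g)^*%C)].
Proof.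
have o : Bd p (fun z w => (m z w^-1%g)^*%C).
  by have [C C0 hC] := Hp l b; exists C => // z uz; exact: (bdd_star p1 (hC z uz)).
have g1 := Gd_mul (Hp l b) (Bd1 (2 * p)) (Bd1 (2 * p)) (Gd1 p1 pq).
have g2 := Gd_mul o (Bd1 (2 * p)) (Bd1 (2 * p)) (Gd1 p1 pq).
have g3 := Gd_mul o (Bd1 (2 * p)) (Bd1 (2 * p)) g1.
split.
- by apply: Ext_eq (Ext3 g1) => z g h _; rewrite cj1 !mulr1.
- by apply: Ext_eq (Ext2 g2) => z g h _; rewrite cj1 !mulr1 mulrC.
by apply: Ext_eq (Ext1 g3) => z g h _; rewrite cj1 !mulr1 mulrC.
Qed.

Lemma Ext_main : Ext (fun z g h => m z g * (m z h)^*%C).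
Proof.
have [e1 e2 e3] := Ext_products.
have ed : Ext deltas.
  apply: (@Ext_types types) => [z g h|n nts]; first exact: deltas_types.
  rewrite size_map in nts; rewrite (nth_map (false, (0%N, 0%N))) //; set c := nth _ codes n.
  have cin : c \in codes by exact: mem_nth.
  set t := type_of c.
  have [st em] : stable p t /\ Ext (fun z g h => m z g * (m z h)^*%C * (t g h)%:R).
    move: cin; rewrite mem_cat => /orP[] /allpairsP[[a a'] [ha hc cE]]; rewrite /t cE /type_of /=.
      by move: ha hc; rewrite !mem_iota !add0n /= !ltnS => ha hc; split; [exact: stable_type0|exact: Ext_type0].
    by move: ha hc; rewrite !mem_iota !add0n /= => ha hc; split; [exact: stable_type1|exact: Ext_type1].
  split=> //; apply: Ext_eq (ExtD (ExtB (ExtB (Ext_stable st e3) (Ext_stable st e1)) (Ext_stable st e2)) em) => z g h _.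
  by rewrite /deltas; ring.
apply: Ext_eq (ExtD (ExtB (ExtD e1 e2) e3) ed) => z g h _; rewrite /deltas; ring.
Qed.

(** The square of the 2p-norm of the image is the p-norm of the product with kernel [m(g) m(h)^*];
    the three terms of [Ext_main] give the quadratic inequality solved by [doubling_bound]. *)
Lemma Bd_step : Bd (2 * p) (fun z => lev z b l).
Proof.
have [K1 [K2 [K3 [[C1 C10 h1] [C2 C20 h2] [C3 C30 h3] E]]]] := Ext_main.
pose c := C1 + C2 + C3; have c0 : 0 <= c by rewrite !addr_ge0.
exists (2 * c + 1) => [|z uz X]; first by rewrite addr_ge0 // mulr_ge0.
set T := nm (2 * p) (mult _ X); set A := nm (2 * p) X.
have A0 : 0 <= A := nm_ge0 _ _; have T0 : 0 <= T := nm_ge0 _ _.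
apply: doubling_bound => //.
rewrite /T (nm_sq p1 (val_bil_one (mult (lev z b l) X) (mult (lev z b l) X))).
have V : val_ix (bil (fun _ _ => 1) (mult (lev z b l) X) (mult (lev z b l) X)) =
    val_ix (bil (K1 z) X X ++ bil (K2 z) (mult (lev z b l) X) X) + val_ix (bil (K3 z) X (mult (lev z b l) X)).
  have m1 Y : val_ix Y = val_ix (mult (fun=> 1) Y).
    by rewrite /val_ix /mult big_map; apply: eq_bigr => t _ /=; rewrite mul1r.
  rewrite val_cat val_bil_mult.
  have -> : val_ix (bil (K2 z) (mult (lev z b l) X) X) = val_ix (bil (fun g h => K2 z g h * lev z b l g) X X).
    rewrite !val_bil big_map; apply: eq_bigr => t _; apply: eq_bigr => v _ /=.
    by congr (_ *: _); ring.
  have -> : val_ix (bil (K3 z) X (mult (lev z b l) X)) = val_ix (bil (fun g h => K3 z g h * (lev z b l h)^*%C) X X).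
    rewrite !val_bil; apply: eq_bigr => t _; rewrite big_map; apply: eq_bigr => v _ /=.
    by congr (_ *: _); rewrite cjM; ring.
  rewrite -(val_bilD X X (k1 := K1 z) (fun g h => erefl (K1 z g h + K2 z g h * lev z b l g))).
  by rewrite -(val_bilD X X (fun g h => erefl (_ + K3 z g h * (lev z b l h)^*%C))); congr val_ix;
    congr bil; apply/funext => g; apply/funext => h; rewrite mul1r E.
apply: le_trans (nmD p1 pq V) _; apply: le_trans (lerD (nmD p1 pq (val_cat _ _)) (lexx _)) _.
apply: le_trans (lerD (lerD (h1 z uz X X) (h2 z uz _ X)) (h3 z uz X _)) _; rewrite -/T -/A /c.
rewrite expr2; have AA : 0 <= A * A by exact: mulr_ge0.
have AT : 0 <= A * T by exact: mulr_ge0.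
rewrite (mulrC T A); nra.
Qed.

End Step.

(** Strong induction on [l], and at each [l] the generator symbol before the full one. The first
    needs earlier positions only; the second needs the first to recognise a merger at position
    [l]. *)
Lemma Bd_double p q : 1 < p -> p^-1 + q^-1 = 1 -> (forall l b, Bd p (fun z => lev z b l)) ->
  forall (l : nat) b, Bd (2 * p) (fun z => @lev R z b l).
Proof.
move=> p1 pq Hp l; elim/ltn_ind: l => l IH b.
have low (l' : nat) b' : (l' < l)%N -> Bd (2 * p) (fun z => @lev R z b' l') by move=> h; exact: IH.
have f : Bd (2 * p) (fun z => @lev R z false l) by apply: (Bd_step p1 pq Hp low).
by case: b => //; apply: (Bd_step p1 pq Hp low).
Qed.

End Doubling.

(** * Interpolation between 2 and 4 *)

Section RealInterpolation.
Context {R : realType}.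
Implicit Types (t u v c r : R).

(** A smooth convex substitute for the minimum of [u] and [u^2]: quadratic near 0, where the
    L_2-part is too weak, and linear at infinity, where the L_4-part is too strong. *)
Definition phi u : R := u * u * (1 + u)^-1.

Lemma phi_ge0 u : 0 <= u -> 0 <= phi u.
Proof. by move=> u0; rewrite !mulr_ge0 // invr_ge0 addr_ge0. Qed.

Lemma phi_le_id u : 0 <= u -> phi u <= u.
Proof. by move=> u0; rewrite /phi ler_pdivrMr ?ltr_pwDl //; nra. Qed.
Lemma phi_le_sq u : 0 <= u -> phi u <= u * u.
Proof. by move=> u0; rewrite /phi ler_pdivrMr ?ltr_pwDl //; have := mulr_ge0 u0 u0; nra. Qed.

(** The graph lies above its tangent at [u], whose slope is [1 - (1 + u)^-2]. *)
Lemma phi_convex u v : 0 <= u -> 0 <= v ->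
  0 <= phi v + (- phi u + (1 - (1 + u)^-1 * (1 + u)^-1) * u) - (1 - (1 + u)^-1 * (1 + u)^-1) * v.
Proof.
move=> u0 v0; have u1 : 0 < 1 + u by rewrite ltr_pwDl.
have v1 : 0 < 1 + v by rewrite ltr_pwDl.
rewrite (_ : _ - _ = (v - u) ^+ 2 / ((1 + u) ^+ 2 * (1 + v))).
  by rewrite divr_ge0 ?sqr_ge0 // mulr_ge0 ?sqr_ge0 // ltW.
by rewrite /phi; field; rewrite !lt0r_neq0.
Qed.

(* The two halves of the decomposition x = x k(x^* x) + x (1 - k(x^* x)) with
   k(t) = 1 / (1 + c t) are both controlled by phi(c t). *)
Lemma phi_split (C t c : R) : 0 <= C -> 0 <= c -> 0 <= t ->
  8 * c ^+ 2 * C * ((1 + c * t)^-1 * t * (1 + c * t)^-1) ^+ 2 +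
  2 * c * (t * (1 - (1 + c * t)^-1) ^+ 2) <= (8 * C + 2) * phi (c * t).
Proof.
move=> C0 c0 t0; set u := c * t; have u0 : 0 <= u by exact: mulr_ge0.
have u1 : 0 < 1 + u by rewrite ltr_pwDl.
have w1 : 0 < (1 + u)^-1 by rewrite invr_gt0.
have wu : (1 + u)^-1 <= 1 by rewrite invf_le1 // lerDl.
have -> : 8 * c ^+ 2 * C * ((1 + u)^-1 * t * (1 + u)^-1) ^+ 2 = 8 * C * (phi u * ((1 + u)^-1) ^+ 3).
  by rewrite /phi /u; ring.
have -> : 2 * c * (t * (1 - (1 + u)^-1) ^+ 2) = 2 * (phi u * (u * (1 + u)^-1)).
  rewrite (_ : 1 - (1 + u)^-1 = u * (1 + u)^-1); last by field; exact: lt0r_neq0.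
  by rewrite /phi /u; ring.
have p0 := phi_ge0 u0.
rewrite [leRHS]mulrDl; apply: lerD; [apply: ler_wpM2l; first exact: mulr_ge0|apply: ler_wpM2l => //].
  by rewrite ler_piMr // exprn_ile1 // ltW.
by rewrite ler_piMr // ler_pdivrMr // mul1r lerDr.
Qed.

(** The sum of [4^(i r) phi(4^(-i) t)] over integers [i] from [-K] to [K]. The full series scales
    like [t^r], and converges because [phi] has order 2 at 0 and 1 at infinity. *)
Definition psum r (K : nat) t : R :=
  \sum_(j < K.*2.+1) 4 `^ ((j%:R - K%:R) * r) * phi (4 `^ (K%:R - j%:R) * t).

Lemma four_gt0 x : 0 < 4 `^ x :> R. Proof. by rewrite powR_gt0. Qed.

Lemma fourD x y : 4 `^ (x + y) = 4 `^ x * 4 `^ y :> R.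
Proof. by rewrite powRD //; apply/implyP => _; rewrite pnatr_eq0. Qed.

Lemma psum_term r (K j : nat) t : 0 < t ->
  4 `^ ((j%:R - K%:R) * r) * phi (4 `^ (K%:R - j%:R) * t) =
  t `^ r * ((4 `^ (K%:R - j%:R) * t) `^ (- r) * phi (4 `^ (K%:R - j%:R) * t)).
Proof.
move=> t0; rewrite powRM ?(ltW t0) ?powR_ge0 // -powRrM mulrA; congr (_ * _).
rewrite mulrCA -powRD; last by rewrite (gt_eqF t0) implybT.
by rewrite subrr powRr0 mulr1; congr (_ `^ _); ring.
Qed.

Section Bounds.
Variable r : R.
Hypotheses (r1 : 1 < r) (r2 : r < 2).

(** One term suffices, that with argument [v] in [1, 4]: there [phi v >= v / 2] and
    [v^(-r) >= v^-1 / 4], whence the constant 8. The last summand covers [t] below all the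
    scales. *)
Lemma psum_lower (K : nat) t : 0 <= t -> t <= 4 `^ K%:R -> t `^ r <= 8 * psum r K t + 4 `^ (- K%:R).
Proof.
move=> t0 tK; have term0 (j : nat) : 0 <= 4 `^ ((j%:R - K%:R) * r) * phi (4 `^ (K%:R - j%:R) * t).
  by rewrite mulr_ge0 ?powR_ge0 // phi_ge0 // mulr_ge0 ?powR_ge0.
have ps0 : 0 <= psum r K t by apply: sumr_ge0 => j _; exact: term0.
have [tl|lt] := ltP t (4 `^ (- K%:R)).
  apply: ler_wpDl; first by rewrite mulr_ge0.
  have [->|tn] := eqVneq t 0; first by rewrite powR0 ?powR_ge0 // gt_eqF // (lt_trans ltr01).
  apply: le_trans (ltW tl); have t1 : t <= 1.
    apply: le_trans (ltW tl) _; rewrite -[leRHS](@powRr0 _ 4); apply: ler_powR; first by rewrite ler1n.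
    by rewrite oppr_le0.
  by apply: ge1r_powR; [rewrite lt_def tn t0|exact: ltW].
have tp : 0 < t by apply: lt_le_trans lt; exact: four_gt0.
apply: ler_wpDr; first exact: powR_ge0.
pose V (j : nat) := 4 `^ (K%:R - j%:R) * t.
have V0 : 1 <= V 0%N.
  rewrite /V subr0; apply: le_trans (_ : 4 `^ K%:R * 4 `^ (- K%:R) <= _); first by rewrite -fourD subrr powRr0.
  by apply: ler_wpM2l => //; exact: powR_ge0.
have VK : V K.*2 <= 1.
  rewrite /V -addnn natrD opprD addrA subrr add0r powRN mulrC ler_pdivrMr ?four_gt0 // mul1r //.
have VS (j : nat) : V j = 4 * V j.+1.
  rewrite /V mulrA -{2}(powRr1 (_ : 0 <= 4 :> R)) // -fourD; congr (_ `^ _ * _).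
  by rewrite -natr1; ring.
(* The last index with [V j >= 1]: the next value, four times smaller, is below 1, unless the end of
   the range is reached, where [V] is at most 1. *)
have [j jK /andP[v1 v4]] : exists2 j : nat, (j <= K.*2)%N & (1 <= V j <= 4).
  have ex : exists j : nat, (1 <= V j) && (j <= K.*2)%N by exists 0%N; rewrite V0.
  have ub j : (1 <= V j) && (j <= K.*2)%N -> (j <= K.*2)%N by case/andP.
  have [j /andP[v1 jK] mx] := ex_maxnP ex ub; exists j => //; rewrite v1 /=.
  have [jE|jn] := eqVneq j K.*2; first by rewrite jE (le_trans VK) // ler1n.
  rewrite VS ler_piMr // leNgt; apply/negP => vj.
  have := mx j.+1; rewrite (ltW vj) ltn_neqAle jn jK ltnn => /(_ isT) //.
apply: le_trans (_ : 8 * (4 `^ ((j%:R - K%:R) * r) * phi (V j)) <= _); last first.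
  rewrite ler_wpM2l // /psum (bigD1 (Ordinal (_ : (j < K.*2.+1)%N))) //= lerDl.
  by apply: sumr_ge0 => i _; exact: term0.
rewrite /V psum_term // -/(V j) mulrCA ler_peMr ?powR_ge0 //.
have vp : 0 < V j by apply: lt_le_trans v1.
have h1 : V j / 2 <= phi (V j).
  rewrite /phi ler_pdivlMr ?ltr_pwDl ?(ltW vp) // mulrAC ler_pdivrMr //.
  by move: (V j) v1 => v v1; nra.
have h2 : V j `^ (- r) >= (V j)^-1 * 4^-1.
  rewrite (_ : - r = - 1 + (1 - r)); last by ring.
  rewrite powRD; last by rewrite (gt_eqF vp) implybT.
  rewrite powR_inv1 ?(ltW vp) //; apply: ler_wpM2l; first by rewrite invr_ge0 ltW.
  rewrite (_ : 1 - r = - (r - 1)); last by ring.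
  rewrite powRN lef_pV2 ?posrE ?powR_gt0 //; apply: le_trans (_ : V j `^ 1 <= _); last by rewrite powRr1 // ltW.
  by apply: ler_powR => //; move: r2; lra.
have v0 := ltW vp.
apply: le_trans (_ : 8 * ((V j)^-1 * 4^-1 * (V j / 2)) <= _).
  by rewrite le_eqVlt; apply/orP; left; apply/eqP; field; exact: lt0r_neq0.
apply: ler_wpM2l => //; apply: ler_pM => //; first by rewrite mulr_ge0 ?invr_ge0.
exact: divr_ge0.
Qed.

(** Dividing by [t^r], each term is at most the minimum of [v^y] and [v^(-y)], which is dominated by
    an increment of the bounded function [th] between [v / 4] and [v]. The increments telescope, so
    the bound does not depend on [K]. *)
Lemma psum_upper : exists2 b, 0 <= b & forall (K : nat) t, 0 <= t -> psum r K t <= b * t `^ r.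
Proof.
pose y := Num.min (2 - r) (r - 1); have y0 : 0 < y by rewrite lt_min; move: r1 r2; lra.
have y2 : y <= 2 - r by rewrite ge_min lexx.
have y1 : y <= r - 1 by rewrite ge_min lexx orbT.
pose a := 1 - 4 `^ (- y); have a0 : 0 < a.
  have h41 : (1 : R) < 4 by rewrite ltr1n.
  have := gt0_ltr_powR y0 (ler01 : (1 : R) \in Num.nneg) (ler0n _ 4 : (4 : R) \in Num.nneg) h41.
  by rewrite powR1 => h; rewrite subr_gt0 powRN invf_lt1 ?powR_gt0.
pose th v := v `^ y / (1 + v `^ y).
have th0 v : 0 <= th v by rewrite divr_ge0 ?addr_ge0 ?powR_ge0.
have th1 v : th v <= 1 by rewrite ler_pdivrMr ?ltr_pwDl ?powR_ge0 // mul1r lerDr.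
have key v : 0 < v -> v `^ (- r) * phi v <= 4 / a * (th v - th (v / 4)).
  move=> v0; have s0 : 0 < v `^ y by rewrite powR_gt0.
  have d0 : 0 < 4 `^ (- y) :> R by exact: four_gt0.
  have d1 : 4 `^ (- y) <= 1 :> R by rewrite -subr_ge0 ltW.
  have -> : th (v / 4) = 4 `^ (- y) * v `^ y / (1 + 4 `^ (- y) * v `^ y).
    by rewrite /th powRM ?(ltW v0) ?invr_ge0 // -powR_inv1 // -powRrM mulN1r (mulrC (v `^ y)).
  have vD x x' : v `^ x * v `^ x' = v `^ (x + x') by rewrite powRD // (gt_eqF v0) implybT.
  have up : v `^ (- r) * phi v <= Num.min (v `^ y) (v `^ (- y)).
    have e2 : v * v = v `^ 2 by rewrite -[2]/(2%:R) powR_mulrn ?(ltW v0) // expr2.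
    have [v1|v1] := leP v 1.
      have h : v `^ (- r) * phi v <= v `^ y.
        apply: le_trans (ler_wpM2l (powR_ge0 _ _) (phi_le_sq (ltW v0))) _; rewrite e2 vD.
        by apply: (ger_powR (_ : 0 < v <= 1)); [rewrite v0 v1|move: y2; lra].
      rewrite le_min h /=; apply: le_trans h _.
      by apply: (ger_powR (_ : 0 < v <= 1)); [rewrite v0 v1|move: y0; lra].
    have h : v `^ (- r) * phi v <= v `^ (- y).
      apply: le_trans (ler_wpM2l (powR_ge0 _ _) (phi_le_id (ltW v0))) _; rewrite -{2}(powRr1 (ltW v0)) vD.
      by apply: ler_powR; rewrite ?(ltW v1) //; move: y1; lra.
    rewrite le_min h andbT; apply: le_trans h _; apply: ler_powR; rewrite ?(ltW v1) //.
    by move: y0; lra.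
  apply: (le_trans up); rewrite powRN /th; move: (v `^ y) s0 => s s0.
  have a0' : 0 < 1 - 4 `^ (- y) by exact: a0.
  rewrite /a; move: (4 `^ (- y)) a0' d0 d1 => d a0' d0 d1.
  have s1 : 0 < 1 + s by rewrite ltr_pwDl // ltW.
  have ds1 : 0 < 1 + d * s by rewrite ltr_pwDl // mulr_ge0 // ltW.
  have -> : 4 / (1 - d) * (s / (1 + s) - d * s / (1 + d * s)) = 4 * s / ((1 + s) * (1 + d * s)).
    by field; rewrite !lt0r_neq0.
  rewrite ler_pdivlMr ?mulr_gt0 //.
  apply: le_trans (_ : Num.min s s^-1 * ((1 + s) * (1 + s)) <= _).
    apply: ler_wpM2l; first by rewrite le_min !ltW ?invr_gt0.
    by apply: ler_wpM2l; [exact: ltW|rewrite lerD2l ler_piMl // ltW].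
  have [s1'|s1'] := leP s s^-1.
    have : s * s <= 1 by rewrite -(mulfV (lt0r_neq0 s0)); apply: ler_wpM2l => //; exact: ltW.
    by nra.
  have ss : 1 <= s * s by rewrite -(mulVf (lt0r_neq0 s0)); apply: ler_wpM2r; exact: ltW.
  by rewrite mulrC ler_pdivrMr //; nra.
exists (4 / a) => [|K t t0]; first by rewrite divr_ge0 // ltW.
have [->|tn] := eqVneq t 0.
  rewrite powR0 ?mulr0; last by rewrite gt_eqF // (lt_trans ltr01).
  by rewrite /psum big1 // => j _; rewrite mulr0 /phi mul0r mul0r mulr0.
have tp : 0 < t by rewrite lt_def tn.
pose V (j : nat) := 4 `^ (K%:R - j%:R) * t.
have Vp j : 0 < V j by rewrite mulr_gt0 ?four_gt0.
have VS (j : nat) : V j.+1 = V j / 4.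
  rewrite /V mulrAC -[4^-1](powR_inv1 (_ : 0 <= 4 :> R)) // -fourD; congr (_ `^ _ * _).
  by rewrite -natr1; ring.
apply: le_trans (_ : \sum_(j < K.*2.+1) t `^ r * (4 / a * (th (V j) - th (V j.+1))) <= _).
  apply: ler_sum => j _; rewrite psum_term // -/(V j) VS ler_wpM2l ?powR_ge0 //; exact: key.
rewrite -mulr_sumr -mulr_sumr mulrC ler_wpM2r ?powR_ge0 //.
rewrite -[leRHS]mulr1 ler_wpM2l ?divr_ge0 ?(ltW a0) //.
rewrite -(big_mkord xpredT (fun j => th (V j) - th (V j.+1))).
rewrite (eq_bigr (fun j => - (th (V j.+1) - th (V j)))) => [|j _]; last by rewrite opprB.
rewrite sumrN telescope_sumr // opprB.
by apply: le_trans (th1 (V 0%N)); rewrite gerBl.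
Qed.

End Bounds.
End RealInterpolation.

Lemma klein_arith {R : realFieldType} (c F1 F2 P W D1 D2 S1 S2 : R) : 0 <= c ->
  0 <= F1 + (- P + c * W) - (4 * c) * D1 -> 0 <= F2 + (- P + c * W) - (4 * c) * D2 ->
  0 <= 2 * D1 + 2 * D2 - W -> F1 <= 16 * c ^+ 2 * S1 -> F2 <= 4 * c * S2 ->
  P <= 8 * c ^+ 2 * S1 + 2 * c * S2.
Proof.
move=> c0 h1 h2 h3 h4 h5; have h6 := mulr_ge0 c0 h3.
have -> : 8 * c ^+ 2 * S1 + 2 * c * S2 = (16 * c ^+ 2 * S1 + 4 * c * S2) / 2 by field.
rewrite ler_pdivlMr //.
move: h4 h5; set X := 16 * _ * _; set Y := 4 * c * S2 => h4 h5; move: h1 h2 h6.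
by rewrite !mulrBr !mulrDr !mulrA (mulrC c 2); move: (c * W) (c * D1) (c * D2) => *; nra.
Qed.

Lemma parallelogram_aux {V : zmodType} (a b c d : V) :
  a - b - (c - d) = a + a + (d + d) - (a + b + (c + d)).
Proof.
rewrite opprB.
by rewrite !opprD [RHS]addrACA [a + a + _]addrACA [d + d + _]addrACA !subrr add0r addr0.
Qed.

(** * Interpolation by Klein's inequality *)

Section KleinInterpolation.
Context {R : realType} {I : choiceType}.
Implicit Types (x y h : bop R I).
Variables (N : set (bop R I)) (D : set I) (e : bop R I) (s : seq I).
Hypotheses (hN : cstar_alg N) (hD : tracial_on N D) (he : corner N D e s).
Notation rt := (rtr s).
Notation pw r := (fun t : R => (t `^ r)%R).

Definition kinv (c t : R) := (1 + c * t)^-1.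

Lemma contp_kinv c : 0 <= c -> contp (kinv c).
Proof.
move=> c0; apply: contp_inv => [|t t0]; last by rewrite ltr_pwDl // mulr_ge0.
by apply: contpD; [exact: contp_cst|apply: contpZ; exact: contp_id].
Qed.
Lemma contp_phi c : 0 <= c -> contp (fun t : R => phi (c * t)).
Proof.
move=> c0; apply: contpM; last exact: contp_kinv.
by apply: contpM; apply: contpZ; exact: contp_id.
Qed.

(** [phi_convex] with [u] from [c A] and [v] from [4 c B1] or [4 c B2], averaged over the two. The
    first-order terms have the right sign because [A <= 2 B1 + 2 B2], by the parallelogram identity;
    this explains the dilation by 4. Then [phi(u)] is bounded by [u^2] for [B1] and by [u] for
    [B2]. *)
Lemma klein c h1 h2 : 0 <= c -> N h1 -> inc e h1 -> N h2 -> inc e h2 ->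
  rt (fc (fun t => phi (c * t)) (star (h1 + h2) * (h1 + h2))) <=
  8 * c ^+ 2 * rt (star h1 * h1 * (star h1 * h1)) + 2 * c * rt (star h2 * h2).
Proof.
move=> c0 N1 i1 N2 i2; set h := h1 + h2; set A := star h * h; set B1 := star h1 * h1; set B2 := star h2 * h2.
have Nh := calgD hN N1 N2; have ih : inc e h := incD i1 i2.
have NN x : N x -> N (star x * x) by move=> Nx; apply: (calgM hN) => //; exact: (calg_star hN).
have pA : posop A := posop_star h; have NA : N A := NN _ Nh; have cA := comm_star_mul he ih.
have ci := @contp_id R; have c1 := @contp_cst R 1; have ck := contp_kinv c0.
have cD : contp (fun u => 1 - kinv c u * kinv c u) by apply: contpB => //; exact: contpM.
have cp := contp_phi c0.
have c4 : 0 <= 4 * c by rewrite mulr_ge0.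
have cF := contp_phi c4.
have cDu : contp (fun u => (1 - kinv c u * kinv c u) * (c * u)) by apply: contpM => //; apply: contpZ.
have cf2 : contp (fun u => - phi (c * u) + (1 - kinv c u * kinv c u) * (c * u)) by apply: contpD => //; exact: contpN.
have cf3 : contp (fun u => - (1 - kinv c u * kinv c u)) by exact: contpN.
have cg3 : contp (fun v : R => (4 * c) * v) by exact: contpZ.
set FD := fc (fun u => 1 - kinv c u * kinv c u) A; set W := rt (FD * A).
have E2 : rt (fc (fun u => - phi (c * u) + (1 - kinv c u * kinv c u) * (c * u)) A) =
    - rt (fc (fun t => phi (c * t)) A) + c * W.
  rewrite (fcD (contpN cp) cDu pA) (fcN cp pA) rtrD rtrN (fcM cD (contpZ (c := c) ci) pA).
  by rewrite (fcZ c ci pA) (fc_id pA) rsMr rtrZ.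
have key x : N x -> 0 <= rt (fc (fun v => phi (4 * c * v)) (star x * x)) +
    (- rt (fc (fun t => phi (c * t)) A) + c * W) - (4 * c) * rt (FD * (star x * x)).
  move=> Nx; have pB := posop_star x; have NB := NN _ Nx.
  have := rtr_two_variable3 hN hD he pA NA cA pB NB c1 cF cf2 c1 cf3 cg3.
  rewrite (fc_cst 1 pA) rs1 (fc_cst 1 pB) rs1 -E2 => H.
  have -> : rt (fc (fun v => phi (4 * c * v)) (star x * x)) = rt (1 * fc (fun v => phi (4 * c * v)) (star x * x)).
    by congr (rt _); exact/esym/mul1r.
  have -> : rt (fc (fun u => - phi (c * u) + (1 - kinv c u * kinv c u) * (c * u)) A) =
      rt (fc (fun u => - phi (c * u) + (1 - kinv c u * kinv c u) * (c * u)) A * 1).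
    by congr (rt _); exact/esym/mulr1.
  have -> : - (4 * c * rt (FD * (star x * x))) =
      rt (fc (fun u => - (1 - kinv c u * kinv c u)) A * fc (fun v => 4 * c * v) (star x * x)).
    by rewrite (fcN cD pA) (fcZ (4 * c) ci pB) (fc_id pB) -/FD mulNr rsMr rtrN rtrZ.
  apply: H => u v u0 v0; rewrite mul1r mulr1.
  have := phi_convex (mulr_ge0 c0 u0) (mulr_ge0 c4 v0).
  by rewrite /kinv mulNr.
have P : 0 <= 2 * rt (FD * B1) + 2 * rt (FD * B2) - W.
  have D0 t : 0 <= t -> 0 <= 1 - kinv c t * kinv c t.
    move=> t0; have k1 : kinv c t <= 1 by rewrite invf_le1 ?lerDl ?mulr_ge0 // ltr_pwDl // mulr_ge0.
    have k0 : 0 <= kinv c t by rewrite invr_ge0 addr_ge0 // mulr_ge0.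
    by rewrite subr_ge0 -[leRHS]mulr1; apply: ler_pM.
  have Nd := calgB hN N1 N2.
  have := rtr_pos_fc hN hD he cD D0 pA NA cA (posop_star (h1 - h2)) (NN _ Nd).
  have -> : star (h1 - h2) * (h1 - h2) = rs 2 B1 + rs 2 B2 - A.
    rewrite /A /h !starB !starD !mulrBl !mulrBr !mulrDl !mulrDr -/B1 -/B2.
    rewrite (_ : rs 2 B1 = B1 + B1); last by rewrite (_ : (2 : R) = 1 + 1) // rsDl rs1.
    rewrite (_ : rs 2 B2 = B2 + B2); last by rewrite (_ : (2 : R) = 1 + 1) // rsDl rs1.
    exact: parallelogram_aux.
  by rewrite mulrBr mulrDr !rsMr rtrB rtrD !rtrZ.
have k1 := key _ N1; have k2 := key _ N2; rewrite -/B1 in k1; rewrite -/B2 in k2.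
have p1 : posop B1 := posop_star h1; have p2 : posop B2 := posop_star h2.
have u1 : rt (fc (fun v => phi (4 * c * v)) B1) <= 16 * c ^+ 2 * rt (B1 * B1).
  have cs : contp (fun v => 16 * c ^+ 2 * (v * v)) by apply: contpZ; exact: contpM.
  have -> : 16 * c ^+ 2 * rt (B1 * B1) = rt (fc (fun v => 16 * c ^+ 2 * (v * v)) B1).
    by rewrite (fcZ _ (contpM ci ci) p1) rtrZ (fcM ci ci p1) (fc_id p1).
  apply: rtr_mono; apply: (fc_le_pos cF cs p1) => t /andP[t0 _].
  apply: le_trans (phi_le_sq (mulr_ge0 c4 t0)) _; rewrite le_eqVlt; apply/orP; left; apply/eqP; ring.
have u2 : rt (fc (fun v => phi (4 * c * v)) B2) <= 4 * c * rt B2.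
  have -> : 4 * c * rt B2 = rt (fc (fun v => 4 * c * v) B2) by rewrite (fcZ _ ci p2) rtrZ (fc_id p2).
  apply: rtr_mono; apply: (fc_le_pos cF cg3 p2) => t /andP[t0 _]; exact: phi_le_id (mulr_ge0 c4 t0).
exact: klein_arith c0 k1 k2 P u1 u2.
Qed.

(** Here [h] stands for the image of [y], and [h1], [h2] for the images of [y Q(y^* y)] and of the
    rest, controlled in L_4 (with [C] the fourth power of the bound) and in L_2. The polynomials [Q]
    then tend to [kinv c], and [phi_split] recombines the two pieces. *)
Lemma interp_phi y h C : 0 <= C -> N y -> N h ->
  (forall Q, exists h1 h2, [/\ N h1 /\ inc e h1, N h2 /\ inc e h2, h = h1 + h2,
     rt (star h1 * h1 * (star h1 * h1)) <= C * rt (pev Q (star y * y) * (star y * y) * pev Q (star y * y) *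
        (pev Q (star y * y) * (star y * y) * pev Q (star y * y))) &
     rt (star h2 * h2) <= rt (star (y - y * pev Q (star y * y)) * (y - y * pev Q (star y * y)))]) ->
  forall c, 0 <= c -> rt (fc (fun t => phi (c * t)) (star h * h)) <=
    (8 * C + 2) * rt (fc (fun t => phi (c * t)) (star y * y)).
Proof.
move=> C0 Ny Nh H c c0; set B := star y * y; have pB : posop B := posop_star y.
have ck := contp_kinv c0; have ci := @contp_id R.
have [Q_ hQ] := weierstrass_seq (nrm B) ck.
have lk : olim (fun n => pev (Q_ n) B) (fc (kinv c) B) := fc_lim ck pB (lexx _) hQ cvg_invS.
have lB := olim_cst B; have ly := olim_cst y.
have lZ : olim (fun n => pev (Q_ n) B * B * pev (Q_ n) B) (fc (kinv c) B * B * fc (kinv c) B).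
  by apply: olimM => //; exact: olimM.
have L1 := olimM lZ lZ.
have lx : olim (fun n => y - y * pev (Q_ n) B) (y - y * fc (kinv c) B).
  by apply: olimB => //; exact: olimM.
have L2 := olimM (olim_star lx) lx.
have key n : rt (fc (fun t => phi (c * t)) (star h * h)) <=
    8 * c ^+ 2 * C * rt (pev (Q_ n) B * B * pev (Q_ n) B * (pev (Q_ n) B * B * pev (Q_ n) B)) +
    2 * c * rt (star (y - y * pev (Q_ n) B) * (y - y * pev (Q_ n) B)).
  have [h1 [h2 [[N1 i1] [N2 i2] -> b1 b2]]] := H (Q_ n).
  apply: le_trans (klein c0 N1 i1 N2 i2) _; apply: lerD.
    by rewrite -[leRHS]mulrA; apply: ler_wpM2l => //; rewrite mulr_ge0 ?sqr_ge0.
  by apply: ler_wpM2l => //; rewrite mulr_ge0.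
have L : 8 * c ^+ 2 * C * rt (pev (Q_ n) B * B * pev (Q_ n) B * (pev (Q_ n) B * B * pev (Q_ n) B)) +
    2 * c * rt (star (y - y * pev (Q_ n) B) * (y - y * pev (Q_ n) B)) @[n --> \oo] -->
    8 * c ^+ 2 * C * rt (fc (kinv c) B * B * fc (kinv c) B * (fc (kinv c) B * B * fc (kinv c) B)) +
    2 * c * rt (star (y - y * fc (kinv c) B) * (y - y * fc (kinv c) B)).
  apply: cvgD.
    by apply: cvgM; [exact: cvg_cst|exact: rtr_olim L1].
  by apply: cvgM; [exact: cvg_cst|exact: rtr_olim L2].
have hh := @lim_le R (fun=> rt (fc (fun t => phi (c * t)) (star h * h))) _ _ _
  (cvg_cst (rt (fc (fun t => phi (c * t)) (star h * h)) : R)) L key.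
apply: le_trans (hh _) _ => {hh key L}.
have c2 : contp (fun t => kinv c t * t) by exact: contpM.
have c3 : contp (fun t => kinv c t * t * kinv c t) by exact: contpM.
have c4 : contp (fun t => (kinv c t * t * kinv c t) * (kinv c t * t * kinv c t)) by exact: contpM.
have c1k : contp (fun t => 1 - kinv c t) by apply: contpB => //; exact: contp_cst.
have c5 : contp (fun t => (1 - kinv c t) * t) by exact: contpM.
have c6 : contp (fun t => (1 - kinv c t) * t * (1 - kinv c t)) by exact: contpM.
have E1 : fc (kinv c) B * B * fc (kinv c) B * (fc (kinv c) B * B * fc (kinv c) B) =
    fc (fun t => (kinv c t * t * kinv c t) * (kinv c t * t * kinv c t)) B.
  by rewrite (fcM c3 c3 pB) (fcM c2 ck pB) (fcM ck ci pB) (fc_id pB).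
have E2 : star (y - y * fc (kinv c) B) * (y - y * fc (kinv c) B) = fc (fun t => (1 - kinv c t) * t * (1 - kinv c t)) B.
  have -> : y - y * fc (kinv c) B = y * fc (fun t => 1 - kinv c t) B.
    by rewrite (fcB (@contp_cst R 1) ck pB) (fc_cst 1 pB) rs1 mulrBr mulr1.
  rewrite starM (fc_star c1k pB) mulrA -(mulrA _ (star y)) -/B.
  by rewrite (fcM c5 c1k pB) (fcM c1k ci pB) (fc_id pB).
rewrite E1 E2 -!rtrZ -rtrD -(fcZ _ c4 pB) -(fcZ _ c6 pB) -(fcD (contpZ c4) (contpZ c6) pB) -(fcZ _ (contp_phi c0) pB).
have cL : contp (fun t => 8 * c ^+ 2 * C * (kinv c t * t * kinv c t * (kinv c t * t * kinv c t)) +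
   2 * c * ((1 - kinv c t) * t * (1 - kinv c t))) by apply: contpD; exact: contpZ.
have cR : contp (fun t => (8 * C + 2) * phi (c * t)) by apply: contpZ; exact: contp_phi.
apply: rtr_mono; apply: (fc_le_pos cL cR pB) => t /andP[t0 _].
apply: le_trans (phi_split C0 c0 t0); rewrite /kinv le_eqVlt; apply/orP; left; apply/eqP; ring.
Qed.

Lemma rtr_fc_sum (J : finType) (f : J -> R -> R) (a : J -> R) A : posop A -> (forall j, contp (f j)) ->
  contp (fun t => \sum_j a j * f j t) /\
  rt (fc (fun t => \sum_j a j * f j t) A) = \sum_j a j * rt (fc (f j) A).
Proof.
move=> pA cf; pose F (r : seq J) := fun t => \sum_(j <- r) a j * f j t.
suff H (r : seq J) : contp (F r) /\ rt (fc (F r) A) = \sum_(j <- r) a j * rt (fc (f j) A) by have := H (index_enum J).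
elim: r => [|j r [IH1 IH2]].
  have -> : F [::] = fun=> 0 by apply/funext => t; rewrite /F big_nil.
  by split; [exact: contp_cst|rewrite (fc_cst 0 pA) rtrZ mul0r big_nil].
have -> : F (j :: r) = fun t => a j * f j t + F r t by apply/funext => t; rewrite /F big_cons.
have cj : contp (fun t => a j * f j t) by exact: contpZ.
split; first exact: contpD.
by rewrite (fcD cj IH1 pA) rtrD IH2 big_cons (fcZ _ (cf j) pA) rtrZ.
Qed.

End KleinInterpolation.

(** The comparison at every scale [c] is summed with the weights of [psum]. The error [4^(-n)] of
    [psum_lower] is multiplied by the finite trace of 1 and disappears in the limit, so the constant
    depends on [r] alone. *)
Lemma interp_pow {R : realType} {I : choiceType} (r : R) : 1 < r -> r < 2 -> exists2 b : R, 0 <= b & forall (s : seq I) (A B : bop R I) K, 0 <= K -> posop A -> posop B ->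
  (forall c, 0 <= c -> rtr s (fc (fun t => phi (c * t)) A) <= K * rtr s (fc (fun t => phi (c * t)) B)) ->
  rtr s (fc (fun t : R => t `^ r) A) <= b * K * rtr s (fc (fun t : R => t `^ r) B).
Proof.
move=> r1 r2; have [b b0 hb] := psum_upper r1 r2; exists (8 * b) => [|s A B K K0 pA pB H]; first exact: mulr_ge0.
have r0 : 0 < r by rewrite (lt_trans ltr01).
have cr := contp_powR r0; have ss : 0 <= (size s)%:R :> R by [].
pose c (n : nat) (j : 'I_n.*2.+1) := 4 `^ (n%:R - j%:R) : R.
pose w (n : nat) (j : 'I_n.*2.+1) := 4 `^ ((j%:R - n%:R) * r) : R.
have cc n j : contp (fun t => phi (c n j * t)) by apply: contp_phi; exact: powR_ge0.
have cps n X : posop X -> contp (psum r n) /\ rtr s (fc (psum r n) X) = \sum_j w n j * rtr s (fc (fun t => phi (c n j * t)) X).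
  by move=> pX; exact: (rtr_fc_sum s (w n) pX (cc n)).
have four (n : nat) : n.+1%:R <= 4 `^ n%:R :> R.
  rewrite powR_mulrn // -natrX ler_nat; elim: n => // n IH.
  by rewrite expnS; apply: leq_trans (_ : (4 * n.+1 <= _)%N); [lia|rewrite leq_mul2l IH].
have key (n : nat) : nrm A <= n%:R -> rtr s (fc (fun t : R => t `^ r) A) <= 8 * b * K * rtr s (fc (fun t : R => t `^ r) B) + n.+1%:R^-1 * (size s)%:R.
  move=> An; have [cn sA] := cps n A pA; have [_ sB] := cps n B pB.
  have cl : contp (fun t => 8 * psum r n t + 4 `^ (- n%:R) * 1).
    by apply: contpD; [exact: contpZ|exact: contp_cst].
  apply: le_trans (_ : rtr s (fc (fun t => 8 * psum r n t + 4 `^ (- n%:R) * 1) A) <= _).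
    apply: rtr_mono; apply: (fc_le_pos cr cl pA) => t /andP[t0 tA]; rewrite mulr1.
    apply: (psum_lower r1 r2 t0); apply: le_trans tA _; apply: le_trans An _; apply: le_trans (four n).
    by rewrite ler_nat.
  rewrite (fcD (contpZ (c := 8) cn) (@contp_cst R (4 `^ (- n%:R) * 1)) pA) rtrD (fcZ 8 cn pA) rtrZ.
  apply: lerD; last first.
    rewrite (fc_cst _ pA) rtrZ mulr1; apply: ler_pM; rewrite ?powR_ge0 //.
    - exact/rtr_pos/posop1.
    - by rewrite powRN lef_pV2 ?posrE ?powR_gt0.
    by rewrite rtr_dg -sum1_size natr_sum; apply: ler_sum => i _; rewrite /dg bop1 -nsqE nsq_delta.
  rewrite -!mulrA; apply: ler_wpM2l => //; rewrite sA.
  apply: le_trans (_ : K * rtr s (fc (psum r n) B) <= _).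
    rewrite sB mulr_sumr; apply: ler_sum => j _; rewrite mulrCA; apply: ler_wpM2l; first exact: powR_ge0.
    by apply: H; exact: powR_ge0.
  rewrite mulrCA; apply: ler_wpM2l => //; rewrite -rtrZ -(fcZ b cr pB).
  by apply: rtr_mono; apply: (fc_le_pos cn (contpZ cr) pB) => t /andP[t0 _]; exact: hb.
pose n0 := Num.bound (nrm A); have hn0 : nrm A <= n0%:R by exact: ltW (archi_boundP (nrm_ge0 A)).
have hk (n : nat) : rtr s (fc (fun t : R => t `^ r) A) <= 8 * b * K * rtr s (fc (fun t : R => t `^ r) B) + n.+1%:R^-1 * (size s)%:R.
  apply: le_trans (key (n + n0)%N _) _; first by apply: le_trans hn0 _; rewrite ler_nat leq_addl.
  by rewrite lerD2l; apply: ler_wpM2r => //; rewrite lef_pV2 ?posrE ?ltr0n // ler_nat ltnS leq_addr.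
have L : 8 * b * K * rtr s (fc (fun t : R => t `^ r) B) + n.+1%:R^-1 * (size s)%:R @[n --> \oo] --> 8 * b * K * rtr s (fc (fun t : R => t `^ r) B) + 0 * (size s)%:R.
  by apply: cvgD; [exact: cvg_cst|apply: cvgM; [exact: cvg_invS|exact: cvg_cst]].
have := @lim_le R (fun=> rtr s (fc (fun t : R => t `^ r) A)) _ _ _ (cvg_cst (rtr s (fc (fun t : R => t `^ r) A) : R)) L hk.
by rewrite mul0r addr0; apply.
Qed.

(** * Multiplier bounds for all exponents *)

Section Multipliers.
Context {R : realType}.
Notation G := freegroup.
Notation I := (nat * freegroup)%type.
Implicit Types (g h : G) (c : R[i]) (X Y W : @Ix R) (m : G -> R[i]).

Definition supp n X := all (fun t : R[i] * (nat * G * nat) => (t.2.1.1 < n)%N && (t.2.2 < n)%N) X.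

Lemma supp_ex X : exists n, supp n X.
Proof.
exists (\sum_(t <- X) (t.2.1.1 + t.2.2)).+1; apply/allP => t tX.
have : (t.2.1.1 + t.2.2 < (\sum_(t <- X) (t.2.1.1 + t.2.2)).+1)%N by rewrite ltnS (big_rem t tX) leq_addr.
by move=> h; rewrite (leq_ltn_trans _ h) ?leq_addr //= (leq_ltn_trans _ h) ?leq_addl.
Qed.

Lemma supp_inc n X : supp n X -> inc (eM n) (val_ix X).
Proof.
move=> /allP sX; split; rewrite /val_ix.
  rewrite mulr_sumr; apply: eq_big_seq => t /sX /andP[h1 h2]; rewrite bscaleAr; congr (_ *: _); apply: bop_ext_deltas => -[k h].
  by rewrite bopM unit_delta bopZ eM_delta h1 scale1r.
rewrite mulr_suml; apply: eq_big_seq => t /sX /andP[h1 h2].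
rewrite bscaleAl; congr (_ *: _); apply: bop_ext_deltas => -[k h].
rewrite bopM eM_delta bopZ unit_delta scalerA; have [<-|_] := eqVneq t.2.2 k; last by rewrite mulr0.
by rewrite h2 mul1r.
Qed.

Lemma supp_cat n X Y : supp n X -> supp n Y -> supp n (X ++ Y).
Proof. by rewrite /supp all_cat => -> ->. Qed.
Lemma supp_scale n c X : supp n X -> supp n (scale_ix c X).
Proof. by rewrite /supp all_map. Qed.
Lemma supp_mult n m X : supp n X -> supp n (mult m X).
Proof. by rewrite /supp all_map. Qed.
Lemma supp_star n X : supp n X -> supp n (star_ix X).
Proof. by rewrite /supp all_map; apply: sub_all => t /= /andP[-> ->]. Qed.
Lemma supp_mul n X Y : supp n X -> supp n Y -> supp n (mul_ix X Y).
Proof.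
move=> /allP sX /allP sY; apply/allP => w /allpairsP[[t v] /= [tX vY ->]] /=.
by have /andP[-> _] := sX t tX; have /andP[_ ->] := sY v vY.
Qed.

Lemma val_nil : val_ix [::] = 0 :> bop R I. Proof. by rewrite /val_ix big_nil. Qed.

(** Polynomial pieces of a finite family are again finite families, so multipliers act on them: this
    is what interpolation and duality require. *)
Lemma ix_pev n X P : supp n X ->
  exists2 W, supp n W & val_ix W = val_ix X * pev P (star (val_ix X) * val_ix X).
Proof.
move=> sX; elim/poly_ind: P => [|P c [W sW hW]].
  by exists [::]; rewrite // val_nil pev0 mulr0.
exists (mul_ix W (mul_ix (star_ix X) X) ++ scale_ix c%:C%C X).
  by apply: supp_cat; [apply: supp_mul => //; apply: supp_mul => //; exact: supp_star|exact: supp_scale].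
rewrite val_cat val_scale !val_mul val_star hW pevD pevM pevX pevC mulrDr mulrA.
by congr (_ + _); [rewrite !mulrA|rewrite rsMr mulr1].
Qed.

Lemma nm_np p n X : 1 < p -> supp n X -> nm p X = np p (sM n) (val_ix X).
Proof. by move=> p1 /supp_inc ix; have [] := Lb_corner (@eM_cuts R) p1 (NM_val X) ix. Qed.

Lemma val_mult_cat m X Y : val_ix (mult m (X ++ Y)) = val_ix (mult m X) + val_ix (mult m Y).
Proof. by rewrite /mult map_cat val_cat. Qed.
Lemma val_mult_scale m c X : val_ix (mult m (scale_ix c X)) = c *: val_ix (mult m X).
Proof.
rewrite -val_scale /mult /scale_ix -!map_comp; congr val_ix; apply: eq_map => t /=.
by rewrite mulrCA.
Qed.
Lemma mult_comp m m' X : mult m (mult m' X) = mult (fun g => m g * m' g) X.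
Proof. by rewrite /mult -map_comp; apply: eq_map => t /=; rewrite mulrA. Qed.

Lemma val_mult_coord m X j k : val_ix (mult m X) (delta (j, 1%g)) k = m k.2 * val_ix X (delta (j, 1%g)) k.
Proof.
have Z c (xi : ell2 R I) : (c *: xi) k = c * xi k by [].
have E Y : val_ix Y (delta (j, 1%g)) k = \sum_(t <- Y) t.1 * ((t.2.2 == j)%:R * (k == (t.2.1.1, t.2.1.2))%:R).
  rewrite /val_ix bop_sumE ell2_sum; apply: eq_bigr => t _.
  by rewrite bopZE unit_delta mulg1 (Z _ _) (Z _ _) deltaE.
rewrite E E /mult big_map mulr_sumr; apply: eq_bigr => t _ /=.
have [->|ne] := eqVneq k (t.2.1.1, t.2.1.2); last by rewrite !mulr0.
by rewrite /= !mulrA.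
Qed.

Lemma nsq_sqmod (J : choiceType) (xi eta : ell2 R J) : (forall k, sqmod (eta k) = sqmod (xi k)) -> nsq eta = nsq xi.
Proof.
move=> h; suff : sqsum eta = sqsum xi by rewrite !sqsumE => -[].
by apply: eq_esum => k _; rewrite h.
Qed.

(** A unimodular symbol only rotates the entries of the columns that the trace sees. *)
Lemma rtr_mult2 n m X : (forall g, sqmod (m g) = 1) ->
  rtr (sM n) (star (val_ix (mult m X)) * val_ix (mult m X)) = rtr (sM n) (star (val_ix X) * val_ix X).
Proof.
move=> m1; rewrite !rtr_nsq /sM !big_map; apply: eq_bigr => j _.
by apply: nsq_sqmod => k; rewrite val_mult_coord sqmodM m1 mul1r.
Qed.

Lemma apow2 (J : choiceType) (x : bop R J) : apow 2 x = star x * x.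
Proof.
have px := posop_star x; rewrite /apow divff ?pnatr_eq0 // -[RHS](fc_id px).
by apply: fc_ext => // [|t /andP[t0 _]]; [exact: contp_powR|rewrite powRr1].
Qed.

Lemma apow4 (J : choiceType) (x : bop R J) : apow 4 x = star x * x * (star x * x).
Proof.
have px := posop_star x; have ci := @contp_id R; rewrite /apow -[in RHS](fc_id px) -(fcM ci ci px).
have -> : (4 / 2 = 2 :> R) by field.
apply: fc_ext => // [|t /andP[t0 _]]; first exact: contp_powR.
by rewrite -[2]/(2%:R) powR_mulrn // expr2.
Qed.

Lemma nm4 n W : supp n W ->
  nm 4 W ^+ 4 = rtr (sM n) (star (val_ix W) * val_ix W * (star (val_ix W) * val_ix W)).
Proof.
move=> sW; have l4 : (1 : R) < 4 by rewrite ltr1n.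
rewrite (nm_np l4 sW) /np apow4 -powR_mulrn ?powR_ge0 // -powRrM mulVf ?powRr1 ?pnatr_eq0 //.
by rewrite -apow4; apply/rtr_pos/apow_pos.
Qed.

Lemma nm2_mult m X : (forall g, sqmod (m g) = 1) -> nm 2 (mult m X) = nm 2 X.
Proof.
move=> m1; have l2 : (1 : R) < 2 by rewrite ltr1n.
have [n sX] := supp_ex X; rewrite (nm_np l2 sX) (nm_np l2 (supp_mult m sX)) /np !apow2.
by rewrite rtr_mult2.
Qed.

(** [interp_phi] applies with the multiplier acting separately on [W], which represents
    [x Q(x^* x)], and on [x - W]: at 4 by hypothesis and at 2 isometrically. The bound [K] depends
    on [p] and [C] only. *)
Lemma bdd_interp (p : R) (C : R) : 2 < p -> p < 4 -> 0 <= C ->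
  exists2 K, 0 <= K & forall m, (forall g, sqmod (m g) = 1) -> bdd 4 C m -> bdd p K m.
Proof.
move=> p2 p4 C0; have r1 : 1 < p / 2 by lra.
have r2 : p / 2 < 2 by lra.
have p1 : 1 < p by lra.
have p0 : 0 < p by lra.
have [b b0 hb] := @interp_pow R I _ r1 r2; pose L := 8 * C ^+ 4 + 2.
have L0 : 0 <= L by rewrite addr_ge0 // mulr_ge0 // exprn_ge0.
exists ((b * L) `^ p^-1) => [|m m1 h4 X]; first exact: powR_ge0.
have [n sX] := supp_ex X; rewrite (nm_np p1 sX) (nm_np p1 (supp_mult m sX)) /np -powRM; last 2 first.
- exact: mulr_ge0.
- exact/rtr_pos/apow_pos.
apply: ge0_ler_powR; rewrite ?nnegrE ?invr_ge0 ?(ltW p0) //.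
- exact/rtr_pos/apow_pos.
- by apply: mulr_ge0; [exact: mulr_ge0|exact/rtr_pos/apow_pos].
apply: hb => //; [exact: posop_star|exact: posop_star|].
have C4 : 0 <= C ^+ 4 by exact: exprn_ge0.
apply: (interp_phi (@NM_cstar R) (@NM_tracial R) (@eM_corner R n) C4 (NM_val X) (NM_val (mult m X))) => Q.
have [W sW hW] := ix_pev Q sX.
have sV : supp n (X ++ scale_ix (-1) W) by apply: supp_cat => //; exact: supp_scale.
have hV : val_ix (X ++ scale_ix (-1) W) = val_ix X - val_ix W by rewrite val_cat val_scale scaleN1r.
exists (val_ix (mult m W)), (val_ix (mult m (X ++ scale_ix (-1) W))); split.
- by split; [exact: NM_val|exact/supp_inc/supp_mult].
- by split; [exact: NM_val|exact/supp_inc/supp_mult].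
- by rewrite val_mult_cat val_mult_scale scaleN1r addrC subrK.
- have sB : star (star (val_ix X) * val_ix X) = star (val_ix X) * val_ix X by rewrite starM starK.
  have -> : pev Q (star (val_ix X) * val_ix X) * (star (val_ix X) * val_ix X) * pev Q (star (val_ix X) * val_ix X) =
      star (val_ix W) * val_ix W by rewrite hW starM (star_pev _ sB) !mulrA.
  rewrite -(nm4 (supp_mult m sW)) -(nm4 sW) -exprMn.
  by apply: lerXn2r; rewrite ?nnegrE ?mulr_ge0 ?nm_ge0.
- by rewrite rtr_mult2 // hV hW.
Qed.

Lemma sqmod_lev z b l g : @unim R z -> sqmod (lev z b l g) = 1.
Proof.
move=> uz; have := conjM_sqmod (lev z b l g); rewrite mulrC lev_conjM // => h.
by have := congr1 (@complex.Re R) h.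
Qed.

Lemma conj_ex (p : R) : 1 < p -> p^-1 + ((1 - p^-1)^-1)^-1 = 1.
Proof. by move=> p1; rewrite invrK addrC subrK. Qed.

(** Doubling the isometric case gives 4, interpolation gives the exponents in between, and each
    further doubling extends [2, 2 2^k] to [2, 4 2^k]. *)
Lemma Bd_ge2 p : 2 <= p -> forall l b, Bd p (fun z => @lev R z b l).
Proof.
have B2 l b : Bd 2 (fun z => @lev R z b l).
  exists 1; [exact: ler01|move=> z uz X].
  by rewrite mul1r nm2_mult // => g; exact: sqmod_lev.
have l2 : (1 : R) < 2 by rewrite ltr1n.
have B4 l b : Bd 4 (fun z => @lev R z b l).
  have -> : (4 = 2 * 2 :> R) by rewrite -natrM.
  by apply: (Bd_double l2 (conj_ex l2)).
have Blow q l b : 2 <= q -> q < 4 -> Bd q (fun z => @lev R z b l).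
  move=> q2 q4; have [<-|qn] := eqVneq 2 q; first exact: B2.
  have [C C0 h] := B4 l b; have q2' : 2 < q by rewrite lt_neqAle qn.
  have [K K0 hK] := bdd_interp q2' q4 C0; exists K; [exact: K0|move=> z uz].
  by apply: hK; [move=> g; exact: sqmod_lev|exact: h].
have key (k : nat) : forall q, 2 <= q -> q <= 2 * 2 ^+ k -> forall l b, Bd q (fun z => @lev R z b l).
  elim: k => [|k IH] q q2 qk l b.
    by have -> : q = 2; [apply/eqP; rewrite eq_le q2 andbT; move: qk; rewrite expr0 mulr1|exact: B2].
  have [q4|q4] := ltP q 4; first exact: Blow.
  have -> : q = 2 * (q / 2) by field.
  have h1 : 1 < q / 2 by lra.
  apply: (Bd_double h1 (conj_ex h1)) => l' b'; apply: IH; first by lra.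
  by move: qk; rewrite exprS; move: (2 ^+ k) => t; lra.
move=> p2; apply: (key (Num.bound p)) => //.
have p0 : 0 <= p by lra.
apply: le_trans (ltW (archi_boundP p0)) _; move: (Num.bound p) => k.
rewrite -exprS -natrX ler_nat; apply: leq_trans (ltnW (ltn_expl k (isT : 1 < 2)%N)) _.
by rewrite leq_exp2l.
Qed.

Lemma tr_bsum (J : choiceType) (s : seq J) (T : Type) (r : seq T) (F : T -> bop R J) :
  tr s (\sum_(t <- r) F t) = \sum_(t <- r) tr s (F t).
Proof.
elim: r => [|t r IH]; rewrite ?big_nil ?big_cons ?trD ?IH //.
by rewrite -(scale0r (0 : bop R J)) trZ mul0r.
Qed.

Lemma tr_unit n i g j : g != 1%g -> tr (sM n) (@unit_elt R i g j) = 0.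
Proof.
move=> g1; rewrite trE /sM big_map big1 // => k _.
rewrite unit_delta mulg1 ipZr ip_deltal deltaE xpair_eqE [(1 == g)%g]eq_sym (negbTE g1) andbF.
by rewrite mulr0.
Qed.

Lemma tr_mult n m X W :
  tr (sM n) (val_ix (mult m X) * val_ix W) = tr (sM n) (val_ix X * val_ix (mult (fun g => m g^-1%g) W)).
Proof.
rewrite /val_ix /mult !big_map !mulr_suml !tr_bsum; apply: eq_bigr => t _.
rewrite !mulr_sumr !tr_bsum; apply: eq_bigr => v _ /=.
rewrite !bscaleAl !bscaleAr unitM !scalerA !trZ.
have [e|ne] := eqVneq (t.2.1.2 * v.2.1.2)%g 1%g; last by rewrite tr_unit // !mulr0.
have -> : (v.2.1.2^-1)%g = t.2.1.2 by rewrite -[LHS]mul1g -e mulgK.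
by congr (_ * _); ring.
Qed.

(** For the bilinear pairing [tr (X W)] the transpose of the multiplier has symbol [m(g^-1)], as
    only products equal to 1 in the group have a trace. The dual element is again a finite family,
    so the hypothesis at [q] applies to it. *)
Lemma bdd_dual p q m C : 1 < p -> p^-1 + q^-1 = 1 -> 1 < q -> 0 <= C ->
  bdd q C (fun g => m g^-1%g) -> bdd p C m.
Proof.
move=> p1 pq q1 C0 hq X; have [n sX] := supp_ex X; have sY := supp_mult m sX.
rewrite (nm_np p1 sY); have he := @eM_corner R n.
apply: (duality (@NM_cstar R) (@NM_tracial R) he p1 pq (NM_val _) (supp_inc sY)) => [|P].
  by rewrite mulr_ge0 ?nm_ge0.
have [W sW hW] := ix_pev P (supp_star sY).
have {}hW : dual_elt P (val_ix (mult m X)) = val_ix W by rewrite hW val_star starK.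
rewrite hW rtr_tr tr_mult -rtr_tr.
have sZ := supp_mult (fun g => m g^-1%g) sW.
apply: le_trans (rtr_pairing (@NM_cstar R) (@NM_tracial R) he p1 pq (NM_val X) (supp_inc sX) (NM_val _) (supp_inc sZ)) _.
rewrite -(nm_np p1 sX) -(nm_np q1 sZ) -(nm_np q1 sW) (mulrC C) -mulrA.
by apply: ler_wpM2l; [exact: nm_ge0|exact: hq].
Qed.

Lemma Bd_all p : 1 < p -> forall l b, Bd p (fun z => @lev R z b l).
Proof.
move=> p1 l b; have [p2|p2] := leP 2 p; first exact: Bd_ge2.
have p0 : 0 < p by lra.
have i2 : 2^-1 <= p^-1 by rewrite lef_pV2 ?posrE // ltW.
have i1 : p^-1 < 1 by rewrite invf_lt1.
have q2 : 2 <= (1 - p^-1)^-1.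
  by rewrite -[X in X <= _]invrK lef_pV2 ?posrE ?invr_gt0 ?subr_gt0 //; lra.
have q1 : 1 < (1 - p^-1)^-1 by lra.
have [C C0 h] := Bd_ge2 q2 l b; exists C; [exact: C0|move=> z uz].
(* The symbol at [g^-1] is obtained from the one with conjugate parameters by [bdd_star], the two
   conjugations cancelling. *)
apply: (bdd_dual p1 (conj_ex p1) q1 C0).
have := bdd_star q1 (h _ (unim_conj uz)); congr (bdd _ _ _); apply/funext => g.
by rewrite -lev_conj conjcK.
Qed.

Lemma bddM p C C' m m' : 0 <= C -> bdd p C m -> bdd p C' m' -> bdd p (C * C') (fun g => m g * m' g).
Proof.
move=> C0 h h' X; rewrite -mult_comp -mulrA; apply: le_trans (h _) _.
by apply: ler_wpM2l.
Qed.

Lemma bdd_symbol p d : 1 < p -> exists2 C, 0 <= C & forall z, @torus R d z -> bdd p C (symbol_Ld z).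
Proof.
move=> p1; suff [C C0 h] : exists2 C, 0 <= C & forall z, @torus R d z ->
    bdd p C (fun g => \prod_(j <- index_enum 'I_d) lev (z j) true j g).
  by exists C; [exact: C0|move=> z tz; exact: h].
elim: (index_enum _) => [|j r [C C0 h]].
  exists 1 => // z _; have := @bdd1 R p; congr (bdd _ _ _); apply/funext => g; by rewrite big_nil.
have [C' C'0 h'] := Bd_all p1 (val j) true; exists (C' * C) => [|z tz]; first exact: mulr_ge0.
have := bddM C'0 (h' (z j) (tz j)) (h z tz); congr (bdd _ _ _); apply/funext => g.
by rewrite big_cons.
Qed.

End Multipliers.

(** * Extension to the completion *)

Lemma cvg0P {R : realType} (f : nat -> R) : (forall k, 0 <= f k) ->
  (f @ \oo --> (0 : R)) <-> forall e, 0 < e -> exists N0, forall k, (N0 <= k)%N -> f k <= e.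
Proof.
move=> f0; split=> [/cvgrPdist_le h e e0|h].
  by have [N0 _ hN] := h e e0; exists N0 => k kN; have := hN k kN; rewrite /= sub0r normrN ger0_norm.
apply/cvgrPdist_le => e e0; have [N0 hN] := h e e0; exists N0 => // k /= kN.
by rewrite sub0r normrN ger0_norm //; exact: hN.
Qed.

Lemma small_comb {R : realFieldType} (t e r1 r2 : R) : 0 <= t -> 0 < e -> r1 <= e / (2 * (t + 1)) -> r2 <= e / 3 -> t * r1 + r2 < e.
Proof.
move=> t0 e0 h1 h2; have t1 : 0 < t + 1 by lra.
have h3 : t * r1 <= e / 2.
  apply: le_trans (ler_wpM2l t0 h1) _; rewrite mulrC mulrAC ler_pdivrMr ?mulr_gt0 //.
  by rewrite (_ : e / 2 * (2 * (t + 1)) = e * t + e); [rewrite lerDl ltW|field].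
lra.
Qed.

Lemma small_mul {R : realFieldType} (C e r r' : R) : 0 <= C -> 0 <= r' -> 0 < e -> r <= C * r' -> r' <= e / (C + 1) -> r <= e /\ (r' < e / (C + 1) -> r < e).
Proof.
move=> C0 r0 e0 h h'; have C1 : 0 < C + 1 by rewrite ltr_wpDl.
have k : (C + 1) * r' <= e by rewrite mulrC -ler_pdivlMr.
split; first by apply: le_trans h _; apply: le_trans k; rewrite ler_wpM2r // lerDl.
move=> h2; apply: le_lt_trans h _; apply: (@le_lt_trans _ _ ((C + 1) * r')).
  by rewrite ler_wpM2r // lerDl.
by rewrite mulrC -ltr_pdivlMr.
Qed.

Section Completion.
Context {R : realType} {I : choiceType}.
Variables (M : tracial R I) (p : R) (B : set (bop R I)) (n : bop R I -> R).

(* [n] is the Lp-norm on the domain [B] of operators of finite Lp-norm. *)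
Record Lp_model : Prop := LpModel {
  lm_bdd : forall x : op R I, Lp_bounded M p x <-> exists2 b : bop R I, B b & x = bfun b;
  lm_pn : forall b : bop R I, B b -> pnorm M p (bfun b) = (n b)%:E;
  lm_ge0 : forall b, 0 <= n b;
  lm_D : forall a b, B a -> B b -> B (a + b) /\ n (a + b) <= n a + n b;
  lm_Z : forall (k : R[i]) a, B a -> B (k *: a) /\ n (k *: a) = Num.sqrt (sqmod k) * n a }.

Hypothesis H : Lp_model.
Let bddP : forall x : op R I, Lp_bounded M p x <-> exists2 b : bop R I, B b & x = bfun b.
Proof. exact: lm_bdd H. Qed.
Let pnE : forall b : bop R I, B b -> pnorm M p (bfun b) = (n b)%:E.
Proof. exact: lm_pn H. Qed.
Let n0 : forall b, 0 <= n b. Proof. exact: lm_ge0 H. Qed.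
Let BD : forall a b, B a -> B b -> B (a + b) /\ n (a + b) <= n a + n b.
Proof. exact: lm_D H. Qed.
Let BZ : forall (k : R[i]) a, B a -> B (k *: a) /\ n (k *: a) = Num.sqrt (sqmod k) * n a.
Proof. exact: lm_Z H. Qed.

Implicit Types (u v w : nat -> bop R I) (x y z : bop R I) (s : opseq R I).

Definition ops u : opseq R I := fun k => bfun (u k).

Definition cauchy_n u := (forall k, B (u k)) /\
  forall e, 0 < e -> exists N0, forall i j, (N0 <= i)%N -> (N0 <= j)%N -> n (u i - u j) < e.
Definition eqv u v := forall e, 0 < e -> exists N0, forall k, (N0 <= k)%N -> n (u k - v k) <= e.

Lemma BN x : B x -> B (- x) /\ n (- x) = n x.
Proof.
move=> /(BZ (-1)); rewrite scaleN1r (_ : sqmod (-1) = 1) ?sqrtr1 ?mul1r //.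
by rewrite /sqmod /= oppr0 expr0n addr0 sqrrN expr1n.
Qed.
Lemma BB x y : B x -> B y -> B (x - y).
Proof. by move=> Bx /BN[By _]; have [] := BD Bx By. Qed.
Lemma n_swap x y : B x -> B y -> n (x - y) = n (y - x).
Proof. by move=> Bx By; rewrite -[x - y]opprB; have [] := BN (BB By Bx). Qed.
Lemma n_tri y x z : B x -> B y -> B z -> n (x - z) <= n (x - y) + n (y - z).
Proof.
move=> Bx By Bz; have [_] := BD (BB Bx By) (BB By Bz).
by rewrite addrA subrK.
Qed.
Lemma n_self x : B x -> n (x - x) = 0.
Proof.
move=> Bx; rewrite subrr -(scale0r x); have [_ ->] := BZ 0 Bx.
by rewrite (_ : sqmod 0 = 0) ?sqrtr0 ?mul0r // /sqmod /= expr0n addr0.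
Qed.
Lemma n_dist x y : B x -> B y -> `|n x - n y| <= n (x - y).
Proof.
have K a b : B a -> B b -> n a - n b <= n (a - b).
  by move=> Ba Bb; have [_] := BD (BB Ba Bb) Bb; rewrite subrK lerBlDr.
by move=> Bx By; rewrite ler_norml K // andbT lerNl opprB (n_swap Bx By) K.
Qed.

Lemma eqv_refl u : (forall k, B (u k)) -> eqv u u.
Proof. by move=> Bu e e0; exists 0%N => k _; rewrite n_self // ltW. Qed.
Lemma eqv_sym u v : (forall k, B (u k)) -> (forall k, B (v k)) -> eqv u v -> eqv v u.
Proof. by move=> Bu Bv h e e0; have [N0 hN] := h e e0; exists N0 => k kN; rewrite n_swap //; exact: hN. Qed.
Lemma eqv_trans v u w : (forall k, B (u k)) -> (forall k, B (v k)) -> (forall k, B (w k)) ->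
  eqv u v -> eqv v w -> eqv u w.
Proof.
move=> Bu Bv Bw h1 h2 e e0; have e2 : 0 < e / 2 by rewrite divr_gt0.
have [N1 k1] := h1 _ e2; have [N2 k2] := h2 _ e2; exists (maxn N1 N2) => k.
rewrite geq_max => /andP[/k1 a1 /k2 a2]; apply: le_trans (n_tri (Bu k) (Bv k) (Bw k)) _.
by rewrite [e]splitr; exact: lerD.
Qed.
Lemma cauchy_eqv u v : (forall k, B (v k)) -> cauchy_n u -> eqv u v -> cauchy_n v.
Proof.
move=> Bv [Bu cu] h; split=> // e e0; have e3 : 0 < e / 3 by rewrite divr_gt0.
have [N1 k1] := cu _ e3; have [N2 k2] := h _ e3; exists (maxn N1 N2) => i j.
rewrite !geq_max => /andP[i1 i2] /andP[j1 j2].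
have a1 := k1 i j i1 j1; have a2 := k2 i i2; have a3 := k2 j j2.
have b1 := n_tri (Bv i) (Bu i) (Bv j); have b2 := n_tri (Bu i) (Bu j) (Bv j).
rewrite (n_swap (Bv i) (Bu i)) in b1; move: a1 a2 a3 b1 b2.
by move: (n _) (n _) (n _) (n _) (n _) => r1 r2 r3 r4 r5 *; lra.
Qed.

Lemma eqv_inv u v : (forall k : nat, n (u k - v k) <= k.+1%:R^-1) -> eqv u v.
Proof.
move=> hc; have cv : (fun k : nat => k.+1%:R^-1 : R) @ \oo --> (0 : R) := @cvg_invS R.
have f0 (k : nat) : 0 <= k.+1%:R^-1 :> R by rewrite invr_ge0.
move: cv => /(cvg0P f0) cv e e0.
by have [N0 hN] := cv e e0; exists N0 => k kN; apply: le_trans (hc k) _; exact: hN.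
Qed.
Lemma const_cauchy x : B x -> cauchy_n (fun=> x).
Proof. by move=> Bx; split=> // e e0; exists 0%N => i j _ _; rewrite n_self. Qed.

Lemma ops_inj u v : ops u = ops v -> u = v.
Proof. by move=> h; apply/funext => k; apply: bop_ext => xi; exact: (congr1 (fun f : opseq R I => f k xi) h). Qed.

Lemma Lp_cauchyP s : Lp_cauchy M p s <-> exists2 u, cauchy_n u & s = ops u.
Proof.
split=> [[h1 h2]|[u [h1 h2] ->]].
  have /choice[u hu] : forall k, exists b, B b /\ s k = bfun b.
    by move=> k; have /bddP[b Bb e] := h1 k; exists b.
  exists u; last by apply/funext => k; exact: (hu k).2.
  split=> [k|e e0]; first exact: (hu k).1.
  have [N0 hN0] := h2 e e0; exists N0 => i j Ni Nj; have := hN0 i j Ni Nj.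
  rewrite (hu i).2 (hu j).2 -bfunB pnE ?lte_fin //; exact: (BB (hu i).1 (hu j).1).
split=> [k|e e0]; first by apply/bddP; exists (u k).
have [N0 hN0] := h2 e e0; exists N0 => i j Ni Nj.
by rewrite /ops -bfunB pnE ?lte_fin; [exact: hN0|exact: BB].
Qed.

Lemma Lp_classP u s : (forall k, B (u k)) ->
  Lp_class M p (ops u) s <-> exists2 v, cauchy_n v /\ eqv u v & s = ops v.
Proof.
move=> Bu; have E v : (forall k, B (v k)) ->
    (fun k => pnorm M p (ops u k - ops v k)%R) = (fun k => (n (u k - v k))%:E).
  by move=> Bv; apply/funext => k; rewrite /ops -bfunB pnE //; exact: BB.
split=> [[/Lp_cauchyP[v cv ->] h]|[v [cv h] ->]].
  exists v => //; split=> //; move: h; rewrite (E v cv.1) => /fine_cvg h.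
  by apply/(cvg0P (fun k => n0 _)).
split; first by apply/Lp_cauchyP; exists v.
rewrite (E v cv.1); apply: cvg_EFin; first exact: nearW.
by apply/(cvg0P (fun k => n0 (u k - v k))).
Qed.

Lemma class_mem u : cauchy_n u -> Lp_class M p (ops u) (ops u).
Proof. by move=> cu; apply/(Lp_classP _ cu.1); exists u => //; split=> //; exact: eqv_refl cu.1. Qed.

Lemma class_mem_eqv u v : cauchy_n u -> Lp_class M p (ops u) (ops v) -> cauchy_n v /\ eqv u v.
Proof. by move=> cu /(Lp_classP _ cu.1)[v' h /ops_inj ->]. Qed.

Lemma class_eq u v : cauchy_n u -> cauchy_n v -> eqv u v -> Lp_class M p (ops u) = Lp_class M p (ops v).
Proof.
move=> cu cv uv; have [Bu _] := cu; have [Bv _] := cv; have vu := eqv_sym Bu Bv uv.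
apply/seteqP; split=> s /(Lp_classP _ _)-/(_ ltac:(assumption))[w [cw hw] ->].
  by apply/(Lp_classP _ Bv); exists w => //; split=> //; exact: eqv_trans Bv Bu cw.1 vu hw.
by apply/(Lp_classP _ Bu); exists w => //; split=> //; exact: eqv_trans Bu Bv cw.1 uv hw.
Qed.

Lemma Lp_classE X : Lp M p X -> exists2 u, cauchy_n u & X = Lp_class M p (ops u).
Proof. by move=> [s /Lp_cauchyP[u cu ->] <-]; exists u. Qed.
Lemma class_Lp u : cauchy_n u -> Lp M p (Lp_class M p (ops u)).
Proof. by move=> cu; exists (ops u) => //; apply/Lp_cauchyP; exists u. Qed.

Lemma n_comb (k : R[i]) x y x' y' : B x -> B y -> B x' -> B y' ->
  n ((k *: x + y) - (k *: x' + y')) <= Num.sqrt (sqmod k) * n (x - x') + n (y - y').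
Proof.
move=> Bx By Bx' By'; have [Bk <-] := BZ k (BB Bx Bx').
have -> : k *: x + y - (k *: x' + y') = k *: (x - x') + (y - y').
  by rewrite scalerBr opprD addrACA.
by have [] := BD Bk (BB By By').
Qed.

Lemma comb_cauchy (k : R[i]) u v : cauchy_n u -> cauchy_n v -> cauchy_n (fun i => k *: u i + v i).
Proof.
move=> [Bu cu] [Bv cv]; split=> [i|e e0]; first by have [] := BD (BZ k (Bu i)).1 (Bv i).
have t0 : 0 <= Num.sqrt (sqmod k) := sqrtr_ge0 _.
have d0 : 0 < e / (2 * (Num.sqrt (sqmod k) + 1)) by rewrite divr_gt0 // mulr_gt0 // ltr_wpDl.
have e3 : 0 < e / 3 by rewrite divr_gt0.
have [N1 k1] := cu _ d0; have [N2 k2] := cv _ e3; exists (maxn N1 N2) => i j.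
rewrite !geq_max => /andP[i1 i2] /andP[j1 j2].
apply: le_lt_trans (n_comb k (Bu i) (Bv i) (Bu j) (Bv j)) _.
by apply: small_comb => //; apply: ltW; [exact: k1|exact: k2].
Qed.

Lemma comb_eqv (k : R[i]) u v u' v' : cauchy_n u -> cauchy_n v -> cauchy_n u' -> cauchy_n v' ->
  eqv u u' -> eqv v v' -> eqv (fun i => k *: u i + v i) (fun i => k *: u' i + v' i).
Proof.
move=> [Bu _] [Bv _] [Bu' _] [Bv' _] hu hv e e0.
have t0 : 0 <= Num.sqrt (sqmod k) := sqrtr_ge0 _.
have d0 : 0 < e / (2 * (Num.sqrt (sqmod k) + 1)) by rewrite divr_gt0 // mulr_gt0 // ltr_wpDl.
have e3 : 0 < e / 3 by rewrite divr_gt0.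
have [N1 k1] := hu _ d0; have [N2 k2] := hv _ e3; exists (maxn N1 N2) => i.
rewrite geq_max => /andP[i1 i2]; apply: ltW.
apply: le_lt_trans (n_comb k (Bu i) (Bv i) (Bu' i) (Bv' i)) _.
by apply: small_comb => //; [exact: k1|exact: k2].
Qed.

Lemma scale_cauchy (k : R[i]) u : cauchy_n u -> cauchy_n (fun i => k *: u i).
Proof.
move=> cu; have := comb_cauchy k cu (comb_cauchy (-1) cu cu); congr cauchy_n.
by apply/funext => i; rewrite scaleN1r addNr addr0.
Qed.
Lemma scale_eqv (k : R[i]) u v : cauchy_n u -> cauchy_n v -> eqv u v -> eqv (fun i => k *: u i) (fun i => k *: v i).
Proof.
move=> cu cv uv; have := comb_eqv k cu (comb_cauchy (-1) cu cu) cv (comb_cauchy (-1) cu cu) uv (eqv_refl (comb_cauchy (-1) cu cu).1).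
by congr eqv; apply/funext => i; rewrite scaleN1r addNr addr0.
Qed.
Lemma add_cauchy u v : cauchy_n u -> cauchy_n v -> cauchy_n (fun i => u i + v i).
Proof. by move=> cu cv; have := comb_cauchy 1 cu cv; congr cauchy_n; apply/funext => i; rewrite scale1r. Qed.
Lemma add_eqv u v u' v' : cauchy_n u -> cauchy_n v -> cauchy_n u' -> cauchy_n v' ->
  eqv u u' -> eqv v v' -> eqv (fun i => u i + v i) (fun i => u' i + v' i).
Proof.
have E (f g : nat -> bop R I) : (fun i => 1 *: f i + g i) = (fun i => f i + g i) by apply/funext => i; rewrite scale1r.
by move=> cu cv cu' cv' h h'; rewrite -(E u v) -(E u' v'); exact: comb_eqv.
Qed.

Lemma Lp_scale_class (k : R[i]) u : cauchy_n u ->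
  Lp_scale M p k (Lp_class M p (ops u)) = Lp_class M p (ops (fun i => k *: u i)).
Proof.
move=> cu; have ck := scale_cauchy k cu; apply/seteqP; split=> w.
  move=> [s /(Lp_classP _ cu.1)[v [cv uv] ->]].
  by rewrite -[X in Lp_class M p X]/(ops (fun i => k *: v i)) -(class_eq ck (scale_cauchy k cv) (scale_eqv k cu cv uv)).
by move=> h; exists (ops u); [exact: class_mem|exact: h].
Qed.

Lemma Lp_add_class u v : cauchy_n u -> cauchy_n v ->
  Lp_add M p (Lp_class M p (ops u)) (Lp_class M p (ops v)) = Lp_class M p (ops (fun i => u i + v i)).
Proof.
move=> cu cv; have ca := add_cauchy cu cv; apply/seteqP; split=> w.
  move=> [s [t [/(Lp_classP _ cu.1)[u' [cu' uu'] ->] /(Lp_classP _ cv.1)[v' [cv' vv'] ->]]]].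
  by rewrite -[X in Lp_class M p X]/(ops (fun i => u' i + v' i)) -(class_eq ca (add_cauchy cu' cv') (add_eqv cu cv cu' cv' uu' vv')).
by move=> h; exists (ops u), (ops v); split; [exact: class_mem|exact: class_mem|exact: h].
Qed.

(** [Lp_norm] uses a representative picked by [xget]; equivalent Cauchy sequences have the same
    limit of norms, so any representative computes it. *)
Lemma norm_class u : cauchy_n u -> (fun k => n (u k)) @ \oo --> Lp_norm M p (Lp_class M p (ops u)).
Proof.
move=> cu; have := xgetPex 0 (ex_intro _ (ops u) (class_mem cu)); rewrite /Lp_norm.
move=> /(Lp_classP _ cu.1)[v [cv uv] ->].
have -> : (fun k => fine (pnorm M p (ops v k))) = (fun k => n (v k)).
  by apply/funext => k; rewrite /ops pnE //; exact: cv.1.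
have [l hl] : exists l, forall e, 0 < e -> exists N0, forall k, (N0 <= k)%N -> `|n (v k) - l| <= e.
  apply: real_complete => e e0; have [N0 hN] := cv.2 e e0; exists N0 => i j Ni Nj.
  by apply: le_trans (n_dist (cv.1 i) (cv.1 j)) _; apply: ltW; exact: hN.
have Lv : (fun k => n (v k)) @ \oo --> l.
  apply/cvgrPdist_le => e e0; have [N0 hN] := hl e e0; exists N0 => // k /= kN.
  by rewrite distrC; exact: hN.
have Lu : (fun k => n (u k)) @ \oo --> l.
  apply/cvgrPdist_le => e e0; have e2 : 0 < e / 2 by rewrite divr_gt0.
  have [N1 h1] := hl _ e2; have [N2 h2] := uv _ e2; exists (maxn N1 N2) => // k /=; rewrite geq_max => /andP[k1 k2].
  have a1 := h1 k k1; have a2 := le_trans (n_dist (cu.1 k) (cv.1 k)) (h2 k k2).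
  rewrite distrC (_ : n (u k) - l = n (u k) - n (v k) + (n (v k) - l)); last by rewrite addrA subrK.
  by apply: le_trans (ler_normD _ _) _; rewrite [e]splitr; exact: lerD.
by rewrite (cvg_lim (@norm_hausdorff _ _) Lv).
Qed.

Section Extension.
Variables (J : Type) (a b : J -> bop R I) (C : R) (comb : R[i] -> J -> J -> J).
(** Multipliers act on formal families [c], not on operators: [a c] is the operator represented and
    [b c] its image. Linearity of both together with [ed_ab] makes [b c] depend on [a c] only, in a
    Lipschitz way. *)
Record ext_data : Prop := ExtData {
  ed_C : 0 <= C;
  ed_a : forall c, B (a c);
  ed_b : forall c, B (b c);
  ed_aE : forall k c d, a (comb k c d) = k *: a c + a d;
  ed_bE : forall k c d, b (comb k c d) = k *: b c + b d;
  ed_ab : forall c, n (b c) <= C * n (a c);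
  ed_dense : forall x e, B x -> 0 < e -> exists c, n (x - a c) <= e }.
Hypothesis E : ext_data.
Let C0 : 0 <= C. Proof. exact: ed_C E. Qed.
Let Ba : forall c, B (a c). Proof. exact: ed_a E. Qed.
Let Bb : forall c, B (b c). Proof. exact: ed_b E. Qed.
Let aE : forall k c d, a (comb k c d) = k *: a c + a d. Proof. exact: ed_aE E. Qed.
Let bE : forall k c d, b (comb k c d) = k *: b c + b d. Proof. exact: ed_bE E. Qed.
Let ab : forall c, n (b c) <= C * n (a c). Proof. exact: ed_ab E. Qed.
Let adense : forall x e, B x -> 0 < e -> exists c, n (x - a c) <= e. Proof. exact: ed_dense E. Qed.
Implicit Types (c d : nat -> J).

Definition ext (X : set (opseq R I)) : set (opseq R I) :=
  [set w | exists2 c : nat -> J, X (ops (fun k => a (c k))) & Lp_class M p (ops (fun k => b (c k))) w].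

Lemma b_diff i j : n (b i - b j) <= C * n (a i - a j).
Proof.
have F (f : J -> bop R I) : (forall (k : R[i]) (c d : J), f (comb k c d) = k *: f c + f d) -> f (comb (-1) j i) = f i - f j.
  by move=> fE; rewrite fE scaleN1r addrC.
by rewrite -(F a aE) -(F b bE).
Qed.

Lemma b_cauchy c : cauchy_n (fun k => a (c k)) -> cauchy_n (fun k => b (c k)).
Proof.
move=> [_ h]; split=> // e e0; have d0 : 0 < e / (C + 1) by rewrite divr_gt0 // ltr_wpDl.
have [N0 hN] := h _ d0; exists N0 => i j Ni Nj; have k := hN i j Ni Nj.
by have [_] := small_mul C0 (n0 _) e0 (b_diff (c i) (c j)) (ltW k); apply.
Qed.
Lemma b_eqv c d : eqv (fun k => a (c k)) (fun k => a (d k)) -> eqv (fun k => b (c k)) (fun k => b (d k)).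
Proof.
move=> h e e0; have d0 : 0 < e / (C + 1) by rewrite divr_gt0 // ltr_wpDl.
have [N0 hN] := h _ d0; exists N0 => k kN.
by have [] := small_mul C0 (n0 _) e0 (b_diff (c k) (d k)) (hN k kN).
Qed.

Lemma ext_class c : cauchy_n (fun k => a (c k)) ->
  ext (Lp_class M p (ops (fun k => a (c k)))) = Lp_class M p (ops (fun k => b (c k))).
Proof.
move=> cc; apply/seteqP; split=> w; last by move=> h; exists c; [exact: class_mem|exact: h].
move=> [d /(class_mem_eqv cc)[cd cde]].
by rewrite -(class_eq (b_cauchy cc) (b_cauchy cd) (b_eqv cde)).
Qed.

Lemma rep_class X : Lp M p X -> exists2 c, cauchy_n (fun k => a (c k)) & X = Lp_class M p (ops (fun k => a (c k))).
Proof.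
move=> /Lp_classE[u cu ->].
have /choice[c hc] : forall k : nat, exists c : J, n (u k - a c) <= k.+1%:R^-1 by move=> k; exact: (adense (cu.1 k)).
have h : eqv u (fun k => a (c k)) := eqv_inv hc.
have cc := cauchy_eqv (fun k => Ba (c k)) cu h.
by exists c; [exact: cc|exact: (class_eq cu cc h)].
Qed.

Lemma ext_linear : Lp_linear M p ext.
Proof.
split=> [X /rep_class[c cc ->]|k X Y /rep_class[c cc ->] /rep_class[d cd ->]].
  by rewrite ext_class //; exact/class_Lp/b_cauchy.
have L1 := etrans (congr1 (fun Z => Lp_add M p Z (Lp_class M p (ops (fun i => a (d i))))) (Lp_scale_class k cc)) (Lp_add_class (scale_cauchy k cc) cd).
have L2 := etrans (congr1 (fun Z => Lp_add M p Z (Lp_class M p (ops (fun i => b (d i))))) (Lp_scale_class k (b_cauchy cc))) (Lp_add_class (scale_cauchy k (b_cauchy cc)) (b_cauchy cd)).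
apply: etrans (congr1 ext L1) _.
apply: etrans _ (esym (etrans (congr2 (fun Z Z' => Lp_add M p (Lp_scale M p k Z) Z') (ext_class cc) (ext_class cd)) L2)).
have ea : (fun i => k *: a (c i) + a (d i)) = (fun i => a (comb k (c i) (d i))) by apply/funext => i; rewrite aE.
have eb : (fun i => k *: b (c i) + b (d i)) = (fun i => b (comb k (c i) (d i))) by apply/funext => i; rewrite bE.
have cm : cauchy_n (fun i => a (comb k (c i) (d i))) by rewrite -ea; exact: comb_cauchy.
by rewrite ea eb; exact: ext_class cm.
Qed.

Lemma ext_norm : Lp_norm_le M p C ext.
Proof.
split=> [|X /rep_class[c cc ->]]; first exact: ext_linear.
rewrite ext_class //; have h1 := norm_class cc; have h2 := norm_class (b_cauchy cc).
by apply: (lim_le h2 (cvgM (cvg_cst C) h1)) => k; exact: ab.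
Qed.

End Extension.
End Completion.

(** * The trace of an elementary tensor *)

Section CommutingCalculus.
Context {R : realType} {I : choiceType}.
Implicit Types (A B X : bop R I).

Lemma dgD X A i : dg (X + A) i = dg X i + dg A i.
Proof. by rewrite /dg bopDE ipDr. Qed.
Lemma dg_rs (c : R) X i : dg (rs c X) i = c * dg X i.
Proof. by rewrite /dg bopZE ipZr Re_realM. Qed.
Lemma dg1 i : dg (1 : bop R I) i = 1.
Proof. by rewrite /dg bop1 -nsqE nsq_delta. Qed.
Lemma dg_nrm X i : `|dg X i| <= 1 * nrm X.
Proof.
have l1 : l2norm (delta i : ell2 R I) = 1.
  by apply/eqP; rewrite -(pexpr_eq1 (isT : (0 < 2)%N) (l2norm_ge0 (delta i))) sqr_l2norm nsq_delta.
apply: le_trans (abs_Re_ip_le _ _) _; rewrite l1; apply: ler_wpM2l => //.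
by have := l2norm_bop X (delta i); rewrite l1 mulr1.
Qed.

Lemma fc_expr k X : posop X -> fc (fun t => t ^+ k) X = X ^+ k.
Proof.
move=> pX; rewrite -[RHS](pevXn k X) -(fc_poly _ pX); congr (fc _ _).
by apply/funext => t; rewrite hornerXn.
Qed.

Variables (A B : bop R I) (f : R -> R).
Hypotheses (pA : posop A) (pB : posop B) (cAB : A * B = B * A) (cf : contp f).
Hypothesis fM : forall u v, 0 <= u -> 0 <= v -> f (u * v) = f u * f v.

Lemma posop_comm : posop (A * B).
Proof.
have cs : contp (fun t : R => Num.sqrt t) by apply: contp_sqrt; exact: contp_id.
have hE : A = star (fc (fun t : R => Num.sqrt t) A) * fc (fun t : R => Num.sqrt t) A.
  rewrite (fc_star cs pA) -(fcM cs cs pA) -[LHS](fc_id pA).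
  by apply: fc_ext => // [|t /andP[t0 _]]; [exact: contp_id|rewrite -expr2 sqr_sqrtr].
have hB : fc (fun t : R => Num.sqrt t) A * B = B * fc (fun t : R => Num.sqrt t) A.
  by rewrite -(fc_intertwine cs pA pA (esym cAB)).
by rewrite {1}hE -mulrA hB mulrA; apply: posop_conj.
Qed.

(** Two-variable positivity of [e + c (f(u) f(v) - P(u v))], with a diagonal entry as functional.
    The powers in [P(u v)] separate since [A] and [B] commute; taking [c] equal to 1 and to -1 gives
    both inequalities. *)
Lemma fc_mul_near e i P : 0 < e ->
  (forall t : R, 0 <= t <= (nrm A + nrm B + 1) * (nrm A + nrm B + 1) -> `|P.[t] - f t| <= e) ->
  forall c, `|c| = 1 -> 0 <= e + c * (dg (fc f A * fc f B) i - dg (pev P (A * B)) i).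
Proof.
move=> e0 hP c c1; set K := nrm A + nrm B + 1.
have nA := nrm_ge0 A; have nB := nrm_ge0 B.
have K0 : 0 < K by rewrite ltr_wpDl // addr_ge0.
have AK : nrm A <= K by rewrite /K -addrA lerDl addr_ge0.
have BK : nrm B <= K by rewrite /K addrAC lerDr addr_ge0.
pose S : seq ((R -> R) * (R -> R)) := [:: (fun=> e, fun=> 1); (fun t => c * f t, f)] ++
  [seq (fun t => (- c * P`_k) * t ^+ k, fun t => t ^+ k) | k <- index_iota 0 (size P)].
have cX k : contp (fun t : R => t ^+ k) by apply: contpX; exact: contp_id.
have cS h : h \in S -> contp h.1 /\ contp h.2.
  rewrite mem_cat !inE => /orP[/orP[/eqP->|/eqP->]|/mapP[k _ ->]] /=.
  - by split; exact: contp_cst.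
  - by split=> //; exact: contpZ.
  - by split=> //; exact: contpZ.
have hS (u v : R) : 0 <= u <= K -> 0 <= v <= K -> 0 <= \sum_(h <- S) h.1 u * h.2 v.
  move=> /andP[u0 uK] /andP[v0 vK]; rewrite big_cat !big_cons big_nil big_map big_mkord /= addr0 mulr1.
  have -> : \sum_(k < size P) (- c * P`_k) * u ^+ k * v ^+ k = - c * P.[u * v].
    by rewrite horner_coef mulr_sumr; apply: eq_bigr => k _; rewrite exprMn !mulrA.
  rewrite -mulrA -fM // mulNr -addrA -mulrBr.
  have hh : `|c * (f (u * v) - P.[u * v])| <= e.
    by rewrite normrM c1 mul1r distrC; apply: hP; rewrite mulr_ge0 //=; apply: ler_pM.
  by move: hh; rewrite ler_norml => /andP[h _]; rewrite -lerBlDl sub0r.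
have := two_variable_positivity (omega := fun x => dg x i) (M := 1) K0 pA pB AK BK
  (fun x y => dgD x y i) (fun k x => dg_rs k x i) (fun x => dg_nrm x i) _ cS hS.
have -> : \sum_(h <- S) fc h.1 A * fc h.2 B = rs e 1 + rs c (fc f A * fc f B) + rs (- c) (pev P (A * B)).
  rewrite big_cat !big_cons big_nil big_map big_mkord /= addr0.
  rewrite (fc_cst e pA) (fc_cst 1 pB) rs1 mulr1 (fcZ c cf pA) rsMl; congr (_ + _).
  rewrite /pev [in RHS]rsE scaler_sumr; apply: eq_bigr => k _.
  rewrite (fcZ _ (cX k) pA) (fc_expr k pA) (fc_expr k pB) rsMl (exprMn_comm k cAB) rsE scalerA -rmorphM //.
rewrite !dgD !dg_rs dg1 mulr1 mulNr -addrA -mulrBr; apply=> g h cg ch h0.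
have pg : star (fc g A) = fc g A := fc_star cg pA.
have cgB : fc g A * fc h B = fc h B * fc g A.
  have e1 : fc g A * B = B * fc g A := esym (fc_intertwine cg pA pA (esym cAB)).
  exact: (fc_intertwine ch pB pB e1).
rewrite -mulrA cgB mulrA -{1}pg.
have ph : posop (fc h B) by apply: fc_pos => // t /andP[t0 tB]; apply: h0; rewrite t0 (le_trans tB).
exact: (posop_conj (fc g A) ph).2.
Qed.

(** Both sides are within [e / 2] of the entry of [P(A B)]. Only diagonal entries are compared,
    which is all that the trace sees. *)
Lemma dg_fc_mul i : dg (fc f (A * B)) i = dg (fc f A * fc f B) i.
Proof.
apply/eqP; rewrite -subr_eq0 -normr_le0; apply/ler_addgt0Pr => e e0; rewrite add0r.
have e2 : 0 < e / 2 by rewrite divr_gt0.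
have nA := nrm_ge0 A; have nB := nrm_ge0 B.
have K0 : 0 < nrm A + nrm B + 1 by rewrite ltr_wpDl // addr_ge0.
have [P hP] := weierstrass cf (mulr_gt0 K0 K0) e2.
have k1 := fc_mul_near i e2 hP (normr1 _).
have k2 := fc_mul_near i e2 hP (_ : `|-1| = 1); rewrite normrN1 in k2; have {}k2 := k2 erefl.
have AK : nrm A <= nrm A + nrm B + 1 by rewrite -addrA lerDl addr_ge0.
have BK : nrm B <= nrm A + nrm B + 1 by rewrite addrAC lerDr addr_ge0.
have k3 : nrm (pev P (A * B) - fc f (A * B)) <= e / 2.
  apply: (fc_near cf posop_comm (ltW e2)) => t /andP[t0 tn]; apply: hP; rewrite t0 /=.
  by apply: le_trans tn _; apply: le_trans (nrmM _ _) _; exact: ler_pM.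
have := le_trans (dg_nrm (pev P (A * B) - fc f (A * B)) i) (eq_ind_r (fun t => t <= e / 2) k3 (mul1r _)).
rewrite dgB !ler_norml => /andP[k4 k5]; clear -k1 k2 k4 k5 e0.
move: k1 k2 k4 k5; move: (dg _ i) (dg _ i) (dg _ i) => r1 r2 r3 k1 k2 k4 k5.
by apply/andP; split; lra.
Qed.

End CommutingCalculus.

Section TensorTrace.
Context {R : realType}.

Section Slices.
Context {J K : choiceType}.
Implicit Types (a : bop R J) (x : bop R K).

Lemma tbop0r a : tbop a (0 : bop R K) = 0.
Proof. by rewrite -(scale0r (0 : bop R K)) tbopZr scale0r. Qed.
Lemma tbop0l x : tbop (0 : bop R J) x = 0.
Proof. by rewrite -(scale0r (0 : bop R J)) tbopZl scale0r. Qed.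

Lemma pev_tbopl P a : pev P (tbop a (1 : bop R K)) = tbop (pev P a) 1.
Proof.
elim/poly_ind: P => [|P c IH]; first by rewrite !pev0 tbop0l.
by rewrite !pevD !pevM !pevX !pevC IH tbopM mulr1 tbopDl tbopZl tbop11.
Qed.
Lemma pev_tbopr P x : pev P (tbop (1 : bop R J) x) = tbop 1 (pev P x).
Proof.
elim/poly_ind: P => [|P c IH]; first by rewrite !pev0 tbop0r.
by rewrite !pevD !pevM !pevX !pevC IH tbopM mulr1 tbopDr tbopZr tbop11.
Qed.

Lemma posop_tbopl a : posop (tbop (star a * a) (1 : bop R K)).
Proof. by have := posop_star (tbop a (1 : bop R K)); rewrite star_tbop tbopM star1 mulr1. Qed.
Lemma posop_tbopr x : posop (tbop (1 : bop R J) (star x * x)).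
Proof. by have := posop_star (tbop (1 : bop R J) x); rewrite star_tbop tbopM star1 mulr1. Qed.

Lemma fc_tbopl f a : contp f -> fc f (tbop (star a * a) (1 : bop R K)) = tbop (fc f (star a * a)) 1.
Proof.
move=> cf; set A := star a * a; have pA : posop A := posop_star a; have pT := posop_tbopl a.
have [P hP] := weierstrass_seq (nrm A + nrm (tbop A (1 : bop R K))) cf.
have l1 := fc_lim cf pT (_ : _ <= nrm A + nrm (tbop A (1 : bop R K))) hP cvg_invS.
have l2 := fc_lim cf pA (_ : _ <= nrm A + nrm (tbop A (1 : bop R K))) hP cvg_invS.
have {}l1 := l1 (ltac:(by rewrite lerDr nrm_ge0)); have {}l2 := l2 (ltac:(by rewrite lerDl nrm_ge0)).
apply: (olim_unique l1); apply: (olim_le (w := fun n => nrm (pev (P n) A - fc f A))) => [n|]; last exact: l2.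
rewrite pev_tbopl -[X in _ - X]/(tbop (fc f A) 1).
have -> : tbop (pev (P n) A) 1 - tbop (fc f A) 1 = tbop (pev (P n) A - fc f A) (1 : bop R K).
  by rewrite tbopDl -[- fc f A]scaleN1r tbopZl scaleN1r.
apply: le_trans (nrm_tbop _ _) _; rewrite -[leRHS]mulr1; apply: ler_wpM2l; first exact: nrm_ge0.
exact: nrm1_le.
Qed.
Lemma fc_tbopr f x : contp f -> fc f (tbop (1 : bop R J) (star x * x)) = tbop 1 (fc f (star x * x)).
Proof.
move=> cf; set A := star x * x; have pA : posop A := posop_star x; have pT := posop_tbopr x.
have [P hP] := weierstrass_seq (nrm A + nrm (tbop (1 : bop R J) A)) cf.
have l1 := fc_lim cf pT (_ : _ <= nrm A + nrm (tbop (1 : bop R J) A)) hP cvg_invS.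
have l2 := fc_lim cf pA (_ : _ <= nrm A + nrm (tbop (1 : bop R J) A)) hP cvg_invS.
have {}l1 := l1 (ltac:(by rewrite lerDr nrm_ge0)); have {}l2 := l2 (ltac:(by rewrite lerDl nrm_ge0)).
apply: (olim_unique l1); apply: (olim_le (w := fun n => nrm (pev (P n) A - fc f A))) => [n|]; last exact: l2.
rewrite pev_tbopr.
have -> : tbop 1 (pev (P n) A) - tbop 1 (fc f A) = tbop (1 : bop R J) (pev (P n) A - fc f A).
  by rewrite tbopDr -[- fc f A]scaleN1r tbopZr scaleN1r.
apply: le_trans (nrm_tbop _ _) _; rewrite -[leRHS]mul1r; apply: ler_wpM2r; first exact: nrm_ge0.
exact: nrm1_le.
Qed.

Lemma Im_diag (I : choiceType) (y : bop R I) xi : star y = y -> complex.Im (ip xi (y xi)) = 0.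
Proof.
move=> sy; have : (ip xi (y xi))^*%C = ip xi (y xi) by rewrite -ipC -{1}sy ip_starl.
by case: (ip _ _) => u v [] /= h; lra.
Qed.

Lemma dg_tbop a x j g : star a = a -> star x = x -> dg (tbop a x) (j, g) = dg a j * dg x g.
Proof.
move=> sa sx; rewrite /dg tbop_delta ip_tens_delta.
have := Im_diag (delta j) sa; have := Im_diag (delta g) sx.
case: (ip _ _) => u v; case: (ip _ _) => u' v' /= -> ->; ring.
Qed.

(** The square of the modulus of [a (x) x] is the product of the commuting operators [a^* a (x) 1]
    and [1 (x) x^* x], and [t^(p/2)] is multiplicative. *)
Lemma dg_apow_tbop p a x j g : 0 < p -> dg (apow p (tbop a x)) (j, g) = dg (apow p a) j * dg (apow p x) g.
Proof.
move=> p0; have p2 : 0 < p / 2 by rewrite divr_gt0.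
have cf := contp_powR p2; have pa := posop_star a; have px := posop_star x.
rewrite /apow star_tbop tbopM.
have -> : tbop (star a * a) (star x * x) = tbop (star a * a) 1 * tbop 1 (star x * x) by rewrite tbopM mulr1 mul1r.
rewrite (dg_fc_mul (posop_tbopl a) (posop_tbopr x) _ cf) => [||u v u0 v0]; last 2 first.
- by rewrite !tbopM !mulr1 !mul1r.
- exact: powRM.
rewrite (fc_tbopl _ cf) (fc_tbopr _ cf) tbopM mulr1 mul1r.
by rewrite dg_tbop // fc_star.
Qed.

End Slices.

Notation G := freegroup.
Notation I := (nat * freegroup)%type.

Lemma dsum_tbop p (a : bop R nat) (x : bop R G) : 0 < p ->
  dsum DM (apow p (tbop a x)) = ((dg (apow p x) 1%g)%:E * dsum [set: nat] (apow p a))%E.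
Proof.
move=> p0; have c0 : 0 <= dg (apow p x) 1%g := dg_pos 1%g (apow_pos x p0).
rewrite /dsum esum_DM => [|k]; last by rewrite lee_fin; exact/dg_pos/apow_pos.
have h := dsum_rs [set: nat] c0 (apow_pos a p0); rewrite /dsum in h; rewrite -h.
by apply: eq_esum => n _; rewrite dg_apow_tbop // dg_rs mulrC.
Qed.

(** A polynomial at a projection [e] is [P(0) (1 - e) + P(1) e], so only the values of [f] at 0 and
    1 matter. *)
Lemma fc_proj (J : choiceType) (e : bop R J) f : star e = e -> e * e = e -> contp f -> f 0 = 0 -> f 1 = 1 ->
  fc f e = e.
Proof.
move=> se ee cf f0 f1; have pe : posop e by rewrite -ee -{1}se; exact: posop_star.
have z0 (y : bop R J) : rs 0 y = 0 by rewrite rsE (_ : 0%:C%C = 0) // scale0r.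
have pv P : pev P e = rs P.[0] (1 - e) + rs P.[1] e.
  elim/poly_ind: P => [|P c IH]; first by rewrite pev0 !horner0 !z0 addr0.
  have h0 : (P * 'X + c%:P).[0] = c by rewrite !hornerE ?mulr0 ?add0r.
  have h1 : (P * 'X + c%:P).[1] = P.[1] + c by rewrite !hornerE ?mulr1.
  have rB : rs c (1 - e) = rs c 1 - rs c e by rewrite !rsE scalerBr.
  rewrite h0 h1 pevD pevM pevX pevC IH mulrDl rsMl mulrBl mul1r ee subrr rs0r add0r rsMl ee.
  by rewrite rsDl rB [rs P.[1] e + rs c e]addrC addrA subrK addrC.
have [P hP] := weierstrass_seq (nrm e + 1) cf.
have l1 := fc_lim cf pe (_ : nrm e <= nrm e + 1) hP cvg_invS; have {}l1 := l1 (ltac:(by rewrite lerDl)).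
apply: (olim_unique l1); apply: (olim_le (w := fun n => 2 * (n.+1%:R^-1 : R) + 2 * n.+1%:R^-1)) => [n|]; last first.
  rewrite -[X in _ --> X](addr0 0) -[X in _ --> X + _](mulr0 2) -[X in _ --> _ + X](mulr0 2).
  by apply: cvgD; apply: cvgM; (exact: cvg_cst || exact: cvg_invS).
have ne : nrm e <= 1 := nrm_proj se ee.
have h0 := hP n 0; have h1 := hP n 1.
have {}h0 : `|(P n).[0]| <= n.+1%:R^-1 by move: h0; rewrite f0 subr0; apply; rewrite lexx addr_ge0 ?nrm_ge0.
have {}h1 : `|(P n).[1] - 1| <= n.+1%:R^-1 by move: h1; rewrite f1; apply; rewrite ler01 lerDr nrm_ge0.
have i0 : 0 <= n.+1%:R^-1 :> R by rewrite invr_ge0.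
have nrs (c : R) (y : bop R J) : nrm (rs c y) <= `|c| * nrm y.
  by have := nrmZ_le c%:C%C y; rewrite /sqmod /= expr0n addr0 sqrtr_sqr.
rewrite pv -addrA (_ : rs (P n).[1] e - e = rs ((P n).[1] - 1) e); last first.
  by rewrite rsDl rsN1.
apply: le_trans (nrmD _ _) _; apply: lerD; apply: le_trans (nrs _ _) _.
  rewrite mulrC; apply: ler_pM; rewrite ?nrm_ge0 //.
  apply: le_trans (nrmD _ _) _; rewrite nrmN.
  by rewrite (_ : (2 : R) = 1 + 1); [apply: lerD => //; exact: nrm1_le|by []].
rewrite mulrC; apply: ler_pM; rewrite ?nrm_ge0 //.
by apply: le_trans ne _; rewrite ler1n.
Qed.

Definition E00 : bop R nat := elem 0 0.
Lemma E00_sq : E00 * E00 = E00. Proof. by rewrite elemM eqxx scale1r. Qed.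
Lemma star_E00 : star E00 = E00. Proof. exact: star_elem. Qed.

Lemma dsum_E00 p : 0 < p -> dsum [set: nat] (apow p E00) = 1%E.
Proof.
move=> p0; have p2 : 0 < p / 2 by rewrite divr_gt0.
rewrite /apow star_E00 E00_sq fc_proj ?star_E00 ?E00_sq ?powR1 ?powR0 ?(gt_eqF p2) //; last exact: contp_powR.
rewrite -[LHS]/(nnsum (dg E00)) (@nnsum1 _ _ 0%N) /dg ?elem_delta ?eqxx ?scale1r -?nsqE ?nsq_delta //.
move=> j j0; rewrite elem_delta eq_sym (negbTE j0) scale0r ip0r //.
Qed.

(** The L_p-norm on the group von Neumann algebra, realised in the (0, 0) entry of matrices over it:
    [E00] has norm 1, so the triangle inequality and density are inherited from the tensor
    product. *)
Definition nF p (x : bop R G) : R := rn DM p (tbop E00 x).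

Section Norms.
Variable p : R.
Hypothesis p1 : 1 < p.
Let p0 : 0 < p. Proof. exact: lt_trans p1. Qed.

Lemma Lb_tbop a x : NF x -> (dsum [set: nat] (apow p a) < +oo)%E -> Lb NM DM p (tbop a x).
Proof.
move=> Nx ha; split; first exact: NM_tbop.
by rewrite dsum_tbop // lte_mul_pinfty // lee_fin; exact/dg_pos/apow_pos.
Qed.

Lemma Lb_E00 x : NF x -> Lb NM DM p (tbop E00 x).
Proof. by move=> Nx; apply: Lb_tbop => //; rewrite dsum_E00 // ltry. Qed.

Lemma dg_nF x : NF x -> dg (apow p x) 1%g = nF p x `^ p.
Proof.
move=> /Lb_E00 /(dsum_fin p1); rewrite dsum_tbop // dsum_E00 // mule1 => h.
by have [] := h.
Qed.

Lemma rn_tbop a x : NF x -> (dsum [set: nat] (apow p a) < +oo)%E ->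
  rn DM p (tbop a x) = fine (dsum [set: nat] (apow p a)) `^ p^-1 * nF p x.
Proof.
move=> Nx ha; have := dsum_fin p1 (Lb_tbop Nx ha); rewrite dsum_tbop // (dg_nF Nx) => h.
have da := dsum_ge0 [set: nat] (apow_pos a p0).
have fa : dsum [set: nat] (apow p a) \is a fin_num by rewrite ge0_fin_numE.
move: h; rewrite -(fineK fa) -EFinM => -[h].
have n0 : 0 <= nF p x := rn_ge0 _ _ _.
rewrite -(powRK p0 (rn_ge0 DM p (tbop a x))) -h powRM ?powR_ge0 ?fine_ge0 // (powRK p0 n0) mulrC.
by rewrite fineK.
Qed.

Lemma bfun_toBop (I : choiceType) (x : op R I) (h : bounded_op x) : bfun (toBop h) = x.
Proof. by []. Qed.

Lemma abs_powE' (I : choiceType) (x : bop R I) : abs_pow p (bfun x) = bfun (apow p x).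
Proof. exact: abs_powE. Qed.

Lemma vNF_bdd (x : op R G) : Lp_bounded (vNF R) p x <-> exists2 b : bop R G, NF b & x = bfun b.
Proof.
split=> [[[xb hx] _]|[b Nb ->]]; first by exists (toBop xb).
split; first exact: Nb.
by rewrite /pnorm abs_powE' poweR_lty // ltry.
Qed.

Lemma vNF_pn (b : bop R G) : NF b -> pnorm (vNF R) p (bfun b) = (nF p b)%:E.
Proof.
move=> Nb; have n0 : 0 <= nF p b := rn_ge0 _ _ _.
rewrite /pnorm abs_powE'.
have -> : trace (vNF R) (bfun (apow p b)) = (nF p b `^ p)%:E by rewrite -(dg_nF Nb).
by rewrite poweR_EFin (powRK p0 n0).
Qed.

Lemma M_pnorm (b : bop R I) : pnorm (@Bell2_vNF R) p (bfun b) = (dsum DM (apow p b) `^ p^-1)%E.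
Proof. by rewrite /pnorm abs_powE'. Qed.

Lemma M_pn (b : bop R I) : Lb NM DM p b -> pnorm (@Bell2_vNF R) p (bfun b) = (rn DM p b)%:E.
Proof. by move=> fb; rewrite M_pnorm (dsum_fin p1 fb) poweR_EFin (powRK p0 (rn_ge0 _ _ _)). Qed.

Lemma M_bdd (x : op R I) : Lp_bounded (@Bell2_vNF R) p x <-> exists2 b : bop R I, Lb NM DM p b & x = bfun b.
Proof.
have ip0 : p^-1 != 0 by rewrite invr_eq0 gt_eqF.
split=> [[[xb hx] h]|[b fb ->]].
  exists (toBop xb) => //; split; first by split.
  by move: h; rewrite -{1}(bfun_toBop xb) M_pnorm => /(lty_poweRy ip0).
by split; [exact: fb.1|rewrite (M_pn fb) ltry].
Qed.

Lemma Sp_bdd (a : op R nat) : Lp_bounded (Bell2 R) p a ->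
  exists2 b : bop R nat, a = bfun b & (dsum [set: nat] (apow p b) < +oo)%E.
Proof.
have ip0 : p^-1 != 0 by rewrite invr_eq0 gt_eqF.
move=> [ab h]; exists (toBop ab) => //.
by move: h; rewrite -{1}(bfun_toBop ab) /pnorm abs_powE' => /(lty_poweRy ip0).
Qed.

Lemma model_M : Lp_model (@Bell2_vNF R) p (Lb NM DM p) (rn DM p).
Proof.
have pq : p^-1 + ((1 - p^-1)^-1)^-1 = 1 by rewrite invrK addrC subrK.
split; [exact: M_bdd|exact: M_pn|exact: rn_ge0| |].
  exact: (rn_triangle (@NM_cstar R) (@NM_tracial R) (@eM_cuts R) p1 pq).
exact: (rn_scale (@NM_cstar R) p1).
Qed.

Lemma model_F : Lp_model (vNF R) p NF (nF p).
Proof.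
split; [exact: vNF_bdd|exact: vNF_pn|by move=> b; exact: rn_ge0| |].
  move=> a b Na Nb; split; first exact: (calgD (@NF_cstar R)).
  by rewrite /nF tbopDr; have [] := lm_D model_M (Lb_E00 Na) (Lb_E00 Nb).
move=> k a Na; split; first exact: (calgZ (@NF_cstar R)).
by rewrite /nF tbopZr; have [] := lm_Z model_M k (Lb_E00 Na).
Qed.

End Norms.
End TensorTrace.

(** * Extension of the multipliers *)

Section FreeGroupExtension.
Context {R : realType}.
Notation G := freegroup.
Notation I := (nat * freegroup)%type.
Notation J := (seq (R[i] * freegroup)).
Implicit Types (c d : J) (m : G -> R[i]).

Definition galb c : bop R G := \sum_(s <- c) s.1 *: lam s.2.
Definition multg m c : J := [seq (m s.2 * s.1, s.2) | s <- c].
Definition combg (k : R[i]) c d : J := [seq (k * s.1, s.2) | s <- c] ++ d.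

Lemma bfunD (K : choiceType) (x y : bop R K) : bfun (x + y) = (bfun x : op R K) + bfun y.
Proof. by []. Qed.
Lemma bfunZ (K : choiceType) (k : R[i]) (x : bop R K) : bfun (k *: x) = k *: (bfun x : op R K).
Proof. by []. Qed.
Lemma bfun_lam (g : G) : bfun (lam g) = lambda g :> op R G.
Proof. by []. Qed.

Lemma galgE c : galg c = bfun (galb c).
Proof.
rewrite /galg /galb; elim: c => [|s c IH]; first by rewrite !big_nil.
by rewrite !big_cons IH bfunD bfunZ bfun_lam.
Qed.
Lemma alphaE e (z : 'I_e -> nat -> R[i]) c : alpha_Ld z c = bfun (galb (multg (symbol_Ld z) c)).
Proof.
rewrite /alpha_Ld /galb /multg big_map; elim: c => [|s c IH]; first by rewrite !big_nil.
by rewrite !big_cons IH bfunD (mulrC (symbol_Ld z s.2)) -scalerA !bfunZ bfun_lam.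
Qed.

Lemma galb_comb k c d : galb (combg k c d) = k *: galb c + galb d.
Proof.
rewrite /galb /combg big_cat big_map scaler_sumr; congr (_ + _).
by apply: eq_bigr => s _; rewrite scalerA.
Qed.
Lemma multg_comb m k c d : multg m (combg k c d) = combg k (multg m c) (multg m d).
Proof.
rewrite /multg /combg map_cat -!map_comp; congr (_ ++ _); apply: eq_map => s /=.
by rewrite mulrCA.
Qed.
Lemma multg_comp m m' c : multg m (multg m' c) = multg (fun g => m g * m' g) c.
Proof. by rewrite /multg -map_comp; apply: eq_map => s /=; rewrite mulrA. Qed.
Lemma NF_galb c : NF (galb c).
Proof. by apply: (calg_sum (@NF_cstar R)) => s; apply: (calgZ (@NF_cstar R)); exact: NF_lam. Qed.

Lemma tbop_sumr (K L : choiceType) (a : bop R K) (T : Type) (r : seq T) (F : T -> bop R L) :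
  tbop a (\sum_(t <- r) F t) = \sum_(t <- r) tbop a (F t).
Proof. by elim: r => [|t r IH]; rewrite ?big_nil ?big_cons ?tbop0r ?tbopDr ?IH. Qed.
Lemma tbop_suml (K L : choiceType) (x : bop R L) (T : Type) (r : seq T) (F : T -> bop R K) :
  tbop (\sum_(t <- r) F t) x = \sum_(t <- r) tbop (F t) x.
Proof. by elim: r => [|t r IH]; rewrite ?big_nil ?big_cons ?tbop0l ?tbopDl ?IH. Qed.

Definition lift00 c : @Ix R := [seq (s.1, (0%N, s.2, 0%N)) | s <- c].
Lemma val_lift00 c : val_ix (lift00 c) = tbop E00 (galb c).
Proof. by rewrite /val_ix /galb tbop_sumr big_map; apply: eq_bigr => s _; rewrite tbopZr. Qed.
Lemma mult_lift00 m c : mult m (lift00 c) = lift00 (multg m c).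
Proof. by rewrite /mult /lift00 /multg -!map_comp. Qed.

(** The k by k truncation of [a (x) c]. For a general [a] in the Schatten class the tensor itself is
    not a finite family. *)
Definition tcode (a : bop R nat) k c : @Ix R :=
  [seq (a (delta t.2) t.1 * s.1, (t.1, s.2, t.2)) | t <- [seq (i, j) | i <- iota 0 k, j <- iota 0 k], s <- c].

Lemma eM_tbop k : eM k = tbop (\sum_(i <- iota 0 k) elem i i) 1 :> bop R I.
Proof. by rewrite tbop_suml /eM; apply: eq_bigr => i _; rewrite /unit_elt lam1. Qed.

Lemma elem_conj (a : bop R nat) i j : elem i i * a * elem j j = a (delta j) i *: elem i j.
Proof.
apply: bop_ext_deltas => k; rewrite bopM elem_delta bopZ bopM bopZE elem_delta !scalerA.
by rewrite mulrC.
Qed.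

Lemma val_tcode a k c : val_ix (tcode a k c) = cut eM k (tbop a (galb c)).
Proof.
rewrite /cut eM_tbop !tbopM mul1r mulr1 mulr_suml mulr_suml.
rewrite /val_ix /tcode big_allpairs_dep big_allpairs_dep tbop_suml; apply: eq_bigr => i _.
rewrite mulr_sumr tbop_suml; apply: eq_bigr => j _ /=.
rewrite elem_conj tbopZl /galb tbop_sumr scaler_sumr; apply: eq_bigr => s _.
by rewrite tbopZr scalerA.
Qed.

Lemma val_mult_tcode m a k c : val_ix (mult m (tcode a k c)) = val_ix (tcode a k (multg m c)).
Proof.
rewrite /val_ix /mult big_map /tcode !big_allpairs_dep; apply: eq_bigr => i _; apply: eq_bigr => j _.
by rewrite big_map; apply: eq_bigr => s _ /=; rewrite mulrCA.
Qed.

Section Exponent.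
Variable p : R.
Hypothesis p1 : 1 < p.
Let pq : p^-1 + ((1 - p^-1)^-1)^-1 = 1 := conj_ex p1.
Let hN := @NM_cstar R.
Let hD := @NM_tracial R.
Let hc := @eM_cuts R.
Let HF := @model_F R p p1.
Let HM := @model_M R p p1.

Lemma M_dense x e : Lb NM DM p x -> 0 < e -> exists X, Lb NM DM p (x - val_ix X) /\ rn DM p (x - val_ix X) <= e.
Proof.
move=> fx e0; have AN (z : bop R I) : AM z -> NM z by move=> [X _ <-]; exact: NM_val.
have AD (y z : bop R I) : AM y -> AM z -> AM (y + z).
  by move=> [X _ <-] [Y _ <-]; exists (X ++ Y) => //; exact: val_cat.
have AZ (k : R[i]) (z : bop R I) : AM z -> AM (k *: z).
  by move=> [X _ <-]; exists (scale_ix k X) => //; exact: val_scale.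
have AMul (y z : bop R I) : AM y -> AM z -> AM (y * z).
  by move=> [X _ <-] [Y _ <-]; exists (mul_ix X Y) => //; exact: val_mul.
have AS (z : bop R I) : AM z -> AM (star z).
  by move=> [X _ <-]; exists (star_ix X) => //; exact: val_star.
have [z [[X _ <-] h1 h2]] := Lb_dense hN hD hc p1 pq AN AD AZ AMul AS (@AM_dense R) fx e0.
by exists X.
Qed.

(** An approximant of [E00 (x) x] among matrices is compressed to its (0, 0) entry, which does not
    increase the error. *)
Lemma F_dense (x : bop R G) e : NF x -> 0 < e -> exists c, nF p (x - galb c) <= e.
Proof.
move=> Nx e0; have [X [f1 h1]] := M_dense (Lb_E00 p1 Nx) e0.
pose c := [seq (((t.2.1.1 == 0%N) && (t.2.2 == 0%N))%:R * t.1, t.2.1.2) | t <- X] : J.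
exists c; have [_ h2] := rn_cut hN hD hc p1 pq 1 f1; apply: le_trans h1; rewrite /nF.
rewrite (_ : tbop E00 (x - galb c) = cut eM 1 (tbop E00 x - val_ix X)) //.
have e1 : eM 1 = tbop E00 1 :> bop R I by rewrite eM_tbop big_seq1.
rewrite /cut mulrBr mulrBl e1 !tbopM mul1r mulr1 !E00_sq tbopDr; congr (_ + _).
rewrite -[- galb c]scaleN1r tbopZr scaleN1r; congr (- _).
rewrite /galb tbop_sumr big_map /val_ix mulr_sumr mulr_suml; apply: eq_bigr => t _ /=.
rewrite bscaleAr bscaleAl /unit_elt !tbopM mul1r mulr1 /E00 elemM bscaleAl elemM scalerA tbopZr tbopZl scalerA.
rewrite -(eq_sym t.2.1.1) mulrC; congr (_ *: _); congr (_ * _).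
by case: eqP; case: eqP; rewrite /= ?mulr1 ?mulr0.
Qed.

Lemma F_data m C : 0 <= C -> bdd p C m -> ext_data NF (nF p) galb (fun c => galb (multg m c)) C combg.
Proof.
move=> C0 h; split=> //.
- exact: NF_galb.
- by move=> c; exact: NF_galb.
- exact: galb_comb.
- by move=> k c d; rewrite multg_comb galb_comb.
- by move=> c; rewrite /nF -!val_lift00 -mult_lift00; exact: h.
- exact: F_dense.
Qed.

Lemma M_data m C : 0 <= C -> bdd p C m ->
  ext_data (Lb NM DM p) (rn DM p) (@val_ix R) (fun X => val_ix (mult m X)) C (fun k X Y => scale_ix k X ++ Y).
Proof.
move=> C0 h; split=> //.
- by move=> X; exact: Lb_val.
- by move=> X; exact: Lb_val.
- by move=> k X Y; rewrite val_cat val_scale.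
- by move=> k X Y; rewrite val_mult_cat val_mult_scale.
- by move=> x e fx e0; have [X [_ hX]] := M_dense fx e0; exists X.
Qed.

Definition extF m := ext (vNF R) p galb (fun c => galb (multg m c)).
Definition extM m := ext (@Bell2_vNF R) p (@val_ix R) (fun X => val_ix (mult m X)).

Section Tensor.
Variable a : bop R nat.
Hypothesis fa : (dsum [set: nat] (apow p a) < +oo)%E.
Let ka := fine (dsum [set: nat] (apow p a)) `^ p^-1.
Let ka0 : 0 <= ka. Proof. exact: powR_ge0. Qed.

Lemma tens_diff x y : NF x -> NF y -> rn DM p (tbop a x - tbop a y) = ka * nF p (x - y).
Proof.
move=> Nx Ny; rewrite -(rn_tbop p1 (calgB (@NF_cstar R) Nx Ny) fa) tbopDr.
by rewrite -[- y]scaleN1r tbopZr scaleN1r.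
Qed.

Lemma tens_cauchy u : cauchy_n NF (nF p) u -> cauchy_n (Lb NM DM p) (rn DM p) (fun k => tbop a (u k)).
Proof.
move=> [Bu cu]; split=> [k|e e0]; first exact: (Lb_tbop p1 (Bu k) fa).
have d0 : 0 < e / (ka + 1) by rewrite divr_gt0 // ltr_wpDl.
have [N0 hN0] := cu _ d0; exists N0 => i j Ni Nj; have h := hN0 i j Ni Nj.
have := small_mul ka0 (lm_ge0 HF _) e0 (_ : rn DM p (tbop a (u i) - tbop a (u j)) <= ka * nF p (u i - u j)) (ltW h).
by move=> /(_ ltac:(by rewrite (tens_diff (Bu i) (Bu j)))) [_]; apply.
Qed.

Lemma tens_eqv u v : cauchy_n NF (nF p) u -> cauchy_n NF (nF p) v -> eqv (nF p) u v ->
  eqv (rn DM p) (fun k => tbop a (u k)) (fun k => tbop a (v k)).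
Proof.
move=> [Bu _] [Bv _] h e e0; have d0 : 0 < e / (ka + 1) by rewrite divr_gt0 // ltr_wpDl.
have [N0 hN0] := h _ d0; exists N0 => k kN; have hk := hN0 k kN.
have := small_mul ka0 (lm_ge0 HF _) e0 (_ : rn DM p (tbop a (u k) - tbop a (v k)) <= ka * nF p (u k - v k)) hk.
by move=> /(_ ltac:(by rewrite (tens_diff (Bu k) (Bv k)))) [].
Qed.

Lemma Lp_tens_class u : cauchy_n NF (nF p) u ->
  Lp_tens p (bfun a) (Lp_class (vNF R) p (ops u)) = Lp_class (@Bell2_vNF R) p (ops (fun k => tbop a (u k))).
Proof.
move=> cu; have E (v : nat -> bop R G) : (fun k => tens_op (bfun a) (ops v k)) = ops (fun k => tbop a (v k)).
  by apply/funext => k; rewrite /ops tens_opE.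
apply/seteqP; split=> w.
  move=> [s /(Lp_classP HF _ cu.1)[v [cv uv] ->]]; rewrite E.
  by rewrite (class_eq HM (tens_cauchy cu) (tens_cauchy cv) (tens_eqv cu cv uv)).
by move=> h; exists (ops u); [exact: (class_mem HF cu)|rewrite E].
Qed.

Lemma tens_code m c e : 0 < e -> exists X,
  rn DM p (tbop a (galb c) - val_ix X) <= e /\ rn DM p (tbop a (galb (multg m c)) - val_ix (mult m X)) <= e.
Proof.
move=> e0; have [n1 h1] := cut_approx hN hD hc p1 pq (Lb_tbop p1 (NF_galb c) fa) e0.
have [n2 h2] := cut_approx hN hD hc p1 pq (Lb_tbop p1 (NF_galb (multg m c)) fa) e0.
exists (tcode a (maxn n1 n2) c); rewrite val_mult_tcode !val_tcode.
by split; [have [] := h1 _ (leq_maxl n1 n2)|have [] := h2 _ (leq_maxr n1 n2)].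
Qed.

(** The tensors of [a] with a group algebra element and with its image are approximated by the same
    truncation, and truncating commutes with the multiplier; both sides are therefore classes of the
    same sequence of images. *)
Lemma extM_tens m C X : 0 <= C -> bdd p C m -> Lp (vNF R) p X ->
  extM m (Lp_tens p (bfun a) X) = Lp_tens p (bfun a) (extF m X).
Proof.
move=> C0 h; have EF := F_data C0 h; have EM := M_data C0 h.
move=> /(rep_class HF EF)[c cc ->].
have inv0 (k : nat) : 0 < k.+1%:R^-1 :> R by rewrite invr_gt0.
have /choice[D hD'] : forall k : nat, exists X, rn DM p (tbop a (galb (c k)) - val_ix X) <= k.+1%:R^-1 /\
    rn DM p (tbop a (galb (multg m (c k))) - val_ix (mult m X)) <= k.+1%:R^-1.
  by move=> k; exact: tens_code.
have cb := b_cauchy HF EF cc; have ct := tens_cauchy cc; have ct' := tens_cauchy cb.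
have e1 : eqv (rn DM p) (fun k => tbop a (galb (c k))) (fun k => val_ix (D k)) := eqv_inv (fun k => (hD' k).1).
have e2 : eqv (rn DM p) (fun k => tbop a (galb (multg m (c k)))) (fun k => val_ix (mult m (D k))) :=
  eqv_inv (fun k => (hD' k).2).
have cD := cauchy_eqv HM (fun k => Lb_val p1 (D k)) ct e1.
have cD' := cauchy_eqv HM (fun k => Lb_val p1 (mult m (D k))) ct' e2.
have r1 := etrans (congr1 (extM m) (etrans (Lp_tens_class cc) (class_eq HM ct cD e1))) (ext_class HM EM cD).
have r2 := etrans (congr1 (Lp_tens p (bfun a)) (ext_class HF EF cc)) (etrans (Lp_tens_class cb) (class_eq HM ct' cD' e2)).
exact: etrans r1 (esym r2).
Qed.

End Tensor.

Lemma cb_extF m C : 0 <= C -> bdd p C m -> cb_norm_le p C (extF m).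
Proof.
move=> C0 h; split; first exact: (ext_linear HF (F_data C0 h)).
exists (extM m); first exact: (ext_norm HM (M_data C0 h)).
by move=> a X /(Sp_bdd p1)[b -> fb] LX; exact: (extM_tens fb C0 h LX).
Qed.

Lemma extF_emb m C c : 0 <= C -> bdd p C m ->
  extF m (Lp_emb (vNF R) p (bfun (galb c))) = Lp_emb (vNF R) p (bfun (galb (multg m c))).
Proof. by move=> C0 h; exact: (ext_class HF (F_data C0 h) (const_cauchy HF (NF_galb c))). Qed.

Lemma multg1 m c : (forall g, m g = 1) -> multg m c = c.
Proof. by move=> m1; rewrite /multg -[RHS]map_id; apply: eq_map => -[k g] /=; rewrite m1 mul1r. Qed.

Lemma extF_id m X : (forall g, m g = 1) -> Lp (vNF R) p X -> extF m X = X.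
Proof.
move=> m1; have h : bdd p 1 m by rewrite (_ : m = fun=> 1); [exact: bdd1|exact/funext].
move=> /(rep_class HF (F_data ler01 h))[c cc ->]; rewrite /extF (ext_class HF (F_data ler01 h) cc).
by congr (Lp_class _ _ (ops _)); apply/funext => k; rewrite multg1.
Qed.

Lemma extF_comp m m' m2 C C' C2 X : 0 <= C -> 0 <= C' -> 0 <= C2 -> bdd p C m -> bdd p C' m' -> bdd p C2 m2 ->
  (forall g, m2 g = m g * m' g) -> Lp (vNF R) p X -> extF m2 X = extF m (extF m' X).
Proof.
move=> C0 C'0 C20 h h' h2 e; have E := F_data C0 h; have E' := F_data C'0 h'; have E2 := F_data C20 h2.
move=> /(rep_class HF E)[c cc ->].
have s1 := ext_class HF E2 cc; have s2 := ext_class HF E' cc.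
have s3 := ext_class HF E (c := fun k => multg m' (c k)) (b_cauchy HF E' cc).
rewrite /extF; apply: (etrans s1); apply: esym; apply: (etrans (congr1 _ s2)); apply: (etrans s3).
congr (Lp_class _ _ (ops _)); apply/funext => k; congr galb.
by rewrite multg_comp; apply: eq_map => s; rewrite e.
Qed.

End Exponent.
End FreeGroupExtension.

Theorem theorem1p2 (R : realType) (d : nat) (p : R) :
  (1 <= d)%N -> 1 < p ->
  exists (C : R)
    (A : ('I_d -> nat -> R[i]) ->
         set (opseq R freegroup) -> set (opseq R freegroup)),
    [/\ forall z, torus z ->
          extends_alpha_Ld p z (A z) /\ cb_norm_le p C (A z),
        forall X, Lp (vNF R) p X -> A (fun _ _ => 1) X = X
      & forall z w X, torus z -> torus w -> Lp (vNF R) p X ->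
          A (fun j i => z j i * w j i) X = A z (A w X)].
Proof.
move=> _ p1; have [C C0 hC] := @bdd_symbol R p d p1.
exists C, (fun z => extF p (symbol_Ld z)); split=> [z tz|X LX|z w X tz tw LX].
- split; last exact: (cb_extF p1 C0 (hC z tz)).
  by move=> c; rewrite galgE alphaE; exact: (extF_emb p1 c C0 (hC z tz)).
- apply: (extF_id p1) => // g; rewrite /symbol_Ld big1 // => j _; exact: exp1rz.
have tzw : torus (fun j i => z j i * w j i) by move=> j i; rewrite normrM tz tw mulr1.
apply: (extF_comp p1 C0 C0 C0 (hC z tz) (hC w tw) (hC _ tzw)) => // g.
by rewrite /symbol_Ld -big_split; apply: eq_bigr => j _; exact: expfzMl.
Qed.
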